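(* Let $L$ be a countable signature and let $T$ be a countable continuous $\mathcal{L}_{\omega_1\omega}(L)$-theory such that all of its separable models are locally compact. Let $\cong_T$ be the equivalence relation on $\mathrm{Mod}(T)$ given by $\xi\cong_T\eta \iff M_\xi\cong M_\eta$. Then the following are equivalent: (i) $\cong_T$ is potentially $\mathbf{\Sigma}^0_2$; (ii) there exists a fragment $\mathcal{F}$ such that $T$ is an $\mathcal F$-theory and for every $\xi\in\mathrm{Mod}(T)$ there is $k\in\mathbb{N}$ such that the set $\{\bar a\in M_\xi^k : \mathrm{tp}_{\mathcal F}(\bar a)\text{ is rigid}\}$ has non-empty interior in $M_\xi^k$; (iii) $\cong_T$ is essentially countable.
   Context: Logic. A modulus of continuity is a continuous $\Delta\colon[0,\infty)\to[0,\infty)$ with $\Delta(0)=0$ and $\Delta(r)\le\Delta(r+s)\le\Delta(r)+\Delta(s)$; a map $f$ between metric spaces respects $\Delta$ if $d(f(x),f(x'))\le\Delta(d(x,x'))$. A countable signature $L$ consists of predicate and function symbols (constants are $0$-ary functions), each with an arity and a modulus of continuity, and each predicate symbol also with a compact interval bounding its values; there is a distinguished binary predicate $d$ for the metric. An $L$-structure is a complete metric space $(M,d)$ with interpretations of the symbols respecting arities, moduli and bounds; $M^k$ carries the max metric. Continuous $\mathcal{L}_{\omega_1\omega}(L)$-formulas are real-valued, built from atomic formulas and the constant $1$ using $\phi+\psi$, $r\phi$ ($r\in\mathbb{Q}$), $\max$, $\min$, $\sup_x$, $\inf_x$, and countable suprema and infima of families of formulas in the same finite tuple of free variables respecting a common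 modulus of continuity and bound. A sentence is a formula without free variables; a theory is a set of conditions $\phi=c$ with $\phi$ a sentence and $c\in\mathbb{R}$; $M\models T$ means $\phi^M=c$ for all conditions in $T$. A fragment $\mathcal{F}$ is a countable set of formulas containing all atomic formulas and closed under the finitary connectives, quantifiers, subformulas, and substitution of terms for variables. An $\mathcal{F}$-theory is a theory all of whose sentences are in $\mathcal{F}$. Types. For a tuple $\bar a$ in $M$, $\mathrm{tp}_{\mathcal F}(\bar a)$ is the map $\phi\mapsto\phi^M(\bar a)$ on $\mathcal F$-formulas. $\mathrm{S}_k(T)$ is the set of all $\mathrm{tp}_{\mathcal F}(\bar a)$, $M\models T$, $\bar a\in M^k$. A type $p\in \mathrm S_k(T)$ ($T$ an $\mathcal F$-theory) is rigid if whenever $\bar a\in M^k$ and $\bar b\in N^k$ realize $p$ (i.e. have type $p$) in separable models $M,N$ of $T$, then $M\cong N$ (the isomorphism need not send $\bar a$ to $\bar b$). Space of models. Let $\mathcal F$ be a fragment containing all sentences of $T$ and $\bar x=(x_0,x_1,\dots)$. $\mathrm{Mod}(T)$ is the set of types $\xi=\mathrm{tp}_{\mathcal F}(\bar a)$ of sequences $\bar a\in M^{\mathbb N}$ in models $M\models T$ such that $(\inf_y\phi(y,\bar x))^\xi=\inf_j\phi(x_j,\bar x)^\xi$ for all $\phi\in\mathcal F$; equivalently, $\overline{\{a_i:i\in\mathbb N\}}$ is an $\mathcal F$-elementary substructure of $M$. This structure is denoted $M_\xi$; it is a separable model of $T$, well defined up to isomorphism. So $\xi$ codes a separable model of $T$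 together with an enumerated dense sequence (up to isomorphism respecting the enumeration). The topology of pointwise convergence on $\mathcal F$-formulas makes $\mathrm{Mod}(T)$ a Polish space; the underlying set (of such codes) and the resulting standard Borel structure do not depend on the choice of $\mathcal F$. Equivalence relations. An equivalence relation $E$ on a standard Borel space $X$ is potentially $\mathbf\Sigma^0_2$ if there is a Polish topology $\tau$ on $X$ compatible with its Borel structure such that $E\subseteq X^2$ is $\mathbf\Sigma^0_2$ ($F_\sigma$) in $\tau\times\tau$. $E$ is essentially countable if it is Borel reducible to a Borel equivalence relation with countable classes on a standard Borel space. *)

(* Defs.v *)
From HB Require Import structures.
From mathcomp Require Import all_boot all_order all_algebra.
From mathcomp Require Import all_classical all_reals all_analysis.
From mathcomp Require Import borel_hierarchy.

Set Implicit Arguments.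
Unset Strict Implicit.
Unset Printing Implicit Defensive.

Import Order.TTheory GRing.Theory Num.Theory.
Import numFieldNormedType.Exports.

Local Open Scope classical_set_scope.
Local Open Scope ring_scope.

Definition complete_space (X : uniformType) : Prop :=
  forall F : set_system X, ProperFilter F -> cauchy F -> exists x : X, F --> x.

Definition separable_space (X : topologicalType) : Prop :=
  exists2 D : set X, countable D & dense D.

Section SetTypeMetric.
Context (R : realType) (X : metricType R) (A : set X).

Let dA (x y : A) : R := mdist (set_val x) (set_val y).

Let dA_ge0 x y : 0 <= dA x y.
Proof. exact: mdist_ge0. Qed.

Let dA_positivity x y : dA x y = 0 -> x = y.
Proof. by move=> /mdist_positivity; exact: val_inj. Qed.

Let ballEdA (x : A) (e : R) : ball x e = [set y | dA x y < e].
Proof.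
rewrite /ball/= /initial_ball /dA.
by apply/seteqP; split=> y /=; rewrite ballEmdist.
Qed.

HB.instance Definition _ :=
  @PseudoMetric_isMetric.Build R (set_type A) dA dA_ge0 dA_positivity ballEdA.

End SetTypeMetric.

Definition homeomorphic (X Y : topologicalType) : Prop :=
  exists (f : X -> Y) (g : Y -> X),
    [/\ cancel f g, cancel g f, continuous f & continuous g].

Definition polish (R : realType) (X : topologicalType) : Prop :=
  exists M : metricType R,
    [/\ complete_space M, separable_space M & homeomorphic X M].

Definition borel (X : topologicalType) : set (set X) := <<s @open X >>.

(** [tau : Topological X] ranges over all topologies on the carrier of [X]. *)
Definition potentially_Sigma02 (R : realType) (X : topologicalType)
    (E : X -> X -> Prop) : Prop :=
  exists tau : Topological X,
    let Xtau : topologicalType := Topological.Pack tau in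
    [/\ polish R Xtau,
        @borel Xtau = @borel X &
        @Fsigma (Xtau * Xtau)%type [set p | E p.1 p.2]].

(** The standard Borel space [Y] is given by a Polish topology inducing it; the
    Borel sets of the product topology are then those of the product space. *)
Definition essentially_countable (R : realType) (X : topologicalType)
    (E : X -> X -> Prop) : Prop :=
  exists (Y : topologicalType) (Q : Y -> Y -> Prop) (f : X -> Y),
    [/\ polish R Y,
        RelationClasses.Equivalence Q /\
          @borel (Y * Y)%type [set p | Q p.1 p.2],
        forall y, countable [set z | Q y z],
        forall B, borel B -> borel (f @^-1` B) &
        forall x x', E x x' <-> Q (f x) (f x')].

Section Modulus.
Context (R : realType).

(** Only the values on [0, +oo[ are constrained. *)
Definition modulus (D : R -> R) : Prop :=
  [/\ {within [set r | 0 <= r], continuous D},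
      D 0 = 0,
      forall r : R, 0 <= r -> 0 <= D r &
      forall r s : R, 0 <= r -> 0 <= s -> D r <= D (r + s) <= D r + D s].

Definition max_dist (M : metricType R) n (a b : 'I_n -> M) : R :=
  \big[Num.max/0]_(i < n) mdist (a i) (b i).

End Modulus.

(** The distinguished binary predicate for the metric is not a member of
    [pred_sym]; its modulus and bounds are the fields [dist_*]. *)
Record signature (R : realType) := Signature {
  pred_sym : countType;
  pred_ar : pred_sym -> nat;
  pred_mod : pred_sym -> R -> R;
  pred_lo : pred_sym -> R;
  pred_hi : pred_sym -> R;
  fun_sym : countType;
  fun_ar : fun_sym -> nat;
  fun_mod : fun_sym -> R -> R;
  dist_mod : R -> R;
  dist_lo : R;
  dist_hi : R;
  pred_modP : forall P, modulus (pred_mod P);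
  pred_boundP : forall P, pred_lo P <= pred_hi P;
  fun_modP : forall f, modulus (fun_mod f);
  dist_modP : modulus dist_mod;
  dist_boundP : dist_lo <= dist_hi
}.

(** Structures are nonempty, so that [Sup] and [Inf] are real-valued. *)
Record structure (R : realType) (L : signature R) := Structure {
  carrier :> metricType R;
  carrier_inhabited : inhabited carrier;
  carrier_complete : complete_space carrier;
  pred_int : forall P : pred_sym L, ('I_(pred_ar P) -> carrier) -> R;
  fun_int : forall f : fun_sym L, ('I_(fun_ar f) -> carrier) -> carrier;
  pred_int_bound : forall P a, pred_lo P <= pred_int (P := P) a <= pred_hi P;
  pred_int_mod : forall P (a b : 'I_(pred_ar P) -> carrier),
    `|pred_int a - pred_int b| <= pred_mod P (max_dist a b);
  fun_int_mod : forall f (a b : 'I_(fun_ar f) -> carrier),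
    mdist (fun_int a) (fun_int b) <= fun_mod f (max_dist a b);
  dist_bound : forall x y : carrier, dist_lo L <= mdist x y <= dist_hi L;
  dist_mod_int : forall x y x' y' : carrier,
    `|mdist x y - mdist x' y'|
      <= dist_mod L (Num.max (mdist x x') (mdist y y'))
}.

Section Syntax.
Context (R : realType) (L : signature R).

Inductive term (n : nat) : Type :=
| Var : 'I_n -> term n
| App : forall f : fun_sym L, ('I_(fun_ar f) -> term n) -> term n.

(** [preformula n] has its free variables among n variables, indexed by 'I_n.
    [Sup] and [Inf] bind variable [ord0]; variable [i] of the quantified formula
    is variable [lift ord0 i] of its body. *)
Inductive preformula : nat -> Type :=
| Pred : forall n (P : pred_sym L), ('I_(pred_ar P) -> term n) -> preformula n
| Dist : forall n, term n -> term n -> preformula n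
| One : forall n, preformula n
| Add : forall n, preformula n -> preformula n -> preformula n
| Scale : forall n, rat -> preformula n -> preformula n
| Max : forall n, preformula n -> preformula n -> preformula n
| Min : forall n, preformula n -> preformula n -> preformula n
| Sup : forall n, preformula n.+1 -> preformula n
| Inf : forall n, preformula n.+1 -> preformula n
| CSup : forall n, (nat -> preformula n) -> preformula n
| CInf : forall n, (nat -> preformula n) -> preformula n.

Fixpoint tsubst n m (s : 'I_n -> term m) (t : term n) : term m :=
  match t with
  | Var i => s i
  | App f ts => App (fun i => tsubst s (ts i))
  end.

Definition scons (X : Type) n (x : X) (v : 'I_n -> X) : 'I_n.+1 -> X :=
  fun i => if unlift ord0 i is Some j then v j else x.

Definition up n m (s : 'I_n -> term m) : 'I_n.+1 -> term m.+1 :=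
  scons (Var ord0) (fun j => tsubst (fun k => Var (lift ord0 k)) (s j)).

Fixpoint subst n (phi : preformula n) :
    forall m, ('I_n -> term m) -> preformula m :=
  match phi in preformula n
    return forall m, ('I_n -> term m) -> preformula m with
  | Pred _ P ts => fun _ s => Pred (fun i => tsubst s (ts i))
  | Dist _ t u => fun _ s => Dist (tsubst s t) (tsubst s u)
  | One _ => fun m _ => One m
  | Add _ p q => fun _ s => Add (subst p s) (subst q s)
  | Scale _ r p => fun _ s => Scale r (subst p s)
  | Max _ p q => fun _ s => Max (subst p s) (subst q s)
  | Min _ p q => fun _ s => Min (subst p s) (subst q s)
  | Sup _ p => fun _ s => Sup (subst p (up s))
  | Inf _ p => fun _ s => Inf (subst p (up s))
  | CSup _ ps => fun _ s => CSup (fun i => subst (ps i) s)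
  | CInf _ ps => fun _ s => CInf (fun i => subst (ps i) s)
  end.

Section Evaluation.
Context (M : structure L).

Fixpoint teval n (v : 'I_n -> M) (t : term n) : M :=
  match t with
  | Var i => v i
  | App f ts => fun_int (fun i => teval v (ts i))
  end.

Fixpoint eval n (phi : preformula n) : ('I_n -> M) -> R :=
  match phi in preformula n return ('I_n -> M) -> R with
  | Pred _ P ts => fun v => pred_int (fun i => teval v (ts i))
  | Dist _ t u => fun v => mdist (teval v t) (teval v u)
  | One _ => fun=> 1
  | Add _ p q => fun v => eval p v + eval q v
  | Scale _ r p => fun v => ratr r * eval p v
  | Max _ p q => fun v => Num.max (eval p v) (eval q v)
  | Min _ p q => fun v => Num.min (eval p v) (eval q v)
  | Sup _ p => fun v => sup (range (fun y => eval p (scons y v)))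
  | Inf _ p => fun v => inf (range (fun y => eval p (scons y v)))
  | CSup _ ps => fun v => sup (range (fun i => eval (ps i) v))
  | CInf _ ps => fun v => inf (range (fun i => eval (ps i) v))
  end.

End Evaluation.

(** Evaluated semantically, in all structures of the signature. *)
Definition respects n (phi : preformula n) (D : R -> R) (lo hi : R) : Prop :=
  forall (M : structure L) (a b : 'I_n -> M),
    lo <= eval phi a <= hi /\ `|eval phi a - eval phi b| <= D (max_dist a b).

Definition uniformly_respect n (phis : nat -> preformula n) : Prop :=
  exists D lo hi, modulus D /\ forall i, respects (phis i) D lo hi.

(** The L_{omega_1 omega}-formulas: [CSup] and [CInf] are only applied to
    families with a common modulus of continuity and bound, so all suprema and
    infima in [eval] are those of nonempty bounded sets. *)
Fixpoint is_formula n (phi : preformula n) : Prop :=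
  match phi with
  | Pred _ _ _ | Dist _ _ _ | One _ => True
  | Scale _ _ p => is_formula p
  | Add _ p q | Max _ p q | Min _ p q => is_formula p /\ is_formula q
  | Sup _ p | Inf _ p => is_formula p
  | CSup _ ps | CInf _ ps =>
      (forall i, is_formula (ps i)) /\ uniformly_respect ps
  end.

Definition theory := set (preformula 0 * R).

Definition is_theory (T : theory) : Prop := forall c, T c -> is_formula c.1.

(** There is exactly one [v : 'I_0 -> M]. *)
Definition models (M : structure L) (T : theory) : Prop :=
  forall c, T c -> forall v : 'I_0 -> M, eval c.1 v = c.2.

Definition formulas := forall n, set (preformula n).

Definition has_subformulas (F : formulas) n (phi : preformula n) : Prop :=
  match phi with
  | Pred _ _ _ | Dist _ _ _ | One _ => True
  | Scale _ _ p => F _ p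
  | Add _ p q | Max _ p q | Min _ p q => F _ p /\ F _ q
  | Sup _ p | Inf _ p => F _ p
  | CSup _ ps | CInf _ ps => forall i, F _ (ps i)
  end.

(** The constant [One] is treated as a nullary connective. *)
Record fragment (F : formulas) : Prop := Fragment {
  fragment_countable : forall n, countable (F n);
  fragment_formula : forall n phi, F n phi -> is_formula phi;
  fragment_pred : forall n (P : pred_sym L) (ts : 'I_(pred_ar P) -> term n),
    F n (Pred ts);
  fragment_dist : forall n (t u : term n), F n (Dist t u);
  fragment_one : forall n, F n (One n);
  fragment_add : forall n p q, F n p -> F n q -> F n (Add p q);
  fragment_scale : forall n r p, F n p -> F n (Scale r p);
  fragment_max : forall n p q, F n p -> F n q -> F n (Max p q);
  fragment_min : forall n p q, F n p -> F n q -> F n (Min p q);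
  fragment_sup : forall n p, F n.+1 p -> F n (Sup p);
  fragment_inf : forall n p, F n.+1 p -> F n (Inf p);
  fragment_subformulas : forall n phi, F n phi -> has_subformulas F phi;
  fragment_subst : forall n m (s : 'I_n -> term m) phi,
    F n phi -> F m (subst phi s)
}.

Definition theory_in (F : formulas) (T : theory) : Prop :=
  forall c, T c -> F 0%N c.1.

Definition isomorphic (M N : structure L) : Prop :=
  exists h : M -> N,
    [/\ bijective h,
        forall x y, mdist (h x) (h y) = mdist x y,
        forall (P : pred_sym L) (a : 'I_(pred_ar P) -> M),
          pred_int (fun i => h (a i)) = pred_int a &
        forall (f : fun_sym L) (a : 'I_(fun_ar f) -> M),
          fun_int (fun i => h (a i)) = h (fun_int a)].

Definition tp (F : formulas) (M : structure L) k (a : 'I_k -> M) :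
  {phi : preformula k | F k phi} -> R := fun phi => eval (sval phi) a.
Arguments tp F {M k} a.

Definition type_space (F : formulas) (T : theory) k :
    set ({phi : preformula k | F k phi} -> R) :=
  [set p | exists M : structure L, exists a : 'I_k -> M,
    models M T /\ tp F a = p].

Definition rigid (F : formulas) (T : theory) k
    (p : {phi : preformula k | F k phi} -> R) : Prop :=
  type_space T p /\
  forall (M N : structure L) (a : 'I_k -> M) (b : 'I_k -> N),
    separable_space M -> models M T -> separable_space N -> models N T ->
    tp F a = p -> tp F b = p -> isomorphic M N.

(** Types in the variables x_0, x_1, ...: an element of [F n] is read as a
    formula in x_0, ..., x_(n-1). *)
Definition omega_type (F : formulas) :=
  {ptws {n : nat & {phi : preformula n | F n phi}} -> R}.

HB.instance Definition _ (F : formulas) := Topological.copy (omega_type F)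
  {ptws {n : nat & {phi : preformula n | F n phi}} -> R}.

Definition initial_segment (X : Type) (a : nat -> X) n : 'I_n -> X := fun i => a i.

Definition omega_tp (F : formulas) (M : structure L) (a : nat -> M) :
    omega_type F :=
  fun phi => eval (sval (projT2 phi)) (@initial_segment _ a (projT1 phi)).
Arguments omega_tp F {M} a.

Definition tarski_vaught (F : formulas) (M : structure L) (a : nat -> M) :=
  forall n (phi : preformula n.+1), F n.+1 phi ->
    eval (Inf phi) (@initial_segment _ a n) =
    inf (range (fun j => eval phi (scons (a j) (@initial_segment _ a n)))).

Definition Mod (F : formulas) (T : theory) : set (omega_type F) :=
  [set xi | exists M : structure L, exists a : nat -> M,
    [/\ models M T, omega_tp F a = xi & tarski_vaught F a]].

End Syntax.

Arguments tp {R L} F {M k} a _.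
Arguments omega_tp {R L} F {M} a _.
Arguments Mod {R L} F T _.

Section Substructure.
Context (R : realType) (L : signature R) (M : structure L) (A : set M).
Hypothesis A_inhabited : A !=set0.
Hypothesis A_closed : closed A.
Hypothesis A_fun : forall (f : fun_sym L) (a : 'I_(fun_ar f) -> M),
  (forall i, A (a i)) -> A (fun_int a).

Lemma substructure_inhabited : inhabited (set_type A).
Proof. by case: A_inhabited => x Ax; constructor; exists x; rewrite inE. Qed.

Lemma substructure_complete : complete_space (set_type A).
Proof.
move=> F FF /cauchyP Fc.
have [|x Fx] := @carrier_complete _ _ M (set_val @ F) _.
  apply/cauchy_exP => e e0; have [x Fx] := Fc _ e0.
  by exists (set_val x).
have Ax : A x.
  apply: (A_closed (t := x)) => B Bx.
  have FB : F (set_val @^-1` B) := Fx _ Bx.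
  have [y By] := filter_ex FB.
  by exists (set_val y); split => //; exact: set_valP.
exists (exist _ x (mem_set Ax)) => B /nbhs_ballP[e /= e0 eB].
have FB : F (set_val @^-1` ball x e) := Fx _ (nbhsx_ballx x e e0).
by apply: (filterS _ FB) => y xy; exact: eB.
Qed.

Definition substructure_pred (P : pred_sym L)
    (a : 'I_(pred_ar P) -> set_type A) : R :=
  pred_int (fun i => set_val (a i)).

Definition substructure_fun (f : fun_sym L)
    (a : 'I_(fun_ar f) -> set_type A) : set_type A :=
  exist _ (fun_int (fun i => set_val (a i)))
    (mem_set (A_fun (fun i => set_valP (a i)))).

Definition substructure : structure L :=
  @Structure R L (set_type A) substructure_inhabited
    substructure_complete substructure_pred substructure_fun
    (fun P a => pred_int_bound _)
    (fun P a b => pred_int_mod (fun i => set_val (a i)) (fun i => set_val (b i)))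
    (fun f a b => fun_int_mod (fun i => set_val (a i)) (fun i => set_val (b i)))
    (fun x y => dist_bound (set_val x) (set_val y))
    (fun x y x' y' =>
      dist_mod_int (set_val x) (set_val y) (set_val x') (set_val y')).

End Substructure.

Section Model.
Context (R : realType) (L : signature R).

Lemma modulus_small (D : R -> R) (e : R) : modulus D -> 0 < e ->
  exists2 d : R, 0 < d & forall r : R, 0 <= r -> r < d -> D r < e.
Proof.
move=> [cD D0 Dge0 _] e0.
have /subspace_continuousP/(_ 0) := cD; rewrite /= lexx => /(_ isT).
move/cvgrPdist_lt => /(_ e e0); rewrite /from_subspace D0 near_withinE.
move=> /nbhs_ballP[d /= d0 dP]; exists d => // r r0 rd.
have := dP r; rewrite /ball/= sub0r normrN ger0_norm// => /(_ rd r0).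
by rewrite sub0r normrN ger0_norm// Dge0.
Qed.

Lemma max_dist_ge0 (M : metricType R) n (a b : 'I_n -> M) : 0 <= max_dist a b.
Proof.
rewrite /max_dist; elim/big_ind: _ => // [x y x0 y0|i _].
  by rewrite le_max x0.
exact: mdist_ge0.
Qed.

Lemma max_dist_lt (M : metricType R) n (a b : 'I_n -> M) (d : R) : 0 < d ->
  (forall i, mdist (a i) (b i) < d) -> max_dist a b < d.
Proof.
move=> d0 abd; rewrite /max_dist; elim/big_ind: _ => // x y xd yd.
by rewrite gt_max xd.
Qed.

Lemma closure_mdistP (M : metricType R) (A : set M) (x : M) :
  closure A x <-> forall e : R, 0 < e -> exists2 y, A y & mdist x y < e.
Proof.
split=> [Ax e e0|Ax B /nbhs_ballP[e /= e0 eB]].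
  have [y [Ay]] := Ax _ (nbhsx_ballx x e e0).
  by rewrite ballEmdist; exists y.
have [y Ay xy] := Ax e e0.
by exists y; split => //; apply: eB; rewrite ballEmdist.
Qed.

Variables (F : formulas L) (M : structure L) (a : nat -> M).
Hypothesis fragF : fragment F.
Hypothesis tva : tarski_vaught F a.

Lemma closure_fun_range (f : fun_sym L) (i : 'I_(fun_ar f) -> nat) :
  closure (range a) (fun_int (fun l => a (i l))).
Proof.
set c := fun_int _.
have im l : (i l < (\max_l i l).+1)%N by rewrite ltnS leq_bigmax.
pose phi : preformula L (\max_l i l).+2 :=
  Dist (Var L ord0) (App (fun l => Var L (lift ord0 (Ordinal (im l))))).
have phiE y : eval phi (scons y (@initial_segment _ a (\max_l i l).+1)) =
    mdist y c.
  rewrite /phi/= {1}/scons unlift_none; congr (mdist _ (fun_int _)).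
  by apply/funext => l; rewrite /scons liftK.
have infE : inf (range (fun y => mdist y c)) =
    inf (range (fun j => mdist (a j) c)).
  have := tva (fragment_dist fragF _ _ : @F _ phi).
  have -> : (fun j => eval phi (scons (a j) (@initial_segment _ a _))) =
      (fun j => mdist (a j) c) by apply/funext => j; exact: phiE.
  have <- : (fun y => eval phi (scons y (@initial_segment _ a _))) =
      (fun y => mdist y c) by apply/funext => y; exact: phiE.
  exact.
apply/closure_mdistP => e e0.
have : inf (range (fun j => mdist (a j) c)) < e.
  rewrite -infE; apply: le_lt_trans e0.
  apply: ge_inf; first by exists 0 => _ [y _ <-]; exact: mdist_ge0.
  by exists c => //; rewrite mdistxx.
move=> /inf_lt[|_ [j _ <-] je].
  by exists (mdist (a 0%N) c), 0%N.
by exists (a j); [exists j|rewrite metric_sym].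
Qed.

Lemma closure_range_fun (f : fun_sym L) (b : 'I_(fun_ar f) -> M) :
  (forall l, closure (range a) (b l)) -> closure (range a) (fun_int b).
Proof.
move=> bA; apply/closure_mdistP => e e0.
have e20 : 0 < e / 2 by rewrite divr_gt0.
have [d d0 dP] := modulus_small (fun_modP f) e20.
have /choice[i iP] : forall l, exists k, mdist (b l) (a k) < d.
  move=> l; have /closure_mdistP/(_ d d0)[_ [k _ <-] kd] := bA l.
  by exists k.
have /closure_mdistP/(_ _ e20)[y Ay ye] := @closure_fun_range f i.
exists y => //; rewrite (splitr e).
apply: (le_lt_trans (metric_triangle _ (fun_int (fun l => a (i l))) _)).
apply: ltrD => //; apply: (le_lt_trans (fun_int_mod _ _)).
by apply: dP; [exact: max_dist_ge0|exact: max_dist_lt].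
Qed.

Definition closure_structure : structure L :=
  @substructure R L M (closure (range a))
    (ex_intro _ (a 0%N) (subset_closure (ex_intro2 _ _ 0%N I erefl)))
    (@closed_closure _ (range a)) closure_range_fun.

End Model.

Arguments closure_structure {R L F M a} fragF tva.

(** A structure [M] and a sequence [a] witnessing [Mod F T xi] are chosen; the
    isomorphism type of [coded_structure] does not depend on the choice. *)
Section Coded.
Context (R : realType) (L : signature R) (F : formulas L) (T : theory L).
Hypothesis fragF : fragment F.

Definition coded_model (xi : Mod F T) := cid (set_valP xi).
Definition coded_enumeration xi := cid (projT2 (coded_model xi)).

Lemma coded_tarski_vaught xi :
  tarski_vaught F (projT1 (coded_enumeration xi)).
Proof. by case: (projT2 (coded_enumeration xi)). Qed.

Definition coded_structure (xi : Mod F T) : structure L :=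
  closure_structure fragF (coded_tarski_vaught xi).

Definition iso_rel (xi eta : Mod F T) : Prop :=
  isomorphic (coded_structure xi) (coded_structure eta).

End Coded.

(* Main.v *)
From HB Require Import structures.
From mathcomp Require Import all_boot all_order all_algebra.
From mathcomp Require Import all_classical all_reals all_analysis.
From mathcomp Require Import borel_hierarchy.
From mathcomp Require Import lra.
Require Import Defs.

Set Implicit Arguments.
Unset Strict Implicit.
Unset Printing Implicit Defensive.

Import Order.TTheory GRing.Theory Num.Theory.
Import numFieldNormedType.Exports.

Local Open Scope classical_set_scope.
Local Open Scope ring_scope.

(** From rigid types to data: if the types realized near a tuple [a] of a locally compact
    model [M] are rigid, then by compactness every separable model realizing a type close
    to that of [a] is isomorphic to [M].  An omitting types argument (build a generic
    model; it is isomorphic to [M]) yields a tuple [b] in [M] all of whose extensions are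
    isolated up to any [r > 0] among the extensions of tuples near [b].  A back-and-forth
    then shows that the formulas realized near [b] form a countable invariant which
    determines [M] up to isomorphism, and [M] has only countably many such invariants.
    Refining the topology so that they become continuous gives (i), and a Borel choice of
    pieces on which one invariant is a function of another gives (iii).

    Conversely, (i) and (iii) both write each class as a countable union of intersections
    of complements taken from a fixed sequence of Borel sets [V m].  On the dense sequences
    of a model each [V m] agrees, up to a meager set, with an open set defined by countably
    many formulas; complements are handled by the formula giving the distance to an open
    set.  In a fragment containing these formulas, Baire category finds a ball of tuples
    whose type already forces membership in the class, so these types are rigid. *)

(** * Suprema, moduli of continuity and substitution *)

(** Type spaces are never metrized. [near_type F n r c d] says that every open condition met by [d]
    is met within [r] of [c]; up to enlarging radii this is symmetric and transitive, and it
    compares tuples of different structures. The fragment of (ii) need not be the one that defines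
    [Mod], so every notion about models must be Borel in the given coding. This is why validity,
    data and pieces are restated with quantifiers over formula indices and over tuples from one
    dense sequence. For (iii) each class has countably many invariants in [nat -> nat], but the set
    of all invariants is an image of a Borel set, a priori only analytic. On each piece the passage
    from one invariant of a class to another depends on the first invariant alone, so Lusin
    separation extends it to a Borel function on all of Baire space. Standard Borel spaces are
    handled as closed subsets of Baire space, where countably many Borel functions become continuous
    by adding coordinates. In the converse, one family of formulas must serve all separable models
    at once, as the isomorphism class of the model realizing a given type is not known in
    advance. *)

Section RangeBounds.
Context (R : realType) (I : Type).
Implicit Types (f g : I -> R) (c h : R).

Lemma eq_sup_range f g : f =1 g -> sup (range f) = sup (range g).
Proof. by move=> /funext->. Qed.

Lemma eq_inf_range f g : f =1 g -> inf (range f) = inf (range g).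
Proof. by move=> /funext->. Qed.

Lemma le_sup_range f h i : (forall j, f j <= h) -> f i <= sup (range f).
Proof.
move=> fh; apply: ub_le_sup; last by exists i.
by exists h => _ [j _ <-].
Qed.

Lemma ge_inf_range f h i : (forall j, h <= f j) -> inf (range f) <= f i.
Proof.
move=> fh; apply: ge_inf; last by exists i.
by exists h => _ [j _ <-].
Qed.

Lemma sup_range_le f c : inhabited I -> (forall i, f i <= c) ->
  sup (range f) <= c.
Proof.
by move=> [i0] fc; apply: ge_sup; [exists (f i0), i0|move=> _ [i _ <-]].
Qed.

Lemma inf_range_ge f c : inhabited I -> (forall i, c <= f i) ->
  c <= inf (range f).
Proof.
by move=> [i0] fc; apply: lb_le_inf; [exists (f i0), i0|move=> _ [i _ <-]].
Qed.

Lemma inf_range_lt f c : inhabited I -> inf (range f) < c ->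
  exists i, f i < c.
Proof.
by move=> [i0] /inf_lt[|_ [i _ <-] ic]; [exists (f i0), i0|exists i].
Qed.

Lemma sup_range_gt f c : inhabited I -> c < sup (range f) ->
  exists i, c < f i.
Proof.
by move=> [i0] /sup_gt[|_ [i _ <-] ic]; [exists (f i0), i0|exists i].
Qed.

Lemma sup_range_dist f g lo hi e : inhabited I ->
  (forall i, lo <= f i <= hi) -> (forall i, lo <= g i <= hi) ->
  (forall i, `|f i - g i| <= e) ->
  `|sup (range f) - sup (range g)| <= e.
Proof.
move=> I0 fb gb fg; rewrite ler_distl; apply/andP; split.
  rewrite lerBlDr; apply: sup_range_le => // i.
  have := fg i; rewrite ler_distl => /andP[+ _]; rewrite lerBlDr => /le_trans.
  by apply; rewrite lerD2r; apply: (@le_sup_range _ hi) => j; case/andP: (fb j).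
apply: sup_range_le => // i.
have := fg i; rewrite ler_distl => /andP[_ /le_trans]; apply.
by rewrite lerD2r; apply: (@le_sup_range _ hi) => j; case/andP: (gb j).
Qed.

Lemma inf_range_dist f g lo hi e : inhabited I ->
  (forall i, lo <= f i <= hi) -> (forall i, lo <= g i <= hi) ->
  (forall i, `|f i - g i| <= e) ->
  `|inf (range f) - inf (range g)| <= e.
Proof.
move=> I0 fb gb fg; rewrite ler_distl; apply/andP; split.
  apply: inf_range_ge => // i; rewrite lerBlDr.
  have := fg i; rewrite ler_distl => /andP[_ gf].
  have : inf (range g) <= g i by apply: (@ge_inf_range _ lo) => j; case/andP: (gb j).
  by have := fg i; rewrite ler_distl; lra.
rewrite -lerBlDr; apply: inf_range_ge => // i.
have : inf (range f) <= f i by apply: (@ge_inf_range _ lo) => j; case/andP: (fb j).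
by have := fg i; rewrite ler_distl; lra.
Qed.

End RangeBounds.

Section Moduli.
Context (R : realType).
Implicit Types D : R -> R.

Lemma modulus_ge0 D r : modulus D -> 0 <= r -> 0 <= D r.
Proof. by case=> _ _ + _; exact. Qed.

Lemma modulus_le D r s : modulus D -> 0 <= r -> r <= s -> D r <= D s.
Proof.
move=> [_ _ _ DD] r0 rs; have [] := andP (DD r (s - r) r0 _).
  by rewrite subr_ge0.
by rewrite addrC subrK.
Qed.

(** Subadditivity carries continuity at [0] to every point, and monotonicity from [0] gives
    nonnegativity, so a modulus can be checked near [0]. *)
Lemma modulusI D : D 0 = 0 ->
  (forall r s : R, 0 <= r -> 0 <= s -> D r <= D (r + s) <= D r + D s) ->
  (forall e : R, 0 < e ->
    exists2 d : R, 0 < d & forall r : R, 0 <= r -> r < d -> D r < e) ->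
  modulus D.
Proof.
move=> D0 DD Ds.
have Dge0 r : 0 <= r -> 0 <= D r.
  by move=> r0; have := DD 0 r (lexx _) r0; rewrite D0 !add0r => /andP[].
split => //; apply/subspace_continuousP => x /= x0.
apply/cvgrPdist_lt => e e0; rewrite near_withinE.
have [d d0 dP] := Ds e e0; apply/nbhs_ballP; exists d => //= y; rewrite /ball/=.
move=> xy y0; rewrite /from_subspace/=.
have [yx|xy'] := leP y x.
  have := DD y (x - y) y0; rewrite subr_ge0 => /(_ yx); rewrite [y + _]addrC subrK.
  have := dP (x - y); rewrite subr_ge0 => /(_ yx).
  have -> : x - y < d by apply: le_lt_trans xy; exact: ler_norm.
  by move=> /(_ isT) ? /andP[? ?]; rewrite ger0_norm; lra.
have := DD x (y - x) x0; rewrite subr_ge0 => /(_ (ltW xy')); rewrite [x + _]addrC subrK.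
have := dP (y - x); rewrite subr_ge0 => /(_ (ltW xy')).
have -> : y - x < d by apply: le_lt_trans xy; rewrite distrC; exact: ler_norm.
by move=> /(_ isT) ? /andP[? ?]; rewrite distrC ger0_norm; lra.
Qed.

Lemma modulus_id : modulus (@id R).
Proof.
apply: modulusI => // [r s r0 s0|e e0]; last by exists e.
by rewrite lexx andbT lerDl.
Qed.

Lemma modulus0 : modulus (fun=> 0 : R).
Proof.
apply: modulusI => // [r s r0 s0|e e0]; last by exists e.
by rewrite addr0 !lexx.
Qed.

Lemma modulus_add D1 D2 : modulus D1 -> modulus D2 ->
  modulus (fun r => D1 r + D2 r).
Proof.
move=> m1 m2; case: (m1) (m2) => [_ D10 _ DD1] [_ D20 _ DD2].
apply: modulusI => [|r s r0 s0|e e0]; first by rewrite D10 D20 addr0.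
  have /andP[? ?] := DD1 _ _ r0 s0; have /andP[? ?] := DD2 _ _ r0 s0.
  by apply/andP; split; lra.
have e2 : 0 < e / 2 by rewrite divr_gt0.
have [d1 d10 P1] := modulus_small m1 e2; have [d2 d20 P2] := modulus_small m2 e2.
exists (Num.min d1 d2); first by rewrite lt_min d10.
move=> r r0; rewrite lt_min => /andP[/P1 -/(_ r0) ? /P2 -/(_ r0) ?]; lra.
Qed.

Lemma modulus_scale D c : 0 <= c -> modulus D -> modulus (fun r => c * D r).
Proof.
move=> c0 m1; case: (m1) => [_ D0 _ DD].
apply: modulusI => [|r s r0 s0|e e0]; first by rewrite D0 mulr0.
  by rewrite -mulrDr !ler_wpM2l//; have /andP[] := DD _ _ r0 s0.
have c1 : 0 < c + 1 by lra.
have [d d0 P] := modulus_small m1 (divr_gt0 e0 c1).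
exists d => // r r0 /(P _ r0); rewrite ltr_pdivlMr//.
have := modulus_ge0 m1 r0; nra.
Qed.

Lemma modulus_comp D1 D2 : modulus D1 -> modulus D2 -> modulus (D1 \o D2).
Proof.
move=> m1 m2; case: (m1) (m2) => [_ D10 D1ge DD1] [_ D20 D2ge DD2].
apply: modulusI => [|r s r0 s0|e e0] /=; first by rewrite D20.
  have /andP[h1 h2] := DD2 _ _ r0 s0; apply/andP; split.
    by apply: modulus_le => //; exact: D2ge.
  apply: (le_trans (modulus_le m1 _ h2)); first by apply: D2ge; exact: addr_ge0.
  by have /andP[] := DD1 _ _ (D2ge _ r0) (D2ge _ s0).
have [d d0 P] := modulus_small m1 e0; have [d' d'0 P'] := modulus_small m2 d0.
by exists d' => // r r0 rd; apply: P; [exact: D2ge|exact: P'].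
Qed.

Lemma modulus_sum (I : Type) (r : seq I) (D : I -> R -> R) :
  (forall i, modulus (D i)) -> modulus (fun x => \sum_(i <- r) D i x).
Proof.
move=> mD; elim: r => [|i r IH].
  by under eq_fun do rewrite big_nil; exact: modulus0.
by under eq_fun do rewrite big_cons; exact: modulus_add.
Qed.

Lemma max_dist_le (M : metricType R) n (a b : 'I_n -> M) (d : R) : 0 <= d ->
  (forall i, mdist (a i) (b i) <= d) -> max_dist a b <= d.
Proof.
by move=> d0 h; rewrite /max_dist; elim/big_ind: _ => // x y xd yd; rewrite ge_max xd.
Qed.

Lemma le_max_dist (M : metricType R) n (a b : 'I_n -> M) i :
  mdist (a i) (b i) <= max_dist a b.
Proof. by rewrite /max_dist (bigD1 i)//= le_max lexx. Qed.

Lemma max_dist_scons (M : metricType R) n (y : M) (a b : 'I_n -> M) :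
  max_dist (scons y a) (scons y b) <= max_dist a b.
Proof.
apply: max_dist_le; first exact: max_dist_ge0.
move=> i; rewrite /scons; case: unliftP => [j _|_]; first exact: le_max_dist.
by rewrite mdistxx max_dist_ge0.
Qed.

Lemma mdist_dist (M : metricType R) (x y x' y' : M) :
  `|mdist x y - mdist x' y'| <= mdist x x' + mdist y y'.
Proof.
rewrite ler_distl; apply/andP; split.
  have := metric_triangle x' x y'; have := metric_triangle x y y'.
  by rewrite (metric_sym x' x); lra.
have := metric_triangle x x' y; have := metric_triangle x' y' y.
by rewrite (metric_sym y' y); lra.
Qed.

End Moduli.

Section Semantics.
Context (R : realType) (L : signature R).
Implicit Types M N : structure L.

Lemma teval_modulus n (t : term L n) : exists2 D : R -> R, modulus D &
  forall M (a b : 'I_n -> M), mdist (teval a t) (teval b t) <= D (max_dist a b).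
Proof.
elim: t => [i|f ts IH].
  by exists id => [|M a b]; [exact: modulus_id|exact: le_max_dist].
have /choice[D DP] : forall i, exists D : R -> R, modulus D /\
    forall M (a b : 'I_n -> M),
      mdist (teval a (ts i)) (teval b (ts i)) <= D (max_dist a b).
  by move=> i; have [D D1 D2] := IH i; exists D.
(* A sum of moduli dominates each summand and is again a modulus; it stands in for the maximum over
   the arguments. *)
exists (fun_mod f \o (fun x => \sum_(i <- enum 'I_(fun_ar f)) D i x)).
  by apply: modulus_comp; [exact: fun_modP|apply: modulus_sum => i; case: (DP i)].
move=> M a b /=; apply: (le_trans (fun_int_mod _ _)).
apply: modulus_le; [exact: fun_modP|exact: max_dist_ge0|].
have Dge i : 0 <= D i (max_dist a b).
  by apply: modulus_ge0; [case: (DP i)|exact: max_dist_ge0].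
apply: max_dist_le => [|i]; first exact: sumr_ge0.
case: (DP i) => _ /(_ M a b)/le_trans; apply.
rewrite big_enum/= (bigD1 i)//= lerDl; exact: sumr_ge0.
Qed.

(** A quantifier keeps the modulus, because both tuples are extended by the same point. Modulus and
    bounds hold in all structures at once, which is what allows comparisons between different models
    later. *)
Lemma eval_respects n (phi : preformula L n) : is_formula phi ->
  exists D lo hi, modulus D /\ respects phi D lo hi.
Proof.
elim: phi => {n} [n P ts|n t u|n|n p IHp q IHq|n r p IHp|n p IHp q IHq
  |n p IHp q IHq|n p IHp|n p IHp|n ps IH|n ps IH] /=.
- move=> _.
  have /choice[D DP] : forall i, exists D : R -> R, modulus D /\
      forall M (a b : 'I_n -> M),
        mdist (teval a (ts i)) (teval b (ts i)) <= D (max_dist a b).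
    by move=> i; have [D D1 D2] := teval_modulus (ts i); exists D.
  exists (pred_mod P \o (fun x => \sum_(i <- enum 'I_(pred_ar P)) D i x)).
  exists (pred_lo P), (pred_hi P); split.
    by apply: modulus_comp; [exact: pred_modP|apply: modulus_sum => i; case: (DP i)].
  move=> M a b /=; split; first exact: pred_int_bound.
  apply: (le_trans (pred_int_mod _ _)).
  apply: modulus_le; [exact: pred_modP|exact: max_dist_ge0|].
  have Dge i : 0 <= D i (max_dist a b).
    by apply: modulus_ge0; [case: (DP i)|exact: max_dist_ge0].
  apply: max_dist_le => [|i]; first exact: sumr_ge0.
  case: (DP i) => _ /(_ M a b)/le_trans; apply.
  rewrite big_enum/= (bigD1 i)//= lerDl; exact: sumr_ge0.
- move=> _; have [D1 m1 P1] := teval_modulus t; have [D2 m2 P2] := teval_modulus u.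
  exists (fun r => D1 r + D2 r), (dist_lo L), (dist_hi L).
  split=> [|M a b /=]; first exact: modulus_add.
  split; first exact: dist_bound.
  by apply: (le_trans (mdist_dist _ _ _ _)); rewrite lerD.
- move=> _; exists (fun=> 0), 1, 1; split=> [|M a b /=]; first exact: modulus0.
  by rewrite lexx subrr normr0.
- move=> [/IHp[D1 [lo1 [hi1 [m1 P1]]]] /IHq[D2 [lo2 [hi2 [m2 P2]]]]].
  exists (fun r => D1 r + D2 r), (lo1 + lo2), (hi1 + hi2).
  split=> [|M a b /=]; first exact: modulus_add.
  have [/andP[? ?] A1] := P1 M a b; have [/andP[? ?] A2] := P2 M a b.
  split; first by rewrite !lerD.
  by rewrite opprD addrACA; apply: (le_trans (ler_normD _ _)); rewrite lerD.
- move=> /IHp[D [lo [hi [m P]]]].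
  (* The sign of [r] is unknown, hence bounds symmetric about [0]. *)
  exists (fun x => `|ratr r| * D x).
  exists (- (`|ratr r| * (`|lo| + `|hi|))), (`|ratr r| * (`|lo| + `|hi|)).
  split=> [|M a b /=]; first exact: modulus_scale.
  have [/andP[lob hib] A] := P M a b; split.
    rewrite -ler_norml normrM ler_wpM2l// ler_norml.
    have := ler_norm hi; have := ler_norm (- lo); rewrite normrN.
    have := normr_ge0 hi; have := normr_ge0 lo.
    by move=> *; apply/andP; split; lra.
  by rewrite -mulrBr normrM ler_wpM2l.
- move=> [/IHp[D1 [lo1 [hi1 [m1 P1]]]] /IHq[D2 [lo2 [hi2 [m2 P2]]]]].
  exists (fun r => D1 r + D2 r), (Num.max lo1 lo2), (Num.max hi1 hi2).
  split=> [|M a b /=]; first exact: modulus_add.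
  have [/andP[b1 b2] A1] := P1 M a b; have [/andP[b3 b4] A2] := P2 M a b.
  split.
    rewrite !ge_max !le_max b1 b2 b3 b4 !orbT //.
  have := modulus_ge0 m1 (max_dist_ge0 a b); have := modulus_ge0 m2 (max_dist_ge0 a b).
  move: A1 A2; rewrite !ler_distl => /andP[? ?] /andP[? ?] ? ?.
  by rewrite /Num.max; do 2 case: ltP => ?; apply/andP; split; lra.
- move=> [/IHp[D1 [lo1 [hi1 [m1 P1]]]] /IHq[D2 [lo2 [hi2 [m2 P2]]]]].
  exists (fun r => D1 r + D2 r), (Num.min lo1 lo2), (Num.min hi1 hi2).
  split=> [|M a b /=]; first exact: modulus_add.
  have [/andP[b1 b2] A1] := P1 M a b; have [/andP[b3 b4] A2] := P2 M a b.
  split.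
    rewrite !le_min !ge_min b1 b2 b3 b4 !orbT //.
  have := modulus_ge0 m1 (max_dist_ge0 a b); have := modulus_ge0 m2 (max_dist_ge0 a b).
  move: A1 A2; rewrite !ler_distl => /andP[? ?] /andP[? ?] ? ?.
  by rewrite /Num.min; do 2 case: ltP => ?; apply/andP; split; lra.
- move=> /IHp[D [lo [hi [m P]]]]; exists D, lo, hi; split => // M a b /=.
  have M0 := carrier_inhabited M.
  have B (c : 'I_n -> M) y : lo <= eval p (scons y c) <= hi.
    by have [] := P M (scons y c) (scons y c).
  split.
    case: (M0) => y; apply/andP; split.
      have /andP[/le_trans + _] := B a y; apply.
      apply: (@le_sup_range _ _ (fun y => eval p (scons y a)) hi) => z.
      by have /andP[] := B a z.
    by apply: sup_range_le => // z; have /andP[] := B a z.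
  apply: (sup_range_dist M0 (B a) (B b)) => y.
  have [_ /le_trans] := P M (scons y a) (scons y b); apply.
  by apply: modulus_le => //; [exact: max_dist_ge0|exact: max_dist_scons].
- move=> /IHp[D [lo [hi [m P]]]]; exists D, lo, hi; split => // M a b /=.
  have M0 := carrier_inhabited M.
  have B (c : 'I_n -> M) y : lo <= eval p (scons y c) <= hi.
    by have [] := P M (scons y c) (scons y c).
  split.
    case: (M0) => y; apply/andP; split.
      by apply: inf_range_ge => // z; have /andP[] := B a z.
    have /andP[_] := B a y; apply: le_trans.
    apply: (@ge_inf_range _ _ (fun y => eval p (scons y a)) lo) => z.
    by have /andP[] := B a z.
  apply: (inf_range_dist M0 (B a) (B b)) => y.
  have [_ /le_trans] := P M (scons y a) (scons y b); apply.
  by apply: modulus_le => //; [exact: max_dist_ge0|exact: max_dist_scons].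
- move=> [_ [D [lo [hi [m P]]]]]; exists D, lo, hi; split => // M a b /=.
  have I0 : inhabited nat by exists; exact: 0%N.
  have B (c : 'I_n -> M) i : lo <= eval (ps i) c <= hi by have [] := P i M c c.
  split.
    apply/andP; split.
      have /andP[/le_trans + _] := B a 0%N; apply.
      apply: (@le_sup_range _ _ (fun i => eval (ps i) a) hi) => z.
      by have /andP[] := B a z.
    by apply: sup_range_le => // z; have /andP[] := B a z.
  by apply: (sup_range_dist I0 (B a) (B b)) => y; have [] := P y M a b.
- move=> [_ [D [lo [hi [m P]]]]]; exists D, lo, hi; split => // M a b /=.
  have I0 : inhabited nat by exists; exact: 0%N.
  have B (c : 'I_n -> M) i : lo <= eval (ps i) c <= hi by have [] := P i M c c.
  split.
    apply/andP; split.
      by apply: inf_range_ge => // z; have /andP[] := B a z.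
    have /andP[_] := B a 0%N; apply: le_trans.
    apply: (@ge_inf_range _ _ (fun i => eval (ps i) a) lo) => z.
    by have /andP[] := B a z.
  by apply: (inf_range_dist I0 (B a) (B b)) => y; have [] := P y M a b.
Qed.

Lemma scons_lift (Y : Type) n (y : Y) (v : 'I_n -> Y) j :
  scons y v (lift ord0 j) = v j.
Proof. by rewrite /scons liftK. Qed.

Lemma scons0 (Y : Type) n (y : Y) (v : 'I_n -> Y) : scons y v ord0 = y.
Proof. by rewrite /scons unlift_none. Qed.

Lemma teval_subst M n m (s : 'I_n -> term L m) (t : term L n) (a : 'I_m -> M) :
  teval a (tsubst s t) = teval (fun i => teval a (s i)) t.
Proof. by elim: t => //= f ts IH; congr fun_int; apply/funext => i; exact: IH. Qed.

Lemma teval_up M n m (s : 'I_n -> term L m) (a : 'I_m -> M) y :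
  (fun i => teval (scons y a) (up s i)) = scons y (fun i => teval a (s i)).
Proof.
apply/funext => i; rewrite /up; case: (unliftP ord0 i) => [j ->|->].
  rewrite !scons_lift teval_subst; congr teval; apply/funext => k /=.
  by rewrite scons_lift.
by rewrite !scons0/= scons0.
Qed.

Lemma eval_subst M n (phi : preformula L n) m (s : 'I_n -> term L m)
    (a : 'I_m -> M) :
  eval (subst phi s) a = eval phi (fun i => teval a (s i)).
Proof.
elim: phi m s a => {n} [n P ts|n t u|n|n p IHp q IHq|n r p IHp|n p IHp q IHq
  |n p IHp q IHq|n p IHp|n p IHp|n ps IH|n ps IH] m s a //=.
- by congr pred_int; apply/funext => i; rewrite teval_subst.
- by rewrite !teval_subst.
- by rewrite IHp IHq.
- by rewrite IHp.
- by rewrite IHp IHq.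
- by rewrite IHp IHq.
- by apply: eq_sup_range => y; rewrite IHp teval_up.
- by apply: eq_inf_range => y; rewrite IHp teval_up.
- by apply: eq_sup_range => i; rewrite IH.
- by apply: eq_inf_range => i; rewrite IH.
Qed.

Lemma is_formula_subst n (phi : preformula L n) m (s : 'I_n -> term L m) :
  is_formula phi -> is_formula (subst phi s).
Proof.
(* Only countable connectives carry a side condition; substitution composes their common modulus
   with a modulus of the substituted terms. *)
have unif k (ps : nat -> preformula L k) l (s' : 'I_k -> term L l) :
    uniformly_respect ps -> uniformly_respect (fun i => subst (ps i) s').
  move=> [D [lo [hi [m' P]]]].
  have /choice[E EP] : forall i, exists E : R -> R, modulus E /\
      forall M (a b : 'I_l -> M),
        mdist (teval a (s' i)) (teval b (s' i)) <= E (max_dist a b).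
    by move=> i; have [E E1 E2] := teval_modulus (s' i); exists E.
  exists (D \o (fun x => \sum_(i <- enum 'I_k) E i x)), lo, hi; split.
    by apply: modulus_comp => //; apply: modulus_sum => i; case: (EP i).
  move=> i M a b; rewrite !eval_subst.
  have [? /le_trans h] := P i M (fun i => teval a (s' i)) (fun i => teval b (s' i)).
  split => //; apply: h => /=.
  apply: modulus_le => //; first exact: max_dist_ge0.
  have Ege j : 0 <= E j (max_dist a b).
    by apply: modulus_ge0; [case: (EP j)|exact: max_dist_ge0].
  apply: max_dist_le => [|j]; first exact: sumr_ge0.
  case: (EP j) => _ /(_ M a b)/le_trans; apply.
  by rewrite big_enum/= (bigD1 j)//= lerDl; exact: sumr_ge0.
elim: phi m s => {n} [n P ts|n t u|n|n p IHp q IHq|n r p IHp|n p IHp q IHq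
  |n p IHp q IHq|n p IHp|n p IHp|n ps IH|n ps IH] m s //=.
- by move=> [? ?]; split; [exact: IHp|exact: IHq].
- exact: IHp.
- by move=> [? ?]; split; [exact: IHp|exact: IHq].
- by move=> [? ?]; split; [exact: IHp|exact: IHq].
- exact: IHp.
- exact: IHp.
- by move=> [h u]; split => [i|]; [exact: IH|exact: unif].
- by move=> [h u]; split => [i|]; [exact: IH|exact: unif].
Qed.

Definition iso_map M N (h : M -> N) : Prop :=
  [/\ bijective h,
      forall x y, mdist (h x) (h y) = mdist x y,
      forall (P : pred_sym L) (a : 'I_(pred_ar P) -> M),
        pred_int (fun i => h (a i)) = pred_int a &
      forall (f : fun_sym L) (a : 'I_(fun_ar f) -> M),
        fun_int (fun i => h (a i)) = h (fun_int a)].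

Lemma teval_iso M N (h : M -> N) n (t : term L n) (a : 'I_n -> M) :
  iso_map h -> teval (fun i => h (a i)) t = h (teval a t).
Proof.
move=> [_ _ _ hf]; elim: t => //= f ts IH.
by rewrite -hf; congr fun_int; apply/funext => i; exact: IH.
Qed.

Lemma range_bij (I J : Type) (S : Type) (h : I -> J) (f : J -> S) (g : I -> S) :
  bijective h -> (forall i, f (h i) = g i) -> range f = range g.
Proof.
move=> [h' hK h'K] fg; apply/seteqP; split => [_ [j _ <-]|_ [i _ <-]].
  by exists (h' j); rewrite -?fg ?h'K.
by exists (h i).
Qed.

Lemma eval_iso M N (h : M -> N) n (phi : preformula L n) (a : 'I_n -> M) :
  iso_map h -> eval phi (fun i => h (a i)) = eval phi a.
Proof.
move=> ih; have [hb hd hp _] := ih.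
have hs k (b : 'I_k -> M) y :
    scons (h y) (fun i => h (b i)) = (fun i => h (scons y b i)).
  by apply/funext => i; rewrite /scons; case: unliftP.
elim: phi a => {n} [n P ts|n t u|n|n p IHp q IHq|n r p IHp|n p IHp q IHq
  |n p IHp q IHq|n p IHp|n p IHp|n ps IH|n ps IH] a //=.
- by rewrite -hp; congr pred_int; apply/funext => i; rewrite teval_iso.
- by rewrite !teval_iso.
- by rewrite IHp IHq.
- by rewrite IHp.
- by rewrite IHp IHq.
- by rewrite IHp IHq.
- by congr sup; apply: (range_bij hb) => y; rewrite hs IHp.
- by congr inf; apply: (range_bij hb) => y; rewrite hs IHp.
- by apply: eq_sup_range => i; rewrite IH.
- by apply: eq_inf_range => i; rewrite IH.
Qed.

Lemma iso_map_inv M N (h : M -> N) (g : N -> M) :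
  iso_map h -> cancel h g -> cancel g h -> iso_map g.
Proof.
move=> [_ hd hp hf] hK gK; split.
- by exists h.
- by move=> x y; rewrite -{2}(gK x) -{2}(gK y) hd.
- move=> P a; rewrite -hp; congr pred_int; apply/funext => i; exact: gK.
- move=> f a; apply: (can_inj hK); rewrite gK -hf.
  by congr fun_int; apply/funext => i; exact: gK.
Qed.

Lemma isomorphic_refl M : isomorphic M M.
Proof. by exists id; split => //; exists id. Qed.

Lemma isomorphic_sym M N : isomorphic M N -> isomorphic N M.
Proof.
move=> [h ih]; have [[g hK gK] _ _ _] := ih.
by exists g; exact: (@iso_map_inv M N h g).
Qed.

Lemma isomorphic_trans M N (K : structure L) :
  isomorphic M N -> isomorphic N K -> isomorphic M K.
Proof.
move=> [h [hb hd hp hf]] [g [gb gd gp gf]]; exists (g \o h); split => //=.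
- exact: bij_comp.
- by move=> x y; rewrite gd hd.
- by move=> P a; rewrite -hp -gp.
- by move=> f a; rewrite -hf -gf.
Qed.

End Semantics.

(** * Neighbourhoods of types *)

Lemma rat_between (R : realType) (x y : R) : x < y ->
  exists q : rat, x < ratr q /\ ratr q < y.
Proof.
by move=> /rat_in_itvoo[q]; rewrite in_itv/= => /andP[? ?]; exists q.
Qed.

Section Sequences.
Context (R : realType) (L : signature R).
Implicit Types M N : structure L.

(** Tuples are read off infinite sequences, so that lengths can grow during a construction without
    casts; by [evs_agree] only the first [n] entries count. *)
Definition evs M n (phi : preformula L n) (a : nat -> M) : R :=
  eval phi (@initial_segment M a n).

Definition agree (X : Type) n (a b : nat -> X) := forall i, (i < n)%N -> a i = b i.

Definition upd (X : Type) (a : nat -> X) n y := fun i => if i == n then y else a i.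

Definition close (M : metricType R) n (r : R) (a b : nat -> M) :=
  forall i, (i < n)%N -> mdist (a i) (b i) < r.

Lemma evs_agree M n (phi : preformula L n) (a b : nat -> M) :
  agree n a b -> evs phi a = evs phi b.
Proof. by move=> ab; congr eval; apply/funext => i; exact: ab. Qed.

Lemma agree_upd (X : Type) (a : nat -> X) n y : agree n a (upd a n y).
Proof. by move=> i /ltn_eqF; rewrite /upd => ->. Qed.

Lemma close_sym (M : metricType R) n r (a b : nat -> M) :
  close n r a b -> close n r b a.
Proof. by move=> ab i /ab; rewrite metric_sym. Qed.

Lemma close_refl (M : metricType R) n r (a : nat -> M) : 0 < r -> close n r a a.
Proof. by move=> r0 i _; rewrite mdistxx. Qed.

Lemma close_trans (M : metricType R) n r s (a b c : nat -> M) :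
  close n r a b -> close n s b c -> close n (r + s) a c.
Proof.
move=> ab bc i ni; apply: (le_lt_trans (metric_triangle _ (b i) _)).
by rewrite ltrD ?ab ?bc.
Qed.

Lemma close_le (M : metricType R) n m r s (a b : nat -> M) : (m <= n)%N -> r <= s ->
  close n r a b -> close m s a b.
Proof.
move=> mn rs ab i im; apply: (lt_le_trans _ rs); apply: ab.
exact: leq_trans mn.
Qed.

Lemma evs_cont n (phi : preformula L n) (e : R) : is_formula phi -> 0 < e ->
  exists2 d : R, 0 < d & forall M (a b : nat -> M), close n d a b ->
    `|evs phi a - evs phi b| < e.
Proof.
move=> /eval_respects[D [lo [hi [mD P]]]] e0.
have [d d0 dP] := modulus_small mD e0; exists d => // M a b ab.
have [_ /le_lt_trans] := P M (@initial_segment M a n) (@initial_segment M b n).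
apply; apply: dP; first exact: max_dist_ge0.
by apply: max_dist_lt => // i; exact: ab.
Qed.

Lemma evs_lt_open M n (phi : preformula L n) (a : nat -> M) (c : R) :
  is_formula phi -> evs phi a < c ->
  exists2 d : R, 0 < d & forall b : nat -> M, close n d a b -> evs phi b < c.
Proof.
move=> fphi ac; have e0 : 0 < c - evs phi a by rewrite subr_gt0.
have [d d0 dP] := evs_cont fphi e0; exists d => // b /dP.
by rewrite ltr_distl => /andP[]; lra.
Qed.

Definition dense_seq (M : metricType R) (e : nat -> M) :=
  forall (x : M) (r : R), 0 < r -> exists i, mdist x (e i) < r.

Lemma dense_close (M : metricType R) (e : nat -> M) n (z : nat -> M) (r : R) :
  dense_seq e -> 0 < r -> exists v : seq nat, close n r z (e \o nth 0%N v).
Proof.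
move=> de r0; have /choice[f fP] : forall i, exists j, mdist (z i) (e j) < r.
  by move=> i; exact: de.
exists (mkseq f n) => i ni /=; rewrite nth_mkseq//; exact: fP.
Qed.

(** A class of formulas with the closure properties of a fragment, but neither
    countable nor closed under subformulas. *)
Record fclosed (F : formulas L) : Prop := FClosed {
  fc_formula : forall n phi, F n phi -> is_formula phi;
  fc_dist : forall n (t u : term L n), F n (Dist t u);
  fc_one : forall n, F n (One L n);
  fc_add : forall n p q, F n p -> F n q -> F n (Add p q);
  fc_scale : forall n r p, F n p -> F n (Scale r p);
  fc_max : forall n p q, F n p -> F n q -> F n (Max p q);
  fc_min : forall n p q, F n p -> F n q -> F n (Min p q);
  fc_inf : forall n p, F n.+1 p -> F n (Inf p);
  fc_subst : forall n m (s : 'I_n -> term L m) phi, F n phi -> F m (subst phi s)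
}.

Lemma fragment_fclosed F : fragment F -> fclosed F.
Proof. by case=> *; constructor. Qed.

Lemma formula_fclosed : fclosed (fun n => [set phi : preformula L n | is_formula phi]).
Proof.
by constructor => //=; move=> *; exact: is_formula_subst.
Qed.

Section Toolkit.
Variable F : formulas L.
Arguments F : clear implicits.
Hypothesis FF : fclosed F.

(** A function given in all structures at once. With [Fdef], formulas are assembled from their
    meaning, and bound variables are dealt with only in the few lemmas that build syntax. *)
Definition query := forall M : structure L, (nat -> M) -> R.

Definition Fdef n (f : query) :=
  exists2 phi : preformula L n, F n phi & forall M (a : nat -> M), evs phi a = f M a.

Lemma Fd_base n (phi : preformula L n) : F n phi -> Fdef n (fun M a => evs phi a).
Proof. by exists phi. Qed.

Lemma Fd_ext n (f g : query) : (forall M a, f M a = g M a) -> Fdef n f -> Fdef n g.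
Proof. by move=> fg [phi Fp P]; exists phi => // M a; rewrite P. Qed.

Lemma Fd_add n f g : Fdef n f -> Fdef n g -> Fdef n (fun M a => f M a + g M a).
Proof.
move=> [p Fp P] [q Fq Q]; exists (Add p q); first exact: fc_add.
by move=> M a; rewrite -P -Q.
Qed.

Lemma Fd_scale n r f : Fdef n f -> Fdef n (fun M a => ratr r * f M a).
Proof.
move=> [p Fp P]; exists (Scale r p); first exact: fc_scale.
by move=> M a; rewrite -P.
Qed.

Lemma Fd_max n f g : Fdef n f -> Fdef n g -> Fdef n (fun M a => Num.max (f M a) (g M a)).
Proof.
move=> [p Fp P] [q Fq Q]; exists (Max p q); first exact: fc_max.
by move=> M a; rewrite -P -Q.
Qed.

Lemma Fd_const n q : Fdef n (fun M a => ratr q).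
Proof.
exists (Scale q (One L n)); first by apply: fc_scale => //; exact: fc_one.
by move=> M a; rewrite /evs/= mulr1.
Qed.

Lemma Fd_opp n f : Fdef n f -> Fdef n (fun M a => - f M a).
Proof.
move=> /(Fd_scale (-1)); apply: Fd_ext => M a.
by rewrite rmorphN1 mulN1r.
Qed.

Lemma Fd_subc n f q : Fdef n f -> Fdef n (fun M a => f M a - ratr q).
Proof.
by move=> Hf; apply: Fd_add => //; apply: Fd_opp; exact: Fd_const.
Qed.

Lemma Fd_csub n f q : Fdef n f -> Fdef n (fun M a => ratr q - f M a).
Proof.
by move=> Hf; apply: Fd_add; [exact: Fd_const|exact: Fd_opp].
Qed.

Lemma Fd_dist n i j : (i < n)%N -> (j < n)%N -> Fdef n (fun M a => mdist (a i) (a j)).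
Proof.
move=> ni nj; exists (Dist (Var L (Ordinal ni)) (Var L (Ordinal nj))).
  exact: fc_dist.
by [].
Qed.

Lemma Fd_ren n m f (rho : nat -> nat) : Fdef n f ->
  (forall i, (i < n)%N -> (rho i < m)%N) -> Fdef m (fun M a => f M (a \o rho)).
Proof.
move=> [p Fp P] h.
exists (subst p (fun i : 'I_n => Var L (Ordinal (h i (ltn_ord i))))).
  exact: fc_subst.
by move=> M a; rewrite -P /evs eval_subst.
Qed.

Lemma Fd_weak n m f : (n <= m)%N -> Fdef n f -> Fdef m f.
Proof.
move=> nm Ff.
exact: (@Fd_ren n m f id Ff (fun i ni => leq_trans ni nm)).
Qed.

Lemma Fd_agree n f M (a b : nat -> M) : Fdef n f -> agree n a b -> f M a = f M b.
Proof. by move=> [p Fp P] /(evs_agree p); rewrite !P. Qed.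

Lemma Fd_bounded n f : Fdef n f ->
  exists lo hi : R, forall M a, lo <= f M a <= hi.
Proof.
move=> [p Fp P]; have [D [lo [hi [_ h]]]] := eval_respects (fc_formula FF Fp).
by exists lo, hi => M a; rewrite -P; have [] := h M (@initial_segment M a n)
  (@initial_segment M a n).
Qed.

Lemma Fd_inf n f : Fdef n.+1 f ->
  Fdef n (fun M a => inf (range (fun y => f M (upd a n y)))).
Proof.
move=> [p Fp P].
(* [Inf] binds variable [0], whereas entry [n] is to be bound, so the variables are rotated. *)
pose s (i : 'I_n.+1) : term L n.+1 :=
  if unlift ord_max i is Some j then Var L (lift ord0 j) else Var L ord0.
exists (Inf (subst p s)); first by apply: fc_inf => //; exact: fc_subst.
move=> M a; rewrite /evs/=; apply: eq_inf_range => y; rewrite -P eval_subst.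
congr eval; apply/funext => i; rewrite /s /initial_segment /upd.
case: unliftP => [j ->|->] /=; last by rewrite eqxx scons0.
by rewrite scons_lift /bump leqNgt ltn_ord add0n ltn_eqF.
Qed.

(** An iterated infimum over the last [m] entries. The two inequalities are all that is used of it:
    [g] is a lower bound, and a value below [q] is witnessed by some completion of the tuple. *)
Lemma Fd_tail n m f : Fdef (m + n) f -> exists g : query, [/\ Fdef n g,
  forall M (a b : nat -> M), agree n a b -> g M a <= f M b &
  forall M a q, g M a < q -> exists2 b, agree n a b & f M b < q].
Proof.
elim: m f => [|m IH] f Ff.
  by exists f; split => // [M a b ab|M a q fq]; [rewrite (Fd_agree Ff ab)|exists a].
have [lo [hi fb]] := Fd_bounded Ff.
have [g [Fg g1 g2]] := IH _ (Fd_inf Ff); exists g; split => //.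
  move=> M a b ab; apply: (le_trans (g1 M a b ab)).
  have -> : f M b = f M (upd b (m + n) (b (m + n)%N)).
    by apply: (Fd_agree Ff) => i _; rewrite /upd; case: eqP => // ->.
  apply: (@ge_inf_range _ _ (fun y => f M (upd b (m + n) y)) lo) => y.
  by have /andP[] := fb M (upd b (m + n) y).
move=> M a q /g2[b ab /(inf_range_lt (carrier_inhabited M))[y fy]].
exists (upd b (m + n) y) => // i ni; rewrite ab//.
by apply: agree_upd; apply: leq_trans ni _; exact: leq_addl.
Qed.

Lemma Fd_close n k (rho sigma : nat -> nat) :
  (forall i, (i < k)%N -> (rho i < n)%N /\ (sigma i < n)%N) ->
  exists f : query, Fdef n f /\ forall M (a : nat -> M) s, 0 < s ->
    f M a < s <-> close k s (a \o rho) (a \o sigma).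
Proof.
elim: k => [|k IH] h.
  exists (fun M a => ratr 0); split; first exact: Fd_const.
  by move=> M a s s0; rewrite rmorph0; split => // _ i.
have [|f [Ff P]] := IH; first by move=> i ik; apply: h; exact: ltnW.
have [h1 h2] := h k (leqnn _).
exists (fun M a => Num.max (f M a) (mdist (a (rho k)) (a (sigma k)))); split.
  by apply: Fd_max => //; exact: Fd_dist.
move=> M a s s0; rewrite gt_max; split.
  move=> /andP[/(P _ _ _ s0) fa dk] i; rewrite ltnS leq_eqVlt => /predU1P[->//|].
  exact: fa.
move=> ca; apply/andP; split; last exact: ca.
by apply/(P _ _ _ s0) => i ik; apply: ca; exact: ltnW.
Qed.

(** The type of [d] lies in the closure of the types realized within [r] of [c], since the
    conditions [phi < 0] form a base of the logic topology. *)
Definition near_type n (r : R) M (c : nat -> M) N (d : nat -> N) :=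
  forall phi : preformula L n, F n phi -> evs phi d < 0 ->
    exists2 z : nat -> M, close n r c z & evs phi z < 0.

Lemma near_Fd n r M (c : nat -> M) N (d : nat -> N) f :
  near_type n r c d -> Fdef n f -> f N d < 0 ->
  exists2 z : nat -> M, close n r c z & f M z < 0.
Proof.
by move=> cd [p Fp P]; rewrite -P => /(cd _ Fp)[z cz pz]; exists z; rewrite -?P.
Qed.

Lemma near_close n r M (c d : nat -> M) : close n r c d -> near_type n r c d.
Proof. by move=> cd p Fp pd; exists d. Qed.

Lemma near_refl n r M (c : nat -> M) : 0 < r -> near_type n r c c.
Proof. by move=> r0; exact/near_close/close_refl. Qed.

Lemma near_le n r s M (c : nat -> M) N (d : nat -> N) : r <= s ->
  near_type n r c d -> near_type n s c d.
Proof.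
by move=> rs cd p Fp /(cd _ Fp)[z cz pz]; exists z => //; exact: close_le cz.
Qed.

Lemma near_agree n r M (c c' : nat -> M) N (d d' : nat -> N) :
  agree n c c' -> agree n d d' -> near_type n r c d -> near_type n r c' d'.
Proof.
move=> cc dd cd p Fp; rewrite -(evs_agree p dd) => /(cd _ Fp)[z cz pz].
by exists z => // i ni; rewrite -cc ?cz.
Qed.

(** [Fd_tail] quantifies the surplus entries away; accordingly [z] is controlled on the first [n]
    entries only. *)
Lemma near_ext n m r M (c : nat -> M) N (d : nat -> N) f : near_type n r c d ->
  (n <= m)%N -> Fdef m f -> f N d < 0 ->
  exists2 z : nat -> M, close n r c z & f M z < 0.
Proof.
move=> cd nm; rewrite -(subnK nm) => /Fd_tail[g [Fg g1 g2]] fd.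
have gd : g N d < 0 by apply: le_lt_trans fd; exact: g1.
have [z cz /g2[b zb fb]] := near_Fd cd Fg gd.
by exists b => // i ni; rewrite -zb ?cz.
Qed.

Lemma near_ren n m r (v : nat -> nat) M (c : nat -> M) N (d : nat -> N) :
  (forall i, (i < n)%N -> (v i < m)%N) ->
  near_type m r c d -> near_type n r (c \o v) (d \o v).
Proof.
move=> nm cd p Fp pd.
have [|z cz pz] := near_Fd cd (Fd_ren (Fd_base Fp) nm); first exact: pd.
by exists (z \o v) => // i /nm/cz.
Qed.

Lemma near_weak n m r M (c : nat -> M) N (d : nat -> N) : (n <= m)%N ->
  near_type m r c d -> near_type n r c d.
Proof. by move=> nm; apply: (@near_ren n m r id) => i /leq_trans; apply. Qed.

Definition shift_seq (X : Type) n (a b : nat -> X) : nat -> X :=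
  fun i => if (i < n)%N then a i else b (i - n)%N.

Lemma shift_seq_lo (X : Type) n (a b : nat -> X) : agree n a (shift_seq n a b).
Proof. by move=> i ni; rewrite /shift_seq ni. Qed.

Lemma shift_seq_hi (X : Type) n (a b : nat -> X) i : shift_seq n a b (n + i)%N = b i.
Proof. by rewrite /shift_seq ltnNge leq_addr/= addKn. Qed.

(** Finitely many strict inequalities leave room for a smaller rational radius, which a formula can
    name. *)
Lemma close_lt_ex (M : metricType R) n s (a b : nat -> M) : 0 < s -> close n s a b ->
  exists q : rat, [/\ 0 < ratr q :> R, ratr q < s & close n (ratr q) a b].
Proof.
move=> s0; elim: n => [|n IH] ab.
  by have [q [q0 qs]] := rat_between s0; exists q.
have [|q [q0 qs qP]] := IH; first exact: close_le ab.
have := ab n (leqnn _) => /rat_between[q' [q'1 q'2]].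
have [qq'|q'q] := ltP (ratr q : R) (ratr q').
  exists q'; split => // [|i]; first exact: lt_trans qq'.
  rewrite ltnS leq_eqVlt => /predU1P[->//|/qP h]; exact: lt_trans qq'.
exists q; split => // i; rewrite ltnS leq_eqVlt => /predU1P[->|/qP//].
exact: lt_le_trans q'q.
Qed.

(** A condition met by [e] is met by some [z] within [s] of [d]. The concatenation of [d] and [z]
    then meets an open condition in [n + n] variables, to which the nearness of [c] and [d]
    applies. *)
Lemma near_trans n r s M (c : nat -> M) N (d : nat -> N) (K : structure L)
    (e : nat -> K) : 0 < s ->
  near_type n r c d -> near_type n s d e -> near_type n (r + s) c e.
Proof.
move=> s0 cd de p Fp pe; have [z dz pz] := de p Fp pe.
have [q [q0 qs zq]] := close_lt_ex s0 dz.
have [|f [Ff fP]] := @Fd_close (n + n) n id (addn n).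
  by move=> i ni; rewrite ltn_add2l; split => //; exact: ltn_addr.
have Fp' : Fdef (n + n) (fun M a => evs p (a \o addn n)).
  by apply: (Fd_ren (Fd_base Fp)) => i ni; rewrite ltn_add2l.
have Fg := Fd_max (Fd_subc q Ff) Fp'.
have [|w cw] := near_ext (d := shift_seq n d z)
    (near_agree (fun i _ => erefl) (@shift_seq_lo _ n d z) cd) (leq_addr n n) Fg.
  rewrite gt_max subr_lt0; apply/andP; split.
    apply/fP => // i ni /=; rewrite shift_seq_hi -shift_seq_lo//; exact: zq.
  rewrite (@evs_agree _ _ _ _ z)// => i ni /=; exact: shift_seq_hi.
rewrite gt_max subr_lt0 => /andP[/(fP _ _ _ q0) ww pw].
exists (w \o addn n) => //; apply: close_trans cw _.
by apply: close_le ww => //; exact: ltW.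
Qed.

(** The distance to the set where [p < 0] is itself definable. If [p] were nonnegative on the
    [r']-ball around [d], a formula expressing this would hold up to [q] at some [w] within [r] of
    [c], whereas [c] itself violates it by more than [2 q]. *)
Lemma near_sym n r r' M (c : nat -> M) N (d : nat -> N) : 0 < r -> r < r' ->
  near_type n r c d -> near_type n r' d c.
Proof.
move=> r0 rr' cd p Fp pc; apply: contrapT => nz.
have {}nz : forall z, close n r' d z -> 0 <= evs p z.
  by move=> z dz; rewrite leNgt; apply/negP => pz; apply: nz; exists z.
(* Twice [q] fits into both gaps, the one between [p] and [0] at [c] and the one between the
   radii. *)
have [q [q0 q1]] : exists q : rat, 0 < ratr q :> R /\
    2 * ratr q < Num.min (- evs p c) (r' - r).
  have : 0 < Num.min (- evs p c) (r' - r) / 2.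
    by rewrite divr_gt0// lt_min oppr_gt0 pc subr_gt0.
  by move=> /rat_between[q [? ?]]; exists q; split => //; lra.
move: q1; rewrite lt_min => /andP[q1 q2].
have [q' [q'1 q'2]] : exists q' : rat, r + 2 * ratr q < ratr q' /\ ratr q' < r'.
  by apply: rat_between; lra.
have [|f [Ff fP]] := @Fd_close (n + n) n id (addn n).
  by move=> i ni; rewrite ltn_add2l; split => //; exact: ltn_addr.
have Fp' : Fdef (n + n) (fun M a => evs p (a \o addn n)).
  by apply: (Fd_ren (Fd_base Fp)) => i ni; rewrite ltn_add2l.
have Fg := Fd_max (Fd_subc q' Ff) Fp'.
have [g [Gg g1 g2]] := Fd_tail Fg.
have Gq := Fd_subc q (Fd_opp Gg).
have gd : 0 <= g N d.
  rewrite leNgt; apply/negP => /g2[b db]; rewrite gt_max => /andP[bf].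
  apply/negP; rewrite -leNgt; apply: nz => i ni.
  have : f N b < r' by lra.
  by move=> /(fP _ _ _ (lt_trans r0 rr'))/(_ i ni)/=; rewrite -db.
have [|w cw] := near_Fd cd Gq; first lra.
have := g1 M w (shift_seq n w c) (@shift_seq_lo _ _ _ _).
have : f M (shift_seq n w c) < r.
  apply/fP => // i ni /=; rewrite shift_seq_hi -shift_seq_lo// metric_sym; exact: cw.
rewrite (@evs_agree _ _ _ _ c) => [|i ni]; last exact: shift_seq_hi.
rewrite /= => ?; rewrite le_max => /orP[?|?] ?; lra.
Qed.

Lemma near_evs n (phi : preformula L n) (e : R) : F n phi -> 0 < e ->
  exists2 r : R, 0 < r & forall s M (c : nat -> M) N (d : nat -> N),
    s <= r -> near_type n s c d -> evs phi c < evs phi d + e.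
Proof.
move=> Fp e0; have e2 : 0 < e / 2 by rewrite divr_gt0.
have [r r0 rP] := evs_cont (fc_formula FF Fp) e2; exists r => // s M c N d sr cd.
have : evs phi d < evs phi d + e / 2 by rewrite ltrDl.
move=> /rat_between[q [q1 q2]].
have [|z cz] := near_Fd cd (Fd_subc q (Fd_base Fp)); first by rewrite subr_lt0.
have /rP : close n r c z by exact: close_le cz.
by rewrite subr_lt0 ltr_distl => /andP[? ?]; lra.
Qed.

(** An implication between open conditions that holds on the ball around [b] passes to other
    structures: [f < 0] together with any condition met by [w] is met somewhere in that ball. *)
Lemma near_transfer n k s M (b : nat -> M) N (w : nat -> N) r (c : nat -> M) m f :
  (k <= m)%N -> (n <= m)%N -> Fdef m f ->
  (forall z : nat -> M, close k s b z -> f M z < 0 -> near_type n r c z) ->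
  near_type k s b w -> f N w < 0 -> near_type n r c w.
Proof.
move=> km nm Ff h bw fw p Fp pw.
have [|z bz] := near_ext bw km (Fd_max Ff (Fd_weak nm (Fd_base Fp))).
  by rewrite gt_max fw.
by rewrite gt_max => /andP[fz pz]; exact: (h z bz fz p Fp pz).
Qed.

End Toolkit.

Lemma evs_iso M N (h : M -> N) n (phi : preformula L n) (a : nat -> M) :
  iso_map h -> evs phi (h \o a) = evs phi a.
Proof. exact: eval_iso. Qed.

Lemma near_isor F n r M (c : nat -> M) N (h : M -> N) (K : structure L)
    (d : nat -> K) : iso_map h ->
  near_type F n r c d -> near_type F n r (h \o c) d.
Proof.
move=> ih cd p Fp /(cd p Fp)[z cz pz]; exists (h \o z); last by rewrite evs_iso.
by have [_ hd _ _] := ih; move=> i ni /=; rewrite hd cz.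
Qed.

Lemma near_isol F n r M (c : nat -> M) N (h : M -> N) (K : structure L)
    (d : nat -> K) : iso_map h ->
  near_type F n r d c -> near_type F n r d (h \o c).
Proof. by move=> ih cd p Fp; rewrite evs_iso//; exact: cd. Qed.

End Sequences.

(** * Dense sequences and coded models *)

Section Completeness.
Context (R : realType).

Definition seq_cvg (M : metricType R) (y : nat -> M) (l : M) :=
  forall e : R, 0 < e -> exists n, forall i, (n <= i)%N -> mdist l (y i) < e.

Lemma cauchy_seq_cvg (M : metricType R) (y : nat -> M) : complete_space M ->
  (forall e : R, 0 < e -> exists n, forall i j, (n <= i)%N -> (n <= j)%N ->
    mdist (y i) (y j) < e) ->
  exists l, seq_cvg y l.
Proof.
move=> cM yC; have [|l yl] := cM (y @ \oo) _.
  apply/cauchy_exP => e e0; have [n nP] := yC e e0.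
  exists (y n); exists n => // i /= ni.
  by rewrite ballEmdist/=; exact: nP.
exists l => e e0.
have [n _ nP] : (y @ \oo) (ball l e) by apply: yl; exact: nbhsx_ballx.
by exists n => i ni; have := nP i ni; rewrite /= ballEmdist.
Qed.

Lemma geometric_seq_cvg (M : metricType R) (y : nat -> M) (s : nat -> R) :
  complete_space M -> (forall n, 0 < s n) ->
  (forall n, s n.+1 <= s n / 2) ->
  (forall n, mdist (y n) (y n.+1) < s n) ->
  exists l, forall n, mdist l (y n) <= 2 * s n.
Proof.
move=> cM s0 s2 ys.
(* The subtracted term makes the induction telescope, as [s] at least halves at each step. *)
have tri n k : mdist (y n) (y (n + k)%N) <= 2 * s n - 2 * s (n + k)%N.
  elim: k => [|k IH].
    by rewrite addn0 mdistxx subrr.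
  have := metric_triangle (y n) (y (n + k)%N) (y (n + k).+1).
  by rewrite addnS; have := ys (n + k)%N; have := s2 (n + k)%N; lra.
have trile n m : (n <= m)%N -> mdist (y n) (y m) <= 2 * s n.
  move=> nm; rewrite -(subnKC nm); apply: (le_trans (tri _ _)).
  by have := s0 (n + (m - n))%N; lra.
have sle n : s n <= s 0%N / 2 ^+ n.
  elim: n => [|n IH]; first by rewrite expr0 divr1.
  have -> : s 0%N / 2 ^+ n.+1 = (s 0%N / 2 ^+ n) / 2 by rewrite exprSr invfM mulrA.
  by have := s2 n; lra.
have [l lP] : exists l, seq_cvg y l.
  apply: cauchy_seq_cvg => // e e0.
  have [n sn] : exists n, s n < e / 4.
    have h : 0 < e / 4 / s 0%N by rewrite !divr_gt0.
    have [n _ /(_ n (leqnn _)) nP] := near_infty_natSinv_expn_lt (PosNum h).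
    exists n; apply: (le_lt_trans (sle n)).
    by move: nP; rewrite /= mul1r -ltr_pdivlMl// mulrC.
  exists n => i j ni nj; apply: (le_lt_trans (metric_triangle _ (y n) _)).
  have := trile _ _ ni; have := trile _ _ nj; rewrite (metric_sym (y i)); lra.
exists l => n; apply/ler_addgt0Pr => e e0; have [m mP] := lP e e0.
have := mP _ (leq_maxl m n); have := trile _ _ (leq_maxr m n).
have := metric_triangle l (y (maxn m n)) (y n).
by rewrite (metric_sym (y (maxn m n)) (y n)); lra.
Qed.

Lemma countable_enum (Y : Type) (D : set Y) (d0 : Y) : countable D -> D d0 ->
  exists e : nat -> Y, range e = D.
Proof.
move=> /countable_injP[f fi] Dd0.
have /choice[e eP] : forall n, exists y, D y /\ forall x, D x -> f x = n -> x = y.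
  move=> n; have [[x [Dx xn]]|nx] := pselect (exists x, D x /\ f x = n).
    exists x; split => // x' Dx' x'n; apply: fi; rewrite ?inE//.
    by rewrite x'n xn.
  by exists d0; split => // x Dx xn; exfalso; apply: nx; exists x.
exists e; apply/seteqP; split => [_ [n _ <-]|x Dx]; first by case: (eP n).
by exists (f x) => //; case: (eP (f x)) => _ /(_ x Dx erefl) <-.
Qed.

Lemma dense_seq_separable (M : metricType R) (e : nat -> M) :
  dense_seq e -> separable_space M.
Proof.
move=> de; exists (range e); first exact: card_image_le.
move=> O [x Ox] oO.
have /nbhs_ballP[r /= r0 rO] : nbhs x O by exact: open_nbhs_nbhs.
have [i xi] := de x r r0; exists (e i); split; last by exists i.
by apply: rO; rewrite ballEmdist.
Qed.

Lemma separable_dense_seq (M : metricType R) (x0 : M) : separable_space M ->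
  exists e : nat -> M, dense_seq e.
Proof.
move=> [D cD dD].
have ball_meets (x : M) (r : R) : 0 < r -> exists2 y, D y & mdist x y < r.
  move=> r0; have [||y [xy Dy]] := dD (interior (ball x r)).
  - by exists x; exact: nbhsx_ballx.
  - exact: open_interior.
  by exists y => //; have := interior_subset xy; rewrite ballEmdist.
have [d0 Dd0 _] := ball_meets x0 1 ltr01.
have [e eD] := countable_enum cD Dd0; exists e => x r r0.
have [y Dy xy] := ball_meets x r r0.
by move: Dy; rewrite -eD => -[i _ iy]; exists i; rewrite iy.
Qed.

End Completeness.

Section DenseSequences.
Context (R : realType) (L : signature R).
Implicit Types M N : structure L.

Definition pad (X : Type) k (a : 'I_k -> X) (x0 : X) : nat -> X :=
  fun i => if insub i is Some j then a j else x0.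

Lemma initial_pad (X : Type) k (a : 'I_k -> X) x0 :
  @initial_segment X (pad a x0) k = a.
Proof. by apply/funext => i; rewrite /initial_segment /pad valK. Qed.

Variable F : formulas L.
Arguments F : clear implicits.
Hypothesis fragF : fragment F.
Let FF := fragment_fclosed fragF.

Lemma evs_ren n (phi : preformula L n) M (a : nat -> M) (v : nat -> nat) N
    (c : nat -> N) : F n phi ->
  (forall m (psi : preformula L m), F m psi -> evs psi a = evs psi c) ->
  evs phi (a \o v) = evs phi (c \o v).
Proof.
move=> Fp ac.
have h i : (i < n)%N -> (v i < (\max_(j < n) v j).+1)%N.
  by move=> ni; rewrite ltnS; exact: (@leq_bigmax _ (fun j : 'I_n => v j) (Ordinal ni)).
have [q Fq Q] := Fd_ren FF (Fd_base Fp) h.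
by rewrite -Q -[RHS]Q; exact: ac.
Qed.

(** A correspondence of dense sequences that preserves the type is isometric, hence extends to the
    completions; the symbols are then preserved because atomic formulas are. *)
Lemma dense_iso M N (c : nat -> M) (d : nat -> N) : dense_seq c -> dense_seq d ->
  (forall n (phi : preformula L n), F n phi -> evs phi c = evs phi d) ->
  exists h : M -> N, iso_map h /\ forall i, h (c i) = d i.
Proof.
move=> dc dd cd.
(* The image of a point is specified by its distances to the dense sequence, which avoids comparing
   limits of different approximating sequences. *)
have half (M' N' : structure L) (c' : nat -> M') (d' : nat -> N') : dense_seq c' ->
    (forall i j, mdist (c' i) (c' j) = mdist (d' i) (d' j)) ->
    forall x, exists y, forall i, mdist y (d' i) = mdist x (c' i).
  move=> dc' cd' x.
  have /choice[v vP] : forall n, exists j, mdist x (c' j) < n.+1%:R^-1.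
    by move=> n; apply: dc'; rewrite invr_gt0.
  have small (e : R) : 0 < e -> exists n : nat, forall i, (n <= i)%N ->
      mdist x (c' (v i)) < e.
    move=> e0; have [n _ nP] := near_infty_natSinv_lt (PosNum e0).
    by exists n => i ni; apply: (lt_trans (vP i)); exact: nP.
  have [|y yP] := @cauchy_seq_cvg _ _ (d' \o v) (@carrier_complete _ _ N').
    move=> e e0; have e2 : 0 < e / 2 by rewrite divr_gt0.
    have [n nP] := small _ e2; exists n => i j ni nj /=; rewrite -cd'.
    have := metric_triangle (c' (v i)) x (c' (v j)).
    by rewrite (metric_sym _ x); have := nP _ ni; have := nP _ nj; lra.
  exists y => i; apply/eqP; rewrite eq_le; apply/andP; split.
    apply/ler_addgt0Pr => e e0; have e2 : 0 < e / 2 by rewrite divr_gt0.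
    have [n nP] := small _ e2; have [m mP] := yP _ e2.
    have := nP _ (leq_maxl n m); have := mP _ (leq_maxr n m).
    have := metric_triangle y (d' (v (maxn n m))) (d' i); rewrite -cd'.
    have := metric_triangle (c' (v (maxn n m))) x (c' i).
    by rewrite (metric_sym _ x) /=; lra.
  apply/ler_addgt0Pr => e e0; have e2 : 0 < e / 2 by rewrite divr_gt0.
  have [n nP] := small _ e2; have [m mP] := yP _ e2.
  have := nP _ (leq_maxl n m); have := mP _ (leq_maxr n m).
  have := metric_triangle x (c' (v (maxn n m))) (c' i); rewrite cd'.
  have := metric_triangle (d' (v (maxn n m))) y (d' i).
  by rewrite (metric_sym _ y) /=; lra.
have cdd i j : mdist (c i) (c j) = mdist (d i) (d j).
  pose m := (maxn i j).+1.
  have im : (i < m)%N by rewrite ltnS leq_maxl.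
  have jm : (j < m)%N by rewrite ltnS leq_maxr.
  by have [p Fp P] := Fd_dist FF im jm; rewrite -P cd// P.
have /choice[h hP] := half _ _ _ _ dc cdd.
have /choice[g gP] := half _ _ _ _ dd (fun i j => esym (cdd i j)).
have uniq (M' : structure L) (c' : nat -> M') x y : dense_seq c' ->
    (forall i, mdist x (c' i) = mdist y (c' i)) -> x = y.
  move=> dc' xy; apply: mdist_positivity; apply/eqP; rewrite eq_le mdist_ge0 andbT.
  apply/ler_addgt0Pr => e e0; have e2 : 0 < e / 2 by rewrite divr_gt0.
  have [i iP] := dc' x _ e2; have := metric_triangle x (c' i) y.
  by rewrite (metric_sym (c' i) y) -xy; lra.
have hK : cancel h g by move=> x; apply: (uniq _ c) => // i; rewrite gP hP.
have gK : cancel g h by move=> x; apply: (uniq _ d) => // i; rewrite hP gP.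
have hc i : h (c i) = d i by apply: (uniq _ d) => // j; rewrite hP cdd.
have hd x y : mdist (h x) (h y) = mdist x y.
  have sm (e : R) : 0 < e -> `|mdist (h x) (h y) - mdist x y| <= e.
    move=> e0; have e2 : 0 < e / 2 by rewrite divr_gt0.
    have [i iP] := dc y _ e2; have hi := hP x i.
    have := mdist_dist (h x) (h y) (h x) (d i); rewrite mdistxx add0r hi hP.
    have := mdist_dist x (c i) x y; rewrite mdistxx add0r (metric_sym (c i) y).
    rewrite !ler_distl => /andP[? ?] /andP[? ?].
    by apply/andP; split; lra.
  apply/eqP; rewrite -subr_eq0 -normr_le0; apply/ler_addgt0Pr => e e0.
  by rewrite add0r; exact: sm.
have he n (phi : preformula L n) (a : nat -> M) : F n phi ->
    evs phi (h \o a) = evs phi a.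
  move=> Fp; apply/eqP; rewrite -subr_eq0 -normr_le0; apply/ler_addgt0Pr => e e0.
  rewrite add0r; have e2 : 0 < e / 2 by rewrite divr_gt0.
  have [r r0 rP] := evs_cont (fragment_formula fragF Fp) e2.
  have [v av] := dense_close n a dc r0.
  have := rP _ _ _ av.
  have /rP : close n r (h \o a) (d \o nth 0%N v).
    by move=> i ni /=; rewrite -hc hd; exact: av.
  rewrite (evs_ren (nth 0%N v) Fp cd).
  rewrite !ltr_distl => /andP[? ?] /andP[? ?].
  by rewrite ler_distl; apply/andP; split; lra.
exists h; split => //; split => //; first by exists g.
  move=> P a; have [x0] := carrier_inhabited M.
  have Fp := @fragment_pred _ _ _ fragF _ P (fun i => Var L i).
  have := he _ _ (pad a x0) Fp; rewrite /evs/= (@initial_pad _ _ a).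
  move=> <-; congr pred_int; apply/funext => i.
  by rewrite /initial_segment/= /pad valK.
(* The graph of [f] is the zero set of the atomic formula that measures the distance from
   [f(x_0, ...)] to one more variable. *)
move=> f a; pose x := fun_int a; pose b := shift_seq (fun_ar f) (pad a x) (fun=> x).
have fs (i : 'I_(fun_ar f)) : (i < (fun_ar f).+1)%N by rewrite ltnS ltnW.
pose t : term L (fun_ar f).+1 := App (fun i => Var L (Ordinal (fs i))).
have Fp := @fragment_dist _ _ _ fragF _ t (Var L ord_max).
have := he _ _ b Fp; rewrite /evs/=.
have ba : (fun i : 'I_(fun_ar f) => b i) = a.
  by apply/funext => i; rewrite /b -shift_seq_lo// /pad valK.
have bx : b (fun_ar f) = x by rewrite /b -[X in shift_seq _ _ _ X]addn0 shift_seq_hi.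
rewrite /initial_segment/= ba bx mdistxx => /mdist_positivity <-.
by congr fun_int; apply/funext => i /=; congr h; exact: (esym (congr1 (@^~ i) ba)).
Qed.

Lemma dense_tarski_vaught M (e : nat -> M) : dense_seq e -> tarski_vaught F e.
Proof.
move=> de n phi Fp.
have [D [lo [hi [_ h]]]] := eval_respects (fragment_formula fragF Fp).
pose f y := eval phi (scons y (@initial_segment M e n)).
have fb y : lo <= f y by have [/andP[]] := h M (scons y (@initial_segment M e n))
  (scons y (@initial_segment M e n)).
have I0 : inhabited nat by exists; exact: 0%N.
change (inf (range f) = inf (range (f \o e))).
apply/eqP; rewrite eq_le; apply/andP; split.
  by apply: inf_range_ge => // i; exact: (@ge_inf_range _ _ f lo).
apply: inf_range_ge => [|y]; first exact: carrier_inhabited.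
apply/ler_addgt0Pr => r r0.
have [d d0 dP] := evs_cont (fragment_formula fragF Fp) r0.
pose sq z i := if i is j.+1 then e j else z.
have sqE z : @initial_segment M (sq z) n.+1 = scons z (@initial_segment M e n).
  apply/funext => i; case: (unliftP ord0 i) => [j ->|->].
    by rewrite scons_lift.
  by rewrite scons0.
have [i yi] := de y d d0.
have /dP : close n.+1 d (sq (e i)) (sq y).
  by case=> [|j] _ //=; rewrite ?mdistxx // metric_sym.
rewrite /evs !sqE ltr_distl => /andP[_ /ltW]; apply: le_trans.
by apply: (@ge_inf_range _ _ (f \o e) lo i) => j; exact: fb.
Qed.

End DenseSequences.

Definition scons_seq (X : Type) (y : X) (a : nat -> X) : nat -> X :=
  fun i => if i is j.+1 then a j else y.

Lemma initial_scons (X : Type) (y : X) (a : nat -> X) n :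
  @initial_segment X (scons_seq y a) n.+1 = scons y (@initial_segment X a n).
Proof.
apply/funext => i; case: (unliftP ord0 i) => [j ->|->].
  by rewrite scons_lift.
by rewrite scons0.
Qed.

Section Coded.
Context (R : realType) (L : signature R).
Variables (F : formulas L) (fragF : fragment F).
Arguments F : clear implicits.
Let FF := fragment_fclosed fragF.

(** [tarski_vaught] speaks of initial segments of the enumeration only; closure of [F] under
    substitution extends it to arbitrary tuples of enumerated points. *)
Lemma tarski_vaught_ren (M : structure L) (a : nat -> M) n
    (p : preformula L n.+1) (v : nat -> nat) (y : M) (e : R) :
  tarski_vaught F a -> F n.+1 p -> 0 < e ->
  exists j, evs p (scons_seq (a j) (a \o v)) < evs p (scons_seq y (a \o v)) + e.
Proof.
move=> tva Fp e0.
have h (i : 'I_n) : (v i < (\max_(j < n) v j).+1)%N.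
  by rewrite ltnS; exact: (@leq_bigmax _ (fun j : 'I_n => v j) i).
set m := (\max_(j < n) v j).+1 in h.
pose s (i : 'I_n.+1) : term L m.+1 :=
  if unlift ord0 i is Some j then Var L (lift ord0 (Ordinal (h j))) else Var L ord0.
have Fs : F m.+1 (subst p s) by exact: fragment_subst.
have E z : eval (subst p s) (scons z (@initial_segment M a m)) =
    evs p (scons_seq z (a \o v)).
  rewrite eval_subst /evs initial_scons; congr eval; apply/funext => i.
  rewrite /s; case: unliftP => [j ->|->] /=; first by rewrite !scons_lift.
  by rewrite !scons0.
have I0 : inhabited nat by exists; exact: 0%N.
have [D [lo [hi [_ hb]]]] := eval_respects (fragment_formula fragF Fp).
have := tva _ _ Fs; rewrite /=; under eq_fun do rewrite E.
move=> /esym; under eq_fun do rewrite E.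
move=> inf_eq; apply: inf_range_lt => //; rewrite inf_eq.
apply: (@le_lt_trans _ _ (evs p (scons_seq y (a \o v)))); last by rewrite ltrDl.
apply: (@ge_inf_range _ _ (fun z => evs p (scons_seq z (a \o v))) lo) => z.
by have [/andP[]] := hb M (@initial_segment M (scons_seq z (a \o v)) n.+1)
  (@initial_segment M (scons_seq z (a \o v)) n.+1).
Qed.

Section ClosureStructure.
Variables (M : structure L) (a : nat -> M).
Hypothesis tva : tarski_vaught F a.
Let K := closure_structure fragF tva.

Lemma closure_teval n (t : term L n) (v : 'I_n -> K) :
  teval (fun i => set_val (v i)) t = set_val (teval v t).
Proof.
elim: t => //= f ts IH; rewrite [RHS]/=.
by congr fun_int; apply/funext => i; exact: IH.
Qed.

Lemma closure_approx n (p : preformula L n.+1) (b : nat -> K) (y : M) (e : R) :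
  F n.+1 p -> 0 < e -> exists z : K,
    evs p (scons_seq (set_val z) (set_val \o b)) <
    evs p (scons_seq y (set_val \o b)) + e.
Proof.
move=> Fp e0; have e3 : 0 < e / 3 by rewrite divr_gt0.
have [d d0 dP] := evs_cont (fragment_formula fragF Fp) e3.
have /choice[v vP] : forall i, exists j, mdist (set_val (b i) : M) (a j) < d.
  move=> i; have /closure_mdistP/(_ d d0)[_ [j _ <-] h] := set_valP (b i).
  by exists j.
have c (x : M) : close n.+1 d (scons_seq x (set_val \o b)) (scons_seq x (a \o v)).
  by move=> [|i] _ /=; [rewrite mdistxx|exact: vP].
have [j jP] := tarski_vaught_ren v y tva Fp e3.
have Aj : closure (range a) (a j) by apply: subset_closure; exists j.
exists (exist _ (a j) (mem_set Aj)).
have := dP _ _ _ (c (a j)); have := dP _ _ _ (c y).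
rewrite !ltr_distl => /andP[? ?] /andP[? ?].
rewrite [set_val _]/=; lra.
Qed.

(** The Tarski-Vaught test. Each quantifier step compares a point of [M] with an approximate witness
    in the closure. *)
Lemma closure_evs n (phi : preformula L n) (b : nat -> K) : F n phi ->
  evs phi ((set_val : K -> M) \o b) = evs phi b.
Proof.
elim: phi b => {n} [n P ts|n t u|n|n p IHp q IHq|n r p IHp|n p IHp q IHq
  |n p IHp q IHq|n p IHp|n p IHp|n ps IH|n ps IH] b Fphi;
  have := fragment_subformulas fragF Fphi; rewrite /evs /=.
- by move=> _; congr pred_int; apply/funext => i; exact: closure_teval.
- move=> _; transitivity (mdist (set_val (teval (@initial_segment K b n) t) : M)
    (set_val (teval (@initial_segment K b n) u))); last by [].
  by congr mdist; exact: closure_teval.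
- by [].
- by move=> [Fp Fq]; congr (_ + _); [exact: IHp|exact: IHq].
- by move=> Fp; congr (_ * _); exact: IHp.
- by move=> [Fp Fq]; congr Num.max; [exact: IHp|exact: IHq].
- by move=> [Fp Fq]; congr Num.min; [exact: IHp|exact: IHq].
- move=> Fp; have [D [lo [hi [_ hb]]]] := eval_respects (fragment_formula fragF Fp).
  have B (N : structure L) y (c : nat -> N) :
      lo <= eval p (scons y (@initial_segment N c n)) <= hi.
    by have [] := hb N (scons y (@initial_segment N c n)) (scons y (@initial_segment N c n)).
  have E (z : K) : eval p (scons z (@initial_segment K b n)) =
      eval p (scons (set_val z) (@initial_segment M (set_val \o b) n)).
    rewrite -!initial_scons -[LHS](IHp (scons_seq z b))//.
    by congr eval; apply/funext => -[[|i] ?].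
  apply/eqP; rewrite eq_le; apply/andP; split.
    apply: sup_range_le => [|y]; first exact: carrier_inhabited.
    apply/ler_addgt0Pr => e e0.
    (* Suprema reduce to infima of the negated formula. *)
    have [z] := closure_approx b y (fragment_scale fragF (-1) Fp) e0.
    rewrite /evs /= rmorphN1 !mulN1r !initial_scons -E => h.
    have : eval p (scons z (@initial_segment K b n)) <=
        sup (range (fun z => eval p (scons z (@initial_segment K b n)))).
      apply: (@le_sup_range _ _ (fun z => eval p (scons z (@initial_segment K b n))) hi).
      by move=> w; have /andP[] := B _ w b.
    by lra.
  apply: sup_range_le => [|z]; first exact: (carrier_inhabited K).
  rewrite E.
  apply: (@le_sup_range _ _
    (fun y => eval p (scons y (@initial_segment M (set_val \o b) n))) hi) => y.
  by have /andP[] := B _ y (set_val \o b : nat -> M).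
- move=> Fp; have [D [lo [hi [_ hb]]]] := eval_respects (fragment_formula fragF Fp).
  have B (N : structure L) y (c : nat -> N) :
      lo <= eval p (scons y (@initial_segment N c n)) <= hi.
    by have [] := hb N (scons y (@initial_segment N c n)) (scons y (@initial_segment N c n)).
  have E (z : K) : eval p (scons z (@initial_segment K b n)) =
      eval p (scons (set_val z) (@initial_segment M (set_val \o b) n)).
    rewrite -!initial_scons -[LHS](IHp (scons_seq z b))//.
    by congr eval; apply/funext => -[[|i] ?].
  apply/eqP; rewrite eq_le; apply/andP; split.
    apply: inf_range_ge => [|z]; first exact: (carrier_inhabited K).
    rewrite E.
    apply: (@ge_inf_range _ _
      (fun y => eval p (scons y (@initial_segment M (set_val \o b) n))) lo) => y.
    by have /andP[] := B _ y (set_val \o b : nat -> M).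
  apply: inf_range_ge => [|y]; first exact: carrier_inhabited.
  apply/ler_addgt0Pr => e e0.
  have [z] := closure_approx b y Fp e0.
  rewrite /evs !initial_scons -E => h.
  have : inf (range (fun z => eval p (scons z (@initial_segment K b n)))) <=
      eval p (scons z (@initial_segment K b n)).
    apply: (@ge_inf_range _ _ (fun z => eval p (scons z (@initial_segment K b n))) lo).
    by move=> w; have /andP[] := B _ w b.
  by lra.
- by move=> Fp; apply: eq_sup_range => i; exact: IH.
- by move=> Fp; apply: eq_inf_range => i; exact: IH.
Qed.

Definition closure_seq (i : nat) : K :=
  exist _ (a i) (mem_set (@subset_closure _ (range a) _ (ex_intro2 _ _ i I erefl))).

Lemma closure_seq_dense : dense_seq closure_seq.
Proof.
move=> x r r0; have /closure_mdistP/(_ r r0)[_ [i _ <-] xi] := set_valP x.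
by exists i.
Qed.

Lemma closure_models (T : theory L) : theory_in F T -> models M T -> models K T.
Proof.
move=> TF MT c Tc v.
have -> : v = @initial_segment K closure_seq 0 by apply/funext => -[].
by have := closure_evs closure_seq (TF c Tc); rewrite /evs MT.
Qed.

End ClosureStructure.

Variable T : theory L.
Hypothesis TF : theory_in F T.
Implicit Type xi : set_type (Mod F T).

Definition coded_seq (xi : set_type (Mod F T)) : nat -> coded_structure fragF xi :=
  closure_seq (coded_tarski_vaught xi).

Lemma coded_dense xi : dense_seq (coded_seq xi).
Proof. exact: closure_seq_dense. Qed.

Lemma coded_separable xi : separable_space (coded_structure fragF xi).
Proof.
apply: (@dense_seq_separable R (coded_structure fragF xi) (coded_seq xi)).
exact: coded_dense.
Qed.

Lemma coded_models xi : models (coded_structure fragF xi) T.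
Proof.
by apply: closure_models => //; case: (projT2 (coded_enumeration xi)).
Qed.

Lemma coded_evs xi n phi (Fphi : F n phi) :
  evs phi (coded_seq xi) = set_val xi (existT _ n (exist _ phi Fphi)).
Proof.
have [_ exi _] := projT2 (coded_enumeration xi).
rewrite /coded_seq -(closure_evs _ Fphi).
exact: (congr1 (@^~ (existT _ n (exist _ phi Fphi))) exi).
Qed.

Lemma coded_iso xi (N : structure L) (e : nat -> N) : dense_seq e ->
  omega_tp F e = set_val xi ->
  exists h : coded_structure fragF xi -> N,
    iso_map h /\ forall i, h (coded_seq xi i) = e i.
Proof.
move=> de exi; apply: (dense_iso fragF) => // [|n phi Fphi]; first exact: coded_dense.
by rewrite (coded_evs xi Fphi) -exi.
Qed.

Lemma code_exists (N : structure L) (e : nat -> N) : dense_seq e -> models N T ->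
  exists xi : set_type (Mod F T), omega_tp F e = set_val xi.
Proof.
move=> de NT; have h : Mod F T (omega_tp F e).
  by exists N, e; split => //; exact: dense_tarski_vaught.
by exists (exist _ (omega_tp F e) (mem_set h)).
Qed.

End Coded.

Lemma seq_complete_space (R : realType) (M : metricType R) :
  (forall y : nat -> M,
    (forall e : R, 0 < e -> exists n, forall i j, (n <= i)%N -> (n <= j)%N ->
      mdist (y i) (y j) < e) -> exists l, seq_cvg y l) ->
  complete_space M.
Proof.
move=> sM F PF /cauchyP Fc.
have Fc' n : exists x : M, F (ball x (n.+1%:R^-1 : R)).
  by apply: Fc; rewrite invr_gt0.
have /choice[y yP] := Fc'.
have small (e : R) : 0 < e -> exists n : nat, forall i, (n <= i)%N -> i.+1%:R^-1 < e.
  by move=> e0; have [n _ nP] := near_infty_natSinv_lt (PosNum e0); exists n.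
have [|l lP] := sM y.
  move=> e e0; have e2 : 0 < e / 2 by rewrite divr_gt0.
  have [n nP] := small _ e2; exists n => i j ni nj.
  have [z []] := filter_ex (filterI (yP i) (yP j)); rewrite !ballEmdist/= => yi yj.
  apply: (le_lt_trans (metric_triangle _ z _)).
  rewrite (metric_sym z) (splitr e); apply: ltrD.
    exact: lt_trans (nP _ ni).
  exact: lt_trans (nP _ nj).
exists l => A /nbhs_ballP[e /= e0 eA].
have e2 : 0 < e / 2 by rewrite divr_gt0.
have [n nP] := small _ e2; have [m mP] := lP _ e2.
apply: filterS (yP (maxn n m)) => z; rewrite ballEmdist/= => yz.
apply: eA; rewrite ballEmdist/=.
apply: (le_lt_trans (metric_triangle _ (y (maxn n m)) _)).
rewrite (splitr e); apply: ltrD; first by apply: mP; exact: leq_maxr.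
by apply: (lt_trans yz); apply: nP; exact: leq_maxl.
Qed.

(** * Completion of a pseudometric on the natural numbers *)

Section KuratowskiCompletion.
Context (R : realType).
Variables (d : nat -> nat -> R) (B : R).
Hypotheses (d_refl : forall i, d i i = 0) (d_sym : forall i j, d i j = d j i).
Hypothesis d_tri : forall i j k, d i k <= d i j + d j k.
Hypothesis d_bd : forall i j, d i j <= B.

(** A point of the completion is its distance function to the enumerated points, a uniform limit of
    rows of [d]. Points at distance zero are identified without a quotient. *)
Definition kpoint (x : nat -> R) :=
  forall e : R, 0 < e -> exists i, forall j, `|x j - d i j| <= e.

Definition kspace := {x : nat -> R | kpoint x}.

HB.instance Definition _ := gen_eqMixin kspace.
HB.instance Definition _ := gen_choiceMixin kspace.

Definition kdist (x y : kspace) : R := sup (range (fun j => `|sval x j - sval y j|)).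

Let d_ge0 i j : 0 <= d i j.
Proof. by have := d_tri i j i; rewrite d_refl (d_sym j i); lra. Qed.

Lemma kpoint_bd (x : kspace) j : -1 <= sval x j <= B + 1.
Proof.
have [i /(_ j)] := svalP x 1 ltr01; rewrite ler_distl => /andP[? ?].
by have := d_bd i j; have := d_ge0 i j => ? ?; apply/andP; split; lra.
Qed.

Lemma kdist_le (x y : kspace) j : `|sval x j - sval y j| <= kdist x y.
Proof.
apply: (@le_sup_range _ _ (fun j => `|sval x j - sval y j|) (B + 2)) => i.
have /andP[? ?] := kpoint_bd x i; have /andP[? ?] := kpoint_bd y i.
by rewrite ler_distl; apply/andP; split; lra.
Qed.

Lemma kdist_ge (x y : kspace) e : (forall j, `|sval x j - sval y j| <= e) ->
  kdist x y <= e.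
Proof. by move=> h; apply: sup_range_le => //; exists; exact: 0%N. Qed.

Lemma kdist_xx x : kdist x x = 0.
Proof.
apply/eqP; rewrite eq_le; apply/andP; split.
  by apply: kdist_ge => j; rewrite subrr normr0.
exact: le_trans (kdist_le x x 0%N).
Qed.

Lemma kdist_eq0 x y : kdist x y = 0 -> x = y.
Proof.
case: x y => [x px] [y py] xy; apply: eq_exist; apply/funext => j; apply/eqP.
rewrite -subr_eq0 -normr_le0 -xy.
exact: (kdist_le (exist kpoint x px) (exist kpoint y py)).
Qed.

Lemma kdist_sym x y : kdist x y = kdist y x.
Proof. by apply: eq_sup_range => j; rewrite distrC. Qed.

Lemma kdist_tri y x z : kdist x z <= kdist x y + kdist y z.
Proof.
apply: kdist_ge => j; rewrite (le_trans (ler_distD (sval y j) _ _))//.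
by rewrite lerD ?kdist_le.
Qed.

Definition kmetric : metricType R :=
  HB.pack_for (metricType R) kspace
    (isMetric.Build R kspace kdist_xx kdist_eq0 kdist_sym kdist_tri).

Lemma kmdistE (x y : kmetric) : mdist x y = kdist x y.
Proof. by []. Qed.

Lemma kpoint_emb i : kpoint (d i).
Proof. by move=> e e0; exists i => j; rewrite subrr normr0 ltW. Qed.

Definition kemb i : kmetric := exist kpoint (d i) (kpoint_emb i).

Lemma mdist_kemb (x : kmetric) i : mdist x (kemb i) = sval (x : kspace) i.
Proof.
have x0 : 0 <= sval (x : kspace) i.
  rewrite -(addr0 (sval _ _)); apply/ler_addgt0Pr => e e0.
  rewrite addr0; have [j /(_ i)] := svalP (x : kspace) e e0.
  by rewrite ler_distl => /andP[? ?]; have := d_ge0 j i; lra.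
rewrite kmdistE; apply/eqP; rewrite eq_le; apply/andP; split; last first.
  by have := kdist_le x (kemb i) i; rewrite /= d_refl subr0 ger0_norm.
apply: kdist_ge => j /=; apply/ler_addgt0Pr => e e0.
have e2 : 0 < e / 2 by rewrite divr_gt0.
have [k kP] := svalP (x : kspace) _ e2; have := kP i; have := kP j.
have := d_tri k i j; have := d_tri i k j; rewrite (d_sym i k).
by rewrite !ler_distl => ? ? /andP[? ?] /andP[? ?]; apply/andP; split; lra.
Qed.

Lemma kemb_dense : dense_seq kemb.
Proof.
move=> x r r0; have r2 : 0 < r / 2 by rewrite divr_gt0.
have [i iP] := svalP (x : kspace) _ r2; exists i; rewrite kmdistE.
by apply: (@le_lt_trans _ _ (r / 2)); [apply: kdist_ge => j; exact: iP|lra].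
Qed.

Lemma kmetric_complete : complete_space kmetric.
Proof.
apply: seq_complete_space => y yC.
have /choice[l lP] : forall j, exists l : R^o,
    seq_cvg (fun n => sval (y n : kspace) j : R^o) l.
  move=> j; apply: (@cauchy_seq_cvg R R^o).
    by move=> F PF /cauchy_cvg Fc; exists (lim F).
  move=> e e0; have [n nP] := yC e e0; exists n => i k ni nk.
  apply: le_lt_trans (nP _ _ ni nk).
  by rewrite /mdist/= distrC; exact: kdist_le.
have near_l (e : R) : 0 < e -> exists n, forall i, (n <= i)%N -> forall j,
    `|l j - sval (y i : kspace) j| <= e.
  move=> e0; have e2 : 0 < e / 2 by rewrite divr_gt0.
  have [n nP] := yC _ e2; exists n => i ni j.
  have [m mP] := lP j _ e2.
  have := mP _ (leq_maxr n m); rewrite /mdist/= distrC => lm.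
  have := nP _ _ (leq_maxl n m) ni; rewrite kmdistE => nm.
  have := kdist_le (y (maxn n m)) (y i) j.
  move: lm; rewrite ltr_distl => /andP[? ?]; rewrite !ler_distl => /andP[? ?].
  by apply/andP; split; lra.
have lK : kpoint l.
  move=> e e0; have e2 : 0 < e / 2 by rewrite divr_gt0.
  have [n nP] := near_l _ e2; have [i iP] := svalP (y n : kspace) _ e2.
  exists i => j; have := nP n (leqnn _) j; have := iP j.
  by rewrite !ler_distl => /andP[? ?] /andP[? ?]; apply/andP; split; lra.
exists (exist kpoint l lK) => e e0; have e2 : 0 < e / 2 by rewrite divr_gt0.
have [n nP] := near_l _ e2; exists n => i ni; rewrite kmdistE.
by apply: (@le_lt_trans _ _ (e / 2)); [apply: kdist_ge => j; exact: nP|lra].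
Qed.

End KuratowskiCompletion.

(** * Realizing limits of types *)

Section Realization.
Context (R : realType) (L : signature R).
Variables (F : formulas L) (T : theory L).
Arguments F : clear implicits.
Hypotheses (fragF : fragment F) (TF : theory_in F T).
Let FF := fragment_fclosed fragF.
Implicit Type M : structure L.

Definition formula_index := {n : nat & {phi : preformula L n | F n phi}}.

(** The value [0] outside [F] spares membership proofs in statements. *)
Definition xval (xi : omega_type F) n (phi : preformula L n) : R :=
  if pselect (F n phi) is left h then xi (existT _ n (exist _ phi h)) else 0.

Definition var_bound n (v : nat -> nat) := (\max_(j < n) v j)%N.

Definition var_subst n (v : nat -> nat) (i : 'I_n) : term L (var_bound n v).+1 :=
  Var L (inord (v i)).

Definition val_at (xi : omega_type F) n (phi : preformula L n) (v : nat -> nat) : R :=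
  xval xi (subst phi (@var_subst n v)).

(** Membership in the closure of the types of sequences from models of [T]; [s] and [k] list a
    finite set of formulas. *)
Definition approximable (xi : omega_type F) :=
  forall (s : nat -> formula_index) k (e : R), 0 < e ->
    exists (M : structure L) (a : nat -> M), models M T /\
      forall j, (j < k)%N -> `|xi (s j) - omega_tp F a (s j)| < e.

(** Suprema and infima over infinite families do not pass to limits of types. These conditions force
    their values to be computed along the sequence; with [approximable] they characterize [Mod] (see
    [Mod_iff]). *)
Record witnessed (xi : omega_type F) : Prop := Witnessed {
  witness_inf : forall n p, F n (Inf p) -> forall e : R, 0 < e ->
    exists j, val_at xi p (scons_seq j id) < xval xi (Inf p) + e;
  witness_sup : forall n p, F n (Sup p) -> forall e : R, 0 < e ->
    exists j, xval xi (Sup p) - e < val_at xi p (scons_seq j id);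
  witness_cinf : forall n ps, F n (CInf ps) -> forall e : R, 0 < e ->
    exists i, xval xi (ps i) < xval xi (CInf ps) + e;
  witness_csup : forall n ps, F n (CSup ps) -> forall e : R, 0 < e ->
    exists i, xval xi (CSup ps) - e < xval xi (ps i)
}.

Lemma evs_var_subst M n (phi : preformula L n) (v : nat -> nat) (a : nat -> M) :
  evs (subst phi (@var_subst n v)) a = evs phi (a \o v).
Proof.
rewrite /evs eval_subst; congr eval; apply/funext => i /=.
rewrite /initial_segment inordK// ltnS.
exact: (@leq_bigmax _ (fun j : 'I_n => v j) i).
Qed.

Lemma evs_inf M n (p : preformula L n.+1) (a : nat -> M) :
  evs (Inf p) a = inf (range (fun y => evs p (scons_seq y a))).
Proof. by apply: eq_inf_range => y; rewrite /evs initial_scons. Qed.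

Lemma evs_sup M n (p : preformula L n.+1) (a : nat -> M) :
  evs (Sup p) a = sup (range (fun y => evs p (scons_seq y a))).
Proof. by apply: eq_sup_range => y; rewrite /evs initial_scons. Qed.

Lemma xval_tp M (a : nat -> M) n (phi : preformula L n) : F n phi ->
  xval (omega_tp F a) phi = evs phi a.
Proof. by move=> Fp; rewrite /xval; case: pselect. Qed.

Lemma val_at_tp M (a : nat -> M) n (phi : preformula L n) v : F n phi ->
  val_at (omega_tp F a) phi v = evs phi (a \o v).
Proof.
by move=> Fp; rewrite /val_at xval_tp ?evs_var_subst//; exact: fragment_subst.
Qed.

Variable xi : omega_type F.
Hypotheses (xi_apx : approximable xi) (xi_wit : witnessed xi).

Let idx0 : formula_index := existT _ 0%N (exist _ (One L 0) (fragment_one fragF 0%N)).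

(** "For all approximants close enough to [xi]"; not a [set_system], for universe
    reasons. *)
Definition for_apx (A : forall M, (nat -> M) -> Prop) : Prop :=
  exists (s : nat -> formula_index) (k : nat) (e : R), 0 < e /\
    forall M (a : nat -> M), models M T ->
      (forall j, (j < k)%N -> `|xi (s j) - omega_tp F a (s j)| < e) -> A M a.

Lemma for_apx_ex A : for_apx A -> exists M (a : nat -> M), models M T /\ A M a.
Proof.
move=> [s [k [e [e0 h]]]]; have [M [a [MT P']]] := xi_apx s k e0.
by exists M, a; split => //; exact: h.
Qed.

Lemma for_apx_and A B : for_apx A -> for_apx B -> for_apx (fun M a => A M a /\ B M a).
Proof.
move=> [s [k [e [e0 h]]]] [s' [k' [e' [e'0 h']]]].
exists (shift_seq k s s'), (k + k')%N, (Num.min e e'); split.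
  by rewrite lt_min e0.
move=> M a pT ps; split.
  apply: h => // j jk; have := ps j (ltn_addr _ jk).
  by rewrite -shift_seq_lo// lt_min => /andP[].
apply: h' => // j jk; have := ps (k + j)%N.
by rewrite ltn_add2l shift_seq_hi lt_min => /(_ jk)/andP[].
Qed.

Lemma for_apx_sub A B : (forall M (a : nat -> M), models M T -> A M a -> B M a) ->
  for_apx A -> for_apx B.
Proof.
move=> AB [s [k [e [e0 h]]]]; exists s, k, e; split => // M a pT ps.
by apply: AB => //; exact: h.
Qed.

Lemma for_apxT : for_apx (fun _ _ => True).
Proof. by exists (fun=> idx0), 0%N, 1; split. Qed.

(** Convergence along the approximants. Inequalities valid in all models thereby pass to the values
    that [xi] prescribes. *)
Definition appr (x : R) (q : query L) :=
  forall e : R, 0 < e -> for_apx (fun M a => `|x - q M a| < e).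

Lemma appr_xval n (phi : preformula L n) : F n phi ->
  appr (xval xi phi) (fun M a => evs phi a).
Proof.
move=> Fp e e0; exists (fun=> existT _ n (exist _ phi Fp)), 1%N, e; split => //.
move=> M a pT /(_ 0%N isT); rewrite /xval; case: pselect => // Fp'.
by rewrite (Prop_irrelevance Fp' Fp).
Qed.

Lemma appr_val n (phi : preformula L n) v : F n phi ->
  appr (val_at xi phi v) (fun M a => evs phi (a \o v)).
Proof.
move=> Fp e e0.
have := @appr_xval _ _ (fragment_subst fragF (@var_subst n v) Fp) e e0.
by apply: for_apx_sub => M a _; rewrite evs_var_subst.
Qed.

Lemma appr_le x y q r : appr x q -> appr y r ->
  (forall M (a : nat -> M), models M T -> q M a <= r M a) -> x <= y.
Proof.
move=> xq yr qr; apply/ler_addgt0Pr => e e0.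
have e2 : 0 < e / 2 by rewrite divr_gt0.
have [M [a [MT [h1 h2]]]] := for_apx_ex (for_apx_and (xq _ e2) (yr _ e2)).
have := qr M a MT; move: h1 h2; rewrite !ltr_distl => /andP[? ?] /andP[? ?].
by lra.
Qed.

Lemma appr_ext q r x : (forall M (a : nat -> M), models M T -> q M a = r M a) ->
  appr x q -> appr x r.
Proof.
by move=> qr xq e e0; apply: for_apx_sub (xq e e0) => M a MT; rewrite qr.
Qed.

Lemma appr_eq x y q r : appr x q -> appr y r ->
  (forall M (a : nat -> M), models M T -> q M a = r M a) -> x = y.
Proof.
move=> xq yr qr; apply/eqP; rewrite eq_le (appr_le xq yr) ?(appr_le yr xq)//.
  by move=> M a MT; rewrite qr.
by move=> M a MT; rewrite qr.
Qed.

Lemma appr_const c : appr c (fun _ _ => c).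
Proof.
by move=> e e0; apply: for_apx_sub for_apxT => M a _ _; rewrite subrr normr0.
Qed.

Lemma appr_lip2 (f : R -> R -> R) x y q r :
  (forall x y x' y', `|f x y - f x' y'| <= `|x - x'| + `|y - y'|) ->
  appr x q -> appr y r -> appr (f x y) (fun M a => f (q M a) (r M a)).
Proof.
move=> fl xq yr e e0; have e2 : 0 < e / 2 by rewrite divr_gt0.
apply: for_apx_sub (for_apx_and (xq _ e2) (yr _ e2)) => M a _ [h1 h2].
by apply: (le_lt_trans (fl _ _ _ _)); rewrite (splitr e) ltrD.
Qed.

Lemma appr_add x y q r : appr x q -> appr y r ->
  appr (x + y) (fun M a => q M a + r M a).
Proof.
by apply: appr_lip2 => *; rewrite opprD addrACA; exact: ler_normD.
Qed.

Lemma appr_dist x y q r : appr x q -> appr y r ->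
  appr (`|x - y|) (fun M a => `|q M a - r M a|).
Proof.
apply: (@appr_lip2 (fun x y => `|x - y|)) => x0 y0 x1 y1.
apply: (le_trans (ler_dist_dist _ _)).
have -> : x0 - y0 - (x1 - y1) = (x0 - x1) - (y0 - y1) by lra.
exact: ler_normB.
Qed.

Lemma appr_max x y q r : appr x q -> appr y r ->
  appr (Num.max x y) (fun M a => Num.max (q M a) (r M a)).
Proof.
apply: appr_lip2 => x0 y0 x1 y1.
have /andP[? ?] : x1 - `|x0 - x1| <= x0 <= x1 + `|x0 - x1| by rewrite -ler_distl.
have /andP[? ?] : y1 - `|y0 - y1| <= y0 <= y1 + `|y0 - y1| by rewrite -ler_distl.
have := normr_ge0 (x0 - x1); have := normr_ge0 (y0 - y1) => ? ?.
by rewrite ler_distl /Num.max; do 2 case: ltP => ?; apply/andP; split; lra.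
Qed.

Lemma appr_min x y q r : appr x q -> appr y r ->
  appr (Num.min x y) (fun M a => Num.min (q M a) (r M a)).
Proof.
apply: appr_lip2 => x0 y0 x1 y1.
have /andP[? ?] : x1 - `|x0 - x1| <= x0 <= x1 + `|x0 - x1| by rewrite -ler_distl.
have /andP[? ?] : y1 - `|y0 - y1| <= y0 <= y1 + `|y0 - y1| by rewrite -ler_distl.
have := normr_ge0 (x0 - x1); have := normr_ge0 (y0 - y1) => ? ?.
by rewrite ler_distl /Num.min; do 2 case: ltP => ?; apply/andP; split; lra.
Qed.

Lemma appr_scale c x q : appr x q -> appr (c * x) (fun M a => c * q M a).
Proof.
move=> xq e e0; have c1 : 0 < `|c| + 1 by have := normr_ge0 c; lra.
apply: for_apx_sub (xq _ (divr_gt0 e0 c1)) => M a _; rewrite ltr_pdivlMr// -mulrBr normrM.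
by have := normr_ge0 c; have := normr_ge0 (x - q M a); nra.
Qed.

Lemma appr_modulus (D : R -> R) x q : modulus D ->
  (forall M (a : nat -> M), 0 <= q M a) -> appr x q ->
  appr (D x) (fun M a => D (q M a)).
Proof.
move=> mD q0 xq e e0; have [d d0 dP] := modulus_small mD e0.
have x0 : 0 <= x by apply: (appr_le (appr_const 0) xq) => M a _.
apply: for_apx_sub (xq _ d0) => M a _; set y := q _ _; have y0 : 0 <= y by exact: q0.
have main u w : 0 <= u -> u <= w -> w - u < d -> `|D u - D w| < e.
  move=> u0 uw wu; have wu0 : 0 <= w - u by rewrite subr_ge0.
  have [_ _ _ /(_ _ _ u0 wu0)] := mD; rewrite [u + _]addrC subrK => /andP[? ?].
  by have := dP _ wu0 wu; rewrite ltr_distl => ?; apply/andP; split; lra.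
have [xy|yx] := leP x y.
  by rewrite distrC ger0_norm ?subr_ge0//; exact: main.
by rewrite ger0_norm ?subr_ge0 ?ltW// => h; rewrite distrC; apply: main => //; exact: ltW.
Qed.

Lemma appr_bigmax k (x : 'I_k -> R) (q : 'I_k -> query L) :
  (forall i, appr (x i) (q i)) ->
  appr (\big[Num.max/0]_(i < k) x i) (fun M a => \big[Num.max/0]_(i < k) q i M a).
Proof.
move=> h; elim: (index_enum _) => [|i s IH].
  by rewrite big_nil; apply: appr_ext (appr_const 0) => M a _; rewrite big_nil.
rewrite big_cons; apply: appr_ext (appr_max (h i) IH) => M a _.
by rewrite big_cons.
Qed.

Let pair_seq (i j : nat) : nat -> nat := fun m => if m is 0 then i else j.
Let dist01 : preformula L 2 := Dist (Var L ord0) (Var L ord_max).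
Let F_dist01 : F 2 dist01. Proof. exact: fragment_dist. Qed.
Let d i j := val_at xi dist01 (pair_seq i j).

Lemma appr_d i j : appr (d i j) (fun M a => mdist (a i) (a j)).
Proof. exact: appr_val. Qed.

Let d_refl i : d i i = 0.
Proof. by apply: appr_eq (appr_d i i) (appr_const 0) _ => M a _; rewrite mdistxx. Qed.

Let d_sym i j : d i j = d j i.
Proof. by apply: appr_eq (appr_d i j) (appr_d j i) _ => M a _; rewrite metric_sym. Qed.

Let d_tri i j k : d i k <= d i j + d j k.
Proof.
apply: appr_le (appr_d i k) (appr_add (appr_d i j) (appr_d j k)) _ => M a _.
exact: metric_triangle.
Qed.

Let d_bd i j : d i j <= dist_hi L.
Proof.
apply: appr_le (appr_d i j) (appr_const _) _ => M a _.
by have /andP[] := dist_bound (a i) (a j).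
Qed.

(** The completion of the enumerated points, by Kuratowski's embedding. *)
Let K : metricType R := kmetric d_refl d_sym d_tri d_bd.
Let emb : nat -> K := kemb d_refl d_sym d_tri d_bd.

Let mdist_emb (x : K) i : mdist x (emb i) = sval (x : kspace d) i.
Proof. exact: mdist_kemb. Qed.

Let emb_dense : dense_seq emb.
Proof. exact: kemb_dense. Qed.

Let dmax k (v w : 'I_k -> nat) := \big[Num.max/0]_(i < k) d (v i) (w i).

Let max_dist_emb k (v w : 'I_k -> nat) : max_dist (emb \o v) (emb \o w) = dmax v w.
Proof. by rewrite /max_dist /dmax; apply: eq_bigr => i _ /=; rewrite mdist_emb. Qed.

Let appr_dmax k (v w : 'I_k -> nat) : appr (dmax v w) (fun M a => max_dist (a \o v) (a \o w)).
Proof. by apply: appr_bigmax => i; exact: appr_d. Qed.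

Lemma max_dist_tri (N : metricType R) k (x y z : 'I_k -> N) :
  max_dist x z <= max_dist x y + max_dist y z.
Proof.
apply: max_dist_le => [|i]; first by rewrite addr_ge0// max_dist_ge0.
by apply: (le_trans (metric_triangle _ (y i) _)); rewrite lerD ?le_max_dist.
Qed.

Lemma max_dist_sym (N : metricType R) k (x y : 'I_k -> N) : max_dist x y = max_dist y x.
Proof. by rewrite /max_dist; apply: eq_bigr => i _; rewrite metric_sym. Qed.

(** McShane extension from tuples of enumerated points. *)
Let ext k (D : R -> R) (f : ('I_k -> nat) -> R) (x : 'I_k -> K) : R :=
  inf (range (fun v : 'I_k -> nat => f v + D (max_dist x (emb \o v)))).

Section Extension.
Variables (k : nat) (D : R -> R) (f : ('I_k -> nat) -> R) (lo : R).
Hypotheses (mD : modulus D) (f_lo : forall v, lo <= f v).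
Hypothesis f_mod : forall v w, `|f v - f w| <= D (dmax v w).

Let g x v := f v + D (max_dist x (emb \o v)).
Let g_lo x v : lo <= g x v.
Proof.
by rewrite /g; have := f_lo v; have := modulus_ge0 mD (max_dist_ge0 x (emb \o v)); lra.
Qed.
Let I0 : inhabited ('I_k -> nat).
Proof. by exists; exact: (fun=> 0%N). Qed.

Lemma ext_lip x y : `|ext D f x - ext D f y| <= D (max_dist x y).
Proof.
have half x' y' : ext D f x' <= ext D f y' + D (max_dist x' y').
  rewrite -lerBlDr; apply: inf_range_ge => // v; rewrite lerBlDr.
  apply: (le_trans (@ge_inf_range _ _ (g x') lo v (g_lo x'))).
  rewrite /g -addrA lerD2l.
  have [_ _ _ DD] := mD.
  have /andP[_ h] := DD _ _ (max_dist_ge0 y' (emb \o v)) (max_dist_ge0 x' y').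
  apply: (le_trans _ h); apply: modulus_le => //; first exact: max_dist_ge0.
  by rewrite addrC; exact: max_dist_tri.
have := half x y; have := half y x; rewrite (max_dist_sym y x) => ? ?.
by rewrite ler_distl; apply/andP; split; lra.
Qed.

Lemma ext_emb v : ext D f (emb \o v) = f v.
Proof.
apply/eqP; rewrite eq_le; apply/andP; split.
  apply: (le_trans (@ge_inf_range _ _ (g (emb \o v)) lo v (g_lo _))).
  rewrite /g; have -> : max_dist (emb \o v) (emb \o v) = 0.
    apply/eqP; rewrite eq_le max_dist_ge0 andbT.
    by apply: max_dist_le => // i; rewrite mdistxx.
  by case: mD => _ -> _ _; rewrite addr0.
apply: inf_range_ge => // w; rewrite max_dist_emb.
by have := f_mod v w; rewrite ler_distl => /andP[? ?]; lra.
Qed.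

Lemma ext_near x v : `|ext D f x - f v| <= D (max_dist x (emb \o v)).
Proof. by rewrite -{1}(ext_emb v); exact: ext_lip. Qed.

End Extension.

Lemma emb_approx k (x : 'I_k -> K) (r : R) : 0 < r ->
  exists v : 'I_k -> nat, max_dist x (emb \o v) < r.
Proof.
move=> r0; have /choice[v vP] : forall i, exists j, mdist (x i) (emb j) < r.
  by move=> i; exact: emb_dense.
by exists v; exact: max_dist_lt.
Qed.

Let pred_formula (Q : pred_sym L) : preformula L (pred_ar Q) := Pred (fun i => Var L i).
Let F_pred Q : F _ (pred_formula Q). Proof. exact: fragment_pred. Qed.
Let pred_nat Q (v : 'I_(pred_ar Q) -> nat) := val_at xi (pred_formula Q) (pad v 0%N).

Let appr_pred Q (v : 'I_(pred_ar Q) -> nat) :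
  appr (pred_nat v) (fun M a => pred_int (a \o v)).
Proof.
apply: appr_ext (appr_val _ (F_pred Q)) => M a _; rewrite /evs /=.
by congr pred_int; apply/funext => i; rewrite /initial_segment /= /pad valK.
Qed.

Let pred_nat_bound Q (v : 'I_(pred_ar Q) -> nat) : pred_lo Q <= pred_nat v <= pred_hi Q.
Proof.
apply/andP; split.
  apply: appr_le (appr_const _) (appr_pred v) _ => M a _.
  by have /andP[] := pred_int_bound (a \o v).
apply: appr_le (appr_pred v) (appr_const _) _ => M a _.
by have /andP[] := pred_int_bound (a \o v).
Qed.

Let pred_nat_mod Q (v w : 'I_(pred_ar Q) -> nat) :
  `|pred_nat v - pred_nat w| <= pred_mod Q (dmax v w).
Proof.
apply: appr_le (appr_dist (appr_pred v) (appr_pred w))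
  (appr_modulus (pred_modP Q) _ (appr_dmax v w)) _ => M a.
  exact: max_dist_ge0.
by move=> _; exact: pred_int_mod.
Qed.

Let kpred (Q : pred_sym L) (x : 'I_(pred_ar Q) -> K) : R :=
  ext (pred_mod Q) (@pred_nat Q) x.

Let widen_var k (i : 'I_k) : 'I_k.+1 := widen_ord (leqnSn k) i.

(** [Dist x_k t(x_0, ..., x_(k-1))] *)
Let dist_term k (t : term L k) : preformula L k.+1 :=
  Dist (Var L ord_max) (tsubst (fun i => Var L (widen_var i)) t).
Let F_dist_term k (t : term L k) : F _ (dist_term t).
Proof. exact: fragment_dist. Qed.
Let term_nat k (t : term L k) (v : 'I_k -> nat) (j : nat) :=
  val_at xi (dist_term t) (shift_seq k (pad v 0%N) (fun=> j)).

Let appr_term k (t : term L k) v j :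
  appr (term_nat t v j) (fun M a => mdist (a j) (teval (a \o v) t)).
Proof.
apply: appr_ext (appr_val _ (F_dist_term t)) => M a _; rewrite /evs /=.
congr mdist; first by rewrite /initial_segment /= /shift_seq ltnn.
rewrite teval_subst; congr teval; apply/funext => i.
by rewrite /initial_segment /= -shift_seq_lo// /pad valK.
Qed.

Let fun_term (f : fun_sym L) : term L (fun_ar f) := App (fun i => Var L i).

Let fun_nat_mod (f : fun_sym L) (j : nat) (v w : 'I_(fun_ar f) -> nat) :
  `|term_nat (fun_term f) v j - term_nat (fun_term f) w j| <= fun_mod f (dmax v w).
Proof.
apply: appr_le (appr_dist (appr_term _ v j) (appr_term _ w j))
  (appr_modulus (fun_modP f) _ (appr_dmax v w)) _ => M a.
  exact: max_dist_ge0.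
move=> _; apply: (le_trans (mdist_dist _ _ _ _)); rewrite mdistxx add0r.
exact: fun_int_mod.
Qed.

Let term_nat_ge0 k (t : term L k) v j : 0 <= term_nat t v j.
Proof. by apply: appr_le (appr_const 0) (appr_term t v j) _ => M a _; exact: mdist_ge0. Qed.

Lemma val_at_inf_witness n (p : preformula L n.+1) v (e : R) : F n (Inf p) -> 0 < e ->
  exists j, val_at xi p (scons_seq j v) < val_at xi (Inf p) v + e.
Proof.
move=> Fp e0; have Fp' := fragment_subst fragF (@var_subst n v) Fp.
have [j jP] := witness_inf xi_wit Fp' e0; exists j.
suff -> : val_at xi p (scons_seq j v) =
    val_at xi (subst p (up (@var_subst n v))) (scons_seq j id) by [].
have F1 : F n.+1 p := fragment_subformulas fragF Fp.
have F2 : F _ (subst p (up (@var_subst n v))) := fragment_subformulas fragF Fp'.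
apply: appr_eq (appr_val _ F1) (appr_val _ F2) _ => M a _.
have E z (b : nat -> M) : evs (subst p (up (@var_subst n v))) (scons_seq z b) =
    evs p (scons_seq z (b \o v)).
  rewrite /evs !initial_scons eval_subst; congr eval; rewrite teval_up.
  congr scons; apply/funext => i /=; rewrite /initial_segment inordK// ltnS.
  exact: (@leq_bigmax _ (fun j : 'I_n => v j) i).
have -> : a \o scons_seq j v = scons_seq (a j) (a \o v) by apply/funext => -[].
have -> : a \o scons_seq j id = scons_seq (a j) a by apply/funext => -[].
by rewrite E.
Qed.

Lemma val_at_sup_witness n (p : preformula L n.+1) v (e : R) : F n (Sup p) -> 0 < e ->
  exists j, val_at xi (Sup p) v - e < val_at xi p (scons_seq j v).
Proof.
move=> Fp e0; have Fp' := fragment_subst fragF (@var_subst n v) Fp.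
have [j jP] := witness_sup xi_wit Fp' e0; exists j.
suff -> : val_at xi p (scons_seq j v) =
    val_at xi (subst p (up (@var_subst n v))) (scons_seq j id) by [].
have F1 : F n.+1 p := fragment_subformulas fragF Fp.
have F2 : F _ (subst p (up (@var_subst n v))) := fragment_subformulas fragF Fp'.
apply: appr_eq (appr_val _ F1) (appr_val _ F2) _ => M a _.
have E z (b : nat -> M) : evs (subst p (up (@var_subst n v))) (scons_seq z b) =
    evs p (scons_seq z (b \o v)).
  rewrite /evs !initial_scons eval_subst; congr eval; rewrite teval_up.
  congr scons; apply/funext => i /=; rewrite /initial_segment inordK// ltnS.
  exact: (@leq_bigmax _ (fun j : 'I_n => v j) i).
have -> : a \o scons_seq j v = scons_seq (a j) (a \o v) by apply/funext => -[].
have -> : a \o scons_seq j id = scons_seq (a j) a by apply/funext => -[].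
by rewrite E.
Qed.

Let term_kat k (t : term L k) v i j : `|term_nat t v j - d i j| <= term_nat t v i.
Proof.
apply: appr_le (appr_dist (appr_term t v j) (appr_d i j)) (appr_term t v i) _ => M a _.
rewrite (metric_sym (a i)); apply: (le_trans (mdist_dist _ _ _ _)).
by rewrite mdistxx add0r metric_sym.
Qed.

(** The infimum over [y] of the distance from [y] to [t] is [0] in every structure, and [xi]
    witnesses infima: enumerated points come arbitrarily close to the value of a term. *)
Let term_witness k (t : term L k) v (e : R) : 0 < e -> exists i, term_nat t v i < e.
Proof.
move=> e0; pose p : preformula L k.+1 :=
  Dist (Var L ord0) (tsubst (fun i => Var L (lift ord0 i)) t).
have Fp : F k.+1 p by exact: fragment_dist.
have [j] := val_at_inf_witness (pad v 0%N) (fragment_inf fragF Fp) e0.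
have E M (a : nat -> M) y : evs p (scons_seq y (a \o pad v 0%N)) = mdist y (teval (a \o v) t).
  rewrite /evs initial_scons /= scons0 teval_subst; congr (mdist _ (teval _ _)).
  by apply/funext => i; rewrite /= scons_lift /initial_segment /= /pad valK.
have -> : val_at xi p (scons_seq j (pad v 0%N)) = term_nat t v j.
  apply: appr_eq (appr_val _ Fp) (appr_term t v j) _ => M a _.
  by rewrite -E; congr evs; apply/funext => -[].
have -> : val_at xi (Inf p) (pad v 0%N) = 0.
  apply: appr_eq (appr_val _ (fragment_inf fragF Fp)) (appr_const 0) _ => M a _.
  rewrite evs_inf (eq_inf_range (E M a)).
  apply/eqP; rewrite eq_le; apply/andP; split; last first.
    apply: inf_range_ge => [|y]; [exact: carrier_inhabited|exact: mdist_ge0].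
  rewrite -(mdistxx (teval (a \o v) t)).
  apply: (@ge_inf_range _ _ (fun y => mdist y (teval (a \o v) t)) 0) => y.
  exact: mdist_ge0.
by rewrite add0r => h; exists j.
Qed.

(** The distance from the future [f(x)] to point [j]. It is prescribed at enumerated tuples [x] and
    extended to all others. *)
Let kfun_val (f : fun_sym L) (x : 'I_(fun_ar f) -> K) (j : nat) : R :=
  ext (fun_mod f) (fun v => term_nat (fun_term f) v j) x.

Let kfun_near (f : fun_sym L) (x : 'I_(fun_ar f) -> K) j v :
  `|kfun_val x j - term_nat (fun_term f) v j| <= fun_mod f (max_dist x (emb \o v)).
Proof.
by apply: (@ext_near _ _ _ 0) => //; exact: fun_modP.
Qed.

Let kfun_point (f : fun_sym L) (x : 'I_(fun_ar f) -> K) : kpoint d (kfun_val x).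
Proof.
move=> e e0; have e2 : 0 < e / 2 by rewrite divr_gt0.
have [r r0 rP] := modulus_small (fun_modP f) e2.
have [v xv] := emb_approx x r0; have [i iP] := term_witness (fun_term f) v e2.
exists i => j; have := kfun_near x j v; have := rP _ (max_dist_ge0 _ _) xv.
have := term_kat (fun_term f) v i j.
by rewrite !ler_distl => /andP[? ?] ? /andP[? ?]; apply/andP; split; lra.
Qed.

Let kfun (f : fun_sym L) (x : 'I_(fun_ar f) -> K) : K :=
  exist (kpoint d) (kfun_val x) (kfun_point x).

Let kpred_bound (Q : pred_sym L) (x : 'I_(pred_ar Q) -> K) : pred_lo Q <= kpred x <= pred_hi Q.
Proof.
have h (e : R) : 0 < e -> pred_lo Q - e <= kpred x <= pred_hi Q + e.
  move=> e0; have [r r0 rP] := modulus_small (pred_modP Q) e0.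
  have [v xv] := emb_approx x r0.
  have := @ext_near _ _ (@pred_nat Q) (pred_lo Q) (pred_modP Q)
    (fun v => proj1 (andP (pred_nat_bound v))) (@pred_nat_mod Q) x v.
  have := rP _ (max_dist_ge0 _ _) xv; have /andP[? ?] := pred_nat_bound v.
  by rewrite ler_distl => ? /andP[? ?]; rewrite /kpred; apply/andP; split; lra.
by apply/andP; split; apply/ler_addgt0Pr => e /h/andP[? ?]; lra.
Qed.

Let kpred_mod (Q : pred_sym L) (x y : 'I_(pred_ar Q) -> K) :
  `|kpred x - kpred y| <= pred_mod Q (max_dist x y).
Proof.
apply: (@ext_lip _ _ _ (pred_lo Q)) => [|v]; first exact: pred_modP.
by have /andP[] := pred_nat_bound v.
Qed.

Let kfun_mod (f : fun_sym L) (x y : 'I_(fun_ar f) -> K) :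
  mdist (kfun x) (kfun y) <= fun_mod f (max_dist x y).
Proof.
rewrite kmdistE; apply: kdist_ge => j /=.
apply: (@ext_lip _ _ _ 0) => //; exact: fun_modP.
Qed.

Let kdist_bound (x y : K) : dist_lo L <= mdist x y <= dist_hi L.
Proof.
have h (e : R) : 0 < e -> dist_lo L - e <= mdist x y <= dist_hi L + e.
  move=> e0; have e2 : 0 < e / 2 by rewrite divr_gt0.
  have [i xi'] := emb_dense x e2; have [j yj] := emb_dense y e2.
  have := mdist_dist x y (emb i) (emb j); rewrite mdist_emb /=.
  have ? : dist_lo L <= d i j.
    apply: appr_le (appr_const _) (appr_d i j) _ => M a _.
    by have /andP[] := dist_bound (a i) (a j).
  have ? := d_bd i j.
  by rewrite ler_distl => /andP[? ?]; apply/andP; split; lra.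
by apply/andP; split; apply/ler_addgt0Pr => e /h/andP[? ?]; lra.
Qed.

Let kdist_mod (x y x' y' : K) :
  `|mdist x y - mdist x' y'| <= dist_mod L (Num.max (mdist x x') (mdist y y')).
Proof.
have mD := dist_modP L.
have emb_case i j i' j' : `|d i j - d i' j'| <= dist_mod L (Num.max (d i i') (d j j')).
  apply: appr_le (appr_dist (appr_d i j) (appr_d i' j'))
    (appr_modulus mD _ (appr_max (appr_d i i') (appr_d j j'))) _ => M a.
    by rewrite le_max mdist_ge0.
  by move=> _; exact: dist_mod_int.
apply/ler_addgt0Pr => e e0; have e5 : 0 < e / 5 by rewrite divr_gt0.
have [r r0 rP] := modulus_small mD e5.
(* Moving four points by [s] changes each of the two distances by at most [2 s], hence by [2 e / 5];
   as [2 s < r], the modulus contributes the last [e / 5]. *)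
pose s := Num.min (e / 5) (r / 3).
have s0 : 0 < s by rewrite lt_min e5 divr_gt0.
have [i xi'] := emb_dense x s0; have [j yj] := emb_dense y s0.
have [i' xi''] := emb_dense x' s0; have [j' yj'] := emb_dense y' s0.
have sl : s <= e / 5 by rewrite ge_min lexx.
have sr : s <= r / 3 by rewrite ge_min lexx orbT.
have h1 := mdist_dist x y (emb i) (emb j); have h2 := mdist_dist x' y' (emb i') (emb j').
have h3 := mdist_dist x x' (emb i) (emb i'); have h4 := mdist_dist y y' (emb j) (emb j').
move: h1 h2 h3 h4; rewrite !mdist_emb /=.
set t := Num.max (mdist x x') (mdist y y').
have t0 : 0 <= t by rewrite le_max mdist_ge0.
rewrite !ler_distl => /andP[? ?] /andP[? ?] /andP[? ?] /andP[? ?].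
have ht : Num.max (d i i') (d j j') <= t + 2 * s.
  have : mdist x x' <= t by rewrite le_max lexx.
  have : mdist y y' <= t by rewrite le_max lexx orbT.
  rewrite !mdist_emb /= in xi' xi'' yj yj' *.
  by rewrite ge_max => ? ?; apply/andP; split; lra.
have d0 : 0 <= Num.max (d i i') (d j j').
  rewrite le_max; have -> : 0 <= d i i'.
    by apply: appr_le (appr_const 0) (appr_d i i') _ => M a _; exact: mdist_ge0.
  by [].
have s20 : 0 <= 2 * s by lra.
have := emb_case i j i' j'; have := modulus_le mD d0 ht.
have [_ _ _ /(_ _ _ t0 s20)/andP[_ ?]] := mD.
have : dist_mod L (2 * s) < e / 5 by apply: rP => //; lra.
rewrite !mdist_emb /= in xi' xi'' yj yj' *.
by rewrite ler_distl => ? ? /andP[? ?]; apply/andP; split; lra.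
Qed.

Let kinhabited : inhabited K. Proof. by exists; exact: (emb 0%N). Qed.

Definition realized : structure L :=
  @Structure R L K kinhabited (@kmetric_complete R d (dist_hi L) d_refl d_sym d_tri d_bd)
    (@kpred) (@kfun) (@kpred_bound) (@kpred_mod) (@kfun_mod) kdist_bound kdist_mod.

Definition realized_seq : nat -> realized := emb.

Lemma realized_dense : dense_seq realized_seq.
Proof. exact: emb_dense. Qed.

Let term_kdist n (t : term L n) (v : 'I_n -> nat) j :
  mdist (teval (realized_seq \o v) t) (realized_seq j) = term_nat t v j ->
  forall e : R, 0 < e -> for_apx (fun M a =>
    `|mdist (teval (realized_seq \o v) t) (realized_seq j)
      - mdist (a j) (teval (a \o v) t)| < e).
Proof. by move=> -> e e0; exact: appr_term. Qed.

Lemma teval_realized n (t : term L n) (v : 'I_n -> nat) j :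
  mdist (teval (realized_seq \o v) t) (realized_seq j) = term_nat t v j.
Proof.
elim: t j => [i|f ts IH] j.
  transitivity (d (v i) j); first exact: mdist_emb.
  by apply: appr_eq (appr_d _ _) (appr_term _ v j) _ => M a _; rewrite metric_sym.
pose x i := teval (realized_seq \o v) (ts i).
transitivity (kfun_val x j); first exact: mdist_emb.
apply/eqP; rewrite -subr_eq0 -normr_le0; apply/ler_addgt0Pr => e e0; rewrite add0r.
have e2 : 0 < e / 3 by rewrite divr_gt0.
have [r r0 rP] := modulus_small (fun_modP f) e2.
have r2 : 0 < r / 2 by rewrite divr_gt0.
have [w xw] := emb_approx x r2.
have h1 := kfun_near x j w.
have h2 : fun_mod f (max_dist x (emb \o w)) < e / 3.
  by apply: rP; [exact: max_dist_ge0|lra].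
have h3 : `|term_nat (fun_term f) w j - term_nat (App ts) v j| <= e / 3.
  (* Only finitely many requirements on approximants can be combined, hence the induction on a list
     of arguments. *)
  have close_w : forall s : seq 'I_(fun_ar f), for_apx (fun M (a : nat -> M) =>
      forall i, i \in s -> mdist (a (w i)) (teval (a \o v) (ts i)) < r).
    elim=> [|i s IHs]; first by apply: for_apx_sub for_apxT.
    apply: for_apx_sub (for_apx_and IHs (term_kdist (IH i (w i)) r2)) => M a _ [h h'].
    move=> k; rewrite inE => /predU1P[->|]; last exact: h.
    have : mdist (teval (realized_seq \o v) (ts i)) (realized_seq (w i)) < r / 2.
      by apply: le_lt_trans xw; exact: (le_max_dist x (emb \o w) i).
    by move: h'; rewrite ltr_distl => /andP[? ?] ?; lra.
  apply/ler_addgt0Pr => s s0.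
  have [M [a [MT [[ha hb] hc]]]] := for_apx_ex (for_apx_and (for_apx_and
    (close_w (enum 'I_(fun_ar f)))
    (appr_dist (appr_term (fun_term f) w j) (appr_term (App ts) v j) s0)) for_apxT).
  have : `|mdist (a j) (teval (a \o w) (fun_term f)) - mdist (a j) (teval (a \o v) (App ts))|
      <= e / 3.
    apply: (le_trans (mdist_dist _ _ _ _)); rewrite mdistxx add0r /=.
    apply: (le_trans (fun_int_mod _ _)); apply/ltW/rP; first exact: max_dist_ge0.
    by apply: max_dist_lt => // i; apply: ha; rewrite mem_enum.
  by move: hb; rewrite ltr_distl => /andP[? ?] ?; lra.
move: h1 h3; rewrite !ler_distl => /andP[? ?] /andP[? ?].
by apply/andP; split; lra.
Qed.

(** Atomic formulas and finitary connectives pass to the limit. For quantifiers and countable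
    connectives one inequality is a limit of inequalities in models; the other needs the
    witnesses. *)
Lemma evs_realized n (phi : preformula L n) v : F n phi ->
  evs phi (realized_seq \o v) = val_at xi phi v.
Proof.
have term_close k (t : term L k) (u : nat -> nat) (r : R) i :
    mdist (teval (realized_seq \o (u \o @nat_of_ord k)) t) (realized_seq i) < r ->
    for_apx (fun M a => mdist (a i) (teval (a \o (u \o @nat_of_ord k)) t) < r).
  move=> h; have r0 : 0 < r - mdist (teval (realized_seq \o (u \o @nat_of_ord k)) t)
    (realized_seq i) by rewrite subr_gt0.
  apply: for_apx_sub (term_kdist (@teval_realized _ t _ i) r0) => M a _.
  by rewrite ltr_distl => /andP[? ?]; lra.
elim: phi v => {n} [n Q ts|n t u|n|n p IHp q IHq|n r p IHp|n p IHp q IHq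
  |n p IHp q IHq|n p IHp|n p IHp|n ps IH|n ps IH] v Fphi;
  have := fragment_subformulas fragF Fphi.
- move=> _; pose v' := v \o @nat_of_ord n.
  pose x i := teval (realized_seq \o v') (ts i).
  transitivity (kpred x); first by [].
  apply/eqP; rewrite -subr_eq0 -normr_le0; apply/ler_addgt0Pr => e e0; rewrite add0r.
  have e2 : 0 < e / 3 by rewrite divr_gt0.
  have [r r0 rP] := modulus_small (pred_modP Q) e2.
  have [w xw] := emb_approx x r0.
  have h1 := @ext_near _ _ (@pred_nat Q) (pred_lo Q) (pred_modP Q)
    (fun v => proj1 (andP (pred_nat_bound v))) (@pred_nat_mod Q) x w.
  have h2 := rP _ (max_dist_ge0 _ _) xw.
  have h3 : `|pred_nat w - val_at xi (Pred ts) v| <= e / 3.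
    have close_w : forall s : seq 'I_(pred_ar Q), for_apx (fun M (a : nat -> M) =>
        forall i, i \in s -> mdist (a (w i)) (teval (a \o v') (ts i)) < r).
      elim=> [|i s IHs]; first by apply: for_apx_sub for_apxT.
      have hi : mdist (teval (realized_seq \o v') (ts i)) (realized_seq (w i)) < r.
        by apply: le_lt_trans xw; exact: (le_max_dist x (emb \o w) i).
      apply: for_apx_sub (for_apx_and IHs (term_close _ _ _ _ _ hi)) => M a _ [h h'].
      by move=> k; rewrite inE => /predU1P[->|]; last exact: h.
    apply/ler_addgt0Pr => s s0.
    have [M [a [MT [ha hb]]]] := for_apx_ex (for_apx_and
      (close_w (enum 'I_(pred_ar Q)))
      (appr_dist (appr_pred w) (appr_val v Fphi) s0)).
    have : `|pred_int (a \o w) - evs (Pred ts) (a \o v)| <= e / 3.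
      apply: (le_trans (pred_int_mod _ _)); apply/ltW/rP; first exact: max_dist_ge0.
      by apply: max_dist_lt => // i; apply: ha; rewrite mem_enum.
    by move: hb; rewrite ltr_distl => /andP[? ?] ?; lra.
  move: h1 h3; rewrite /kpred !ler_distl => /andP[? ?] /andP[? ?].
  by apply/andP; split; lra.
- move=> _; pose v' := v \o @nat_of_ord n.
  pose x := teval (realized_seq \o v') t; pose y := teval (realized_seq \o v') u.
  transitivity (mdist x y); first by [].
  apply/eqP; rewrite -subr_eq0 -normr_le0; apply/ler_addgt0Pr => e e0; rewrite add0r.
  have e2 : 0 < e / 4 by rewrite divr_gt0.
  have [i xi'] := realized_dense x e2.
  have [M [a [MT [[ha hb] hc]]]] := for_apx_ex (for_apx_and (for_apx_and
    (term_close _ _ _ _ _ xi') (term_kdist (@teval_realized _ u v' i) e2))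
    (appr_val v Fphi e2)).
  have ha' : mdist (a i) (teval (a \o v') t) < e / 4 by exact: ha.
  have hc' : `|val_at xi (Dist t u) v - mdist (teval (a \o v') t) (teval (a \o v') u)| < e / 4.
    exact: hc.
  move: hb hc' xi'.
  have := mdist_dist (a i) (teval (a \o v') u) (teval (a \o v') t) (teval (a \o v') u).
  have := mdist_dist x y (realized_seq i) y.
  rewrite !mdistxx !addr0 (metric_sym (realized_seq i) y) !ler_distl !ltr_distl.
  move=> /andP[? ?] /andP[? ?] /andP[? ?] /andP[? ?] ?.
  by apply/andP; split; lra.
- by move=> _; apply: appr_eq (appr_const 1) (appr_val v Fphi) _.
- move=> [Fp Fq]; transitivity (val_at xi p v + val_at xi q v).
    by rewrite -IHp// -IHq.
  exact: appr_eq (appr_add (appr_val v Fp) (appr_val v Fq)) (appr_val v Fphi) _.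
- move=> Fp; transitivity (ratr r * val_at xi p v); first by rewrite -IHp.
  exact: appr_eq (appr_scale _ (appr_val v Fp)) (appr_val v Fphi) _.
- move=> [Fp Fq]; transitivity (Num.max (val_at xi p v) (val_at xi q v)).
    by rewrite -IHp// -IHq.
  exact: appr_eq (appr_max (appr_val v Fp) (appr_val v Fq)) (appr_val v Fphi) _.
- move=> [Fp Fq]; transitivity (Num.min (val_at xi p v) (val_at xi q v)).
    by rewrite -IHp// -IHq.
  exact: appr_eq (appr_min (appr_val v Fp) (appr_val v Fq)) (appr_val v Fphi) _.
- move=> Fp; have [D [lo [hi [_ hb]]]] := eval_respects (fragment_formula fragF Fp).
  have B (N : structure L) (c : nat -> N) : evs p c <= hi.
    by have [/andP[]] := hb N (@initial_segment N c n.+1) (@initial_segment N c n.+1).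
  have sconsE j : realized_seq \o scons_seq j v = scons_seq (realized_seq j) (realized_seq \o v).
    by apply/funext => -[].
  rewrite evs_sup; apply/eqP; rewrite eq_le; apply/andP; split.
    apply: sup_range_le => [|y]; first exact: carrier_inhabited.
    apply/ler_addgt0Pr => e e0.
    have [r r0 rP] := evs_cont (fragment_formula fragF Fp) e0.
    have [j yj] := realized_dense y r0.
    have cl : close n.+1 r (scons_seq y (realized_seq \o v))
        (scons_seq (realized_seq j) (realized_seq \o v)).
      by move=> [|i] _ //=; rewrite mdistxx.
    have := rP _ _ _ cl; rewrite -sconsE IHp// ltr_distl => /andP[_ /ltW/le_trans].
    apply; rewrite lerD2r; apply: appr_le (appr_val _ Fp) (appr_val _ Fphi) _ => M a _.
    have -> : a \o scons_seq j v = scons_seq (a j) (a \o v) by apply/funext => -[].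
    rewrite evs_sup; apply: (@le_sup_range _ _
      (fun y => evs p (scons_seq y (a \o v))) hi (a j)) => z; exact: B.
  apply/ler_addgt0Pr => e e0; have [j jP] := val_at_sup_witness v Fphi e0.
  have : evs p (realized_seq \o scons_seq j v) <=
      sup (range (fun y => evs p (scons_seq y (realized_seq \o v)))).
    rewrite sconsE; apply: (@le_sup_range _ _
      (fun y => evs p (scons_seq y (realized_seq \o v))) hi (realized_seq j)) => z; exact: B.
  by rewrite IHp//; lra.
- move=> Fp; have [D [lo [hi [_ hb]]]] := eval_respects (fragment_formula fragF Fp).
  have B (N : structure L) (c : nat -> N) : lo <= evs p c.
    by have [/andP[]] := hb N (@initial_segment N c n.+1) (@initial_segment N c n.+1).
  have sconsE j : realized_seq \o scons_seq j v = scons_seq (realized_seq j) (realized_seq \o v).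
    by apply/funext => -[].
  rewrite evs_inf; apply/eqP; rewrite eq_le; apply/andP; split.
    apply/ler_addgt0Pr => e e0; have [j jP] := val_at_inf_witness v Fphi e0.
    have : inf (range (fun y => evs p (scons_seq y (realized_seq \o v)))) <=
        evs p (realized_seq \o scons_seq j v).
      rewrite sconsE; apply: (@ge_inf_range _ _
        (fun y => evs p (scons_seq y (realized_seq \o v))) lo (realized_seq j)) => z; exact: B.
    by rewrite IHp//; lra.
  apply: inf_range_ge => [|y]; first exact: carrier_inhabited.
  apply/ler_addgt0Pr => e e0.
  have [r r0 rP] := evs_cont (fragment_formula fragF Fp) e0.
  have [j yj] := realized_dense y r0.
  have cl : close n.+1 r (scons_seq (realized_seq j) (realized_seq \o v))
      (scons_seq y (realized_seq \o v)).
    by move=> [|i] _ /=; rewrite ?mdistxx// metric_sym.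
  have := rP _ _ _ cl; rewrite -sconsE IHp// ltr_distl => /andP[_ /ltW]; apply: le_trans.
  apply: appr_le (appr_val _ Fphi) (appr_val _ Fp) _ => M a _.
  have -> : a \o scons_seq j v = scons_seq (a j) (a \o v) by apply/funext => -[].
  rewrite evs_inf; apply: (@ge_inf_range _ _
    (fun y => evs p (scons_seq y (a \o v))) lo (a j)) => z; exact: B.
- move=> Fp; have [_ [D [lo [hi [_ hb]]]]] := fragment_formula fragF Fphi.
  have B i (N : structure L) (c : nat -> N) : evs (ps i) c <= hi.
    by have [/andP[]] := hb i N (@initial_segment N c n) (@initial_segment N c n).
  have I0 : inhabited nat by exists; exact: 0%N.
  transitivity (sup (range (fun i => evs (ps i) (realized_seq \o v)))); first by [].
  apply/eqP; rewrite eq_le; apply/andP; split.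
    apply: sup_range_le => // i; rewrite IH//.
    apply: appr_le (appr_val _ (Fp i)) (appr_val _ Fphi) _ => M a _.
    by apply: (@le_sup_range _ _ (fun i => evs (ps i) (a \o v)) hi i) => z; exact: B.
  apply/ler_addgt0Pr => e e0.
  have [i] := witness_csup xi_wit (fragment_subst fragF (@var_subst n v) Fphi) e0.
  rewrite -/(val_at xi (ps i) v) -IH// -/(val_at xi (CSup ps) v).
  have : evs (ps i) (realized_seq \o v) <=
      sup (range (fun i => evs (ps i) (realized_seq \o v))).
    apply: (@le_sup_range _ _ (fun i => evs (ps i) (realized_seq \o v)) hi i).
    by move=> z; exact: B.
  by lra.
- move=> Fp; have [_ [D [lo [hi [_ hb]]]]] := fragment_formula fragF Fphi.
  have B i (N : structure L) (c : nat -> N) : lo <= evs (ps i) c.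
    by have [/andP[]] := hb i N (@initial_segment N c n) (@initial_segment N c n).
  have I0 : inhabited nat by exists; exact: 0%N.
  transitivity (inf (range (fun i => evs (ps i) (realized_seq \o v)))); first by [].
  apply/eqP; rewrite eq_le; apply/andP; split; last first.
    apply: inf_range_ge => // i; rewrite IH//.
    apply: appr_le (appr_val _ Fphi) (appr_val _ (Fp i)) _ => M a _.
    by apply: (@ge_inf_range _ _ (fun i => evs (ps i) (a \o v)) lo i) => z; exact: B.
  apply/ler_addgt0Pr => e e0.
  have [i] := witness_cinf xi_wit (fragment_subst fragF (@var_subst n v) Fphi) e0.
  rewrite -/(val_at xi (ps i) v) -IH// -/(val_at xi (CInf ps) v).
  have : inf (range (fun i => evs (ps i) (realized_seq \o v))) <=
      evs (ps i) (realized_seq \o v).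
    apply: (@ge_inf_range _ _ (fun i => evs (ps i) (realized_seq \o v)) lo i).
    by move=> z; exact: B.
  by lra.
Qed.

Lemma realized_models : models realized T.
Proof.
move=> c Tc v; have -> : v = @initial_segment realized (realized_seq \o id) 0.
  by apply/funext => -[].
transitivity (val_at xi c.1 id); first exact/evs_realized/TF.
apply: appr_eq (appr_val id (TF Tc)) (appr_const c.2) _ => M a MT.
exact: MT.
Qed.

Lemma realized_tp : omega_tp F realized_seq = xi.
Proof.
apply/funext => -[n [phi Fp]]; transitivity (evs phi (realized_seq \o id)) => //.
rewrite (evs_realized id Fp).
have -> : xi (existT _ n (exist _ phi Fp)) = xval xi phi.
  by rewrite /xval; case: pselect => // Fp'; rewrite (Prop_irrelevance Fp' Fp).
by apply: appr_eq (appr_val id Fp) (appr_xval Fp) _.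
Qed.

Lemma realized_exists : exists (M : structure L) (a : nat -> M),
  [/\ models M T, dense_seq a & omega_tp F a = xi].
Proof.
exists realized, realized_seq; split; [exact: realized_models| |exact: realized_tp].
exact: realized_dense.
Qed.

End Realization.

(** * Standard Borel spaces as closed subsets of Baire space *)

Section SigmaAlgebra.
Context (X : Type).

Record sigma_alg (S : set (set X)) : Prop := SigmaAlg {
  sa_not : forall A, S A -> S (~` A);
  sa_union : forall A : nat -> set X, (forall n, S (A n)) -> S [set x | exists n, A n x];
  sa_set0 : S set0
}.

Variable S : set (set X).
Hypothesis SS : sigma_alg S.

Lemma bor_ext (P Q : X -> Prop) : (forall x, P x <-> Q x) ->
  S [set x | P x] -> S [set x | Q x].
Proof. by move=> PQ; rewrite (_ : [set x | P x] = [set x | Q x])//; apply/seteqP; split=> x /PQ. Qed.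

Lemma bor_not (P : X -> Prop) : S [set x | P x] -> S [set x | ~ P x].
Proof. exact: sa_not. Qed.

Lemma bor_const (P : Prop) : S [set x | P].
Proof.
have [p|np] := pselect P.
  by apply: bor_ext (bor_not (sa_set0 SS)) => x; split => [//|_ []].
by apply: bor_ext (sa_set0 SS) => x; split => [[]|/np].
Qed.

Lemma bor_ex (I : countType) (P : I -> X -> Prop) : (forall i, S [set x | P i x]) ->
  S [set x | exists i, P i x].
Proof.
move=> h; pose A n : set X := [set x | if unpickle n is Some i then P i x else False].
have SA n : S (A n).
  by rewrite /A; case: (unpickle n) => [i|] //=; exact: bor_const.
apply: bor_ext (sa_union SS SA) => x; split => [[n]|[i Pi]].
  by rewrite /A/=; case: (unpickle n) => // i Pi; exists i.
by exists (pickle i); rewrite /A/= pickleK.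
Qed.

Lemma bor_all (I : countType) (P : I -> X -> Prop) : (forall i, S [set x | P i x]) ->
  S [set x | forall i, P i x].
Proof.
move=> h; have := @bor_ex I (fun i x => ~ P i x) (fun i => bor_not (h i)).
move=> /bor_not; apply: bor_ext => x; split => [nP i|Pi [i]]; last exact.
by apply: contrapT => nPi; apply: nP; exists i.
Qed.

Lemma bor_or (P Q : X -> Prop) : S [set x | P x] -> S [set x | Q x] ->
  S [set x | P x \/ Q x].
Proof.
move=> SP SQ.
have h (b : bool) : S [set x | if b then P x else Q x] by case: b.
apply: bor_ext (bor_ex h) => x; split => [[b]|[Px|Qx]]; [|by exists true|by exists false].
by case: b; [left|right].
Qed.

Lemma bor_and (P Q : X -> Prop) : S [set x | P x] -> S [set x | Q x] ->
  S [set x | P x /\ Q x].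
Proof.
move=> SP SQ.
have h (b : bool) : S [set x | if b then P x else Q x] by case: b.
apply: bor_ext (bor_all h) => x; split => [{}h|PQ b]; first by split; [exact: (h true)|exact: (h false)].
by case: PQ b => Px Qx [].
Qed.

Lemma bor_imp (P Q : X -> Prop) : S [set x | P x] -> S [set x | Q x] ->
  S [set x | P x -> Q x].
Proof.
move=> SP SQ; apply: bor_ext (bor_or (bor_not SP) SQ) => x; split; first by case.
by move=> PQ; have [/PQ|] := pselect (P x); [right|left].
Qed.

Definition bnat (u : X -> nat) := forall n, S [set x | u x = n].

Lemma bnat_case (A : X -> Prop) (u v : X -> nat) (w : X -> nat) : S [set x | A x] ->
  bnat u -> bnat v -> (forall x, A x -> w x = u x) -> (forall x, ~ A x -> w x = v x) ->
  bnat w.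
Proof.
move=> SA bu bv wu wv n.
apply: bor_ext (bor_or (bor_and SA (bu n)) (bor_and (bor_not SA) (bv n))) => x.
split => [[[Ax <-]|[Ax <-]]|<-]; [exact: wu|exact: wv|].
by have [Ax|Ax] := pselect (A x); [left; rewrite wu|right; rewrite wv].
Qed.

Lemma bnat_const n : bnat (fun=> n).
Proof. by move=> m; exact: bor_const. Qed.

Lemma bnat_eq (u v : X -> nat) : bnat u -> bnat v -> S [set x | u x = v x].
Proof.
move=> bu bv; apply: bor_ext (bor_ex (fun n => bor_and (bu n) (bv n))) => x.
by split => [[n [-> ->]]|->]; last by exists (v x).
Qed.

Lemma bor_subst (u : X -> nat) (P : nat -> X -> Prop) : bnat u ->
  (forall n, S [set x | P n x]) -> S [set x | P (u x) x].
Proof.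
move=> bu SP; apply: bor_ext (bor_ex (fun n => bor_and (bu n) (SP n))) => x.
by split => [[n [-> ?]]//|h]; exists (u x).
Qed.

End SigmaAlgebra.

(** [0] if no [n] satisfies [P]. *)
Definition least (P : nat -> Prop) : nat :=
  if pselect (exists n, P n) is left h then
    ex_minn (let: ex_intro n pn := h in ex_intro (fun n => `[< P n >]) n (asboolT pn))
  else 0%N.

Lemma leastP (P : nat -> Prop) n : P n -> P (least P) /\ (forall m, P m -> (least P <= m)%N).
Proof.
rewrite /least; case: pselect => [h|h Pn]; last by exfalso; apply: h; exists n.
move=> _; case: ex_minnP => m /asboolP Pm mmin; split => // k Pk.
by apply: mmin; exact/asboolP.
Qed.

Lemma least_none (P : nat -> Prop) : (forall n, ~ P n) -> least P = 0%N.
Proof. by move=> nP; rewrite /least; case: pselect => // h; exfalso; case: h => n /nP. Qed.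

Lemma least_eq (P : nat -> Prop) n : P n -> (forall m, (m < n)%N -> ~ P m) -> least P = n.
Proof.
move=> Pn nP; have [Pl /(_ n Pn) ln] := leastP Pn.
by apply/eqP; rewrite eqn_leq ln leqNgt; apply/negP => /nP.
Qed.

Lemma bnat_least (X : Type) (S : set (set X)) (SS : sigma_alg S) (P : nat -> X -> Prop) :
  (forall n, S [set x | P n x]) -> bnat S (fun x => least (P^~ x)).
Proof.
move=> SP n.
have S1 : S [set x | P n x /\ forall m, (m < n)%N -> ~ P m x].
  apply: bor_and => //; apply: bor_all => // m; apply: bor_imp => //.
    exact: bor_const.
  exact: bor_not.
have S2 : S [set x | n = 0%N /\ forall m, ~ P m x].
  by apply: bor_and => //; [exact: bor_const|apply: bor_all => // m; exact: bor_not].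
apply: (bor_ext _ (bor_or SS S1 S2)) => x; split.
  by move=> [[Pn nP]|[-> nP]]; [exact: least_eq|exact: least_none].
move=> <-; have [[m Pm]|nP] := pselect (exists m, P m x).
  left; have [Pl lm] := @leastP (P^~ x) m Pm; split => // k kl Pk.
  by have := lm k Pk; rewrite leqNgt kl.
right; split => [|m Pm]; last by apply: nP; exists m.
by apply: least_none => m Pm; apply: nP; exists m.
Qed.

(** Numbers that code no pair get the value [0]; [flat_cases] therefore has to check the limit point
    there as well. *)
Definition flat (g : nat -> nat -> nat) : nat -> nat :=
  fun m => if pickle_inv m is Some ab then g ab.1 ab.2 else 0%N.

Lemma flatE g a b : flat g (pickle (a, b)) = g a b.
Proof. by rewrite /flat pickleK_inv. Qed.

Lemma flat_cases (w : nat -> nat) g : (forall a b, w (pickle (a, b)) = g a b) ->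
  (forall m, pickle_inv m = None :> option (nat * nat) -> w m = 0%N) -> flat g =1 w.
Proof.
move=> h h0 m; rewrite /flat; move mE : (pickle_inv m) => o.
case: o mE => [[a b]|] mE; last by rewrite h0.
have := @pickle_invK (nat * nat)%type m; rewrite mE /= => mab.
by rewrite -h mab.
Qed.

Lemma bnat_flat (X : Type) (S : set (set X)) (SS : sigma_alg S) (g : X -> nat -> nat -> nat) m :
  (forall a b, bnat S (fun x => g x a b)) -> bnat S (fun x => flat (g x) m).
Proof.
by move=> h; rewrite /flat; case: (pickle_inv m) => [ab|]; [exact: h|exact: bnat_const].
Qed.

Section Standard.
Context (X : Type).
Implicit Type j : X -> nat -> nat.

(** The image of [j] in Baire space is closed. *)
Definition closedim j :=
  forall w, (forall n, exists x, agree n (j x) w) -> exists x, j x =1 w.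

Variable S : set (set X).

(** A presentation of [X] as a closed subspace of Baire space with measurable coordinates. The
    topology stays implicit, so that it can be refined by replacing [j]. *)
Record standard j : Prop := Standard {
  std_closed : closedim j;
  std_inj : forall x x', j x =1 j x' -> x = x';
  std_bnat : forall m, bnat S (j^~ m)
}.

Hypothesis SS : sigma_alg S.
Variable j0 : X -> nat -> nat.
Hypothesis std0 : standard j0.
Hypothesis gen0 : forall C : set (set X), sigma_alg C -> (forall m, bnat C (j0^~ m)) ->
  S `<=` C.

(** Adding the coordinates [g] makes [A] clopen: with the verdict [b], limits of points of [A], as
    of points outside [A], stay on their side. Treating both sides at once makes complements
    immediate. *)
Definition refinable (A : set X) := S A /\ exists g : X -> nat -> nat,
  (forall m, bnat S (g^~ m)) /\
  forall w wg (b : bool), (forall n, exists x, [/\ agree n (j0 x) w, agree n (g x) wg & A x <-> b]) ->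
    exists x, [/\ j0 x =1 w, g x =1 wg & A x <-> b].

Definition ind (A : set X) (x : X) : nat := if pselect (A x) then 1%N else 0%N.

Lemma indP (A : set X) x : A x <-> ind A x = 1%N.
Proof. by rewrite /ind; case: pselect. Qed.

Lemma indP0 (A : set X) x : ~ A x <-> ind A x = 0%N.
Proof. by rewrite /ind; case: pselect. Qed.

Lemma ind_eq (A B : set X) x y : (A x <-> B y) -> ind A x = ind B y.
Proof.
move=> xy; have [By|By] := pselect (B y).
  by rewrite (proj1 (indP _ _) By); apply/indP/xy.
by rewrite (proj1 (indP0 _ _) By); apply/indP0 => /xy.
Qed.

Lemma bnat_ind (A : set X) : S A -> bnat S (ind A).
Proof.
move=> SA; apply: (bnat_case SS SA (bnat_const SS 1%N) (bnat_const SS 0%N)).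
  by move=> x /indP.
by move=> x /indP0.
Qed.

Lemma refinable_cylinder m n : refinable [set x | j0 x m = n].
Proof.
split; first exact: (std_bnat std0).
exists (fun _ _ => 0%N); split => [k|w wg b h]; first exact: bnat_const.
have [|x xw] := std_closed std0 (w := w).
  by move=> k; have [x [? _ _]] := h k; exists x.
exists x; split => // [k|].
  by have [y [_ + _]] := h k.+1; apply.
have [y [/(_ m (leqnn _)) yw _ <-]] := h m.+1.
by rewrite /= xw yw.
Qed.

Lemma refinable_not A : refinable A -> refinable (~` A).
Proof.
move=> [SA [g [bg P]]]; split; first exact: sa_not.
exists g; split => // w wg b h.
have flip x : (~` A) x <-> b -> A x <-> ~~ b.
  case: b {P h} => /= -[h3 h4]; split => //; [by move=> Ax; case: (h4 isT)|].
  by move=> _; apply: contrapT => /h3.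
have flop x : A x <-> ~~ b -> (~` A) x <-> b.
  case: b {P h flip} => /= -[h3 h4]; split => //; [by move=> _ /h3|].
  by move=> nA; case: nA; exact: h4.
have [|x [h1 h2 h3]] := P w wg (~~ b).
  by move=> n; have [x [h1 h2 /flip h3]] := h n; exists x.
by exists x; split => //; exact: flop.
Qed.

(** The union is made closed by recording, besides the witnesses for the [A n],
    the least [n] such that [A n] holds. *)
Lemma refinable_union (A : nat -> set X) : (forall n, refinable (A n)) ->
  refinable [set x | exists n, A n x].
Proof.
move=> rA; have SA n : S (A n) by case: (rA n).
split; first exact: sa_union.
have /choice[g gP] : forall n, exists g : X -> nat -> nat, (forall m, bnat S (g^~ m)) /\
  forall w wg (b : bool), (forall k, exists x, [/\ agree k (j0 x) w, agree k (g x) wg & A n x <-> b]) ->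
    exists x, [/\ j0 x =1 w, g x =1 wg & A n x <-> b].
  by move=> n; case: (rA n).
pose c x := least (fun n => A n x).
pose G x a b := if a is n.+1 then g n x b else if b is n.+1 then ind (A n) x else c x.
exists (fun x => flat (G x)); split.
  move=> m; apply: (bnat_flat SS) => -[|a] b; last by case: (gP a) => + _; exact.
  case: b => [|b]; last exact: bnat_ind.
  exact: (@bnat_least X S SS (fun n x => A n x) SA).
move=> w wg b h.
have prefix k : exists x, [/\ j0 x =1 j0 x, forall m, (m < k)%N -> j0 x m = w m,
    forall a b', (pickle (a, b') < k)%N -> G x a b' = wg (pickle (a, b')) &
    (exists n, A n x) <-> b].
  have [x [h1 h2 h3]] := h k; exists x; split => // a b' /h2.
  by rewrite flatE.
have wg0 m : pickle_inv m = None :> option (nat * nat) -> wg m = 0%N.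
  move=> mN; have [x [_ /(_ m (leqnn _)) <- _]] := h m.+1.
  by rewrite /flat mN.
have /choice[y yP] : forall n, exists x, [/\ j0 x =1 w,
    g n x =1 (fun m => wg (pickle (n.+1, m))) & A n x <-> wg (pickle (0%N, n.+1)) == 1%N].
  move=> n; case: (gP n) => _; apply => k.
  pose K := (k + (\max_(m < k) (pickle (n.+1, nat_of_ord m)).+1)
    + (pickle (0%N, n.+1)).+1)%N.
  have [x [_ h1 h2 h3]] := prefix K; exists x; split.
  - by move=> m mk; apply: h1; rewrite /K; apply: leq_trans mk _; rewrite -addnA leq_addr.
  - move=> m mk; apply: (h2 n.+1 m); rewrite /K.
    apply: (@leq_trans (\max_(m < k) (pickle (n.+1, nat_of_ord m)).+1)).
      exact: (@leq_bigmax _ (fun m : 'I_k => (pickle (n.+1, nat_of_ord m)).+1) (Ordinal mk)).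
    by rewrite addnAC leq_addl.
  - have <- : ind (A n) x = wg (pickle (0%N, n.+1)).
      by apply: (h2 0%N n.+1); rewrite /K leq_addl.
    by rewrite indP; split => [->//|/eqP].
pose x := y 0%N.
(* Each refinement yields its own limit point; injectivity of [j0] identifies them. *)
have yx n : y n = x.
  apply: (std_inj std0) => m; case: (yP n) => -> _ _.
  by case: (yP 0%N) => ->.
have xA n : A n x <-> wg (pickle (0%N, n.+1)) == 1%N by rewrite -(yx n); case: (yP n).
have xind n z : G z 0%N n.+1 = wg (pickle (0%N, n.+1)) -> A n x <-> A n z.
  by rewrite /G xA => <-; rewrite indP; split => [/eqP|->].
have [cx bx] : c x = wg (pickle (0%N, 0%N)) /\ ((exists n, A n x) <-> b).
  set c0 := wg _.
  pose K n := ((pickle (0%N, 0%N)).+1 + \max_(i < n.+1) (pickle (0%N, i.+1)).+1)%N.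
  have ex n : exists z, [/\ c z = c0, (forall i, (i <= n)%N -> A i x <-> A i z) &
      (exists n, A n z) <-> b].
    have [z [_ _ h2 h3]] := prefix (K n); exists z; split => //.
      by rewrite /c0 -h2// /K leq_addr.
    move=> i ni; apply: xind; apply: h2; rewrite /K.
    apply: leq_trans (leq_addl _ _); rewrite -ltnS in ni.
    exact: (@leq_bigmax _ (fun i : 'I_n.+1 => (pickle (0%N, (nat_of_ord i).+1)).+1) (Ordinal ni)).
  (* If the approximants lie in the union, the recorded least index [c0] is a bound for the search,
     and an approximant that agrees with [x] on the sets up to [c0] shows that [x] is in [A c0].
     Otherwise no approximant lies in any [A n]. *)
  case: b {h prefix} ex => ex.
    have [z [cz Az [_ /(_ isT)[n An]]]] := ex c0.
    have [Ac lc] := @leastP (fun n => A n z) n An.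
    have Ac0 : A c0 x by apply/Az => //; rewrite -cz.
    split; last by split => // _; exists c0.
    apply: least_eq => // m mc Am.
    have : A m z by apply/Az => //; exact: ltnW.
    by move=> /lc; rewrite -/(c z) cz leqNgt mc.
  have nA n : ~ A n x.
    move=> An; have [z [_ Az [nz _]]] := ex n.
    have : false by apply: nz; exists n; apply/Az.
    by [].
  split; last by split => // -[n /nA].
  have [z [<- _ [nz _]]] := ex 0%N.
  rewrite /c !least_none// => n An; have : false by apply: nz; exists n.
  by [].
exists x; split; [by case: (yP 0%N)| |by []].
apply: flat_cases => // -[|a] m /=; last by rewrite -(yx a); case: (yP a) => _ ->.
case: m => [|m]; first by rewrite cx.
have [z [_ _ /(_ 0%N m.+1 (leqnn _)) zE _]] := prefix (pickle (0%N, m.+1)).+1.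
symmetry; transitivity (ind (A m) z); last exact: zE.
exact/ind_eq/(xind m z zE).
Qed.

Lemma refinable_all A : S A -> refinable A.
Proof.
apply: gen0; last by move=> m n; exact: refinable_cylinder.
split.
- exact: refinable_not.
- exact: refinable_union.
- split; first exact: sa_set0.
  exists (fun _ _ => 0%N); split => [m|w wg b h]; first exact: bnat_const.
  have [|x xw] := std_closed std0 (w := w).
    by move=> k; have [x [? _ _]] := h k; exists x.
  exists x; split => // [k|].
    by have [y [_ + _]] := h k.+1; apply.
  by have [y [_ _ <-]] := h 0%N.
Qed.

(** Each set where some [u m] takes a given value is refined, and the values of the [u m] are
    recorded as coordinates. Measurable functions become continuous for the new presentation. *)
Lemma refine (u : nat -> X -> nat) : (forall n, bnat S (u n)) ->
  exists j (r : nat -> nat), standard j /\ forall n x, j x (r n) = u n x.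
Proof.
move=> bu.
pose A n := if pickle_inv n is Some mk then [set x | u mk.1 x = mk.2] else set0.
have SA n : S (A n) by rewrite /A; case: pickle_inv => [mk|]; [exact: bu|exact: sa_set0].
have /choice[g gP] : forall n, exists g : X -> nat -> nat, (forall m, bnat S (g^~ m)) /\
  forall w wg (b : bool), (forall k, exists x, [/\ agree k (j0 x) w, agree k (g x) wg & A n x <-> b]) ->
    exists x, [/\ j0 x =1 w, g x =1 wg & A n x <-> b].
  by move=> n; case: (refinable_all (SA n)).
pose G x a b := match a with 0 => j0 x b | 1 => u b x | 2 => ind (A b) x | n.+3 => g n x b end.
exists (fun x => flat (G x)), (fun n => pickle (1%N, n)); split; last first.
  by move=> n x; rewrite flatE.
have jinj x x' : flat (G x) =1 flat (G x') -> x = x'.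
  by move=> h; apply: (std_inj std0) => m; have := h (pickle (0%N, m)); rewrite !flatE.
split => // [|m]; last first.
  apply: (bnat_flat SS) => -[|[|[|a]]] b; [exact: (std_bnat std0)|exact: bu|exact: bnat_ind|].
  by case: (gP a) => + _; exact.
move=> w h.
have prefix (l : seq (nat * nat)) : exists x, forall ab, ab \in l -> G x ab.1 ab.2 = w (pickle ab).
  have [x xP] := h (\max_(ab <- l) (pickle ab).+1)%N; exists x => -[a b] abl.
  rewrite -(flatE (G x)); apply: xP.
  exact: (@leq_bigmax_seq _ _ xpredT (fun ab => (pickle ab).+1) (a, b)).
have w0 m : pickle_inv m = None :> option (nat * nat) -> w m = 0%N.
  by move=> mN; have [x /(_ m (leqnn _)) <-] := h m.+1; rewrite /flat mN.
have /choice[y yP] : forall n, exists x, [/\ j0 x =1 (fun m => w (pickle (0%N, m))),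
    g n x =1 (fun m => w (pickle (n.+3, m))) & A n x <-> w (pickle (2%N, n)) == 1%N].
  move=> n; case: (gP n) => _; apply => k.
  have [x xP] := prefix ((2%N, n) :: [seq (0%N, m) | m <- iota 0 k] ++
    [seq (n.+3, m) | m <- iota 0 k]).
  exists x; split.
  - move=> m mk; apply: (xP (0%N, m)); rewrite inE mem_cat.
    by apply/orP; right; apply/orP; left; apply/mapP; exists m; rewrite ?mem_iota.
  - move=> m mk; apply: (xP (n.+3, m)); rewrite inE mem_cat.
    by apply/orP; right; apply/orP; right; apply/mapP; exists m; rewrite ?mem_iota.
  - have := xP (2%N, n); rewrite inE eqxx => /(_ isT)/= <-.
    by rewrite indP; split => [->//|/eqP].
pose x := y 0%N.
have yx n : y n = x.
  apply: (std_inj std0) => m; case: (yP n) => -> _ _.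
  by case: (yP 0%N) => ->.
have xA n : A n x <-> w (pickle (2%N, n)) == 1%N by rewrite -(yx n); case: (yP n).
exists x; apply: flat_cases => // -[|[|[|a]]] m /=.
- by case: (yP 0%N) => ->.
(* The value claimed for [u m x] amounts to membership of [x] in one of the sets [A n], which has
   just been settled. *)
- pose n := pickle (m, w (pickle (1%N, m))).
  have [z zP] := prefix [:: (1%N, m); (2%N, n)].
  have := zP (1%N, m); rewrite !inE eqxx => /(_ isT)/= zm.
  have := zP (2%N, n); rewrite !inE eqxx orbT => /(_ isT)/= zn.
  have : A n x.
    apply/xA; rewrite -zn; apply/eqP/indP; rewrite /A /n pickleK_inv /=.
    exact: zm.
  by rewrite /A /n pickleK_inv /= => ->.
- have [z zP] := prefix [:: (2%N, m)].
  have := zP (2%N, m); rewrite !inE eqxx => /(_ isT)/= zm.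
  rewrite -zm; apply: ind_eq; rewrite xA -zm indP.
  by split => [->|/eqP].
- by rewrite -(yx a); case: (yP a) => _ ->.
Qed.

End Standard.

(** * Borel sets of Baire space and Lusin separation *)

Section BaireSpace.

(** Borel subsets of Baire space [nat -> nat]. *)
Definition BN : set (set (nat -> nat)) := fun A => forall C : set (set (nat -> nat)),
  sigma_alg C -> (forall m, bnat C (@^~ m)) -> C A.

Lemma BN_sigma : sigma_alg BN.
Proof.
split.
- by move=> A BA C SC gC; apply: sa_not => //; exact: BA.
- by move=> A BA C SC gC; apply: sa_union => // n; exact: BA.
- by move=> C SC gC; exact: sa_set0.
Qed.

Lemma BN_coord m : bnat BN (@^~ m).
Proof. by move=> n C SC gC; exact: gC. Qed.

Lemma BN_preimage (X : Type) (S : set (set X)) (SS : sigma_alg S) (f : X -> nat -> nat) D :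
  (forall m, bnat S (f^~ m)) -> BN D -> S [set x | D (f x)].
Proof.
move=> bf BD; apply: (BD [set A | S [set x | A (f x)]]); last by move=> m n; exact: bf.
split => [A SA|A SA|] /=; [exact: bor_not|exact: bor_ex|exact: sa_set0].
Qed.

(** Lusin's separation theorem: two inseparable images could be shrunk to
    inseparable images of smaller and smaller cylinders, converging to points with
    distinct images. *)
Lemma separation (X1 X2 : Type) (j1 : X1 -> nat -> nat) (j2 : X2 -> nat -> nat)
    (y1 : X1 -> nat -> nat) (y2 : X2 -> nat -> nat) (r1 r2 : nat -> nat) :
  closedim j1 -> closedim j2 ->
  (forall x m, j1 x (r1 m) = y1 x m) -> (forall x m, j2 x (r2 m) = y2 x m) ->
  (forall x1 x2, y1 x1 <> y2 x2) ->
  exists D, [/\ BN D, forall x, D (y1 x) & forall x, ~ D (y2 x)].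
Proof.
move=> c1 c2 yr1 yr2 y12.
pose Sep n w1 w2 := exists D, [/\ BN D,
  forall x, agree n (j1 x) w1 -> D (y1 x) & forall x, agree n (j2 x) w2 -> ~ D (y2 x)].
suff [D [BD D1 D2]] : Sep 0%N id id by exists D; split => // x; [exact: D1|exact: D2].
apply: contrapT => nS0.
have step n w1 w2 : exists ab : nat * nat, ~ Sep n w1 w2 ->
    ~ Sep n.+1 (upd w1 n ab.1) (upd w2 n ab.2).
  apply: contrapT => nab; have allS a b : Sep n.+1 (upd w1 n a) (upd w2 n b).
    apply: contrapT => nS; apply: nab; exists (a, b) => //.
  apply: nab; exists (0%N, 0%N) => nS; exfalso; apply: nS.
  have /choice[D DP] : forall ab : nat * nat, exists D, [/\ BN D,
      forall x, agree n.+1 (j1 x) (upd w1 n ab.1) -> D (y1 x) &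
      forall x, agree n.+1 (j2 x) (upd w2 n ab.2) -> ~ D (y2 x)].
    by move=> ab; exact: allS.
  have ext (w u : nat -> nat) : agree n u w -> agree n.+1 u (upd w n (u n)).
    move=> uw i; rewrite ltnS leq_eqVlt /upd => /predU1P[->|ni]; first by rewrite eqxx.
    by rewrite (ltn_eqF ni) uw.
  (* Separating all pairs of one-step extensions separates the cylinders: a union over the left
     extensions of intersections over the right ones. *)
  exists [set y | exists a, forall b, D (a, b) y]; split.
  - apply: (bor_ex BN_sigma) => a; apply: (bor_all BN_sigma) => b.
    by case: (DP (a, b)).
  - move=> x /ext xw; exists (j1 x n) => b.
    by case: (DP (j1 x n, b)) => _ + _; apply.
  - move=> x /ext xw [a /(_ (j2 x n))].
    by case: (DP (a, j2 x n)) => _ _; apply.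
have /choice[nx nxP] : forall s : nat * ((nat -> nat) * (nat -> nat)),
    exists ab : nat * nat, ~ Sep s.1 s.2.1 s.2.2 ->
      ~ Sep s.1.+1 (upd s.2.1 s.1 ab.1) (upd s.2.2 s.1 ab.2).
  by move=> s; exact: step.
pose st := fix st n := if n is m.+1 then
  (upd (st m).1 m (nx (m, st m)).1, upd (st m).2 m (nx (m, st m)).2)
  else (id : nat -> nat, id : nat -> nat).
have stP n : ~ Sep n (st n).1 (st n).2.
  by elim: n => [|n IH] //; exact: (nxP (n, st n) IH).
pose w1 i := (st i.+1).1 i; pose w2 i := (st i.+1).2 i.
have ag1 n : agree n (st n).1 w1 /\ agree n (st n).2 w2.
  elim: n => [|n [IH1 IH2]]; first by split.
  split=> i; rewrite ltnS leq_eqVlt => /predU1P[->//|ni] /=.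
    by rewrite /upd (ltn_eqF ni) IH1.
  by rewrite /upd (ltn_eqF ni) IH2.
have [x1 x1w] : exists x, j1 x =1 w1.
  (* An empty cylinder would be separated trivially, so [w1] is a limit of points of the image. *)
  apply: c1 => n; apply: contrapT => nx1; apply: (stP n).
  exists set0; split; [exact: (sa_set0 BN_sigma)| |by move=> ? _ []].
  move=> x xw; exfalso; apply: nx1; exists x => i ni.
  by rewrite xw// (proj1 (ag1 n)).
have [x2 x2w] : exists x, j2 x =1 w2.
  apply: (c2 w2) => k; apply: contrapT => nx2; apply: (stP k).
  exists setT; split; [exact: (bor_const BN_sigma True)|by []|].
  move=> x xw; exfalso; apply: nx2; exists x => i ni.
  by rewrite xw// (proj2 (ag1 k)).
apply: (y12 x1 x2); apply/funext => m; apply: contrapT => y1y2.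
(* Beyond the positions [r1 m] and [r2 m], entry [m] of the images is constant on both cylinders,
   and its value separates them. *)
pose n := (maxn (r1 m) (r2 m)).+1; apply: (stP n).
exists [set y | y m = y1 x1 m]; split; first exact: BN_coord.
  move=> x xw /=; rewrite -yr1 -[RHS]yr1 x1w xw ?ltnS ?leq_maxl//.
  by rewrite (proj1 (ag1 n)) ?ltnS ?leq_maxl.
move=> x xw /=; rewrite -yr2 xw ?ltnS ?leq_maxr//.
rewrite (proj2 (ag1 n)) ?ltnS ?leq_maxr// -x2w yr2 => y21.
by apply: y1y2.
Qed.

End BaireSpace.

(** * Separation of Borel images and countable quotients *)

Section StandardSeparation.
Context (X : Type) (S : set (set X)) (SS : sigma_alg S) (j0 : X -> nat -> nat).
Hypothesis std0 : standard S j0.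
Hypothesis gen0 : forall C : set (set X), sigma_alg C -> (forall m, bnat C (j0^~ m)) ->
  S `<=` C.

(** Once the indicator of [B] is a coordinate, membership in [B] is decided by a prefix and passes
    to limits. *)
Lemma standard_sub (B : set X) j r : standard S j -> (forall x, j x r = ind B x) ->
  closedim (fun x : {x | B x} => j (sval x)).
Proof.
move=> sj jr w h; have [|x xw] := std_closed sj (w := w).
  by move=> n; have [x xP] := h n; exists (sval x).
have Bx : B x.
  have [y /(_ r (leqnn _)) yr] := h r.+1; apply/(indP B).
  by rewrite -jr xw -yr jr; apply/(indP B); exact: (svalP y).
by exists (exist _ x Bx).
Qed.

Lemma separate_images (B1 B2 : set X) (f1 f2 : X -> nat -> nat) : S B1 -> S B2 ->
  (forall m, bnat S (f1^~ m)) -> (forall m, bnat S (f2^~ m)) ->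
  (forall x1 x2, B1 x1 -> B2 x2 -> f1 x1 <> f2 x2) ->
  exists D, [/\ BN D, forall x, B1 x -> D (f1 x) & forall x, B2 x -> ~ D (f2 x)].
Proof.
move=> SB1 SB2 bf1 bf2 f12.
have one (B : set X) (f : X -> nat -> nat) : S B -> (forall m, bnat S (f^~ m)) ->
    exists j r, closedim (fun x : {x | B x} => j (sval x)) /\
      forall (x : {x | B x}) m, j (sval x) (r m) = f (sval x) m.
  move=> SB bf.
  have [|j [r [sj jr]]] := refine SS std0 gen0
    (u := fun n => if n is m.+1 then f^~ m else ind B).
    by case=> [|m]; [exact: bnat_ind|exact: bf].
  exists j, (r \o succn); split; last by move=> x m /=; rewrite jr.
  by apply: (standard_sub sj (r := r 0%N)) => x; rewrite jr.
have [j1 [r1 [c1 y1]]] := one B1 f1 SB1 bf1; have [j2 [r2 [c2 y2]]] := one B2 f2 SB2 bf2.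
have [|D [BD D1 D2]] := separation (y1 := fun x : {x | B1 x} => f1 (sval x))
    (y2 := fun x : {x | B2 x} => f2 (sval x)) c1 c2 y1 y2.
  by move=> x1 x2; apply: f12; exact: svalP.
exists D; split => // x Bx; first exact: (D1 (exist _ x Bx)).
exact: (D2 (exist _ x Bx)).
Qed.

Lemma separate_images_countable (I1 I2 : countType) (B1 : I1 -> set X) (B2 : I2 -> set X)
    (f1 : I1 -> X -> nat -> nat) (f2 : I2 -> X -> nat -> nat) :
  (forall i, S (B1 i)) -> (forall i, S (B2 i)) ->
  (forall i m, bnat S (f1 i ^~ m)) -> (forall i m, bnat S (f2 i ^~ m)) ->
  (forall i1 i2 x1 x2, B1 i1 x1 -> B2 i2 x2 -> f1 i1 x1 <> f2 i2 x2) ->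
  exists D, [/\ BN D, forall i x, B1 i x -> D (f1 i x) & forall i x, B2 i x -> ~ D (f2 i x)].
Proof.
move=> SB1 SB2 bf1 bf2 f12.
have /choice[D DP] : forall ii : I1 * I2, exists D, [/\ BN D,
    forall x, B1 ii.1 x -> D (f1 ii.1 x) & forall x, B2 ii.2 x -> ~ D (f2 ii.2 x)].
  by move=> [i1 i2]; apply: separate_images => //; exact: f12.
exists [set y | exists i1, forall i2, D (i1, i2) y]; split.
- apply: (bor_ex BN_sigma) => i1; apply: (bor_all BN_sigma) => i2.
  by case: (DP (i1, i2)).
- by move=> i x Bx; exists i => i2; case: (DP (i, i2)) => _ + _; apply.
- by move=> i x Bx [i1 /(_ i)]; case: (DP (i1, i)) => _ _; apply.
Qed.

(** Every [E]-class is coded by the countable set of the valid values [g s x];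
    distinct classes have disjoint codes, and each piece [Pc c] relates the codes
    of a class by a partial function. *)
Variables (V : nat -> set X) (g : nat -> X -> nat -> nat).
Variable Pc : nat -> nat -> nat -> set X.
Hypotheses (SV : forall s, S (V s)) (bg : forall s m, bnat S (g s ^~ m)).
Hypothesis SPc : forall c s s', S (Pc c s s').
Variable E : X -> X -> Prop.
Hypothesis E_equiv : RelationClasses.Equivalence E.
Hypothesis V_cover : forall x, exists s, V s x.
Hypothesis g_sep : forall x x' s s', V s x -> V s' x' -> g s x = g s' x' -> E x x'.
Hypothesis g_inv : forall x x' s, E x x' -> V s x -> exists2 s', V s' x' & g s' x' = g s x.
Hypothesis Pc_cover : forall x s s', V s x -> V s' x -> exists c, Pc c s s' x.
Hypothesis Pc_fun : forall c x s s' x1 s1 s1', V s x -> V s' x -> V s1 x1 -> V s1' x1 ->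
  Pc c s s' x -> Pc c s1 s1' x1 -> g s x = g s1 x1 -> g s' x = g s1' x1.

Let code x : set (nat -> nat) := [set y | exists2 s, V s x & g s x = y].

Let code_inv x x' : E x x' -> code x = code x'.
Proof.
have h x1 x2 : E x1 x2 -> code x1 `<=` code x2.
  by move=> e y [s Vs <-]; have [s' Vs' gs'] := g_inv e Vs; exists s'.
move=> e; apply/seteqP; split; apply: h => //.
by case: E_equiv => _ sym _; exact: sym.
Qed.

(** On the piece [c], entry [m] of the second code is determined by the first code. The first codes
    for which this entry is [n] and those for which it is not are thus disjoint images; Borel sets
    separate them, and the least [n] whose set contains [y] gives the function. *)
Lemma piece_functions : exists F : nat -> (nat -> nat) -> nat -> nat,
  (forall c m, bnat BN (F c ^~ m)) /\
  forall c s s' x, V s x -> V s' x -> Pc c s s' x -> F c (g s x) = g s' x.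
Proof.
have /choice[D DP] : forall cmn : nat * nat * nat, exists D, [/\ BN D,
    forall (ss : nat * nat) x, [/\ V ss.1 x, V ss.2 x, Pc cmn.1.1 ss.1 ss.2 x &
      g ss.2 x cmn.1.2 = cmn.2] -> D (g ss.1 x) &
    forall (ss : nat * nat) x, [/\ V ss.1 x, V ss.2 x, Pc cmn.1.1 ss.1 ss.2 x &
      g ss.2 x cmn.1.2 <> cmn.2] -> ~ D (g ss.1 x)].
  move=> [[c m] n] /=.
  pose A (b : bool) (ss : nat * nat) : set X := [set x | V ss.1 x /\ V ss.2 x /\
    Pc c ss.1 ss.2 x /\ (if b then g ss.2 x m = n else g ss.2 x m <> n)].
  have SA b ss : S (A b ss).
    apply: (bor_and SS (SV ss.1)); apply: (bor_and SS (SV ss.2)).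
    apply: (bor_and SS (SPc c ss.1 ss.2)).
    by case: b; [exact: bg|apply: (bor_not SS); exact: bg].
  have [|D [BD D1 D2]] := separate_images_countable (SA true) (SA false)
      (fun ss m => @bg ss.1 m) (fun ss m => @bg ss.1 m).
    move=> [s s'] [s1 s1'] x x1 /= [Vs [Vs' [P gn]]] [Vs1 [Vs1' [P1 gn1]]] gg.
    by apply: gn1; rewrite -(Pc_fun Vs Vs' Vs1 Vs1' P P1 gg).
  exists D; split => // ss x [? ? ? ?]; [exact: D1|exact: D2].
exists (fun c y m => least (fun n => D (c, m, n) y)); split.
  move=> c m; apply: (@bnat_least _ _ BN_sigma (fun n y => D (c, m, n) y)) => n.
  by case: (DP (c, m, n)).
move=> c s s' x Vs Vs' P; apply/funext => m; apply: least_eq.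
  by case: (DP (c, m, g s' x m)) => _ /(_ (s, s') x) + _; apply.
move=> n nm; case: (DP (c, m, n)) => _ _ /(_ (s, s') x); apply; split => //= gn.
by rewrite gn ltnn in nm.
Qed.

(** Every [F c] is defined on all of Baire space and may leave the codes of a class. [Dm c] marks
    the codes that [F c] maps to a code of the same class; invariance of the codes makes this depend
    on the code alone, so that separation applies once more. *)
Lemma countable_quotient : exists (f : X -> nat -> nat)
    (F : nat -> (nat -> nat) -> nat -> nat) (Dm : nat -> set (nat -> nat)),
  [/\ forall m, bnat S (f^~ m), forall c m, bnat BN (F c ^~ m), forall c, BN (Dm c) &
    let Z y := [set z | exists2 c, Dm c y & F c y = z] in
    (forall x, Z (f x) (f x)) /\
    forall x x', E x x' <-> Z (f x) = Z (f x')].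
Proof.
have [F [bF FP]] := piece_functions.
have /choice[Dm DmP] : forall c, exists D, [/\ BN D,
    forall s x, V s x /\ (exists s', V s' x /\ F c (g s x) = g s' x) -> D (g s x) &
    forall s x, V s x /\ ~ (exists s', V s' x /\ F c (g s x) = g s' x) -> ~ D (g s x)].
  move=> c.
  have SFg s s' : S [set x | F c (g s x) = g s' x].
    apply: (bor_ext _ (bor_all SS (I := nat) (P := fun m x => F c (g s x) m = g s' x m) _)).
      by move=> x; split => [h|->//]; apply/funext.
    move=> m; apply: bnat_eq => // n.
    exact: (BN_preimage SS (D := [set y | F c y m = n]) (bg s) (bF c m n)).
  have SE s : S [set x | exists s', V s' x /\ F c (g s x) = g s' x].
    by apply: (bor_ex SS) => s'; exact: (bor_and SS (SV s') (SFg s s')).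
  pose A (b : bool) s : set X := [set x | V s x /\
    (if b then exists s', V s' x /\ F c (g s x) = g s' x
     else ~ exists s', V s' x /\ F c (g s x) = g s' x)].
  have SA b s : S (A b s).
    by apply: (bor_and SS (SV s)); case: b => //; exact: (bor_not SS).
  have [|D [BD D1 D2]] := separate_images_countable (SA true) (SA false) bg bg.
    move=> s s1 x x1 [Vs [s' [Vs' Fs]]] [Vs1 nF] gg; apply: nF.
    have ex := g_sep Vs Vs1 gg; have [s1' Vs1' gs1'] := g_inv ex Vs'.
    by exists s1'; rewrite -gg Fs gs1'.
  by exists D; split.
pose sel x := least (fun s => V s x).
have selV x : V (sel x) x.
  by have [s Vs] := V_cover x; have [] := @leastP (fun s => V s x) s Vs.
have bsel : bnat S sel by exact: (@bnat_least X S SS (fun s x => V s x) SV).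
pose Z y := [set z | exists2 c, Dm c y & F c y = z].
have Zcode x y : code x y -> Z y = code x.
  move=> [s Vs <-]; apply/seteqP; split => z.
    move=> [c Dc <-]; apply: contrapT => nz.
    case: (DmP c) => _ _ /(_ s x); apply => //; split => //.
    by move=> [s' [Vs' Fs']]; apply: nz; exists s'.
  move=> [s' Vs' <-]; have [c Pcs] := Pc_cover Vs Vs'.
  exists c; last exact: FP Pcs.
  case: (DmP c) => _ + _; apply; split => //.
  by exists s'; split => //; exact: FP Pcs.
exists (fun x => g (sel x) x), F, Dm; split => //.
- move=> m n; apply: (bor_subst SS (P := fun s x => g s x m = n) bsel) => s; exact: bg.
- by move=> c; case: (DmP c).
have cx x : code x (g (sel x) x) by exists (sel x).
split => [x|x x']; first by rewrite -/(Z _) (Zcode _ _ (cx x)).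
rewrite -!/(Z _) (Zcode _ _ (cx x)) (Zcode _ _ (cx x')); split; first exact: code_inv.
move=> cc; have := cx x; rewrite cc => -[s' Vs' gs'].
exact: g_sep (selV x) Vs' (esym gs').
Qed.

End StandardSeparation.

Section BorelSets.

Lemma borel_sigma (X : topologicalType) : sigma_alg (@borel X).
Proof.
split; rewrite /borel.
- by move=> A bA; rewrite -setTD; exact: sigma_algebraCD.
- move=> A bA; rewrite (_ : [set x | _] = \bigcup_n A n).
    exact: sigma_algebra_bigcup.
  by apply/seteqP; split => [x [n An]|x [n _ An]]; exists n.
- exact: sigma_algebra0.
Qed.

Lemma borel_open (X : topologicalType) (A : set X) : open A -> borel A.
Proof. by move=> oA; exact: sub_sigma_algebra. Qed.

Lemma borel_min (X : topologicalType) (C : set (set X)) : sigma_alg C ->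
  (forall A, open A -> C A) -> forall A, borel A -> C A.
Proof.
move=> SC oC A; apply: smallest_sub => //; split; first exact: sa_set0.
  by move=> B CB; rewrite setTD; exact: sa_not.
move=> B CB; rewrite (_ : \bigcup_n B n = [set x | exists n, B n x]).
  exact: sa_union.
by apply/seteqP; split => [x [n _ Bn]|x [n Bn]]; exists n.
Qed.

Lemma borel_continuous (X Y : topologicalType) (f : X -> Y) (A : set Y) :
  continuous f -> borel A -> borel (f @^-1` A).
Proof.
move=> cf; apply: (@borel_min Y [set A | borel (f @^-1` A)]) => [|B oB].
  have SX := borel_sigma X; split => [B bB|B bB|] /=.
  - exact: (bor_not SX).
  - exact: (bor_ex SX).
  - exact: (sa_set0 SX).
by apply: borel_open; move/continuousP : cf; exact.
Qed.

End BorelSets.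

(** * The metric of first difference and its pullback *)

Section PrefixMetric.
Context (R : realType).

Definition prefix_dist (u v : nat -> nat) : R :=
  if pselect (u = v) then 0 else (2 ^+ least (fun m => u m <> v m))^-1.

Lemma prefix_dist_le u v n : prefix_dist u v <= (2 ^+ n)^-1 <-> agree n u v.
Proof.
rewrite /prefix_dist; case: pselect => uv /=.
  by rewrite uv; split => // _; rewrite invr_ge0 exprn_ge0.
have [m um] : exists m, u m <> v m.
  by apply: contrapT => h; apply: uv; apply/funext => m; apply: contrapT => um; apply: h; exists m.
have [lu lmin] := @leastP (fun m => u m <> v m) m um.
rewrite lef_pV2 ?posrE ?exprn_gt0// ler_eXn2l ?ltr1n//; split.
  by move=> nl i ni; apply: contrapT => /lmin; rewrite leqNgt (leq_trans ni nl).
by move=> ag; rewrite leqNgt; apply/negP => /ag.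
Qed.

Lemma prefix_dist_ge0 u v : 0 <= prefix_dist u v.
Proof. by rewrite /prefix_dist; case: pselect => // _; rewrite invr_ge0 exprn_ge0. Qed.

Lemma prefix_dist_val u v : prefix_dist u v = 0 \/ exists n, prefix_dist u v = (2 ^+ n)^-1.
Proof. by rewrite /prefix_dist; case: pselect => h /=; [left|right; eexists]. Qed.

Lemma prefix_distxx u : prefix_dist u u = 0.
Proof. by rewrite /prefix_dist; case: pselect. Qed.

Lemma prefix_dist0 u v : prefix_dist u v = 0 -> u = v.
Proof.
move=> uv; apply/funext => m.
have : agree m.+1 u v by apply/prefix_dist_le; rewrite uv invr_ge0 exprn_ge0.
exact.
Qed.

Lemma prefix_dist_sym u v : prefix_dist u v = prefix_dist v u.
Proof.
have h u' v' : prefix_dist u' v' <= prefix_dist v' u'.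
  have [/prefix_dist0->|[n nE]] := prefix_dist_val v' u'; first by rewrite prefix_distxx.
  have ag : agree n v' u' by apply/prefix_dist_le; rewrite nE.
  by rewrite nE; apply/prefix_dist_le => i /ag.
by apply/eqP; rewrite eq_le !h.
Qed.

Lemma prefix_dist_tri v u w : prefix_dist u w <= prefix_dist u v + prefix_dist v w.
Proof.
have [/prefix_dist0->|[n nE]] := prefix_dist_val u v; first by rewrite lerDr prefix_dist_ge0.
have [/prefix_dist0->|[m mE]] := prefix_dist_val v w; first by rewrite lerDl prefix_dist_ge0.
have n1 : agree n u v by apply/prefix_dist_le; rewrite nE.
have m1 : agree m v w by apply/prefix_dist_le; rewrite mE.
have [nm|mn] := leqP n m.
  rewrite nE; apply: (@le_trans _ _ (2 ^+ n)^-1); last by rewrite lerDl prefix_dist_ge0.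
  by apply/prefix_dist_le => i ni; rewrite n1// m1// (leq_trans ni).
rewrite mE; apply: (@le_trans _ _ (2 ^+ m)^-1); last by rewrite lerDr prefix_dist_ge0.
by apply/prefix_dist_le => i ni; rewrite n1 ?m1// (ltn_trans ni).
Qed.

Lemma prefix_dist_lt_agree n u v : prefix_dist u v < (2 ^+ n)^-1 -> agree n u v.
Proof. by move=> /ltW/prefix_dist_le. Qed.

Lemma small_pow (e : R) : 0 < e -> exists n, (2 ^+ n)^-1 < e.
Proof.
move=> e0; have [n _ /(_ n (leqnn _))] := near_infty_natSinv_expn_lt (PosNum e0).
by rewrite /= div1r; exists n.
Qed.

Section Pullback.
Variables (X : Type) (j : X -> nat -> nat).
Hypothesis j_inj : forall x x', j x =1 j x' -> x = x'.

Definition prefix_carrier := X.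
HB.instance Definition _ := gen_eqMixin prefix_carrier.
HB.instance Definition _ := gen_choiceMixin prefix_carrier.

Let jd (x y : X) : R := prefix_dist (j x) (j y).
Let jd0 x y : jd x y = 0 -> x = y.
Proof. by move=> /prefix_dist0 xy; apply: j_inj => m; rewrite xy. Qed.

Definition prefix_space : metricType R := HB.pack_for (metricType R) prefix_carrier
  (isMetric.Build R prefix_carrier (fun x => prefix_distxx (j x)) jd0
    (fun x y => prefix_dist_sym (j x) (j y))
    (fun y x z => prefix_dist_tri (j y) (j x) (j z))).

Lemma prefix_space_dist (x y : prefix_space) : mdist x y = prefix_dist (j x) (j y).
Proof. by []. Qed.

Lemma prefix_space_complete : closedim j -> complete_space prefix_space.
Proof.
move=> cj; apply: seq_complete_space => y yC.
have /choice[N NP] : forall n, exists N, forall i k, (N <= i)%N -> (N <= k)%N ->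
    agree n (j (y i)) (j (y k)).
  move=> n; have [|N NP] := yC (2 ^+ n)^-1; first by rewrite invr_gt0 exprn_gt0.
  by exists N => i k Ni Nk; apply: prefix_dist_lt_agree; exact: NP.
pose w m := j (y (N m.+1)) m.
have wE n i : (forall m, (m < n)%N -> (N m.+1 <= i)%N) -> agree n (j (y i)) w.
  by move=> Ni m mn; apply: (NP m.+1) => //; exact: Ni.
have bound n : exists K, forall i, (K <= i)%N -> agree n (j (y i)) w.
  exists (\max_(m < n) N m.+1)%N => i Ki; apply: wE => m mn; apply: leq_trans Ki.
  exact: (@leq_bigmax _ (fun m : 'I_n => N m.+1) (Ordinal mn)).
have [n|x xw] := cj w.
  by have [K KP] := bound n; exists (y K); exact: KP.
exists x => e /small_pow[n ne]; have [K KP] := bound n; exists K => i Ki.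
apply: le_lt_trans ne; rewrite prefix_space_dist; apply/prefix_dist_le => m mn.
by rewrite xw (KP i Ki).
Qed.

Lemma prefix_space_separable : separable_space prefix_space.
Proof.
have [[x0 _]|nX] := pselect (exists x : X, True); last first.
  exists set0; first exact: countable0.
  by move=> O [x Ox] _; exfalso; apply: nX; exists x.
have /choice[p pP] : forall s : seq nat, exists y : X, forall x : X,
    agree (size s) (j x) (nth 0%N s) -> agree (size s) (j y) (nth 0%N s).
  move=> s; have [[y yP]|ny] := pselect (exists y, agree (size s) (j y) (nth 0%N s)).
    by exists y.
  by exists x0 => x xs; exfalso; apply: ny; exists x.
exists (range p).
  by apply: (@card_le_trans _ _ _ [set: seq nat]); [exact: card_image_le|exact: countableP].
move=> O [x Ox] oO.
have /nbhs_ballP[e /= /small_pow[n ne] eO] : nbhs (x : prefix_space) O.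
  exact: open_nbhs_nbhs.
pose s := mkseq (j x) n.
have xs : agree (size s) (j x) (nth 0%N s).
  by move=> i; rewrite size_mkseq => ni; rewrite nth_mkseq.
exists (p s); split; last by exists s.
apply: eO; rewrite ballEmdist/= prefix_space_dist; apply: le_lt_trans ne.
apply/prefix_dist_le => i ni; have := pP s x xs i; rewrite size_mkseq => ->//.
by rewrite nth_mkseq.
Qed.

Lemma cylinder_open m n : open ([set x | j x m = n] : set prefix_space).
Proof.
rewrite openE => x /= xm; apply/nbhs_ballP; exists (2 ^+ m.+1)^-1.
  by rewrite /= invr_gt0 exprn_gt0.
move=> y; rewrite ballEmdist/= prefix_space_dist => /prefix_dist_lt_agree h.
by rewrite -xm h.
Qed.

Lemma cylinder_closed m n : closed ([set x | j x m = n] : set prefix_space).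
Proof.
rewrite -openC (_ : ~` _ = \bigcup_(k in [set k | k <> n]) [set x | j x m = k]).
  by apply: bigcup_open => k _; exact: cylinder_open.
apply/seteqP; split => [x xm|x [k kn /= xk] xn]; first by exists (j x m).
by apply: kn; rewrite -xk.
Qed.

Lemma prefix_open_mem (S : set (set X)) : sigma_alg S -> (forall m, bnat S (j^~ m)) ->
  forall A : set prefix_space, open A -> S A.
Proof.
move=> SS bj A oA.
pose P (s : seq nat) (x : X) := agree (size s) (j x) (nth 0%N s).
have SP s : S [set x | P s x].
  apply: (bor_all SS) => i; apply: (bor_imp SS); first exact: (bor_const SS).
  exact: bj.
have SQ s : S [set x | P s x /\ P s `<=` A].
  by apply: (bor_and SS) => //; exact: (bor_const SS).
apply: (bor_ext _ (bor_ex SS SQ)) => x; split => [[s [Ps]]|Ax]; first exact.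
have /nbhs_ballP[e /= /small_pow[n ne] eA] : nbhs (x : prefix_space) A.
  exact: open_nbhs_nbhs.
exists (mkseq (j x) n); split=> [i|y Py].
  by rewrite size_mkseq => ni; rewrite nth_mkseq.
apply: eA; rewrite ballEmdist/= prefix_space_dist; apply: le_lt_trans ne.
apply/prefix_dist_le => i ni; have := Py i; rewrite size_mkseq => ->//.
by rewrite nth_mkseq.
Qed.

Lemma prefix_space_polish : closedim j -> polish R prefix_space.
Proof.
move=> cj; exists prefix_space; split.
- exact: prefix_space_complete.
- exact: prefix_space_separable.
- by exists id, id; split => // x; exact: cvg_id.
Qed.

End Pullback.
End PrefixMetric.

(** * From countable invariants to the two complexity bounds *)

Section Conclusions.
Context (R : realType) (X : topologicalType) (j0 : X -> nat -> nat).
Hypothesis std0 : standard (@borel X) j0.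
Hypothesis gen0 : forall C : set (set X), sigma_alg C -> (forall m, bnat C (j0^~ m)) ->
  @borel X `<=` C.
Let SS := borel_sigma X.

Variables (V : nat -> set X) (g : nat -> X -> nat -> nat) (E : X -> X -> Prop).
Hypotheses (SV : forall s, borel (V s)) (bg : forall s m, bnat (@borel X) (g s ^~ m)).

(** In the refined topology each [V s] is clopen and each [g s] continuous, so for fixed [s] and
    [s'] the condition on the right is closed. *)
Lemma potentially_Sigma02_codes :
  (forall x x', E x x' <-> exists s s', [/\ V s x, V s' x' & g s x = g s' x']) ->
  potentially_Sigma02 R E.
Proof.
move=> EP.
(* Row [0] keeps the old coordinates, so that the Borel sets stay the same; row [1] holds the
   indicators of the [V b], and row [a + 2] the code [g a]. *)
pose u (n : nat) := if pickle_inv n is Some (a, b) then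
  match a with 0 => j0^~ b | 1 => ind (V b) | a.+2 => g a ^~ b end else fun=> 0%N.
have bu n : bnat (@borel X) (u n).
  rewrite /u; case: pickle_inv => [[[|[|a]] b]|]; last exact: bnat_const.
  - exact: (std_bnat std0).
  - exact: bnat_ind.
  - exact: bg.
have [j [r [sj jr]]] := refine SS std0 gen0 bu.
have jj0 x (m : nat) : j x (r (pickle (0%N, m))) = j0 x m by rewrite jr /u pickleK_inv.
have jV x (s : nat) : j x (r (pickle (1%N, s))) = ind (V s) x by rewrite jr /u pickleK_inv.
have jg x s (m : nat) : j x (r (pickle (s.+2, m))) = g s x m by rewrite jr /u pickleK_inv.
pose M := prefix_space R (std_inj sj).
exists (Topological.class M); split.
- exact: (prefix_space_polish R (std_inj sj) (std_closed sj)).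
- have SM := borel_sigma M; apply/seteqP; split => A.
    apply: (@borel_min M (@borel X)) => // B.
    exact: (prefix_open_mem SS (std_bnat sj)).
  apply: (gen0 (C := @borel M)) => // m n; apply: borel_open.
  suff -> : [set x | j0 x m = n] = [set x | j x (r (pickle (0%N, m))) = n].
    exact: (@cylinder_open R X j (std_inj sj)).
  by apply/seteqP; split => x /=; rewrite jj0.
pose C (n : nat) : set (M * M)%type :=
  if pickle_inv n is Some (s, s') then
    [set p | j p.1 (r (pickle (1%N, s))) = 1%N] `&`
    [set p | j p.2 (r (pickle (1%N, s'))) = 1%N] `&`
    [set p | forall m : nat, j p.1 (r (pickle (s.+2, m))) = j p.2 (r (pickle (s'.+2, m)))]
  else set0.
have cfst : continuous (fst : (M * M)%type -> M) by move=> p; exact: cvg_fst.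
have csnd : continuous (snd : (M * M)%type -> M) by move=> p; exact: cvg_snd.
have co m n : open ([set x | j x m = n] : set M) by exact: (@cylinder_open R X j (std_inj sj)).
have cc m n : closed ([set x | j x m = n] : set M) by exact: (@cylinder_closed R X j (std_inj sj)).
have c1 m n : closed [set p : (M * M)%type | j p.1 m = n].
  exact: (closed_comp (in1W cfst) (cc m n)).
have c2 m n : closed [set p : (M * M)%type | j p.2 m = n].
  exact: (closed_comp (in1W csnd) (cc m n)).
have o1 m n : open [set p : (M * M)%type | j p.1 m = n].
  exact: (open_comp (in1W cfst) (co m n)).
have o2 m n : open [set p : (M * M)%type | j p.2 m = n].
  exact: (open_comp (in1W csnd) (co m n)).
exists C.
  move=> n; rewrite /C; case: pickle_inv => [[s s']|]; last exact: closed0.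
  apply: closedI; first exact: closedI.
  suff -> : [set p : (M * M)%type | forall m : nat,
        j p.1 (r (pickle (s.+2, m))) = j p.2 (r (pickle (s'.+2, m)))] =
      ~` \bigcup_(m : nat) \bigcup_(k : nat)
      ([set p : (M * M)%type | j p.1 (r (pickle (s.+2, m))) = k] `&`
       ~` [set p : (M * M)%type | j p.2 (r (pickle (s'.+2, m))) = k]).
    apply: open_closedC; apply: bigcup_open => m _; apply: bigcup_open => k _.
    by apply: openI => //; rewrite openC.
  apply/seteqP; split => [p /= h [m _ [k _ [/= h1 h2]]]|p h m]; first by apply: h2; rewrite -h.
  apply: contrapT => ne; apply: h; exists m => //.
  exists (j p.1 (r (pickle (s.+2, m)))) => //; split => //= e.
  exact: ne (esym e).
apply/seteqP; split => [[x x'] /= /EP[s [s' [Vs Vs' gs]]]|[x x'] [n _]].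
  exists (pickle (s, s')) => //; rewrite /C pickleK_inv; split; first split => /=.
  - by rewrite jV; exact: (proj1 (indP _ _) Vs).
  - by rewrite jV; exact: (proj1 (indP _ _) Vs').
  - by move=> m /=; rewrite !jg gs.
rewrite /C; case: pickle_inv => [[s s']|//] [[/= h1 h2] h3].
apply/EP; exists s, s'; split; [apply/(indP (V s)); rewrite -jV//|apply/(indP (V s')); rewrite -jV//|].
by apply/funext => m; have := h3 m; rewrite /= !jg.
Qed.

Variable Pc : nat -> nat -> nat -> set X.
Hypothesis SPc : forall c s s', borel (Pc c s s').
Hypothesis E_equiv : RelationClasses.Equivalence E.
Hypothesis V_cover : forall x, exists s, V s x.
Hypothesis g_sep : forall x x' s s', V s x -> V s' x' -> g s x = g s' x' -> E x x'.
Hypothesis g_inv : forall x x' s, E x x' -> V s x -> exists2 s', V s' x' & g s' x' = g s x.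
Hypothesis Pc_cover : forall x s s', V s x -> V s' x -> exists c, Pc c s s' x.
Hypothesis Pc_fun : forall c x s s' x1 s1 s1', V s x -> V s' x -> V s1 x1 -> V s1' x1 ->
  Pc c s s' x -> Pc c s1 s1' x1 -> g s x = g s1 x1 -> g s' x = g s1' x1.

Lemma essentially_countable_codes : essentially_countable R E.
Proof.
have [f [F [Dm [bf bF BD]]]] := countable_quotient SS std0 gen0 SV bg SPc E_equiv
  V_cover g_sep g_inv Pc_cover Pc_fun.
set Z := fun y => _ => -[Zf ZE].
have id_inj (x x' : (nat -> nat)) : (x : nat -> nat) =1 x' -> x = x' by move=> h; exact/funext.
pose Y := @prefix_space R (nat -> nat) (fun y => y) id_inj.
have BNY A : BN A -> @borel Y A.
  move=> BA; apply: (BA (@borel Y)); first exact: (borel_sigma Y).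
  by move=> m n; apply: (@borel_open Y); exact: (@cylinder_open R _ _ id_inj).
(* Points that do not occur in their own [Z] represent no class; equality is used there, which makes
   [Q] reflexive. *)
pose Q (y y' : Y) := y = y' \/ [/\ Z y = Z y', Z y y & Z y' y'].
exists Y, Q, f; split.
- by apply: prefix_space_polish => w h; exists w.
- split.
    split.
    + by move=> y; left.
    + by move=> y y' [->|[? ? ?]]; [left|right].
    + move=> y y' y'' [->//|[h1 h2 h3]] [<-|[h4 h5 h6]]; right; split => //.
      by rewrite h1.
  have SY2 := borel_sigma (Y * Y)%type.
  have fstB A : BN A -> @borel (Y * Y)%type [set p | A p.1].
    by move=> /BNY; apply: (borel_continuous (f := fst)) => p; exact: cvg_fst.
  have sndB A : BN A -> @borel (Y * Y)%type [set p | A p.2].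
    by move=> /BNY; apply: (borel_continuous (f := snd)) => p; exact: cvg_snd.
  have eqB (h h' : Y * Y -> nat -> nat) :
      (forall m, bnat (@borel (Y * Y)%type) (h^~ m)) ->
      (forall m, bnat (@borel (Y * Y)%type) (h'^~ m)) ->
      @borel (Y * Y)%type [set p | h p = h' p].
    move=> bh bh'; apply: (bor_ext _ (bor_all SY2 (fun m => bnat_eq SY2 (bh m) (bh' m)))) => p.
    by split => [hm|-> //]; exact/funext.
  have b1 m : bnat (@borel (Y * Y)%type) (fun p => (p.1 : nat -> nat) m).
    by move=> n; exact: (fstB [set y | y m = n] (@BN_coord m n)).
  have b2 m : bnat (@borel (Y * Y)%type) (fun p => (p.2 : nat -> nat) m).
    by move=> n; exact: (sndB [set y | y m = n] (@BN_coord m n)).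
  have bF1 c m : bnat (@borel (Y * Y)%type) (fun p => F c p.1 m).
    by move=> n; apply: (fstB [set y | F c y m = n]); exact: bF.
  have bF2 c m : bnat (@borel (Y * Y)%type) (fun p => F c p.2 m).
    by move=> n; apply: (sndB [set y | F c y m = n]); exact: bF.
  apply: (bor_or SY2); first exact: (eqB (fun p => p.1) (fun p => p.2)).
  have ZB1 : @borel (Y * Y)%type [set p | Z p.1 p.1].
    apply: (bor_ext _ (bor_ex SY2 (I := nat) (P := fun c p => Dm c p.1 /\ F c p.1 = p.1) _)).
      by move=> p; split => [[c [? ?]]|[c ? ?]]; exists c.
    move=> c; apply: (bor_and SY2); first exact: (fstB (Dm _)).
    exact: (eqB (fun p => F c p.1) (fun p => p.1)).
  have ZB2 : @borel (Y * Y)%type [set p | Z p.2 p.2].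
    apply: (bor_ext _ (bor_ex SY2 (I := nat) (P := fun c p => Dm c p.2 /\ F c p.2 = p.2) _)).
      by move=> p; split => [[c [? ?]]|[c ? ?]]; exists c.
    move=> c; apply: (bor_and SY2); first exact: (sndB (Dm _)).
    exact: (eqB (fun p => F c p.2) (fun p => p.2)).
  have ZZ : @borel (Y * Y)%type [set p | Z p.1 = Z p.2].
    have Z1 : @borel (Y * Y)%type [set p | forall c, Dm c p.1 ->
        exists c', Dm c' p.2 /\ F c' p.2 = F c p.1].
      apply: (bor_all SY2) => c; apply: (bor_imp SY2); first exact: (fstB (Dm c)).
      apply: (bor_ex SY2) => c'; apply: (bor_and SY2); first exact: (sndB (Dm c')).
      exact: (eqB (fun p => F c' p.2) (fun p => F c p.1)).
    have Z2 : @borel (Y * Y)%type [set p | forall c, Dm c p.2 ->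
        exists c', Dm c' p.1 /\ F c' p.1 = F c p.2].
      apply: (bor_all SY2) => c; apply: (bor_imp SY2); first exact: (sndB (Dm c)).
      apply: (bor_ex SY2) => c'; apply: (bor_and SY2); first exact: (fstB (Dm c')).
      exact: (eqB (fun p => F c' p.1) (fun p => F c p.2)).
    apply: (bor_ext _ (bor_and SY2 Z1 Z2)) => p; split => [[h1 h2]|ZE'].
      apply/seteqP; split => z [c Dc <-].
        by have [c' [? ?]] := h1 c Dc; exists c'.
      by have [c' [? ?]] := h2 c Dc; exists c'.
    split => c Dc.
      have : Z p.2 (F c p.1) by rewrite -ZE'; exists c.
      by move=> [c' ? ?]; exists c'.
    have : Z p.1 (F c p.2) by rewrite ZE'; exists c.
    by move=> [c' ? ?]; exists c'.
  apply: (bor_ext _ (bor_and SY2 ZZ (bor_and SY2 ZB1 ZB2))) => p.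
  by split => [[? [? ?]]|[? ? ?]].
(* A point [z] other than [y] in the class lies in [Z z = Z y], hence is some [F c y]. *)
- move=> y; pose e (n : nat) : Y := if n is c.+1 then F c y else y.
  apply: (@sub_countable _ _ _ (range e)); last exact: card_image_le.
  apply: subset_card_le => z [<-|[Zyz _ Zz]]; first by exists 0%N.
  by move: Zz; rewrite -Zyz => -[c _ <-]; exists c.+1.
- apply: (@borel_min Y [set A | borel (f @^-1` A)]) => [|A oA].
    split => [A bA|A bA|] /=; [exact: (bor_not SS)|exact: (bor_ex SS)|exact: (sa_set0 SS)].
  apply: (BN_preimage SS bf).
  exact: (@prefix_open_mem R _ _ id_inj BN BN_sigma BN_coord A oA).
- move=> x x'; rewrite ZE; split => [h|[h|[]//]]; last by rewrite h.
  by right; split.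
Qed.

End Conclusions.

(** * The space of models is standard Borel *)

Section PointwiseTopology.

Lemma ptws_cvg_coord (I : Type) (V : topologicalType) (F : set_system (I -> V))
    (f : I -> V) : Filter F -> (forall i, (fun g => g i) @ F --> f i) ->
  F --> (f : {ptws I -> V}).
Proof.
move=> FF h; apply/cvg_sup => i A; case=> _ /= [] [W oW <- /= Wx sWU].
apply: filterS sWU _; apply: h; exact: open_nbhs_nbhs.
Qed.

Lemma ptws_proj_continuous (I : Type) (V : topologicalType) (i : I) :
  continuous (fun f : {ptws I -> V} => f i).
Proof.
move=> f U; rewrite nbhsE /= => -[W [oW Wf] WU].
have : nbhs (f : {ptws I -> V}) --> (f : {ptws I -> V}) by exact: cvg_id.
move/cvg_sup => /(_ i).
move=> h; apply: (h ((fun g : I -> V => g i) @^-1` U)).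
eexists; split; first (eexists; first exact: oW; reflexivity); first exact: Wf.
by move=> g /WU.
Qed.

Lemma set_type_nbhs (X : topologicalType) (A : set X) (x : set_type A) (U : set (set_type A)) :
  nbhs x U -> exists2 W, nbhs (set_val x) W & set_val @^-1` W `<=` U.
Proof.
case=> _ /= [] [W oW <- /= Wx sWU]; exists W => //.
exact: open_nbhs_nbhs.
Qed.

Lemma set_val_continuous (X : topologicalType) (A : set X) :
  continuous (set_val : set_type A -> X).
Proof. exact: initial_continuous. Qed.

End PointwiseTopology.

Section RealFunctions.
Context (R : realType) (X : Type) (S : set (set X)).
Hypothesis SS : sigma_alg S.

Definition rmeas (f : X -> R) := forall q : rat, S [set x | f x < ratr q].

Lemma rmeas_ext f g : f =1 g -> rmeas f -> rmeas g.
Proof. by move=> /funext->. Qed.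

Lemma rmeas_lt f g : rmeas f -> rmeas g -> S [set x | f x < g x].
Proof.
move=> mf mg; apply: (bor_ext _ (bor_ex SS (fun q => bor_and SS (mf q) (bor_not SS (mg q))))) => x.
split => [[q [fq /negP]]|/rat_between[q [fq qg]]].
  by rewrite -leNgt; exact: lt_le_trans.
by exists q; split => //; apply/negP; rewrite -leNgt ltW.
Qed.

Lemma rmeas_const c : rmeas (fun=> c).
Proof. by move=> q; exact: bor_const. Qed.

Lemma rmeas_le f g : rmeas f -> rmeas g -> S [set x | f x <= g x].
Proof.
move=> mf mg; apply: (bor_ext _ (bor_not SS (rmeas_lt mg mf))) => x.
by split => [/negP|h]; [rewrite -leNgt|apply/negP; rewrite -leNgt].
Qed.

Lemma rmeas_eq f g : rmeas f -> rmeas g -> S [set x | f x = g x].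
Proof.
move=> mf mg; apply: (bor_ext _ (bor_and SS (rmeas_le mf mg) (rmeas_le mg mf))) => x.
split => [[? ?]|->]; last by rewrite lexx.
by apply/eqP; rewrite eq_le; apply/andP.
Qed.

Lemma rmeas_add f g : rmeas f -> rmeas g -> rmeas (fun x => f x + g x).
Proof.
move=> mf mg q.
apply: (bor_ext _ (bor_ex SS (fun r : rat => bor_and SS (mf r) (mg (q - r))))) => x.
split => [[r [fr]]|]; first by rewrite rmorphB /=; lra.
rewrite -ltrBrDr => /rat_between[r [fr rg]]; exists r; split => //.
by rewrite rmorphB /=; lra.
Qed.

Lemma rmeas_opp f : rmeas f -> rmeas (fun x => - f x).
Proof.
move=> mf q; apply: (bor_ext _ (rmeas_lt (rmeas_const (- ratr q)) mf)) => x.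
by rewrite ltrNl.
Qed.

Lemma rmeas_scale r f : rmeas f -> rmeas (fun x => ratr r * f x).
Proof.
move=> mf q; have [r0|r0|r0] := ltgtP r 0.
- have r0' : ratr r < 0 :> R by rewrite ltrq0.
  apply: (bor_ext _ (rmeas_lt (rmeas_const (ratr q / ratr r)) mf)) => x.
  by rewrite ltr_ndivrMr// mulrC.
- have r0' : 0 < ratr r :> R by rewrite ltr0q.
  apply: (bor_ext _ (mf (q / r))) => x.
  by rewrite fmorph_div ltr_pdivlMr// mulrC.
- by rewrite r0; apply: (bor_ext _ (rmeas_const 0 q)) => x; rewrite rmorph0 mul0r.
Qed.

Lemma rmeas_max f g : rmeas f -> rmeas g -> rmeas (fun x => Num.max (f x) (g x)).
Proof.
move=> mf mg q; apply: (bor_ext _ (bor_and SS (mf q) (mg q))) => x.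
by rewrite gt_max; split => [[-> ->]|/andP].
Qed.

Lemma rmeas_min f g : rmeas f -> rmeas g -> rmeas (fun x => Num.min (f x) (g x)).
Proof.
move=> mf mg q; apply: (bor_ext _ (bor_or SS (mf q) (mg q))) => x.
by rewrite gt_min; split => [[]->|/orP]; rewrite ?orbT.
Qed.

Lemma rmeas_inf (f : nat -> X -> R) lo : (forall i x, lo <= f i x) ->
  (forall i, rmeas (f i)) -> rmeas (fun x => inf (range (f^~ x))).
Proof.
move=> flo mf q; apply: (bor_ext _ (bor_ex SS (fun i => mf i q))) => x.
have I0 : inhabited nat by exists; exact: 0%N.
split => [[i]|/(inf_range_lt I0)//].
by apply: le_lt_trans; apply: (@ge_inf_range _ _ (f^~ x) lo).
Qed.

Lemma rmeas_sup (f : nat -> X -> R) hi : (forall i x, f i x <= hi) ->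
  (forall i, rmeas (f i)) -> rmeas (fun x => sup (range (f^~ x))).
Proof.
move=> fhi mf.
have I0 : inhabited nat by exists; exact: 0%N.
apply: (@rmeas_ext (fun x => - inf (range (fun i => - f i x)))).
  move=> x; apply/eqP; rewrite eq_le; apply/andP; split.
    rewrite lerNl; apply: inf_range_ge => // i; rewrite lerN2.
    exact: (@le_sup_range _ _ (f^~ x) hi).
  apply: sup_range_le => // i; rewrite lerNr.
  by apply: (@ge_inf_range _ _ (fun i => - f i x) (- hi)) => k; rewrite lerN2.
apply: rmeas_opp; apply: (@rmeas_inf _ (- hi)) => [i x|i]; first by rewrite lerN2.
exact: rmeas_opp.
Qed.

End RealFunctions.

(** * Real sequences as a closed subset of Baire space *)

Section RealSequences.
Context (R : realType).

Definition nth_rat (n : nat) : rat := odflt 0 (unpickle n).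

Lemma nth_rat_pickle q : nth_rat (pickle q) = q.
Proof. by rewrite /nth_rat pickleK. Qed.

(** A Dedekind cut, with the witnesses of its being open, nonempty and proper. *)
Definition cut_code (r : R) (a b : nat) : nat :=
  match a with
  | 0 => nat_of_bool (r < ratr (nth_rat b))
  | 1 => least (fun m => [/\ r < ratr (nth_rat b), r < ratr (nth_rat m) & nth_rat m < nth_rat b])
  | 2 => least (fun m => r < ratr (nth_rat m))
  | _ => least (fun m => ~~ (r < ratr (nth_rat m)))
  end.

Definition real_seq_code (om : nat -> R) : nat -> nat :=
  flat (fun i => flat (cut_code (om i))).

Lemma real_seq_codeE om i a b :
  real_seq_code om (pickle (i, pickle (a, b))) = cut_code (om i) a b.
Proof. by rewrite /real_seq_code !flatE. Qed.

Lemma rat_gt_ex (r : R) : exists m, r < ratr (nth_rat m).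
Proof.
have : r < r + 1 by rewrite ltrDl.
by move=> /rat_between[q [rq _]]; exists (pickle q); rewrite nth_rat_pickle.
Qed.

Lemma rat_le_ex (r : R) : exists m, ~~ (r < ratr (nth_rat m)).
Proof.
have : r - 1 < r by rewrite ltrBlDr ltrDl.
move=> /rat_between[q [_ rq]]; exists (pickle q); rewrite nth_rat_pickle.
by rewrite -leNgt ltW.
Qed.

(** A pointwise limit of open upper cuts of rationals may be empty, contain all rationals, or
    include its endpoint. The recorded least witnesses exclude all three. *)
Lemma cut_code_closed (w : nat -> nat -> nat) :
  (forall s : seq (nat * nat), exists r : R, forall ab, ab \in s ->
     cut_code r ab.1 ab.2 = w ab.1 ab.2) ->
  exists r : R, forall a b, cut_code r a b = w a b.
Proof.
move=> h; pose bit m := w 0%N m == 1%N.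
have bitE r m : cut_code r 0 m = w 0%N m -> (r < ratr (nth_rat m)) = bit m.
  by rewrite /bit => <- /=; case: (_ < _).
pose D : set R := [set ratr (nth_rat m) | m in [set m | bit m]].
pose r := inf D.
have [m2 b2] : exists m, bit m.
  exists (w 2%N 0%N); have [s sP] := h [:: (2%N, 0%N); (0%N, w 2%N 0%N)].
  have := sP (2%N, 0%N); rewrite !inE eqxx => /(_ isT)/= e2.
  have := sP (0%N, w 2%N 0%N); rewrite !inE eqxx orbT => /(_ isT)/bitE <-.
  have [m mP] := rat_gt_ex s.
  by rewrite -e2; have [] := @leastP (fun m => s < ratr (nth_rat m)) m mP.
have mono m m' : bit m -> ~~ bit m' -> nth_rat m' < nth_rat m.
  move=> bm bm'; have [s sP] := h [:: (0%N, m); (0%N, m')].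
  have := sP (0%N, m); rewrite !inE eqxx => /(_ isT)/bitE; rewrite bm => sm.
  have := sP (0%N, m'); rewrite !inE eqxx orbT => /(_ isT)/bitE.
  rewrite (negbTE bm') => /negbT; rewrite -leNgt => sm'.
  by rewrite -(ltr_rat R); exact: le_lt_trans sm' _.
have [m3 b3] : exists m, ~~ bit m.
  exists (w 3%N 0%N); have [s sP] := h [:: (3%N, 0%N); (0%N, w 3%N 0%N)].
  have := sP (3%N, 0%N); rewrite !inE eqxx => /(_ isT)/= e2.
  have := sP (0%N, w 3%N 0%N); rewrite !inE eqxx orbT => /(_ isT)/bitE <-.
  have [m mP] := rat_le_ex s.
  by rewrite -e2; have [] := @leastP (fun m => ~~ (s < ratr (nth_rat m))) m mP.
have Dlb : has_inf D.
  split; first by exists (ratr (nth_rat m2)), m2.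
  by exists (ratr (nth_rat m3)) => _ [m bm <-]; rewrite ler_rat ltW// mono.
(* The infimum [r] is not attained on the cut: row [1] provides a smaller rational whose bit is also
   set. *)
have rbit m : (r < ratr (nth_rat m)) = bit m.
  have [bm|bm] := boolP (bit m); last first.
    apply/negbTE; rewrite -leNgt; apply: lb_le_inf; first by case: Dlb.
    by move=> _ [m' bm' <-]; rewrite ler_rat ltW// mono.
  pose m' := w 1%N m; have [s sP] := h [:: (1%N, m); (0%N, m); (0%N, m')].
  have := sP (1%N, m); rewrite !inE eqxx => /(_ isT)/= e1.
  have := sP (0%N, m); rewrite !inE eqxx orbT => /(_ isT)/bitE; rewrite bm => sm.
  have := sP (0%N, m'); rewrite !inE eqxx !orbT => /(_ isT)/bitE sm'.
  have /rat_between[q [sq qm]] := sm.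
  have [] := @leastP (fun k => [/\ s < ratr (nth_rat m), s < ratr (nth_rat k)
    & nth_rat k < nth_rat m]) (pickle q).
    by split => //; rewrite nth_rat_pickle// -(ltr_rat R).
  rewrite e1 -/m' => -[_ sm'2 m'm] _.
  apply: (@le_lt_trans _ _ (ratr (nth_rat m'))); last by rewrite ltr_rat.
  by apply: ge_inf; [case: Dlb|exists m' => //=; rewrite -sm'].
have same s m : cut_code s 0 m = w 0%N m -> (s < ratr (nth_rat m)) = (r < ratr (nth_rat m)).
  by move=> /bitE ->; rewrite rbit.
exists r; case=> [|[|[|a]]] b.
- have [s sP] := h [:: (0%N, b)]; have := sP (0%N, b); rewrite inE eqxx => /(_ isT) sb.
  by rewrite -sb /= (same s b sb).
(* If [s] and [r] have the same bits up to the recorded witness, then that witness is least for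
   both. *)
- have [s sP] := h ((1%N, b) :: (0%N, b) :: [seq (0%N, m) | m <- iota 0 (w 1%N b).+1]).
  have e1 := sP (1%N, b); rewrite !inE eqxx in e1; move: (e1 isT) => /= {}e1.
  have eb : (s < ratr (nth_rat b)) = (r < ratr (nth_rat b)).
    by apply: same; apply: (sP (0%N, b)); rewrite !inE eqxx orbT.
  have em m : (m <= w 1%N b)%N -> (s < ratr (nth_rat m)) = (r < ratr (nth_rat m)).
    move=> mw; apply: same; apply: (sP (0%N, m)); rewrite 2!in_cons; apply/orP; right.
    by apply/orP; right; apply/mapP; exists m; rewrite ?mem_iota.
  have [rb|rb] : r < ratr (nth_rat b) \/ ~~ (r < ratr (nth_rat b)).
      by case: (_ < _); [left|right].
    2: {
    have nr m : ~ [/\ r < ratr (nth_rat b), r < ratr (nth_rat m) & nth_rat m < nth_rat b].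
      by case=> + _ _; rewrite (negbTE rb).
    have ns m : ~ [/\ s < ratr (nth_rat b), s < ratr (nth_rat m) & nth_rat m < nth_rat b].
      by case=> + _ _; rewrite eb (negbTE rb).
    by rewrite -e1 /= !least_none. }
  rewrite -eb in rb; have /rat_between[q [sq qm]] := rb.
  have := @leastP (fun k => [/\ s < ratr (nth_rat b), s < ratr (nth_rat k)
    & nth_rat k < nth_rat b]) (pickle q).
  case; first by split => //; rewrite nth_rat_pickle// -(ltr_rat R).
  rewrite e1 => -[_ sw wb] wmin; rewrite /=; apply: least_eq.
    by split => //; rewrite -?eb -?em.
  move=> m mw [h1 h2 h3]; have := wmin m; rewrite leqNgt mw => /(_ _)/negP; apply=> //.
  by split => //; rewrite em// ltnW.
- have [s sP] := h ((2%N, b) :: [seq (0%N, m) | m <- iota 0 (w 2%N b).+1]).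
  have e1 := sP (2%N, b); rewrite !inE eqxx in e1; move: (e1 isT) => /= {}e1.
  have em m : (m <= w 2%N b)%N -> (s < ratr (nth_rat m)) = (r < ratr (nth_rat m)).
    move=> mw; apply: same; apply: (sP (0%N, m)); rewrite in_cons; apply/orP; right.
    by apply/mapP; exists m; rewrite ?mem_iota.
  have [m0 m0P] := rat_gt_ex s.
  have := @leastP (fun m => s < ratr (nth_rat m)) m0 m0P; rewrite e1 => -[sw wmin].
  rewrite /=; apply: least_eq; first by rewrite -em.
  by move=> m mw; rewrite -em ?(ltnW mw)// => /wmin; rewrite leqNgt mw.
- have [s sP] := h ((a.+3, b) :: [seq (0%N, m) | m <- iota 0 (w a.+3 b).+1]).
  have e1 := sP (a.+3, b); rewrite !inE eqxx in e1; move: (e1 isT) => /= {}e1.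
  have em m : (m <= w a.+3 b)%N -> (s < ratr (nth_rat m)) = (r < ratr (nth_rat m)).
    move=> mw; apply: same; apply: (sP (0%N, m)); rewrite in_cons; apply/orP; right.
    by apply/mapP; exists m; rewrite ?mem_iota.
  have [m0 m0P] := rat_le_ex s.
  have := @leastP (fun m => ~~ (s < ratr (nth_rat m))) m0 m0P; rewrite e1 => -[sw wmin].
  rewrite /=; apply: least_eq; first by rewrite -em.
  by move=> m mw; rewrite -em ?(ltnW mw)// => /wmin; rewrite leqNgt mw.
Qed.

Lemma cut_code_inj r s : (forall b, cut_code r 0 b = cut_code s 0 b) -> r = s.
Proof.
move=> rs; have h q : (r < ratr q) = (s < ratr q).
  by have := rs (pickle q); rewrite /= nth_rat_pickle; do 2 case: (_ < _).
apply/eqP; rewrite eq_le !leNgt; apply/andP; split; apply/negP => /rat_between[q [q1 q2]].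
  by have := h q; rewrite q1; apply/negP; rewrite -leNgt ltW.
by have := h q; rewrite q1 => /esym; apply/negP; rewrite -leNgt ltW.
Qed.

(** The Borel structure of the product of countably many lines. *)
Definition RN : set (set (nat -> R)) := fun A => forall C : set (set (nat -> R)),
  sigma_alg C -> (forall i, rmeas C (@^~ i)) -> C A.

Lemma RN_sigma : sigma_alg RN.
Proof.
split.
- by move=> A BA C SC gC; apply: sa_not => //; exact: BA.
- by move=> A BA C SC gC; apply: sa_union => // n; exact: BA.
- by move=> C SC gC; exact: sa_set0.
Qed.

Lemma RN_coord i : rmeas RN (@^~ i).
Proof. by move=> q C SC gC; exact: gC. Qed.

Lemma real_seq_code_standard : standard RN real_seq_code.
Proof.
split.
- move=> w h.
  have hs (s : seq (nat * (nat * nat))) : exists om : nat -> R, forall t, t \in s ->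
      cut_code (om t.1) t.2.1 t.2.2 = w (pickle (t.1, pickle t.2)).
    have [om omP] := h (\max_(t <- s) (pickle (t.1, pickle t.2)).+1)%N.
    exists om => -[i [a b]] ts; rewrite -real_seq_codeE; apply: omP.
    exact: (@leq_bigmax_seq _ _ xpredT (fun t => (pickle (t.1, pickle t.2)).+1) (i, (a, b))).
  have /choice[om omP] : forall i : nat, exists r : R, forall a b : nat,
      cut_code r a b = w (pickle (i, pickle (a, b))).
    move=> i; apply: (@cut_code_closed (fun a b => w (pickle (i, pickle (a, b))))) => s.
    have [om omP] := hs [seq (i, ab) | ab <- s]; exists (om i) => -[a b] abs.
    by apply: (omP (i, (a, b))); apply/mapP; exists (a, b).
  have pre0 m : exists om : nat -> R, real_seq_code om m = w m.
    by have [om' /(_ m (leqnn _))] := h m.+1; exists om'.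
  exists om; apply: flat_cases => [i b|m mN]; last first.
    by have [om' <-] := pre0 m; rewrite /real_seq_code /flat mN.
  symmetry; apply: (flat_cases (w := fun b => w (pickle (i, b)))) => [a c|m mN] //.
  have [om' <-] := pre0 (pickle (i, m)).
  by rewrite /real_seq_code flatE /flat mN.
- move=> om om' oo; apply/funext => i; apply: cut_code_inj => b.
  by rewrite -!real_seq_codeE oo.
- move=> m; apply: (bnat_flat RN_sigma) => i b; apply: (bnat_flat RN_sigma) => a c.
  have mb k : RN [set om | om i < ratr (nth_rat k)] by exact: RN_coord.
  rewrite /cut_code; case: a => [|[|[|a]]].
  + move=> n; case: n => [|[|n]].
    * apply: (bor_ext _ (bor_not RN_sigma (mb c))) => om.
      by case: (_ < _); split => //; case.
    * by apply: (bor_ext _ (mb c)) => om; case: (_ < _).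
    * by apply: (bor_ext _ (bor_const RN_sigma False)) => om; case: (_ < _).
  + apply: (bnat_least RN_sigma (P := fun m om => [/\ om i < ratr (nth_rat c),
      om i < ratr (nth_rat m) & nth_rat m < nth_rat c])) => k.
    apply: (bor_ext _ (bor_and RN_sigma (mb c) (bor_and RN_sigma (mb k)
      (bor_const RN_sigma (nth_rat k < nth_rat c))))) => om.
    by split => [[? []]|[]].
  + by apply: (bnat_least RN_sigma (P := fun m om => om i < ratr (nth_rat m))).
  + apply: (bnat_least RN_sigma (P := fun m om => ~~ (om i < ratr (nth_rat m)))) => k.
    by apply: (bor_ext _ (bor_not RN_sigma (mb k))) => om; split => /negP.
Qed.

Lemma real_seq_code_gen (C : set (set (nat -> R))) : sigma_alg C ->
  (forall m, bnat C (real_seq_code^~ m)) -> RN `<=` C.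
Proof.
move=> SC bC A; apply => // i q.
apply: (bor_ext _ (bC (pickle (i, pickle (0%N, pickle q))) 1%N)) => om.
by rewrite real_seq_codeE /= nth_rat_pickle; case: (_ < _).
Qed.

End RealSequences.

(** * The codes of models form a standard Borel space *)

Section CodeSpace.
Context (R : realType) (L : signature R).
Variables (F : formulas L) (T : theory L).
Arguments F : clear implicits.
Hypotheses (fragF : fragment F) (TF : theory_in F T).
Let FF := fragment_fclosed fragF.
Implicit Type M : structure L.
Local Notation X := (set_type (Mod F T)).

Lemma dense_inf M (c : nat -> M) n (p : preformula L n.+1) (a : nat -> M) :
  dense_seq c -> is_formula p ->
  evs (Inf p) a = inf (range (fun j => evs p (scons_seq (c j) a))).
Proof.
move=> dc fp; rewrite evs_inf.
have [D [lo [hi [_ h]]]] := eval_respects fp.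
have flo (b : nat -> M) : lo <= evs p b.
  by have [/andP[]] := h M (@initial_segment M b n.+1) (@initial_segment M b n.+1).
have I0 : inhabited nat by exists; exact: 0%N.
apply/eqP; rewrite eq_le; apply/andP; split.
  apply: inf_range_ge => // j.
  exact: (@ge_inf_range _ _ (fun y => evs p (scons_seq y a)) lo (c j)).
apply: inf_range_ge => [|y]; first by exists; exact: (a 0%N).
apply/ler_addgt0Pr => e e0.
have [d d0 dP] := evs_cont fp e0; have [j jP] := dc y d d0.
apply: (@le_trans _ _ (evs p (scons_seq (c j) a))).
  exact: (@ge_inf_range _ _ (fun j => evs p (scons_seq (c j) a)) lo j).
have /dP : close n.+1 d (scons_seq (c j) a) (scons_seq y a).
  by case=> [|i] _ /=; [rewrite metric_sym|rewrite mdistxx].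
by rewrite ltr_distl => /andP[_ /ltW].
Qed.

Lemma dense_sup M (c : nat -> M) n (p : preformula L n.+1) (a : nat -> M) :
  dense_seq c -> is_formula p ->
  evs (Sup p) a = sup (range (fun j => evs p (scons_seq (c j) a))).
Proof.
have inf_opp (I : Type) (f : I -> R) : inf (range (fun i => - f i)) = - sup (range f).
  rewrite /inf; congr (- sup _); apply/seteqP; split => [_ [_ [j _ <-] <-]|_ [j _ <-]].
    by exists j => //; rewrite opprK.
  by exists (- f j); [exists j|rewrite opprK].
have negE b : evs (Scale (-1) p) b = - evs p b by rewrite /evs/= rmorphN1 mulN1r.
move=> dc fp; have := dense_inf a dc (p := Scale (-1) p) fp.
rewrite evs_inf evs_sup.
under eq_inf_range do rewrite negE.
under [in RHS]eq_inf_range do rewrite negE.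
by rewrite !inf_opp => /oppr_inj.
Qed.

Lemma coded_tp (xi : X) : omega_tp F (coded_seq fragF xi) = set_val xi.
Proof.
apply/funext => -[n [phi Fphi]]; rewrite /omega_tp /=.
exact: (coded_evs fragF xi Fphi).
Qed.

Lemma seq_witnessed M (c : nat -> M) : dense_seq c -> witnessed (omega_tp F c).
Proof.
move=> dc.
have I0 : inhabited nat by exists; exact: 0%N.
have cE n (p : preformula L n.+1) : F n.+1 p -> forall j,
    val_at (omega_tp F c) p (scons_seq j id) = evs p (scons_seq (c j) c).
  by move=> Fp j; rewrite (val_at_tp fragF)//; congr evs; apply/funext => -[].
split=> n p Fq e e0; have := fragment_subformulas fragF Fq; rewrite /= => Fp;
  have fp := fragment_formula fragF Fq.
- rewrite xval_tp// (dense_inf c dc fp).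
  have /(inf_range_lt I0)[j jP] : inf (range (fun j => evs p (scons_seq (c j) c))) <
    inf (range (fun j => evs p (scons_seq (c j) c))) + e by rewrite ltrDl.
  by exists j; rewrite cE.
- rewrite xval_tp// (dense_sup c dc fp).
  have /(sup_range_gt I0)[j jP] : sup (range (fun j => evs p (scons_seq (c j) c))) - e <
    sup (range (fun j => evs p (scons_seq (c j) c))) by rewrite ltrBlDr ltrDl.
  by exists j; rewrite cE.
- have /(inf_range_lt I0)[i iP] : inf (range (fun i => evs (p i) c)) <
    inf (range (fun i => evs (p i) c)) + e by rewrite ltrDl.
  by exists i; rewrite !xval_tp.
- have /(sup_range_gt I0)[i iP] : sup (range (fun i => evs (p i) c)) - e <
    sup (range (fun i => evs (p i) c)) by rewrite ltrBlDr ltrDl.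
  by exists i; rewrite !xval_tp.
Qed.

(** The definition of [Mod] quantifies over structures. Here this quantifier survives only in
    approximability, where it speaks of basic open sets. *)
Lemma Mod_iff (xi : omega_type F) : Mod F T xi <-> approximable T xi /\ witnessed xi.
Proof.
split=> [Mxi|[ax wx]].
  pose x : X := exist _ xi (mem_set Mxi).
  split=> [s k e e0|].
    exists (coded_structure fragF x), (coded_seq fragF x); split; first exact: coded_models.
    by move=> j _; rewrite coded_tp subrr normr0.
  by rewrite -[xi]/(set_val x) -coded_tp; apply: seq_witnessed; exact: coded_dense.
have [M [a [MT da axi]]] := realized_exists fragF TF ax wx.
by exists M, a; split => //; exact: dense_tarski_vaught.
Qed.

Lemma formula_enum : exists idx : nat -> formula_index F, forall phi, exists i, idx i = phi.
Proof.
have enum n : exists e : nat -> preformula L n, range e = F n.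
  apply: (countable_enum (d0 := One L n)); first exact: fragment_countable.
  exact: fragment_one.
pose e n := projT1 (cid (enum n)).
have eP n : range (e n) = F n := projT2 (cid (enum n)).
have eF n m : F n (e n m) by rewrite -eP; exists m.
pose idx i : formula_index F := if pickle_inv i is Some (n, m)
  then existT _ n (exist _ (e n m) (eF n m))
  else existT _ 0%N (exist _ (e 0%N 0%N) (eF 0%N 0%N)).
exists idx => -[n [phi Fphi]]; have [m _ em] : range (e n) phi by rewrite eP.
exists (pickle (n, m)); rewrite /idx pickleK_inv; congr existT.
by subst phi; congr exist; exact: Prop_irrelevance.
Qed.

Definition idx := projT1 (cid formula_enum).
Lemma idxP phi : exists i, idx i = phi.
Proof. exact: (projT2 (cid formula_enum)). Qed.
Definition rank phi := projT1 (cid (idxP phi)).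
Lemma rankK phi : idx (rank phi) = phi.
Proof. exact: (projT2 (cid (idxP phi))). Qed.

Definition coords (xi : omega_type F) : nat -> R := fun i => xi (idx i).
Definition of_coords (om : nat -> R) : omega_type F := fun phi => om (rank phi).

Lemma coordsK xi : of_coords (coords xi) = xi.
Proof. by apply/funext => phi; rewrite /of_coords /coords rankK. Qed.

Definition in_box (s : seq (nat * (rat * rat))) (om : nat -> R) :=
  forall t, t \in s -> ratr t.2.1 < om t.1 < ratr t.2.2.

Lemma bor_box (Y : Type) (C : set (set Y)) (f : Y -> nat -> R) s : sigma_alg C ->
  (forall i, rmeas C (fun y => f y i)) -> C [set y | in_box s (f y)].
Proof.
move=> SC mf; apply: (bor_all SC) => t; apply: (bor_imp SC); first exact: bor_const.
apply: (bor_ext _ (bor_and SC (rmeas_lt SC (rmeas_const SC (ratr t.2.1)) (mf t.1)) (mf t.1 t.2.2))).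
by move=> y; split => /andP.
Qed.

(** There are countably many rational boxes, and the existence of a model in a box does not depend
    on [om]; this makes the condition Borel. *)
Definition box_approximable (om : nat -> R) := forall s, in_box s om ->
  exists M (a : nat -> M), models M T /\ in_box s (coords (omega_tp F a)).

Lemma box_approximableP xi : approximable T xi <-> box_approximable (coords xi).
Proof.
split=> [ax s sx|bx s k e e0].
  have [e e0 eP] : exists2 e : R, 0 < e & forall t, t \in s ->
      ratr t.2.1 + e <= coords xi t.1 /\ coords xi t.1 + e <= ratr t.2.2.
    elim: s sx => [|t s IH] sx; first by exists 1.
    have [|e e0 eP] := IH; first by move=> u us; apply: sx; rewrite inE us orbT.
    have /andP[t1 t2] := sx t (mem_head _ _).
    exists (Num.min e (Num.min (coords xi t.1 - ratr t.2.1) (ratr t.2.2 - coords xi t.1))).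
      by rewrite !lt_min e0 !subr_gt0 t1.
    move=> u; set m := Num.min _ _; rewrite inE => /orP[/eqP->|/eP[u1 u2]].
      have : m <= coords xi t.1 - ratr t.2.1 by rewrite !ge_min lexx !orbT.
      have : m <= ratr t.2.2 - coords xi t.1 by rewrite !ge_min lexx !orbT.
      by split; lra.
    have : m <= e by rewrite ge_min lexx.
    by split; lra.
  have [M [a [MT aP]]] := ax (fun j => idx (nth 0%N [seq t.1 | t <- s] j)) (size s) e e0.
  exists M, a; split => // t ts; have := aP (index t s); rewrite index_mem => /(_ ts).
  rewrite (nth_map (0%N, (0, 0))) ?index_mem// nth_index// -/(coords xi t.1) ltr_distl.
  rewrite /coords /= in eP *; case: (eP t ts) => t1 t2.
  by move=> /andP[? ?]; apply/andP; split; lra.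
have hq j : exists q : rat * rat,
   (ratr q.1 < xi (s j) < ratr q.2) /\ (xi (s j) - e < ratr q.1 /\ ratr q.2 < xi (s j) + e).
  have [q1 [q11 q12]] : exists q : rat, xi (s j) - e < ratr q /\ ratr q < xi (s j).
    by apply: rat_between; rewrite ltrBlDr ltrDl.
  have [q2 [q21 q22]] : exists q : rat, xi (s j) < ratr q /\ ratr q < xi (s j) + e.
    by apply: rat_between; rewrite ltrDl.
  by exists (q1, q2); rewrite q12 q21.
have /choice[q qP] := hq.
have [|M [a [MT aP]]] := bx [seq (rank (s j), q j) | j <- iota 0 k].
  by move=> _ /mapP[j _ ->] /=; rewrite /coords rankK; case: (qP j).
exists M, a; split => // j jk.
have := aP (rank (s j), q j); rewrite /coords /= rankK.
have -> : (rank (s j), q j) \in [seq (rank (s j), q j) | j <- iota 0 k].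
  by apply/mapP; exists j; rewrite ?mem_iota.
move=> /(_ isT)/andP[a1 a2]; have [_ [q1 q2]] := qP j.
by rewrite ltr_distl; apply/andP; split; lra.
Qed.

Definition witness_at (xi : omega_type F) n (phi : preformula L n) : Prop :=
  match phi with
  | Inf _ p => forall e : rat, 0 < ratr e :> R ->
      exists j, val_at xi p (scons_seq j id) < xval xi (Inf p) + ratr e
  | Sup _ p => forall e : rat, 0 < ratr e :> R ->
      exists j, xval xi (Sup p) - ratr e < val_at xi p (scons_seq j id)
  | CInf _ ps => forall e : rat, 0 < ratr e :> R ->
      exists i, xval xi (ps i) < xval xi (CInf ps) + ratr e
  | CSup _ ps => forall e : rat, 0 < ratr e :> R ->
      exists i, xval xi (CSup ps) - ratr e < xval xi (ps i)
  | _ => True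
  end.

Lemma witness_atP xi :
  witnessed xi <-> forall i, witness_at xi (sval (projT2 (idx i))).
Proof.
split=> [[w1 w2 w3 w4] i|h].
  case: (idx i) => n [phi Fphi] /=; case: phi Fphi => //= {}n p Fp e e0;
    [exact: w2|exact: w1|exact: w4|exact: w3].
have {}h n phi : F n phi -> witness_at xi phi.
  by move=> Fphi; have := h (rank (existT _ n (exist _ phi Fphi))); rewrite rankK.
split => n p Fp e e0; have [q [q0 qe]] := rat_between e0;
  have [j jP] := h _ _ Fp q q0; exists j; lra.
Qed.

Lemma rmeas_xval n (phi : preformula L n) :
  rmeas (@RN R) (fun om => xval (of_coords om) phi).
Proof.
rewrite /xval; case: pselect => Fphi; last exact: (rmeas_const (@RN_sigma R)).
exact: RN_coord.
Qed.

Lemma RN_Mod : @RN R [set om | Mod F T (of_coords om)].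
Proof.
have SS := @RN_sigma R.
suff : RN [set om | box_approximable (fun i => om (rank (idx i))) /\
    forall i, witness_at (of_coords om) (sval (projT2 (idx i)))].
  by apply: bor_ext => om; rewrite Mod_iff box_approximableP witness_atP.
apply: (bor_and SS).
  apply: (bor_all SS) => s; apply: (bor_imp SS); last exact: bor_const.
  apply: (bor_box (f := fun om i => om (rank (idx i))) s SS) => i.
  exact: RN_coord.
apply: (bor_all SS) => i; case: (idx i) => n [phi Fphi] /= {i}.
have wit (f g : nat -> (nat -> R) -> R) :
    (forall i, rmeas (@RN R) (f i)) -> (forall i, rmeas (@RN R) (g i)) ->
    RN [set om | forall e : rat, 0 < ratr e :> R -> exists i, f i om < g i om + ratr e].
  move=> mf mg; apply: (bor_all SS) => e; apply: (bor_imp SS); first exact: bor_const.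
  apply: (bor_ex SS) => i; apply: (rmeas_lt SS) => //; apply: (rmeas_add SS) => //.
  exact: (rmeas_const SS).
have wit' (f g : nat -> (nat -> R) -> R) :
    (forall i, rmeas (@RN R) (f i)) -> (forall i, rmeas (@RN R) (g i)) ->
    RN [set om | forall e : rat, 0 < ratr e :> R -> exists i, f i om - ratr e < g i om].
  move=> mf mg; apply: (bor_ext _ (wit _ _ mf mg)) => om.
  by split => h e /h[j jP]; exists j; move: jP; rewrite ltrBlDr.
case: phi {Fphi} => //= *; try exact: (bor_const SS True).
- by apply: wit' => i; exact: rmeas_xval.
- by apply: wit => i; exact: rmeas_xval.
- by apply: wit' => i; exact: rmeas_xval.
- by apply: wit => i; exact: rmeas_xval.
Qed.

Lemma rmeas_coord phi : rmeas (@borel X) (fun x => set_val x phi).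
Proof.
move=> q; apply: borel_open.
have cf : continuous (fun x : X => set_val x phi).
  move=> x; apply: (@continuous_comp X (omega_type F) R set_val (fun f : omega_type F => f phi)).
    exact: set_val_continuous.
  exact: (@ptws_proj_continuous (formula_index F) R phi).
have := @open_lt R (ratr q); move/continuousP : cf; exact.
Qed.

Lemma box_nbhs (xi : omega_type F) (W : set (omega_type F)) : nbhs xi W ->
  exists2 s, in_box s (coords xi) & forall eta, in_box s (coords eta) -> W eta.
Proof.
pose G : set_system (formula_index F -> R) := [set A | exists2 s, in_box s (coords xi) &
  forall eta, in_box s (coords eta) -> A eta].
have FG : Filter G.
  split.
  - by exists nil.
  - move=> A B [s s1 s2] [t t1 t2]; exists (s ++ t).
      by move=> u; rewrite mem_cat => /orP[/s1|/t1].
    by move=> eta st; split; [apply: s2|apply: t2] => u us; apply: st; rewrite mem_cat us ?orbT.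
  - by move=> A B AB [s s1 s2]; exists s => // eta /s2/AB.
suff : G --> xi by move=> /(_ W).
apply: ptws_cvg_coord => phi A /nbhs_ballP[e /= e0 eA].
have [q1 [q11 q12]] : exists q : rat, xi phi - e < ratr q /\ ratr q < xi phi.
  by apply: rat_between; rewrite ltrBlDr ltrDl.
have [q2 [q21 q22]] : exists q : rat, xi phi < ratr q /\ ratr q < xi phi + e.
  by apply: rat_between; rewrite ltrDl.
exists [:: (rank phi, (q1, q2))].
  by move=> t; rewrite inE => /eqP->; rewrite /coords /= rankK q12.
move=> eta /(_ _ (mem_head _ _)); rewrite /coords /= rankK => /andP[e1 e2].
apply: eA; rewrite /ball /= ltr_distlC; apply/andP; split; lra.
Qed.

Lemma borel_coords (C : set (set X)) : sigma_alg C ->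
  (forall phi, rmeas C (fun x : X => set_val x phi)) -> @borel X `<=` C.
Proof.
move=> SC mC; apply: borel_min => // A oA.
pose om (x : X) : nat -> R := coords (set_val x).
apply: (bor_ext _ (bor_ex SC (fun s => bor_and SC
  (bor_box (f := om) s SC (fun i => mC (idx i)))
  (bor_const SC (forall y, in_box s (om y) -> A y))))) => x.
split => [[s [xs]]|Ax]; first exact.
have /set_type_nbhs[W Wx WA] : nbhs x A by exact: open_nbhs_nbhs.
have [s xs sW] := box_nbhs Wx; exists s; split => // y /sW Wy; exact: WA.
Qed.

Theorem Mod_standard : exists j : X -> nat -> nat, standard (@borel X) j /\
  forall C : set (set X), sigma_alg C -> (forall m, bnat C (j^~ m)) -> @borel X `<=` C.
Proof.
have SS := @RN_sigma R; have SX := borel_sigma X.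
(* The enumeration [idx] may repeat a formula, so a sequence of reals comes from a type only if it
   is constant along repetitions. *)
pose Mc : set (nat -> R) := [set om | (forall i, om i = om (rank (idx i))) /\
  Mod F T (of_coords om)].
have bMc : RN Mc.
  apply: (bor_and SS _ RN_Mod); apply: (bor_all SS) => i.
  exact: (rmeas_eq SS (RN_coord i) (RN_coord _)).
pose u n := if n is m.+1 then (@real_seq_code R)^~ m else ind Mc.
have [|j [r [sj jr]]] := refine SS (@real_seq_code_standard R) (@real_seq_code_gen R) (u := u).
  by case=> [|m]; [exact: bnat_ind|exact: std_bnat (@real_seq_code_standard R) m].
pose om (x : X) : nat -> R := coords (set_val x).
have omMc x : Mc (om x).
  split => [i|]; first by rewrite /om /coords rankK.
  by rewrite /om coordsK; exact: set_valP.
have mom i : rmeas (@borel X) (om^~ i) by exact: rmeas_coord.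
have pre A : RN A -> borel (om @^-1` A).
  move=> bA; apply: (bA [set A | borel (om @^-1` A)]) => [|i q]; last exact: mom.
  split => [B bB|B bB|] /=.
  - exact: (bor_not SX).
  - exact: (bor_ex SX).
  - exact: (sa_set0 SX).
exists (fun x => j (om x)); split; first split.
- move=> w h; have [|[f fMc] fw] := @standard_sub _ _ Mc j (r 0%N) sj (jr 0%N) w.
    by move=> n; have [x xw] := h n; exists (exist _ (om x) (omMc x)).
  have [f1 f2] := fMc.
  exists (exist _ (of_coords f) (mem_set f2)) => m; rewrite -fw /=; congr j.
  by apply/funext => i; exact: esym (f1 i).
- move=> x y xy; apply: val_inj; rewrite /= -[LHS]coordsK -[RHS]coordsK.
  by congr of_coords; apply: (std_inj sj).
- by move=> m n; apply: (pre [set f | j f m = n]); exact: std_bnat sj m n.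
move=> C SC bC.
have cC i : rmeas C (om^~ i).
  move=> q; apply: (bor_ext _ (bC (r (pickle (i, pickle (0%N, pickle q))).+1) 1%N)) => x.
  by rewrite jr /= real_seq_codeE /= nth_rat_pickle; case: (_ < _).
by apply: borel_coords => // phi; rewrite -(rankK phi); exact: cC.
Qed.

(** Formulas outside [F] are Borel functions of the code as well, as quantifiers may be restricted
    to the coded dense sequence. *)
Lemma rmeas_evs n (phi : preformula L n) : is_formula phi -> forall v : nat -> nat,
  rmeas (@borel X) (fun xi => evs phi (coded_seq fragF xi \o v)).
Proof.
have SX := borel_sigma X.
have base m (psi : preformula L m) v : F m psi ->
    rmeas (@borel X) (fun xi => evs psi (coded_seq fragF xi \o v)).
  move=> Fp; have Fq := fragment_subst fragF (@var_subst _ L m v) Fp.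
  apply: (rmeas_ext _ (rmeas_coord (existT _ _ (exist _ _ Fq)))) => xi.
  by rewrite -(coded_evs fragF xi Fq) evs_var_subst.
elim: phi => {n} [n P ts|n t u|n|n p IHp q IHq|n r p IHp|n p IHp q IHq
  |n p IHp q IHq|n p IHp|n p IHp|n ps IH|n ps IH] /= fp v.
- by apply: base; exact: fragment_pred.
- by apply: base; exact: fragment_dist.
- by apply: base; exact: fragment_one.
- by apply: (rmeas_add SX); [apply: IHp|apply: IHq]; case: fp.
- by apply: (rmeas_scale SX); exact: IHp.
- by apply: (rmeas_max SX); [apply: IHp|apply: IHq]; case: fp.
- by apply: (rmeas_min SX); [apply: IHp|apply: IHq]; case: fp.
- have [D [lo [hi [_ h]]]] := eval_respects fp.
  have seqE (xi : X) j : scons_seq (coded_seq fragF xi j) (coded_seq fragF xi \o v) =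
    coded_seq fragF xi \o scons_seq j v by apply/funext => -[].
  apply: (@rmeas_ext R X _ (fun xi =>
    sup (range (fun j => evs p (coded_seq fragF xi \o scons_seq j v))))).
    move=> xi; rewrite (dense_sup _ (@coded_dense _ _ _ fragF T xi) fp).
    by apply: eq_sup_range => j; rewrite seqE.
  apply: (rmeas_sup SX (hi := hi)) => [i xi|i]; last exact: IHp.
  by have [/andP[]] := h _ (@initial_segment _ (coded_seq fragF xi \o scons_seq i v) n.+1)
    (@initial_segment _ (coded_seq fragF xi \o scons_seq i v) n.+1).
- have [D [lo [hi [_ h]]]] := eval_respects fp.
  have seqE (xi : X) j : scons_seq (coded_seq fragF xi j) (coded_seq fragF xi \o v) =
    coded_seq fragF xi \o scons_seq j v by apply/funext => -[].
  apply: (@rmeas_ext R X _ (fun xi =>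
    inf (range (fun j => evs p (coded_seq fragF xi \o scons_seq j v))))).
    move=> xi; rewrite (dense_inf _ (@coded_dense _ _ _ fragF T xi) fp).
    by apply: eq_inf_range => j; rewrite seqE.
  apply: (rmeas_inf SX (lo := lo)) => [i xi|i]; last exact: IHp.
  by have [/andP[]] := h _ (@initial_segment _ (coded_seq fragF xi \o scons_seq i v) n.+1)
    (@initial_segment _ (coded_seq fragF xi \o scons_seq i v) n.+1).
- have [fps [D [lo [hi [_ h]]]]] := fp.
  apply: (rmeas_sup SX (hi := hi)) => [i xi|i]; last exact: IH.
  by have [/andP[]] := h i _ (@initial_segment _ (coded_seq fragF xi \o v) n)
    (@initial_segment _ (coded_seq fragF xi \o v) n).
- have [fps [D [lo [hi [_ h]]]]] := fp.
  apply: (rmeas_inf SX (lo := lo)) => [i xi|i]; last exact: IH.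
  by have [/andP[]] := h i _ (@initial_segment _ (coded_seq fragF xi \o v) n)
    (@initial_segment _ (coded_seq fragF xi \o v) n).
Qed.

End CodeSpace.

(** * Generic models and isolated tuples *)

Section Generic.
Context (R : realType) (L : signature R).
Variables (F : formulas L) (T : theory L).
Arguments F : clear implicits.
Hypotheses (fragF : fragment F) (TF : theory_in F T).
Let FF := fragment_fclosed fragF.
Variables (M : structure L) (a : nat -> M) (k : nat) (d : R).
Hypotheses (MT : models M T) (d0 : 0 < d).

(** The forcing conditions are formulas of [F] that are satisfiable within [d] of [a] in [M]. The
    generic sequence is thus a limit of sequences from [M], although its model is a new
    structure. *)
Definition realizes n (theta : preformula L n) (z : nat -> M) :=
  close k d a z /\ evs theta z < 0.

Definition consistent n (theta : preformula L n) := exists z, realizes theta z.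

Definition stronger n (theta : preformula L n) n' (theta' : preformula L n') :=
  forall (K : structure L) (z : nat -> K), evs theta' z < 0 -> evs theta z < 0.

Lemma stronger_realizes n (theta : preformula L n) n' (theta' : preformula L n') z :
  stronger theta theta' -> realizes theta' z -> realizes theta z.
Proof. by move=> st [cz tz]; split => //; exact: st. Qed.

Definition decides n (phi : preformula L n) (e : R) m (theta : preformula L m) :=
  exists c : R, forall z, realizes theta z -> `|evs phi z - c| <= e.

Definition witnesses n (phi : preformula L n) (e : R) m (theta : preformula L m) : Prop :=
  match phi with
  | Inf _ p => exists j, forall z, realizes theta z ->
      evs p (z \o scons_seq j id) < evs (Inf p) z + e
  | Sup _ p => exists j, forall z, realizes theta z ->
      evs (Sup p) z - e < evs p (z \o scons_seq j id)
  | CInf _ ps => exists i, forall z, realizes theta z ->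
      evs (ps i) z < evs (CInf ps) z + e
  | CSup _ ps => exists i, forall z, realizes theta z ->
      evs (CSup ps) z - e < evs (ps i) z
  | _ => True
  end.

Lemma strengthen n (theta : preformula L n) m f z : F n theta -> close k d a z ->
  evs theta z < 0 -> Fdef F m f -> f M z < 0 ->
  exists n' (theta' : preformula L n'), [/\ F n' theta', consistent theta',
    stronger theta theta' & forall (K : structure L) (y : nat -> K), evs theta' y < 0 -> f K y < 0].
Proof.
move=> Ft cz tz Ff fz.
have [p Fp P] := Fd_max FF (Fd_weak FF (leq_maxl n m) (Fd_base Ft))
  (Fd_weak FF (leq_maxr n m) Ff).
exists (maxn n m), p; split => //.
- by exists z; split; rewrite // P gt_max tz.
- by move=> K y; rewrite P gt_max => /andP[].
- by move=> K y; rewrite P gt_max => /andP[].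
Qed.

Lemma decides_dense n (phi : preformula L n) e m (theta : preformula L m) : F n phi ->
  0 < e -> F m theta -> consistent theta ->
  exists m' (theta' : preformula L m'), [/\ F m' theta', consistent theta',
    stronger theta theta' & decides phi e theta'].
Proof.
move=> Fp e0 Ft [z [cz tz]].
have [q1 [q11 q12]] : exists q : rat, evs phi z - e < ratr q /\ ratr q < evs phi z.
  by apply: rat_between; rewrite ltrBlDr ltrDl.
have [q2 [q21 q22]] : exists q : rat, evs phi z < ratr q /\ ratr q < evs phi z + e.
  by apply: rat_between; rewrite ltrDl.
have Ff := Fd_max FF (Fd_subc FF q2 (Fd_base Fp)) (Fd_csub FF q1 (Fd_base Fp)).
have [|m' [t' [Ft' ct' st' h]]] := strengthen Ft cz tz Ff.
  by rewrite gt_max !subr_lt0 q21.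
exists m', t'; split => //; exists (evs phi z) => y [cy /h].
by rewrite gt_max !subr_lt0 => /andP[? ?]; rewrite ler_distl; apply/andP; split; lra.
Qed.

Lemma witnesses_dense n (phi : preformula L n) e m (theta : preformula L m) : F n phi ->
  0 < e -> F m theta -> consistent theta ->
  exists m' (theta' : preformula L m'), [/\ F m' theta', consistent theta',
    stronger theta theta' & witnesses phi e theta'].
Proof.
move=> Fp e0 Ft ct; have [z [cz tz]] := ct.
have triv : exists m' (theta' : preformula L m'), [/\ F m' theta', consistent theta',
  stronger theta theta' & True] by exists m, theta; split.
have [q [q0 qe]] := rat_between e0.
have Msub := fragment_subformulas fragF Fp.
have M0 : inhabited M := carrier_inhabited M.
have N0 : inhabited nat by exists; exact: 0%N.
case: phi Fp Msub => //= {}n.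
- move=> p Fq Fp.
  have /(sup_range_gt M0)[y yP] : sup (range (fun y => evs p (scons_seq y z))) - ratr q <
    sup (range (fun y => evs p (scons_seq y z))) by rewrite ltrBlDr ltrDl.
  (* The witness is stored at a fresh entry, beyond the ball and beyond the variables of both
     formulas. *)
  pose l := maxn k (maxn n m).
  have [kl nl ml] : [/\ k <= l, n <= l & m <= l]%N by rewrite /l !leq_max !leqnn !orbT.
  have agz : agree l z (upd z l y) by exact: agree_upd.
  have rl i : (i < n.+1)%N -> (scons_seq l id i < l.+1)%N.
    by case: i => [|i] //= i1; rewrite ltnS ltnW// (leq_trans _ nl).
  have Ff := Fd_csub FF (- q) (Fd_add FF (Fd_ren FF (Fd_base Fp) rl)
    (Fd_opp FF (Fd_weak FF (leqW nl) (Fd_base Fq)))).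
  have [|||m' [t' [Ft' ct' st' h]]] := strengthen (z := upd z l y) Ft _ _ Ff.
  + by move=> i ik; rewrite -agz ?cz// (leq_trans ik).
  + by rewrite -(evs_agree theta (a := z))// => i im; rewrite agz// (leq_trans im).
  + rewrite -(evs_agree (Sup p) (a := z)); last by move=> i im; rewrite agz// (leq_trans im).
    rewrite -(evs_agree p (a := scons_seq y z)); last first.
      case=> [|i] i1 /=; first by rewrite /upd eqxx.
      by rewrite agz// (leq_trans _ nl).
    by rewrite evs_sup rmorphN /=; lra.
  exists m', t'; split => //; exists l => x [cx /h].
  by rewrite rmorphN /=; lra.
- move=> p Fq Fp.
  have /(inf_range_lt M0)[y yP] : inf (range (fun y => evs p (scons_seq y z))) <
    inf (range (fun y => evs p (scons_seq y z))) + ratr q by rewrite ltrDl.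
  pose l := maxn k (maxn n m).
  have [kl nl ml] : [/\ k <= l, n <= l & m <= l]%N by rewrite /l !leq_max !leqnn !orbT.
  have agz : agree l z (upd z l y) by exact: agree_upd.
  have rl i : (i < n.+1)%N -> (scons_seq l id i < l.+1)%N.
    by case: i => [|i] //= i1; rewrite ltnS ltnW// (leq_trans _ nl).
  have Ff := Fd_subc FF q (Fd_add FF (Fd_ren FF (Fd_base Fp) rl)
    (Fd_opp FF (Fd_weak FF (leqW nl) (Fd_base Fq)))).
  have [|||m' [t' [Ft' ct' st' h]]] := strengthen (z := upd z l y) Ft _ _ Ff.
  + by move=> i ik; rewrite -agz ?cz// (leq_trans ik).
  + by rewrite -(evs_agree theta (a := z))// => i im; rewrite agz// (leq_trans im).
  + rewrite -(evs_agree (Inf p) (a := z)); last by move=> i im; rewrite agz// (leq_trans im).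
    rewrite -(evs_agree p (a := scons_seq y z)); last first.
      case=> [|i] i1 /=; first by rewrite /upd eqxx.
      by rewrite agz// (leq_trans _ nl).
    by rewrite evs_inf; lra.
  exists m', t'; split => //; exists l => x [cx /h].
  by lra.
- move=> ps Fq Fp.
  have /(sup_range_gt N0)[i iP] : sup (range (fun i => evs (ps i) z)) - ratr q <
    sup (range (fun i => evs (ps i) z)) by rewrite ltrBlDr ltrDl.
  have Ff := Fd_csub FF (- q) (Fd_add FF (Fd_base (Fp i)) (Fd_opp FF (Fd_base Fq))).
  have [|m' [t' [Ft' ct' st' h]]] := strengthen Ft cz tz Ff.
    by rewrite rmorphN /=; move: iP; rewrite /evs /=; lra.
  exists m', t'; split => //; exists i => x [cx /h].
  by rewrite rmorphN /=; lra.
- move=> ps Fq Fp.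
  have /(inf_range_lt N0)[i iP] : inf (range (fun i => evs (ps i) z)) <
    inf (range (fun i => evs (ps i) z)) + ratr q by rewrite ltrDl.
  have Ff := Fd_subc FF q (Fd_add FF (Fd_base (Fp i)) (Fd_opp FF (Fd_base Fq))).
  have [|m' [t' [Ft' ct' st' h]]] := strengthen Ft cz tz Ff.
    by move: iP; rewrite /evs /=; lra.
  exists m', t'; split => //; exists i => x [cx /h].
  by lra.
Qed.

Variables (D : nat -> forall n, preformula L n -> Prop) (n0 : nat) (theta0 : preformula L n0).
Hypotheses (Ftheta0 : F n0 theta0) (theta0_cons : consistent theta0).
Hypothesis D_dense : forall j n (theta : preformula L n), F n theta -> consistent theta ->
  stronger theta0 theta ->
  exists n' (theta' : preformula L n'),
    [/\ F n' theta', consistent theta', stronger theta theta' & D j theta'].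

(** One numbering of all requirements: [c = 0] asks for [D i], [c = 1] for a decision of formula
    [i], larger [c] for a witness. The precision is rational [m], or [1] if that is not positive. *)
Let task (j : nat) n (theta : preformula L n) : Prop :=
  if pickle_inv j is Some (c, (i, m)) then
    let phi := sval (projT2 (idx fragF i)) in
    let e : R := if 0 < nth_rat m then ratr (nth_rat m) else 1 in
    match c with 0 => D i theta | 1 => decides phi e theta | _ => witnesses phi e theta end
  else True.

Let task_dense j n (theta : preformula L n) : F n theta -> consistent theta ->
  stronger theta0 theta -> exists n' (theta' : preformula L n'),
    [/\ F n' theta', consistent theta', stronger theta theta' & task j theta'].
Proof.
move=> Ft ct st; rewrite /task; case: pickle_inv => [[c [i m]]|]; last by exists n, theta; split.
set e := (if _ then _ else _).
have e0 : 0 < e by rewrite /e; case: ifP => // q0; rewrite ltr0q.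
case: (idx fragF i) => p [phi Fp] /=.
case: c => [|[|c]]; [exact: D_dense|exact: decides_dense|exact: witnesses_dense].
Qed.

Lemma decides_le n (phi : preformula L n) e e' m (theta : preformula L m) : e <= e' ->
  decides phi e theta -> decides phi e' theta.
Proof. by move=> ee' [c h]; exists c => z /h; move=> /le_trans; apply. Qed.

Lemma witnesses_le n (phi : preformula L n) e e' m (theta : preformula L m) : e <= e' ->
  witnesses phi e theta -> witnesses phi e' theta.
Proof. by move=> ee'; case: phi => //= {}n p [j h]; exists j => z /h; lra. Qed.

(** The margin [q] between consecutive conditions makes each of them hold strictly in the limit,
    where otherwise only [<= 0] would survive. *)
Lemma generic_sequence : exists s : nat -> formula_index F,
  let th j := sval (projT2 (s j)) in
  [/\ stronger theta0 (th 0%N),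
      forall j, consistent (th j),
      forall j, exists2 q : R, 0 < q & forall (K : structure L) (z : nat -> K),
        evs (th j.+1) z < 0 -> evs (th j) z < - q &
      [/\ forall n (phi : preformula L n) e, F n phi -> 0 < e -> exists j, decides phi e (th j),
      forall n (phi : preformula L n) e, F n phi -> 0 < e -> exists j, witnesses phi e (th j)
    & forall j, exists j', D j (th j')]].
Proof.
pose S := {x : formula_index F | consistent (sval (projT2 x)) /\ stronger theta0 (sval (projT2 x))}.
pose thS (x : S) := sval (projT2 (sval x)).
have step (js : nat * S) : exists x : S, task js.1 (thS x) /\
    exists2 q : R, 0 < q & forall (K : structure L) (z : nat -> K),
      evs (thS x) z < 0 -> evs (thS js.2) z < - q.
  case: js => j [[n [theta Ft]] [ct st]]; rewrite /thS /= in ct st *.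
  have [z [cz tz]] := ct.
  have [q [q0 qz]] : exists q : rat, 0 < ratr q :> R /\ ratr q < - evs theta z.
    by apply: rat_between; rewrite oppr_gt0.
  have Fq := Fd_subc FF (- q) (Fd_base Ft).
  have [|m [t [Fm ctm stm h]]] := strengthen Ft cz tz Fq; first by rewrite rmorphN /=; lra.
  have [|m' [t' [Fm' ctm' stm' tt']]] := task_dense j Fm ctm.
    by move=> K x /stm/st.
  have sx : stronger theta0 t' by move=> K x /stm'/stm/st.
  exists (exist _ (existT _ m' (exist _ t' Fm')) (conj ctm' sx)); split => //=.
  by exists (ratr q) => // K x /stm'/h; rewrite rmorphN /=; lra.
have [f fP] := choice step.
pose s0 : S := exist (fun x : formula_index F =>
    consistent (sval (projT2 x)) /\ stronger theta0 (sval (projT2 x)))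
  (existT _ n0 (exist _ theta0 Ftheta0)) (conj theta0_cons (fun _ _ => id)).
pose s := fix s j : S := if j is i.+1 then f (i, s i) else s0.
have taskP j : task j (thS (s j.+1)) by have [] := fP (j, s j).
have half (e : R) : 0 < e -> exists m, (if 0 < nth_rat m then ratr (nth_rat m) else 1) <= e.
  move=> e0; have [q [q0 qe]] := rat_between e0; exists (pickle q).
  by rewrite nth_rat_pickle -(ltr0q R) q0 ltW.
exists (fun j => sval (s j)); split => // [j|j|]; first by case: (svalP (s j)).
  by have [_] := fP (j, s j).
split=> [n phi e Fp e0|n phi e Fp e0|j].
- have [m me] := half e e0; have [i iP] := idxP fragF (existT _ n (exist _ phi Fp)).
  exists (pickle (1%N, (i, m))).+1; apply: (decides_le me).
  by have := taskP (pickle (1%N, (i, m))); rewrite /task pickleK_inv iP.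
- have [m me] := half e e0; have [i iP] := idxP fragF (existT _ n (exist _ phi Fp)).
  exists (pickle (2%N, (i, m))).+1; apply: (witnesses_le me).
  by have := taskP (pickle (2%N, (i, m))); rewrite /task pickleK_inv iP.
- exists (pickle (0%N, (j, 0%N))).+1.
  by have := taskP (pickle (0%N, (j, 0%N))); rewrite /task pickleK_inv.
Qed.

(** The decisions define a limit type, the witnesses make it [witnessed], and the realization
    theorem turns it into a model. Nearness to [a] is inherited from the realizations in [M]. *)
Theorem generic_model : exists (N : structure L) (e : nat -> N),
  [/\ models N T, dense_seq e, near_type F k d a e, evs theta0 e < 0 &
    forall j, exists n (theta : preformula L n), [/\ F n theta, D j theta & evs theta e < 0]].
Proof.
have [s [s0 sc sq [sdec swit sD]]] := generic_sequence.
pose th j := sval (projT2 (s j)).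
have Fth j : F _ (th j) := svalP (projT2 (s j)).
have mono i j : (i <= j)%N -> stronger (th i) (th j).
  move=> ij K z; rewrite -(subnKC ij); elim: (j - i)%N => [|l IH]; first by rewrite addn0.
  rewrite addnS => zl; apply: IH; have [q q0 /(_ K z zl)] := sq (i + l)%N.
  by move=> /lt_le_trans; apply; rewrite oppr_le0 ltW.
have [z zP] := choice sc.
have zr i j : (i <= j)%N -> realizes (th i) (z j).
  by move=> ij; apply: (stronger_realizes (mono _ _ ij)); exact: zP.
(* The lower bounds that are eventually forced; their supremum is the value in the limit. *)
pose S n (phi : preformula L n) : set R :=
  [set q | exists j, forall x, realizes (th j) x -> q <= evs phi x].
have lim n (phi : preformula L n) (e : R) : F n phi -> 0 < e ->
    exists j, forall x, realizes (th j) x -> `|evs phi x - sup (S n phi)| < e.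
  move=> Fp e0; have e3 : 0 < e / 3 by rewrite divr_gt0.
  have [j [c jc]] := sdec _ phi _ Fp e3; exists j => x /jc xc.
  have Sc : S n phi (c - e / 3).
    by exists j => y /jc; rewrite ler_distl => /andP[].
  have Su q : S n phi q -> q <= c + e / 3.
    move=> [i iP]; apply: (le_trans (iP (z (maxn i j)) _)); first by apply: zr; exact: leq_maxl.
    have /jc : realizes (th j) (z (maxn i j)) by apply: zr; exact: leq_maxr.
    by rewrite ler_distl => /andP[].
  have s1 : sup (S n phi) <= c + e / 3 by apply: ge_sup; [exists (c - e / 3)|exact: Su].
  have s2 : c - e / 3 <= sup (S n phi) by apply: ub_le_sup => //; exists (c + e / 3).
  by move: xc; rewrite ler_distl ltr_distl => /andP[? ?]; apply/andP; split; lra.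
pose xi : omega_type F := fun phi => sup (S _ (sval (projT2 phi))).
have xiE n (phi : preformula L n) : F n phi -> xval xi phi = sup (S n phi).
  by move=> Fp; rewrite /xval; case: pselect.
have limv n (phi : preformula L n) (v : nat -> nat) (e : R) : F n phi -> 0 < e ->
    exists j, forall x, realizes (th j) x -> `|evs phi (x \o v) - val_at xi phi v| < e.
  move=> Fp e0; have Fq := fragment_subst fragF (@var_subst _ L n v) Fp.
  have [j jP] := lim _ _ _ Fq e0; exists j => x /jP.
  by rewrite evs_var_subst /val_at xiE.
have apx : approximable T xi.
  move=> t l e e0; suff [j jP] : exists j, forall i, (i < l)%N -> forall x, realizes (th j) x ->
      `|evs (sval (projT2 (t i))) x - xi (t i)| < e.
    exists M, (z j); split => // i /jP/(_ (z j))/(_ (zr _ _ (leqnn j))).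
    by rewrite distrC.
  elim: l => [|l [j jP]]; first by exists 0%N.
  have [j' j'P] := lim _ _ e (svalP (projT2 (t l))) e0.
  exists (maxn j j') => i; rewrite ltnS leq_eqVlt => /orP[/eqP->|il] x xr.
    by apply: j'P; apply: stronger_realizes xr; apply: mono; exact: leq_maxr.
  by apply: jP => //; apply: stronger_realizes xr; apply: mono; exact: leq_maxl.
have common (P Q W : (nat -> M) -> Prop) j1 j2 j3 :
    (forall x, realizes (th j1) x -> P x) -> (forall x, realizes (th j2) x -> Q x) ->
    (forall x, realizes (th j3) x -> W x) -> exists x, [/\ P x, Q x & W x].
  move=> h1 h2 h3; exists (z (maxn j1 (maxn j2 j3))).
  by split; [apply: h1|apply: h2|apply: h3]; apply: zr; rewrite !leq_max leqnn ?orbT.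
have wit : witnessed xi.
  split=> n p Fq e e0; have e3 : 0 < e / 3 by [rewrite divr_gt0];
    have := fragment_subformulas fragF Fq => /= Fp;
    have [j1 [i h1]] := swit _ _ _ Fq e3; have [j2 h2] := lim _ _ _ Fq e3; exists i.
  - have [j3 h3] := limv _ _ (scons_seq i id) _ Fp e3.
    have [x []] := common _ _ _ _ _ _ h1 h2 h3.
    by rewrite xiE// !ltr_distl => ? /andP[? ?] /andP[? ?]; lra.
  - have [j3 h3] := limv _ _ (scons_seq i id) _ Fp e3.
    have [x []] := common _ _ _ _ _ _ h1 h2 h3.
    by rewrite xiE// !ltr_distl => ? /andP[? ?] /andP[? ?]; lra.
  - have [j3 h3] := lim _ _ _ (Fp i) e3.
    have [x []] := common _ _ _ _ _ _ h1 h2 h3.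
    by rewrite !xiE// !ltr_distl => ? /andP[? ?] /andP[? ?]; lra.
  - have [j3 h3] := lim _ _ _ (Fp i) e3.
    have [x []] := common _ _ _ _ _ _ h1 h2 h3.
    by rewrite !xiE// !ltr_distl => ? /andP[? ?] /andP[? ?]; lra.
have [N [e [NT de exi]]] := realized_exists fragF TF apx wit.
have eE n (phi : preformula L n) : F n phi -> evs phi e = sup (S n phi).
  by move=> Fp; rewrite -xiE// -exi xval_tp.
have thN j : evs (th j) e < 0.
  have [q q0 qP] := sq j; have [i iP] := lim _ _ q (Fth j) q0.
  rewrite eE//; pose x := z (maxn i j.+1).
  have /iP : realizes (th i) x by apply: zr; exact: leq_maxl.
  have [_ /qP] : realizes (th j.+1) x by apply: zr; exact: leq_maxr.
  by rewrite -/(th j) ltr_distl => ? /andP[? ?]; lra.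
exists N, e; split => //; last 2 first.
- by apply: s0; exact: thN.
- by move=> j; have [i iD] := sD j; exists _, (th i); split.
move=> phi Fp; rewrite eE// => p0.
have [|j jP] := lim _ phi (- sup (S _ phi)) Fp; first by rewrite oppr_gt0.
have [cz _] := zr _ _ (leqnn j); exists (z j) => //.
by have := jP _ (zr _ _ (leqnn j)); rewrite ltr_distl => /andP[_]; lra.
Qed.

End Generic.

(** * Compactness of balls and isolated tuples *)

Section Isolation.
Context (R : realType) (L : signature R).
Variables (F : formulas L) (T : theory L).
Arguments F : clear implicits.
Hypotheses (fragF : fragment F) (TF : theory_in F T).
Let FF := fragment_fclosed fragF.
Implicit Types M N : structure L.

Lemma near_transfer_ren n k s M (b : nat -> M) N (w : nat -> N) r (c : nat -> M) m f
    (v : nat -> nat) : Fdef F m f ->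
  (forall z : nat -> M, close k s b z -> f M z < 0 -> near_type F n r c (z \o v)) ->
  near_type F k s b w -> f N w < 0 -> near_type F n r c (w \o v).
Proof.
move=> Ff h bw fw p Fp pw; have Fq := fragment_subst fragF (@var_subst _ L n v) Fp.
have Fg := Fd_max FF (Fd_weak FF (leq_maxl m (var_bound n v).+1) Ff)
  (Fd_weak FF (leq_maxr _ _) (Fd_base Fq)).
have [|z bz] := near_ext FF bw (leq_maxl k _) (Fd_weak FF (leq_maxr k _) Fg).
  by rewrite gt_max fw evs_var_subst.
rewrite gt_max evs_var_subst => /andP[fz pz].
exact: h pz.
Qed.

(** Relative compactness of the ball in sequential form; cluster points may lie on the boundary,
    hence [<= d]. *)
Definition compact_ball M k (d : R) (a : nat -> M) := forall z : nat -> nat -> M,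
  (forall n, close k d a (z n)) -> exists w : nat -> M,
  (forall i, (i < k)%N -> mdist (a i) (w i) <= d) /\
  forall (e : R) (n : nat), 0 < e -> exists2 m, (n <= m)%N & close k e w (z m).

(** Meet the first [n] conditions by [z n] and take a cluster point. It satisfies them only weakly,
    but conditions with all rational thresholds and both signs occur, so the values agree
    exactly. *)
Lemma compact_limit M k d (a : nat -> M) N (y : nat -> N) (P : (nat -> M) -> Prop) :
  compact_ball k d a ->
  (forall psi : preformula L k, F k psi -> evs psi y < 0 ->
    exists z, [/\ close k d a z, evs psi z < 0 & P z]) ->
  exists w : nat -> M, [/\ forall i, (i < k)%N -> mdist (a i) (w i) <= d,
    forall phi : preformula L k, F k phi -> evs phi w = evs phi y &
    forall e : R, 0 < e -> exists2 z, close k e w z & P z].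
Proof.
move=> cb yP.
pose G : set (preformula L k) := [set psi | F k psi /\ evs psi y < 0].
have [g gG] : exists g : nat -> preformula L k, range g = G.
  apply: (countable_enum (d0 := Scale (-1) (One L k))).
    by apply: sub_countable (fragment_countable fragF k); apply: subset_card_le => psi [].
  split; first by apply: fragment_scale => //; exact: fragment_one.
  by rewrite /evs /= rmorphN1 mulN1r oppr_lt0.
have Gg n : G (g n) by rewrite -gG; exists n.
pose mx := fix mx n := if n is m.+1 then Max (mx m) (g m.+1) else g 0%N.
have mxG n : G (mx n).
  elim: n => [|n [IH1 IH2]] /=; first exact: Gg.
  by have [? ?] := Gg n.+1; split; [exact: fragment_max|rewrite /evs /= gt_max IH2].
have mxg n M' (z : nat -> M') j : (j <= n)%N -> evs (mx n) z < 0 -> evs (g j) z < 0.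
  elim: n => [|n IH]; first by rewrite leqn0 => /eqP->.
  rewrite leq_eqVlt => /orP[/eqP->|jn]; rewrite /evs /= gt_max => /andP[] //.
  by move=> h _; exact: IH.
have /choice[z zP] : forall n, exists z, [/\ close k d a z, evs (mx n) z < 0 & P z].
  by move=> n; have [? ?] := mxG n; exact: yP.
have [|w [aw wz]] := cb z; first by move=> n; case: (zP n).
(* A positive value at [w] would persist at members of the sequence that satisfy [g j < 0]. *)
have neg psi : G psi -> evs psi w <= 0.
  rewrite -gG => -[j _ <-]; rewrite leNgt; apply/negP => w0.
  have [Fg _] := Gg j; have [p Fp pE] := Fd_opp FF (Fd_base Fg).
  have := oppr_lt0 (evs (g j) w); rewrite w0 -pE => pw.
  have [e e0 eP] := evs_lt_open (fragment_formula fragF Fp) pw.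
  have [m jm /eP] := wz e j e0; rewrite pE oppr_lt0.
  have [_ /(mxg _ _ _ _ jm) h _] := zP m.
  by move=> /lt_trans/(_ h); rewrite ltxx.
exists w; split => //; last first.
  by move=> e e0; have [m _ wm] := wz e 0%N e0; exists (z m) => //; case: (zP m).
have half (phi : preformula L k) : F k phi -> evs phi w <= evs phi y.
  move=> Fp; rewrite leNgt; apply/negP => /rat_between[q [q1 q2]].
  have [p Fp' pE] := Fd_subc FF q (Fd_base Fp).
  by have := neg p; rewrite /G /= !pE subr_lt0 subr_le0 leNgt q2 => /(_ (conj Fp' q1)).
move=> phi Fp; apply/eqP; rewrite eq_le half//=.
have [p Fp' pE] := Fd_opp FF (Fd_base Fp).
by have := half p Fp'; rewrite !pE lerN2.
Qed.

Lemma near_same_type n r M (c : nat -> M) N (y : nat -> N) : 0 < r ->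
  (forall phi : preformula L n, F n phi -> evs phi c = evs phi y) -> near_type F n r c y.
Proof. by move=> r0 cy phi Fp; rewrite -cy// => p0; exists c => //; exact: close_refl. Qed.

(** By compactness a type near that of [a] is realized in the closed ball of [M] itself, where it is
    rigid. *)
Lemma rigid_ball M k d (a : nat -> M) : separable_space M -> models M T -> 0 < d ->
  compact_ball k d a ->
  (forall c, (forall i, (i < k)%N -> mdist (a i) (c i) <= d) ->
    rigid T (tp F (@initial_segment M c k))) ->
  forall N (y : nat -> N), separable_space N -> models N T -> near_type F k d a y ->
  isomorphic N M.
Proof.
move=> sM MT d0 cb rg N y sN NT ay.
have [psi Fp py|w [aw wy _]] := @compact_limit M k d a N y (fun=> True) cb.
  by have [z az pz] := ay _ Fp py; exists z.
have [_ /(_ N M (@initial_segment N y k) (@initial_segment M w k) sN NT sM MT)] := rg w aw.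
by apply => //; apply/funext => -[phi Fp]; rewrite /tp /=; exact: esym (wy phi Fp).
Qed.

(** Otherwise tuples that are not near to [a] accumulate at a realization of the type of [a], in
    contradiction to the triangle inequality for nearness. *)
Lemma near_open M k d (a : nat -> M) r : 0 < r -> compact_ball k d a ->
  exists theta : preformula L k, [/\ F k theta, evs theta a < 0 &
    forall z, close k d a z -> evs theta z < 0 -> near_type F k r a z].
Proof.
move=> r0 cb; apply: contrapT => nth; have r2 : 0 < r / 2 by rewrite divr_gt0.
have [psi Fp pa|w [_ wa wP]] :=
    @compact_limit M k d a M a (fun z => ~ near_type F k r a z) cb.
  apply: contrapT => nz; apply: nth; exists psi; split => // z az pz.
  by apply: contrapT => naz; apply: nz; exists z.
have [z wz] := wP _ r2; apply; rewrite (splitr r).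
apply: (near_trans FF (d := w)) => //; last exact: near_close.
by apply: near_same_type => // phi Fp; rewrite wa.
Qed.

(** A metric form of atomicity over [b]: among tuples starting near [b], a logic neighbourhood of
    any extension of such a tuple lies within [r] of it, for every [r > 0]. *)
Definition isolated M (b : nat -> M) k (d : R) := forall p (c : nat -> M) (r : R),
  (k <= p)%N -> close k d b c -> 0 < r ->
  exists theta : preformula L p, [/\ F p theta, evs theta c < 0 &
    forall z, close k d b z -> evs theta z < 0 -> near_type F p r c z].

Section Existence.
Variables (M : structure L) (c : nat -> M) (k : nat) (a : nat -> M) (d : R).
Hypotheses (MT : models M T) (dc : dense_seq c) (d0 : 0 < d).
Hypothesis Miso : forall N (e : nat -> N), dense_seq e -> models N T ->
  near_type F k d a e -> isomorphic N M.

(** Otherwise a model could omit the neighbourhoods of all tuples of [c], in spite of being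
    isomorphic to [M]. *)
Lemma isolating_dense n (theta : preformula L n) p (v : nat -> nat) (r : R) : 0 < r ->
  F n theta -> consistent a k d theta ->
  exists n' (rho : preformula L n'), [/\ F n' rho, consistent a k d rho, stronger theta rho &
    exists z1 : nat -> M, forall z, realizes a k d rho z -> near_type F p r z1 (z \o v)].
Proof.
move=> r0 Ft ct; apply: contrapT => nrho.
(* The [w j] run through all finite tuples of the dense sequence; requirement [j] keeps the type of
   the generic tuple away from the [r]-ball around [w j]. *)
pose w (j : nat) : nat -> M := c \o nth 0%N (odflt [::] (unpickle j)).
pose D (j : nat) n' (rho : preformula L n') := exists phi : preformula L p, [/\ F p phi,
  forall (K : structure L) (z : nat -> K), evs rho z < 0 -> evs phi (z \o v) < 0 &
  ~ exists2 z : nat -> M, close p r (w j) z & evs phi z < 0].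
have [j n' rho Fr cr sr|N [e [NT de ae te eD]]] :=
    @generic_model R L F T fragF TF M a k d MT D n theta Ft ct.
  have [z zr nz] : exists2 z, realizes a k d rho z & ~ near_type F p r (w j) (z \o v).
    apply: contrapT => nz; apply: nrho; exists n', rho; split => //; exists (w j) => z zr.
    by apply: contrapT => nw; apply: nz; exists z.
  have [phi [Fp pz np]] : exists phi : preformula L p, [/\ F p phi, evs phi (z \o v) < 0 &
      ~ exists2 z : nat -> M, close p r (w j) z & evs phi z < 0].
    apply: contrapT => nphi; apply: nz => phi Fp pz; apply: contrapT => nz.
    by apply: nphi; exists phi.
  have [cz rz] := zr.
  have [|n2 [t2 [F2 c2 s2 h2]]] := strengthen fragF Fr cz rz
    (Fd_base (fragment_subst fragF (@var_subst _ L p v) Fp)).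
    by rewrite evs_var_subst.
  by exists n2, t2; split => //; exists phi; split => // K x /h2; rewrite evs_var_subst.
have [h hi] := Miso de NT ae.
have [u hu] := dense_close p (h \o e \o v) dc r0.
have [m [rho [Fr [phi [Fp rp nphi]] re]]] := eD (pickle u).
apply: nphi; exists (h \o e \o v); last by rewrite (evs_iso _ _ hi); exact: rp.
by rewrite /w pickleK /=; exact: close_sym.
Qed.

Lemma isolated_model (theta0 : preformula L k) : F k theta0 -> evs theta0 a < 0 ->
  (forall z, close k d a z -> evs theta0 z < 0 -> near_type F k (d / 16) a z) ->
  exists N (e : nat -> N), [/\ models N T, dense_seq e, isomorphic N M &
    isolated e k (d / 8)].
Proof.
move=> F0 t0 h0.
(* For each length [p], index tuple [u] and rational [q], the generic tuple along [u] shall be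
   determined up to [q]. *)
pose D (j : nat) n (theta : preformula L n) :=
  if (unpickle j : option (nat * (seq nat * rat))) is Some (p, (u, q)) then
    0 < q -> exists z1 : nat -> M, forall z, realizes a k d theta z ->
    near_type F p (ratr q) z1 (z \o nth 0%N u)
  else True.
have D_dense (j : nat) n (theta : preformula L n) : F n theta -> consistent a k d theta ->
  stronger theta0 theta ->
  exists n' (theta' : preformula L n'),
    [/\ F n' theta', consistent a k d theta', stronger theta theta' & D j n' theta'].
  move=> Ft ct _; rewrite /D; case: unpickle => [[p [u q]]|]; last by exists n, theta; split.
  have [q0|q0] := pselect (0 < q); last by exists n, theta; split.
  have rq0 : 0 < ratr q :> R by rewrite ltr0q.
  have [n' [rho [Fr cr sr hr]]] := isolating_dense p (nth 0%N u) rq0 Ft ct.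
  by exists n', rho; split.
have ct0 : consistent a k d theta0 by exists a; split => //; exact: close_refl.
have [N [e [NT de ae te eD]]] := generic_model fragF TF MT F0 ct0 D_dense.
have Ni := Miso de NT ae.
exists N, e; split => // p c0 r kp ec r0.
have ae16 : near_type F k (d / 16) a e.
  exact: (near_transfer FF (leqnn k) (leqnn k) (Fd_base F0) h0 ae te).
(* Because [theta0] brings [e] within [d / 16] of [a], tuples within [15 d / 16] of [e] are still in
   the [d]-ball of which the requirements speak. *)
have nearN y s : s <= d * 15 / 16 -> 0 < s -> close k s e y -> near_type F k d a y.
  move=> sd s0 ey; apply: (near_le (r := d / 16 + s)); first by lra.
  by apply: (near_trans FF (d := e)) => //; exact: near_close.
have [q [q0 qr]] : exists q : rat, 0 < ratr q :> R /\ ratr q < r / 8.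
  by apply: rat_between; rewrite divr_gt0.
have [q2 [q20 q2d]] : exists q : rat, d / 8 < ratr q /\ ratr q < d / 6.
  have d86 : d / 8 < d / 6 by move: d0; lra.
  exact: rat_between d86.
have [u cu] := dense_close p c0 de q0; set v := nth 0%N u in cu.
have [n [theta [Ft Dt thE]]] := eD (pickle (p, (u, q))).
have [z1 z1P] : exists z1 : nat -> M, forall z, realizes a k d theta z ->
    near_type F p (ratr q) z1 (z \o v).
  by move: Dt; rewrite /D pickleK; apply; rewrite -(ltr0q R).
have z1N (y : nat -> N) : near_type F k d a y -> evs theta y < 0 ->
    near_type F p (ratr q) z1 (y \o v).
  by move=> ay ty; apply: (near_transfer_ren (Fd_base Ft) _ ay ty) => z az tz; exact: z1P.
pose m := (n + k + (var_bound p v).+1)%N.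
have vm i : (i < p)%N -> (v i < (var_bound p v).+1)%N.
  by move=> ip; rewrite ltnS; exact: (@leq_bigmax _ (fun j : 'I_p => v j) (Ordinal ip)).
have [i ip|f1 [Ff1 f1P]] := @Fd_close R L F FF (m + p) p id (fun i => p + v i)%N.
  rewrite (ltn_addl _ ip) addnC ltn_add2r; split => //.
  by apply: (leq_trans (vm i ip)); exact: leq_addl.
have [i ik|f2 [Ff2 f2P]] := @Fd_close R L F FF (m + p) k id (addn p).
  rewrite (ltn_addl _ (leq_trans ik kp)) addnC ltn_add2r; split => //.
  by rewrite /m -addnA addnCA; exact: ltn_addr.
have Ff3 : Fdef F (m + p) (fun K (x : nat -> K) => evs theta (x \o addn p)).
  apply: (Fd_ren FF (Fd_base Ft)) => i i_n; rewrite addnC ltn_add2r.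
  by rewrite /m -addnA; exact: ltn_addr.
(* The isolating formula says that some [y] satisfies [theta], is within [q] of the given tuple
   along [v], and starts within [q2] of it. For [c0] the sequence [e] is such a [y]. *)
have := Fd_max FF Ff3 (Fd_max FF (Fd_subc FF q Ff1) (Fd_subc FF q2 Ff2)).
move=> /(Fd_tail FF)[g [[phi Fphi phiE] g1 g2]].
have q2p : 0 < ratr q2 :> R by apply: le_lt_trans q20; rewrite divr_ge0// ltW.
exists phi; split => //.
  rewrite phiE; apply: (le_lt_trans (g1 _ _ (shift_seq p c0 e) _)).
    exact: shift_seq_lo.
  have hi : shift_seq p c0 e \o addn p = e by apply/funext => i; exact: shift_seq_hi.
  rewrite !gt_max hi thE !subr_lt0; apply/andP; split => //; apply/andP; split.
    apply/(f1P _ _ _ q0) => i ip; have := shift_seq_lo c0 e ip => /= <-.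
    by rewrite shift_seq_hi; exact: cu.
  apply/(f2P _ _ _ q2p) => i ik; have := shift_seq_lo c0 e (leq_trans ik kp) => /= <-.
  rewrite shift_seq_hi metric_sym; exact: lt_trans (ec i ik) q20.
move=> z ez; rewrite phiE => /g2[b zb]; rewrite !gt_max !subr_lt0 => /andP[tb /andP[]].
move=> /(f1P _ _ _ q0) h1 /(f2P _ _ _ q2p) h2.
set y := b \o addn p in tb.
have zy : close k (ratr q2) z y by move=> i ik; rewrite (zb i (leq_trans ik kp)); exact: h2.
have zyv : close p (ratr q) z (y \o v) by move=> i ip; rewrite (zb i ip); exact: h1.
have y1 : near_type F p (ratr q) z1 (y \o v).
  apply: z1N => //; apply: (nearN _ (d / 8 + ratr q2)); try lra.
  exact: close_trans ez zy.
have e1 : near_type F p (ratr q) z1 (e \o v).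
  by apply: z1N.
have e1' : near_type F p (2 * ratr q) (e \o v) z1 by apply: (near_sym FF q0 _ e1); lra.
have s1 := near_trans FF q0 e1' y1.
have s2 := near_trans FF q0 s1 (near_close (close_sym zyv)).
(* From [c0] to [e] along [v], to [z1], to [y] along [v], to [z]: in all [5 q < r], the second step
   costing [2 q] because nearness is reversed there. *)
have s3 : near_type F p (ratr q + (2 * ratr q + ratr q + ratr q)) c0 z.
  by apply: (near_trans FF _ (near_close cu) s2); lra.
by apply: near_le s3; lra.
Qed.

End Existence.

End Isolation.

(** * Back and forth *)

Section BackAndForth.
Context (R : realType) (L : signature R).
Variables (F : formulas L).
Arguments F : clear implicits.
Hypotheses (fragF : fragment F).
Let FF := fragment_fclosed fragF.
Implicit Types M N : structure L.

Definition halving (d : R) (l : nat) : R := d / 2 ^+ l.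

Lemma halving_gt0 d l : 0 < d -> 0 < halving d l.
Proof. by move=> d0; rewrite divr_gt0// exprn_gt0. Qed.

Lemma halvingS d l : halving d l.+1 = halving d l / 2.
Proof. by rewrite /halving exprSr invfM mulrA. Qed.

Lemma halving_small (d e : R) n : 0 < d -> 0 < e ->
  exists l, (n <= l)%N /\ forall l', (l <= l')%N -> halving d l' < e.
Proof.
move=> d0 e0; pose m := Num.Def.archi_bound (d / e).
exists (maxn n m); split; first exact: leq_maxl.
move=> l' ml; rewrite /halving ltr_pdivrMr ?exprn_gt0// -ltr_pdivrMl// mulrC.
apply: (@lt_le_trans _ _ m%:R).
  by apply: archi_boundP; rewrite divr_ge0// ltW.
rewrite -natrX ler_nat; apply: (leq_trans (leq_trans (leq_maxr n m) ml)).
by apply: ltnW; exact: ltn_expl.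
Qed.

Lemma coordinate_limits (K : metricType R) (c : nat -> nat -> K) (n : nat -> nat) (s : nat -> R) :
  complete_space K -> (forall l, 0 < s l) -> (forall l, s l.+1 <= s l / 2) ->
  (forall l, (l <= n l)%N) -> (forall l, (n l <= n l.+1)%N) ->
  (forall l, close (n l) (s l) (c l) (c l.+1)) ->
  exists w : nat -> K, forall l i, (i < n l)%N -> mdist (w i) (c l i) <= 2 * s l.
Proof.
move=> cK s0 sS nl nS cS.
(* Coordinate [i] is controlled from stage [i + 1] on, as [l <= n l]. *)
have /choice[w wP] : forall i, exists y : K,
    forall l, mdist y (c (i.+1 + l)%N i) <= 2 * s (i.+1 + l)%N.
  move=> i; apply: (@geometric_seq_cvg _ _ (fun l => c (i.+1 + l)%N i)) => [|l|l|l] //=.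
  - by rewrite addnS.
  - by rewrite addnS; apply: cS; apply: leq_trans (nl _); rewrite leq_addr.
have nmono l j : (n l <= n (l + j))%N.
  by elim: j => [|j IH]; [rewrite addn0|rewrite addnS (leq_trans IH)].
exists w => l i il.
have tri j : mdist (c l i) (c (l + j)%N i) <= 2 * s l - 2 * s (l + j)%N.
  elim: j => [|j IH]; first by rewrite addn0 subrr mdistxx.
  have := metric_triangle (c l i) (c (l + j)%N i) (c (l + j).+1 i).
  have := cS (l + j)%N i (leq_trans il (nmono l j)); have := sS (l + j)%N.
  by rewrite addnS; lra.
have := wP i l; have := tri i.+1; rewrite [(l + _)%N]addnC => h1 h2.
have := metric_triangle (w i) (c (i.+1 + l)%N i) (c l i).
by rewrite (metric_sym (c (i.+1 + l)%N i)); lra.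
Qed.

(** One step of the back-and-forth. The formula isolating the extended tuple in [M] is satisfied in
    [N] near [c'] because types are near; since the start of the tuple found is near [b], that
    formula isolates in [N] too. *)
Lemma isolated_extension M N (b : nat -> M) (b' : nat -> N) k d c c' m (e e' r : R) x :
  isolated F b k d -> near_type F k (d / 8) b b' -> (k <= m)%N -> close k d b c ->
  close k r b' c' -> 0 < r -> near_type F m e c' c -> 0 < e -> r + e <= d * 7 / 8 -> 0 < e' ->
  exists z, [/\ close m e c' z, near_type F m.+1 e' (upd c m x) z &
    near_type F m.+1 e' z (upd c m x)].
Proof.
move=> ib bb' km bc bc' r0 cc e0 re e'0.
have agc : agree m c (upd c m x) by exact: agree_upd.
have bc1 : close k d b (upd c m x).
  by move=> i ik; rewrite -agc ?bc// (leq_trans ik).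
have e20 : 0 < e' / 2 by rewrite divr_gt0.
have [theta [Ft tc th]] := ib m.+1 _ _ (leqW km) bc1 e20.
have cc1 : near_type F m e c' (upd c m x) by apply: near_agree cc.
have [z cz tz] := near_ext FF cc1 (leqnSn m) (Fd_base Ft) tc.
(* The bound [7 d / 8] in the hypothesis leaves exactly [d / 8] for the passage from [b] to [b']. *)
have bz : near_type F k d b z.
  apply: (near_le (r := d / 8 + (r + e))); first by lra.
  apply: (near_trans FF (d := b')) => //; first by lra.
  by apply: near_close; apply: (close_trans bc') => i ik; apply: cz; exact: leq_trans km.
have n1 : near_type F m.+1 (e' / 2) (upd c m x) z.
  exact: (near_transfer FF (leqW km) (leqnn m.+1) (Fd_base Ft) th bz tz).
exists z; split => //; first by apply: near_le n1; lra.
by apply: (near_sym FF e20 _ n1); lra.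
Qed.

Section Limit.
Variables (M N : structure L) (b : nat -> M) (b' : nat -> N) (k : nat) (d : R).
Variables (e : nat -> M) (e' : nat -> N).
Hypotheses (de : dense_seq e) (de' : dense_seq e') (d0 : 0 < d).
Hypotheses (ib : isolated F b k d) (ib' : isolated F b' k d).
Hypotheses (bb' : near_type F k (d / 8) b b') (b'b : near_type F k (d / 8) b' b).

Let s := halving (d / 8).
Let s0 l : 0 < s l. Proof. by apply: halving_gt0; rewrite divr_gt0. Qed.
Let sS l : s l.+1 = s l / 2. Proof. exact: halvingS. Qed.
Let s_le l : s l <= d / 8.
Proof. by elim: l => [|l IH]; [rewrite /s /halving expr0 divr1|rewrite sS; have := s0 l; lra]. Qed.

(** Each stage adds one entry for [M] and one for [N], hence the length [k + 2 l]. The permitted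
    radius grows by [s l] per stage, the amount by which tuples move, and stays below [d / 2]. *)
Definition stage l (x : (nat -> M) * (nat -> N)) :=
  [/\ close k (d / 2 - 2 * s l) b x.1, close k (d / 2 - 2 * s l) b' x.2,
    near_type F (k + l.*2) (s l) x.1 x.2 & near_type F (k + l.*2) (s l) x.2 x.1].

(** [logn 2] takes every value infinitely often. *)
Definition visited (l : nat) : nat := logn 2 l.

Definition successor l (x y : (nat -> M) * (nat -> N)) :=
  [/\ close (k + l.*2) (s l) x.1 y.1, close (k + l.*2) (s l) x.2 y.2,
    mdist (e (visited l)) (y.1 (k + l.*2)%N) < s l &
    mdist (e' (visited l)) (y.2 (k + l.*2).+1) < s l].

Lemma stage_step l x : stage l x -> exists y, stage l.+1 y /\ successor l x y.
Proof.
move=> [bx1 bx2 n12 n21]; have sl := s0 l; have sl1 := sS l; have sd := s_le l.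
set m := (k + l.*2)%N in n12 n21 *.
have r0 : 0 < d / 2 - 2 * s l by lra.
have kle : (k <= m)%N by exact: leq_addr.
have [|||||z [x2z nz1 nz2]] := @isolated_extension M N b b' k d x.1 x.2 m (s l) (s l.+1)
  (d / 2 - 2 * s l) (e (visited l)) ib bb' kle _ bx2 _ n21.
- by apply: close_le bx1 => //; lra.
- by [].
- by [].
- by lra.
- by rewrite sS divr_gt0.
set c1 := upd _ _ _ in nz1 nz2.
have agc : agree m x.1 c1 by exact: agree_upd.
have bz : close k (d / 2 - s l) b' z.
  apply: (@close_le R N k k (d / 2 - 2 * s l + s l)) => //; first by lra.
  by apply: (close_trans bx2) => i ik; apply: x2z; exact: leq_trans kle.
have [|||||w [c1w nw1 nw2]] := @isolated_extension N M b' b k d z c1 m.+1 (s l.+1) (s l.+1)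
  (d / 2 - 2 * s l) (e' (visited l)) ib' b'b (leqW kle) _ _ r0 nz1.
- by apply: close_le bz => //; lra.
- by move=> i ik; rewrite -agc ?bx1// (leq_trans ik).
- by [].
- by rewrite sS; lra.
- by [].
set z1 := upd _ _ _ in nw1 nw2.
have agz : agree m.+1 z z1 by exact: agree_upd.
have mE : (k + l.+1.*2)%N = m.+2 by rewrite doubleS !addnS.
have x1w : close m (s l) x.1 w.
  move=> i im; rewrite (agc i im); apply: (lt_trans (c1w i (ltnW im))).
  by rewrite sS; lra.
have x2z1 : close m (s l) x.2 z1.
  by move=> i im; rewrite -(agz i (ltnW im)); exact: x2z.
exists (w, z1); split; last first.
  split => //=.
    have := c1w m (ltnSn m); rewrite /c1 /upd eqxx => /lt_trans; apply.
    by rewrite sS; lra.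
  by rewrite /z1 /upd eqxx mdistxx.
rewrite /stage mE /=; split => //.
  apply: (@close_le R M k k (d / 2 - 2 * s l + s l)) => //; first by rewrite sS; lra.
  by apply: (close_trans bx1) => i ik; apply: x1w; exact: leq_trans kle.
apply: (@close_le R N k k (d / 2 - 2 * s l + s l)) => //; first by rewrite sS; lra.
by apply: (close_trans bx2) => i ik; apply: x2z1; exact: leq_trans kle.
Qed.

Lemma back_and_forth : isomorphic M N.
Proof.
have st0 : stage 0 (b, b').
  have sE : s 0%N = d / 8 by rewrite /s /halving expr0 divr1.
  by rewrite /stage addn0 sE; split => //=; apply: close_refl; move: d0; lra.
have /choice[f fP] : forall lx : nat * ((nat -> M) * (nat -> N)), exists y,
    stage lx.1 lx.2 -> stage lx.1.+1 y /\ successor lx.1 lx.2 y.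
  case=> l x; have [/stage_step[y yP]|nx] := pselect (stage l x); first by exists y.
  by exists x => /nx.
pose u := fix u l := if l is l'.+1 then f (l', u l') else (b, b').
have uP l : stage l (u l).
  by elim: l => [|l IH] //; have [] := fP (l, u l) IH.
have uS l : successor l (u l) (u l.+1) by have [] := fP (l, u l) (uP l).
have lim (K : structure L) (c : nat -> nat -> K) :
    (forall l, close (k + l.*2) (s l) (c l) (c l.+1)) ->
    exists w : nat -> K, forall l i, (i < k + l.*2)%N -> mdist (w i) (c l i) <= 2 * s l.
  apply: coordinate_limits => // [|l|l|l].
  - exact: carrier_complete.
  - by rewrite sS.
  - by rewrite -addnn addnCA leq_addr.
  - by rewrite leq_add2l leq_double.
have [w wP] := lim M (fun l => (u l).1) (fun l => let: And4 h _ _ _ := uS l in h).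
have [w' w'P] := lim N (fun l => (u l).2) (fun l => let: And4 _ h _ _ := uS l in h).
(* An odd multiple of [2 ^ j] has valuation [j] and can be taken arbitrarily large. *)
have visit j n : exists l, (n <= l)%N /\ visited l = j.
  exists (2 ^ j * n.*2.+1)%N; split.
    apply: (leq_trans _ (leq_pmull _ _)); last by rewrite expn_gt0.
    by rewrite -addnn -addnS leq_addr.
  rewrite /visited lognM ?expn_gt0// pfactorK// logn_coprime ?addn0//.
  by rewrite coprime2n /= odd_double.
have dense_lim (K : structure L) (c : nat -> nat -> K) (g v : nat -> K) (i : nat -> nat) :
    dense_seq g -> (forall l, (i l < k + l.+1.*2)%N) ->
    (forall l, mdist (g (visited l)) (c l.+1 (i l)) < s l) ->
    (forall l i, (i < k + l.*2)%N -> mdist (v i) (c l i) <= 2 * s l) -> dense_seq v.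
  move=> dg il gc vP x r r0.
  have r4 : 0 < r / 4 by rewrite divr_gt0.
  have [j xj] := dg x _ r4; have d8 : 0 < d / 8 by rewrite divr_gt0.
  have [n [_ nP]] := halving_small 0 d8 r4; have [l [nl lj]] := visit j n.
  exists (i l); have := gc l; rewrite lj => h1; have h2 := vP l.+1 _ (il l).
  have h3 := nP l nl; rewrite -/(s l) in h3; rewrite sS in h2.
  have := metric_triangle x (g j) (v (i l)).
  have := metric_triangle (g j) (c l.+1 (i l)) (v (i l)).
  by rewrite (metric_sym (c l.+1 (i l))); lra.
have dw : dense_seq w.
  apply: (dense_lim M (fun l => (u l).1) e w (fun l => (k + l.*2)%N)) => // l.
    by rewrite ltn_add2l doubleS ltnS leqnSn.
  by case: (uS l).
have dw' : dense_seq w'.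
  apply: (dense_lim N (fun l => (u l).2) e' w' (fun l => (k + l.*2).+1)) => // l.
    by rewrite doubleS !addnS.
  by case: (uS l).
(* Both limits are within [3 s l] of the tuples of stage [l], which are near up to [s l]; the total
   [7 s l] is below [r]. *)
have near_lim (r : R) n : 0 < r -> near_type F n r w w' /\ near_type F n r w' w.
  move=> r0; have d8 : 0 < d / 8 by rewrite divr_gt0.
  have r9 : 0 < r / 9 by rewrite divr_gt0.
  have [l [nl /(_ l (leqnn _)) sl]] := halving_small n d8 r9; rewrite -/(s l) in sl.
  have nm : (n <= k + l.*2)%N by rewrite -addnn addnCA; exact: leq_trans (leq_addr _ _).
  have [_ _ n12 n21] := uP l.
  have c1 : close n (3 * s l) w (u l).1.
    by move=> i i_n; apply: (le_lt_trans (wP l i (leq_trans i_n nm))); have := s0 l; lra.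
  have c2 : close n (3 * s l) w' (u l).2.
    by move=> i i_n; apply: (le_lt_trans (w'P l i (leq_trans i_n nm))); have := s0 l; lra.
  have s3 : 0 < 3 * s l by rewrite mulr_gt0.
  split; apply: (near_le (r := 3 * s l + (s l + 3 * s l))); try lra.
    apply: (near_trans FF (d := (u l).1)); [have := s0 l; lra|exact: near_close|].
    apply: (near_trans FF (d := (u l).2)) => //; first exact: near_weak n12.
    exact/near_close/close_sym.
  apply: (near_trans FF (d := (u l).2)); [have := s0 l; lra|exact: near_close|].
  apply: (near_trans FF (d := (u l).1)) => //; first exact: near_weak n21.
  exact/near_close/close_sym.
have [n phi Fp|h [ih _]] := dense_iso fragF dw dw'; last by exists h.
apply/eqP; rewrite eq_le; apply/andP; split; apply/ler_addgt0Pr => r r0;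
  have [t t0 tP] := near_evs FF Fp r0; have [n1 n2] := near_lim t n t0; apply/ltW;
  exact: (tP t).
Qed.

End Limit.

End BackAndForth.

(** * Classification by countable data *)

Section LocalCompactness.
Context (R : realType).

Lemma ptws_ball_nbhs (M : metricType R) k (a : 'I_k -> M) (W : set {ptws 'I_k -> M}) :
  nbhs (a : {ptws 'I_k -> M}) W ->
  exists2 e : R, 0 < e & forall b : 'I_k -> M, (forall i, mdist (a i) (b i) < e) -> W b.
Proof.
pose G : set_system ('I_k -> M) := [set A | exists2 e : R, 0 < e &
  forall b : 'I_k -> M, (forall i, mdist (a i) (b i) < e) -> A b].
have FG : Filter G.
  split.
  - by exists 1.
  - move=> A B [e e0 eA] [e' e'0 e'B]; exists (Num.min e e'); first by rewrite lt_min e0.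
    by move=> b ab; split; [apply: eA|apply: e'B] => i; have := ab i; rewrite lt_min => /andP[].
  - by move=> A B AB [e e0 eA]; exists e => // b /eA/AB.
suff : G --> (a : {ptws 'I_k -> M}) by move=> /(_ W).
apply: ptws_cvg_coord => i A /nbhs_ballP[e /= e0 eA]; exists e => // b ab /=.
by apply: eA; rewrite ballEmdist; exact: ab.
Qed.

Lemma locally_compact_ball (M : metricType R) : locally_compact [set: M] -> forall x : M,
  exists2 e : R, 0 < e & exists2 K : set M, compact K & forall y, mdist x y < e -> K y.
Proof.
move=> lc x; have [K xK [cK _]] := lc x I; move: xK.
move=> /nbhs_ballP[e /= e0 eK]; exists e => //; exists K => // y xy.
by apply: eK => //; rewrite ballEmdist.
Qed.

Lemma locally_compact_product (L : signature R) (M : structure L) (a : nat -> M) k :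
  locally_compact [set: M] -> exists2 d : R, 0 < d &
    forall d', d' <= d -> compact_ball k d' a.
Proof.
move=> lc; have h0 := locally_compact_ball lc.
have [d d0 dP] : exists2 d : R, 0 < d & forall i, (i < k)%N ->
    exists2 K : set M, compact K & forall y, mdist (a i) y < d -> K y.
  elim: k => [|k [d d0 dP]]; first by exists 1.
  have [e e0 [K cK eK]] := h0 (a k); exists (Num.min d e); first by rewrite lt_min d0.
  move=> i; rewrite ltnS leq_eqVlt => /orP[/eqP->|ik].
    by exists K => // y; rewrite lt_min => /andP[_ /eK].
  by have [K' cK' dK'] := dP i ik; exists K' => // y; rewrite lt_min => /andP[/dK'].
exists d => // d' d'd z az.
have /choice[K KP] : forall i : 'I_k, exists K : set M, compact K /\
    forall y, mdist (a i) y < d -> K y.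
  by move=> i; have [K cK iK] := dP i (ltn_ord i); exists K.
have cK : compact [set f : prod_topology (fun _ : 'I_k => M) | forall i, K i (f i)].
  by apply: (@tychonoff _ (fun _ : 'I_k => M)) => i; case: (KP i).
pose zk n : prod_topology (fun _ : 'I_k => M) := @initial_segment M (z n) k.
have [|w [_ wc]] := cK (zk @ \oo) _.
  exists 0%N => // n _ i; have [_] := KP i; apply.
  by apply: lt_le_trans (az n i (ltn_ord i)) d'd.
have wz (e : R) n : 0 < e -> exists2 m, (n <= m)%N & forall i, mdist (w i) (zk m i) < e.
  move=> e0; have zn : (zk @ \oo) [set f | exists2 m, (n <= m)%N & f = zk m].
    by exists n => // m /= nm; exists m.
  have we : nbhs w [set f : prod_topology (fun _ : 'I_k => M) | forall i, mdist (w i) (f i) < e].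
    apply: (@filter_forall _ _ (fun i (f : prod_topology (fun _ : 'I_k => M)) =>
      mdist (w i) (f i) < e) (nbhs w)) => i.
    apply: (@proj_continuous _ (fun _ : 'I_k => M) i w [set y | mdist (w i) y < e]).
    by rewrite -ballEmdist; exact: nbhsx_ballx.
  by have [_ [[m nm ->] wm]] := wc _ _ zn we; exists m.
exists (pad w (a 0%N)).
have pE i (ik : (i < k)%N) : pad w (a 0%N) i = w (Ordinal ik).
  by rewrite /pad insubT.
split=> [i ik|e n e0].
  rewrite pE; apply/ler_addgt0Pr => e e0; have [m _ wm] := wz e 0%N e0.
  have := wm (Ordinal ik); have := az m i ik; rewrite /zk /initial_segment /=.
  have := metric_triangle (a i) (z m i) (w (Ordinal ik)).
  by rewrite (metric_sym (z m i)); lra.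
have [m nm wm] := wz e n e0; exists m => // i ik.
by rewrite pE; exact: wm.
Qed.

End LocalCompactness.

(** * Valid tuples, their data and the pieces relating them *)

Section Transport.
Context (R : realType) (L : signature R).
Variables (F : formulas L) (T : theory L).
Arguments F : clear implicits.
Hypotheses (fragF : fragment F).
Let FF := fragment_fclosed fragF.
Implicit Types M N : structure L.

Lemma isolated_iso M N (h : N -> M) e k d : iso_map h -> isolated F e k d ->
  isolated F (h \o e) k d.
Proof.
move=> hi ie p c r kp ec r0; have [[g hK gK] hd _ _] := hi.
have gi := iso_map_inv hi hK gK; have [_ gd _ _] := gi.
have hg (x : nat -> M) : h \o (g \o x) = x by apply/funext => i; exact: gK.
have gc (z : nat -> M) : close k d (h \o e) z -> close k d e (g \o z).
  by move=> ez i ik /=; have := ez i ik; rewrite /= -gd hK.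
have [theta [Ft tc th]] := ie p (g \o c) r kp (gc _ ec) r0.
exists theta; split => //; first by rewrite -(evs_iso _ _ gi).
move=> z ez tz; have := th _ (gc _ ez); rewrite (evs_iso _ _ gi) => /(_ tz).
by move=> /(near_isor hi)/(near_isol hi); rewrite !hg.
Qed.

Lemma isolated_close M (b b' : nat -> M) k d d' eta : isolated F b k d -> d' + eta <= d ->
  close k eta b b' -> isolated F b' k d'.
Proof.
move=> ib dd bb p c r kp bc r0.
have sub z : close k d' b' z -> close k d b z.
  by move=> bz; apply: close_le (close_trans bb bz) => //; rewrite addrC.
have [theta [Ft tc th]] := ib p c r kp (sub _ bc) r0.
by exists theta; split => // z /sub; exact: th.
Qed.

(** [theta] determines the type of [b] up to [r1] within its ball. The strict inequalities [d < d1]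
    and [r1 < d / 32] make validity open in [b], so that valid tuples can be taken from a dense
    sequence. *)
Definition valid M (b : nat -> M) k (theta : preformula L k) (d : R) :=
  exists d1 r1, [/\ d < d1, 0 < r1 & r1 < d / 32] /\ [/\ isolated F b k d1, evs theta b < 0 &
    forall z, close k d1 b z -> evs theta z < 0 -> near_type F k r1 b z].

(** Among valid tuples the data determine the isomorphism type. *)
Definition datum M (b : nat -> M) k (theta : preformula L k) (d : R) n (phi : preformula L n) :=
  exists z : nat -> M, [/\ close k d b z, evs theta z < 0 & evs phi z < 0].

Lemma valid_gt0 M (b : nat -> M) k (theta : preformula L k) d : valid b theta d -> 0 < d.
Proof. by move=> [d1 [r1 [[dd1 r0 rd] _]]]; lra. Qed.

Lemma valid_isolated M (b : nat -> M) k (theta : preformula L k) d : valid b theta d ->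
  isolated F b k d.
Proof.
move=> va; have d0 := valid_gt0 va; case: va => d1 [r1 [[dd1 r0 rd] [ib _ _]]].
apply: (isolated_close (eta := d1 - d) ib) => //; first by lra.
by apply: close_refl; lra.
Qed.

(** A condition met by [b'] belongs to the data of [b'], hence to those of [b]; its witness
    satisfies [theta], which forces it to be near [b]. *)
Lemma datum_near M N (b : nat -> M) (b' : nat -> N) k (theta : preformula L k) d :
  valid b theta d -> valid b' theta d ->
  (forall phi : preformula L k, F k phi -> datum b' theta d phi -> datum b theta d phi) ->
  near_type F k (d / 32) b b'.
Proof.
move=> va va' bb' phi Fp pb; have d0 := valid_gt0 va.
case: va => d1 [r1 [[dd1 r0 rd] [ib tb h]]].
have [|z [bz tz pz]] := bb' phi Fp.
  case: va' => d1' [r1' [_ [_ tb' _]]].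
  by exists b'; split => //; exact: close_refl.
have [|z' bz' pz'] := h z _ tz phi Fp pz; first by apply: close_le bz => //; exact: ltW.
by exists z' => //; apply: close_le bz' => //; exact: ltW.
Qed.

(** Conversely, data are stable: a witness for [b] is near [b] up to [r1 < d / 32] by [theta], so
    the datum is met near [b1] within [d / 2 + d / 32 < d]. *)
Lemma near_datum M N (b : nat -> M) (b1 : nat -> N) k (theta : preformula L k) d n
    (phi : preformula L n) : F k theta -> F n phi -> valid b theta d ->
  near_type F k (d / 2) b1 b -> datum b theta d phi -> datum b1 theta d phi.
Proof.
move=> Ft Fp va n1 [z [bz tz pz]]; have d0 := valid_gt0 va.
case: va => d1 [r1 [[dd1 r0 rd] [ib tb h]]].
have bz1 : close k d1 b z by apply: close_le bz => //; exact: ltW.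
have n2 := near_trans FF r0 n1 (h z bz1 tz).
have Fg := Fd_max FF (Fd_weak FF (leq_maxl k n) (Fd_base Ft))
  (Fd_weak FF (leq_maxr k n) (Fd_base Fp)).
have [|z1 bz' ] := near_ext FF n2 (leq_maxl k n) Fg; first by rewrite gt_max tz.
rewrite gt_max => /andP[tz1 pz1]; exists z1; split => //.
by apply: close_le bz' => //; lra.
Qed.

Lemma datum_iff_isomorphic M N (e : nat -> M) (e' : nat -> N) (b : nat -> M) (b' : nat -> N)
    k (theta : preformula L k) d : dense_seq e -> dense_seq e' ->
  valid b theta d -> valid b' theta d ->
  (forall phi : preformula L k, F k phi -> datum b' theta d phi <-> datum b theta d phi) ->
  isomorphic M N.
Proof.
move=> de de' va va' bb'; have d0 := valid_gt0 va.
have le (K K' : structure L) (c : nat -> K) (c' : nat -> K') : near_type F k (d / 32) c c' ->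
  near_type F k (d / 8) c c' by apply: near_le; lra.
apply: (back_and_forth fragF de de' d0 (valid_isolated va) (valid_isolated va')).
  by apply: le; apply: (datum_near va va') => phi /bb'[].
by apply: le; apply: (datum_near va' va) => phi /bb'[].
Qed.

Lemma valid_iso M N (h : N -> M) b k (theta : preformula L k) d : iso_map h ->
  valid b theta d -> valid (h \o b) theta d.
Proof.
move=> hi [d1 [r1 [dr [ib tb th]]]]; exists d1, r1; split => //; split.
- exact: isolated_iso.
- by rewrite evs_iso.
have [[g hK gK] hd _ _] := hi; have gi := iso_map_inv hi hK gK; have [_ gd _ _] := gi.
have hg (x : nat -> M) : h \o (g \o x) = x by apply/funext => i; exact: gK.
move=> z bz tz; have := th (g \o z); rewrite (evs_iso _ _ gi) => /(_ _ tz) {}th.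
have /th : close k d1 b (g \o z) by move=> i ik /=; have := bz i ik; rewrite /= -gd hK.
by move=> /(near_isor hi)/(near_isol hi); rewrite !hg.
Qed.

Lemma valid_open M (b : nat -> M) k (theta : preformula L k) d : F k theta ->
  valid b theta d ->
  exists2 eta, 0 < eta & forall b', close k eta b b' -> valid b' theta d.
Proof.
move=> Ft [d1 [r1 [[dd1 r0 rd] [ib tb th]]]].
have [eta eta0 etaP] := evs_lt_open (fragment_formula fragF Ft) tb.
pose t := Num.min eta (Num.min ((d1 - d) / 2) ((d / 32 - r1) / 2)).
have [t1 t2 t3] : [/\ t <= eta, t <= (d1 - d) / 2 & t <= (d / 32 - r1) / 2].
  by rewrite /t !ge_min !lexx !orbT.
have t0 : 0 < t by rewrite !lt_min eta0 !divr_gt0// subr_gt0.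
exists t => // b' bb'; exists (d1 - t), (r1 + t); split; first by split; lra.
split.
- by apply: isolated_close ib _ bb'; lra.
- by apply: etaP; exact: close_le bb'.
move=> z bz tz; have bz1 : close k d1 b z.
  by apply: close_le (close_trans bb' bz) => //; lra.
rewrite addrC; apply: (near_trans FF r0 _ (th z bz1 tz)).
exact/near_close/close_sym.
Qed.

Section Pieces.
Variables (M : structure L) (b b' : nat -> M) (k k' : nat).

(** [chi] links a realization of the type of [b] to one of the type of [b']. Fixing [chi] makes the
    data of [b'] a function of the data of [b]. *)
Definition piece (d d' : R) n (chi : preformula L n) :=
  evs chi (shift_seq k b b') < 0 /\ forall z, close k d b z -> evs chi z < 0 ->
    near_type F k' (d' / 32) b' (z \o addn k).

Lemma shift_close (X : metricType R) (x y : nat -> X) (d : R) : 0 < d -> close k d x (shift_seq k x y).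
Proof. by move=> d0 i ik; rewrite -(shift_seq_lo x y ik) mdistxx. Qed.

Lemma shift_addn (X : Type) (x y : nat -> X) : shift_seq k x y \o addn k = y.
Proof. by apply/funext => i; exact: shift_seq_hi. Qed.

Lemma piece_exists (theta : preformula L k) (d d' : R) : valid b theta d -> 0 < d' ->
  exists chi : preformula L (k + k'), F (k + k')%N chi /\ piece d d' chi.
Proof.
move=> va d'0; have d0 := valid_gt0 va; have ib := valid_isolated va.
have d32 : 0 < d' / 32 by rewrite divr_gt0.
have [chi [Fc cb ch]] := ib _ _ _ (leq_addr k' k) (shift_close b b' d0) d32.
exists chi; split => //; split => // z bz cz.
have := near_ren FF (v := addn k) _ (ch z bz cz); rewrite shift_addn; apply.
by move=> i ik'; rewrite ltn_add2l.
Qed.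

End Pieces.

Lemma piece_near M N (b b' : nat -> M) (b1 b1' : nat -> N) k k' d d' n (chi : preformula L n) :
  0 < d -> F n chi -> piece b b' k k' d d' chi -> evs chi (shift_seq k b1 b1') < 0 ->
  near_type F k d b b1 -> near_type F k' (d' / 32) b' b1'.
Proof.
move=> d0 Fc [_ h] c1 bb1; rewrite -(shift_addn k b1 b1').
apply: (near_transfer_ren fragF (Fd_base Fc) h _ c1).
by apply: near_agree bb1 => //; exact: shift_seq_lo.
Qed.

End Transport.

(** * Restatements with countable quantifiers *)

Section DenseForms.
Context (R : realType) (L : signature R).
Variable F : formulas L.
Arguments F : clear implicits.
Hypothesis fragF : fragment F.
Let FF := fragment_fclosed fragF.
Implicit Types M N : structure L.

Local Notation "c @@ w" := (c \o nth 0%N w) (at level 50).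

Definition index_arity (i : nat) : nat := projT1 (idx fragF i).
Definition index_formula (i : nat) : preformula L (index_arity i) := sval (projT2 (idx fragF i)).

Lemma index_formulaP i : F (index_arity i) (index_formula i).
Proof. exact: svalP (projT2 (idx fragF i)). Qed.

(** Packs the arity, so that case analysis replaces both components. *)
Variant index_spec n (phi : preformula L n) : forall m, preformula L m -> Prop :=
  IndexSpec : index_spec phi phi.

Lemma index_formula_ex n (phi : preformula L n) : F n phi ->
  exists i, index_spec phi (index_formula i).
Proof.
move=> Fp; have [i iP] := idxP fragF (existT _ n (exist _ phi Fp)); exists i.
by rewrite /index_formula /index_arity iP.
Qed.

Section Structure.
Variables (M : structure L) (c : nat -> M).
Hypothesis dc : dense_seq c.

Lemma dense_pick k d (b z : nat -> M) m (phi : preformula L m) : 0 < d -> is_formula phi ->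
  close k d b z -> evs phi z < 0 ->
  exists w : seq nat, close k d b (c @@ w) /\ evs phi (c @@ w) < 0.
Proof.
move=> d0 fp bz pz; have [e e0 eP] := evs_lt_open fp pz.
have [q [q0 qd bq]] := close_lt_ex d0 bz.
have t0 : 0 < Num.min e (d - ratr q) by rewrite lt_min e0 subr_gt0.
have [w zw] := dense_close (maxn k m) z dc t0; exists w; split.
  have zk : close k (d - ratr q) z (c @@ w).
    by apply: close_le zw; [exact: leq_maxl|rewrite ge_min lexx orbT].
  by apply: close_le (close_trans bq zk) => //; rewrite addrC subrK.
by apply: eP; apply: close_le zw; [exact: leq_maxr|rewrite ge_min lexx].
Qed.

(** Open conditions met in a ball are met by tuples of the dense sequence, so quantifying over
    indices is enough and keeps the condition Borel in the code. *)
Definition dense_near p (r : R) (w w' : nat -> nat) :=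
  forall j, index_arity j = p -> evs (index_formula j) (c \o w') < 0 ->
    exists w'' : seq nat, close p r (c \o w) (c @@ w'') /\ evs (index_formula j) (c @@ w'') < 0.

Lemma dense_nearP p r w w' : 0 < r ->
  dense_near p r w w' <-> near_type F p r (c \o w) (c \o w').
Proof.
move=> r0; split=> [h phi Fp pw|h j jp pw]; last first.
  subst p; have [z cz pz] := h _ (index_formulaP j) pw.
  exact: (dense_pick r0 (fragment_formula fragF (index_formulaP j)) cz pz).
have [j jP] := index_formula_ex Fp; have {}h := h j.
case: jP h => /(_ erefl pw)[w'' [cw pw'']].
by exists (c @@ w'').
Qed.

Lemma dense_upgrade k d (b : nat -> M) n (phi : preformula L n) p r (x : nat -> M) (v : nat -> nat) :
  0 < d -> F n phi ->
  (forall w : seq nat, close k d b (c @@ w) -> evs phi (c @@ w) < 0 ->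
    near_type F p r x (c @@ w \o v)) ->
  forall z, close k d b z -> evs phi z < 0 -> near_type F p r x (z \o v).
Proof.
move=> d0 Fp h z bz pz psi Fq qz.
have Fq' := fragment_subst fragF (@var_subst _ L p v) Fq.
have [g Fg gE] := Fd_max FF (Fd_weak FF (leq_maxl n _) (Fd_base Fp))
  (Fd_weak FF (leq_maxr _ _) (Fd_base Fq')).
have [|w [bw]] := dense_pick d0 (fragment_formula fragF Fg) bz.
  by rewrite gE gt_max pz evs_var_subst.
by rewrite gE gt_max evs_var_subst => /andP[pw qw]; exact: h qw.
Qed.

Definition dense_isolated (u : nat -> nat) k (d : R) := forall p, (k <= p)%N ->
  forall w : seq nat, close k d (c \o u) (c @@ w) -> forall r : rat, 0 < r ->
  exists i, [/\ index_arity i = p, evs (index_formula i) (c @@ w) < 0 &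
    forall w' : seq nat, close k d (c \o u) (c @@ w') -> evs (index_formula i) (c @@ w') < 0 ->
      dense_near p (ratr r) (nth 0%N w) (nth 0%N w')].

Lemma isolated_dense u k d : isolated F (c \o u) k d -> dense_isolated u k d.
Proof.
move=> h p kp w bw r r0; have r0' : 0 < ratr r :> R by rewrite ltr0q.
have [theta [Ft tw th]] := h p _ _ kp bw r0'.
have [i iP] := index_formula_ex Ft; exists i; case: iP; split => // w' bw' tw'.
by apply/dense_nearP => //; exact: th.
Qed.

(** The radius shrinks to make room for moving an arbitrary tuple into the dense sequence by [q];
    the moved tuple's isolating formula, quantified over tuples within [q], isolates the original
    one up to [3 q < r]. *)
Lemma dense_isolatedP u k d d' : 0 < d -> d' < d -> dense_isolated u k d ->
  isolated F (c \o u) k d'.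
Proof.
move=> d0 d'd h p x r kp bx r0.
have m0 : 0 < Num.min (r / 8) ((d - d') / 2) by rewrite lt_min !divr_gt0// subr_gt0.
have [q [q0]] := rat_between m0; rewrite lt_min => /andP[qr qd].
have [w xw] := dense_close p x dc q0.
have bw : close k d (c \o u) (c @@ w).
  apply: (@close_le R M k k (d' + ratr q)) => //; first by lra.
  by apply: (close_trans bx) => i ik; apply: xw; exact: leq_trans kp.
have q0' : 0 < q by rewrite -(ltr0q R).
have [i [ai wi ih]] := h p kp w bw q q0'.
have th z : close k d (c \o u) z -> evs (index_formula i) z < 0 ->
    near_type F p (ratr q) (c @@ w) z.
  move=> bz iz; apply: (dense_upgrade (v := id) d0 (index_formulaP i) _ bz iz) => w' bw' iw'.
  by apply/dense_nearP => //; exact: ih.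
have [j jp|f [Ff fP]] := @Fd_close R L F FF (p + p) p id (addn p).
  by rewrite ltn_add2l; split => //; exact: ltn_addr.
have Fi : Fdef F (p + p) (fun K (x : nat -> K) => evs (index_formula i) (x \o addn p)).
  apply: (Fd_ren FF (Fd_base (index_formulaP i))) => l; rewrite ai ltn_add2l; exact.
have [g [[phi Fp pE] g1 g2]] := Fd_tail FF (Fd_max FF Fi (Fd_subc FF q Ff)).
exists phi; split => //.
  rewrite pE; apply: (le_lt_trans (g1 _ _ (shift_seq p x (c @@ w)) (shift_seq_lo _ _))).
  rewrite gt_max shift_addn wi subr_lt0; apply/(fP _ _ _ q0) => l lp.
  by have := shift_seq_lo x (c @@ w) lp => /= <-; rewrite shift_seq_hi; exact: xw.
move=> z bz; rewrite pE => /g2[y zy]; rewrite gt_max subr_lt0 => /andP[iy].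
move=> /(fP _ _ _ q0) yc.
have zy' : close p (ratr q) z (y \o addn p) by move=> l lp; rewrite (zy l lp); exact: yc.
have byk : close k d (c \o u) (y \o addn p).
  apply: (@close_le R M k k (d' + ratr q)) => //; first by lra.
  by apply: (close_trans bz) => l lk; apply: zy'; exact: leq_trans kp.
have s1 := near_trans FF q0 (th _ byk iy) (near_close (close_sym zy')).
have s2 : near_type F p (ratr q + (ratr q + ratr q)) x z.
  by apply: (near_trans FF _ (near_close xw) s1); lra.
by apply: near_le s2; lra.
Qed.

Definition dense_valid (u : nat -> nat) (i : nat) (d d1 r1 : R) :=
  [/\ d < d1, 0 < r1 & r1 < d / 32] /\
  [/\ dense_isolated u (index_arity i) d1, evs (index_formula i) (c \o u) < 0 &
    forall w : seq nat, close (index_arity i) d1 (c \o u) (c @@ w) ->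
      evs (index_formula i) (c @@ w) < 0 -> dense_near (index_arity i) r1 u (nth 0%N w)].

Lemma dense_validP u i d d1 r1 : dense_valid u i d d1 r1 ->
  valid F (c \o u) (index_formula i) d.
Proof.
move=> [[dd1 r0 rd] [iu tu h]]; exists ((d + d1) / 2), r1; split; first by split; lra.
split => //; first by apply: dense_isolatedP iu; lra.
move=> z bz tz; have d10 : 0 < d1 by lra.
have up := @dense_upgrade _ _ (c \o u) _ _ (index_arity i) r1 (c \o u) id d10 (index_formulaP i).
apply: up tz => [w bw tw|]; first exact: (proj1 (dense_nearP _ _ _ r0) (h w bw tw)).
by apply: (close_le (leqnn _) _ bz); lra.
Qed.

Lemma valid_dense u i d : valid F (c \o u) (index_formula i) d ->
  exists d1 r1 : rat, dense_valid u i d (ratr d1) (ratr r1).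
Proof.
move=> [d1 [r1 [[dd1 r0 rd] [iu tu h]]]].
have [q1 [q11 q12]] := rat_between dd1; have [q2 [q21 q22]] := rat_between rd.
have q20 : 0 < ratr q2 :> R by exact: lt_trans q21.
exists q1, q2; split => //; split => //.
  apply: isolated_dense; apply: (isolated_close (eta := d1 - ratr q1) iu); first by lra.
  by apply: close_refl; lra.
move=> w bw tw; apply/dense_nearP => //; apply: near_le (h _ _ tw); first exact: ltW.
by apply: (close_le (leqnn _) _ bw); exact: ltW.
Qed.

Definition dense_datum (u : nat -> nat) (i : nat) (d : R) (j : nat) := exists w : seq nat,
  [/\ close (index_arity i) d (c \o u) (c @@ w), evs (index_formula i) (c @@ w) < 0 &
    evs (index_formula j) (c @@ w) < 0].

Lemma dense_datumP u i d j : 0 < d ->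
  dense_datum u i d j <-> datum (c \o u) (index_formula i) d (index_formula j).
Proof.
move=> d0; split=> [[w [cw iw jw]]|[z [cz iz jz]]]; first by exists (c @@ w).
have [g Fg gE] := Fd_max FF (Fd_weak FF (leq_maxl _ (index_arity j)) (Fd_base (index_formulaP i)))
  (Fd_weak FF (leq_maxr _ _) (Fd_base (index_formulaP j))).
have [|w [bw]] := dense_pick d0 (fragment_formula fragF Fg) cz.
  by rewrite gE gt_max iz.
by rewrite gE gt_max => /andP[iw jw]; exists w.
Qed.

Definition dense_piece (u u' : nat -> nat) (i i' : nat) (d d' : R) (j : nat) :=
  evs (index_formula j) (c \o shift_seq (index_arity i) u u') < 0 /\
  forall w : seq nat, close (index_arity i) d (c \o u) (c @@ w) ->
    evs (index_formula j) (c @@ w) < 0 ->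
    dense_near (index_arity i') (d' / 32) u' (nth 0%N w \o addn (index_arity i)).

Lemma comp_shift k u u' : c \o shift_seq k u u' = shift_seq k (c \o u) (c \o u').
Proof. by apply/funext => i; rewrite /shift_seq /=; case: ifP. Qed.

Lemma dense_pieceP u u' i i' d d' j : 0 < d -> 0 < d' -> dense_piece u u' i i' d d' j <->
  piece F (c \o u) (c \o u') (index_arity i) (index_arity i') d d' (index_formula j).
Proof.
move=> d0 d'0; have d32 : 0 < d' / 32 by rewrite divr_gt0.
rewrite /dense_piece comp_shift; split=> -[h1 h2]; split => //.
  apply: (dense_upgrade d0 (index_formulaP j)) => w bw jw.
  by rewrite -compA; apply/dense_nearP => //; exact: h2.
by move=> w bw jw; apply/dense_nearP => //; rewrite compA; exact: h2.
Qed.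

End Structure.

End DenseForms.

(** * Borel codes for valid tuples and the two reductions *)

Section ClassificationByData.
Context (R : realType) (L : signature R) (T : theory L).
Variables F0 F : formulas L.
Arguments F : clear implicits.
Arguments F0 : clear implicits.
Hypotheses (fragF0 : fragment F0) (TF0 : theory_in F0 T).
Hypotheses (fragF : fragment F) (TF : theory_in F T).
Hypothesis T_lc : forall M : structure L,
  separable_space M -> models M T -> locally_compact [set: M].
Let FF := fragment_fclosed fragF.

Local Notation X := (set_type (Mod F0 T)).
Local Notation "c @@ w" := (c \o nth 0%N w) (at level 50).
Local Notation cs := (coded_structure fragF0).
Local Notation csq := (coded_seq fragF0).

Hypothesis rigid_interior : forall xi : X, exists k : nat,
  interior [set a : {ptws 'I_k -> cs xi} | rigid T (tp F a)] !=set0.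

(** The isolated tuple lives in a generic model and is carried over by an isomorphism; openness of
    validity then replaces it by a tuple of the coded dense sequence. *)
Lemma valid_exists (xi : X) : exists (u : seq nat) (d : rat) (i : nat),
  0 < d /\ valid F (csq xi @@ u) (index_formula fragF i) (ratr d).
Proof.
have [k [a0 /ptws_ball_nbhs[e e0 eP]]] := rigid_interior xi.
have sM := coded_separable fragF0 xi.
have MT := @coded_models _ _ _ fragF0 _ TF0 xi.
have dM := @coded_dense _ _ _ fragF0 T xi.
pose a := pad a0 (csq xi 0%N).
have [d1 d10 d1P] := locally_compact_product a k (T_lc sM MT).
(* Strictly below [e], because compactness yields points of the closed ball and their types must
   still be rigid. *)
pose d := Num.min d1 (e / 2).
have d0 : 0 < d by rewrite lt_min d10 divr_gt0.
have de : d < e.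
  have : d <= e / 2 by rewrite ge_min lexx orbT.
  by lra.
have cb : compact_ball k d a by apply: d1P; rewrite ge_min lexx.
have aE : @initial_segment _ a k = a0 by exact: initial_pad.
have rg (c : nat -> cs xi) : (forall i, (i < k)%N -> mdist (a i) (c i) <= d) ->
    rigid T (tp F (@initial_segment (cs xi) c k)).
  move=> ac; apply: eP => i; rewrite -aE; apply: le_lt_trans (ac i (ltn_ord i)) de.
have star (N : structure L) (y : nat -> N) : dense_seq y -> models N T ->
    near_type F k d a y -> isomorphic N (cs xi).
  move=> dy NT ay; apply: (rigid_ball fragF sM MT d0 cb rg _ NT ay).
  exact: dense_seq_separable dy.
have d16 : 0 < d / 16 by rewrite divr_gt0.
have [theta0 [F0t t0 t0P]] := near_open fragF d16 cb.
have [N [y [NT dy [h hi] yi]]] := isolated_model fragF TF MT dM d0 star F0t t0 t0P.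
have bi := isolated_iso hi yi; set b := h \o y in bi.
(* The rational radius [q < d / 16] and the precision [q / 64] leave the slack that [valid] asks for
   against the isolation radius [d / 8]. *)
have [q [q0 qd]] := rat_between d16.
have r0 : 0 < ratr q / 64 :> R by rewrite divr_gt0.
have d8 : 0 < d / 8 by rewrite divr_gt0.
have [theta [Ft tb th]] := bi k b (ratr q / 64) (leqnn k) (close_refl b d8) r0.
have vb : valid F b theta (ratr q).
  exists (d / 8), (ratr q / 64); split; last by split.
  by split => //; [apply: lt_trans qd _|]; lra.
have [eta eta0 etaP] := valid_open fragF Ft vb.
have [u bu] := dense_close k b dM eta0.
have [i iP] := index_formula_ex fragF Ft; exists u, q, i.
split; first by rewrite -(ltr0q R).
by case: iP; exact: etaP.
Qed.

Definition code := (seq nat * (rat * (nat * (rat * rat))))%type.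

Definition code_valid (s : code) (xi : X) : Prop :=
  let: (u, (d, (i, (d1, r1)))) := s in
  dense_valid fragF (csq xi) (nth 0%N u) i (ratr d) (ratr d1) (ratr r1).

(** Entry [0] records the radius and the formula, since data are comparable only for the same ones;
    the tuple and the slack are not part of the invariant. *)
Definition code_data (s : code) (xi : X) (m : nat) : nat :=
  let: (u, (d, (i, _))) := s in
  if m is j.+1 then
    ind [set xi | dense_datum fragF (csq xi) (nth 0%N u) i (ratr d) j] xi
  else pickle (d, i).

Definition code_piece (p : rat * (nat * nat)) (s s' : code) (xi : X) : Prop :=
  let: (d', (i', j)) := p in
  let: (u, (d, (i, _))) := s in
  let: (u', (d2, (i2, _))) := s' in
  (d2, i2) = (d', i') /\
  dense_piece fragF (csq xi) (nth 0%N u) (nth 0%N u') i i' (ratr d) (ratr d') j.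

Lemma code_validP s xi : code_valid s xi ->
  valid F (csq xi @@ s.1) (index_formula fragF s.2.2.1) (ratr s.2.1).
Proof.
by case: s => u [d [i [d1 r1]]] /=; apply: dense_validP; exact: coded_dense.
Qed.

Lemma valid_code (xi : X) (u : seq nat) (d : rat) i :
  valid F (csq xi @@ u) (index_formula fragF i) (ratr d) ->
  exists d1 r1, code_valid (u, (d, (i, (d1, r1)))) xi.
Proof. by move=> /(valid_dense (@coded_dense _ _ _ fragF0 T xi))[d1 [r1 h]]; exists d1, r1. Qed.

Lemma code_data_eq s s' xi xi' : code_valid s xi -> code_valid s' xi' ->
  code_data s xi = code_data s' xi' <->
  [/\ s.2.1 = s'.2.1, s.2.2.1 = s'.2.2.1 & forall j,
    datum (csq xi @@ s.1) (index_formula fragF s.2.2.1) (ratr s.2.1) (index_formula fragF j) <->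
    datum (csq xi' @@ s'.1) (index_formula fragF s'.2.2.1) (ratr s'.2.1) (index_formula fragF j)].
Proof.
move=> vs vs'; have d0 := valid_gt0 (code_validP vs); have d0' := valid_gt0 (code_validP vs').
have dP := dense_datumP fragF (@coded_dense _ _ _ fragF0 T xi) (nth 0%N s.1) s.2.2.1 _ d0.
have dP' := dense_datumP fragF (@coded_dense _ _ _ fragF0 T xi') (nth 0%N s'.1) s'.2.2.1 _ d0'.
case: s vs d0 dP => u [d [i r]] /= vs d0 dP; case: s' vs' d0' dP' => u' [d' [i' r']] /= vs' d0' dP'.
split=> [e|[ed ei e]]; last first.
  by subst d' i'; apply/funext => -[|j] //=; apply: ind_eq; rewrite /= dP dP'.
have e0 : pickle (d, i) = pickle (d', i') := congr1 (@^~ 0%N) e.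
have [ed ei] := pcan_inj pickleK e0; split => // j.
subst d' i'; rewrite -dP -dP'; have /= ej := congr1 (@^~ j.+1) e.
have iA := indP [set xi | dense_datum fragF (csq xi) (nth 0%N u) i (ratr d) j] xi.
have iB := indP [set xi | dense_datum fragF (csq xi) (nth 0%N u') i (ratr d) j] xi'.
by split=> h; [apply/iB; rewrite -ej; exact/iA|apply/iA; rewrite ej; exact/iB].
Qed.

Let SX := borel_sigma X.

Lemma bor_close p (r : R) v w :
  borel [set xi : X | close p r (csq xi \o v) (csq xi \o w)].
Proof.
apply: (bor_all SX) => i; apply: (bor_imp SX); first exact: bor_const.
pose phi : preformula L 2 := Dist (Var L ord0) (Var L ord_max).
have fp : is_formula phi by [].
have m := rmeas_evs fragF0 (T := T) fp (fun j => if j is 0 then v i else w i).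
exact: (rmeas_lt SX m (rmeas_const SX r)).
Qed.

Lemma bor_evs i v :
  borel [set xi : X | evs (index_formula fragF i) (csq xi \o v) < 0].
Proof.
have m := rmeas_evs fragF0 (T := T) (fragment_formula fragF (index_formulaP fragF i)) v.
by apply: (bor_ext _ (m 0)) => xi; rewrite rmorph0.
Qed.

Lemma bor_dense_near p r w w' : borel [set xi : X | dense_near fragF (csq xi) p r w w'].
Proof.
apply: (bor_all SX) => j; apply: (bor_imp SX); first exact: bor_const.
apply: (bor_imp SX); first exact: bor_evs.
apply: (bor_ex SX) => w''; apply: (bor_and SX); [exact: bor_close|exact: bor_evs].
Qed.

Lemma bor_code_valid s : borel [set xi | code_valid s xi].
Proof.
case: s => u [d [i [d1 r1]]]; apply: (bor_and SX); first exact: bor_const.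
set k := index_arity fragF i; set D : R := ratr d1.
have S1 : borel [set xi : X | dense_isolated fragF (csq xi) (nth 0%N u) k D].
  apply: (bor_all SX) => p; apply: (bor_imp SX); first exact: bor_const.
  apply: (bor_all SX) => w; apply: (bor_imp SX); first exact: bor_close.
  apply: (bor_all SX) => r; apply: (bor_imp SX); first exact: bor_const.
  apply: (bor_ex SX) => j.
  have h := bor_and SX (bor_const SX (index_arity fragF j = p))
    (bor_and SX (bor_evs j (nth 0%N w)) (bor_all SX (fun w' : seq nat =>
      bor_imp SX (bor_close k D (nth 0%N u) (nth 0%N w'))
      (bor_imp SX (bor_evs j (nth 0%N w')) (bor_dense_near p (ratr r) (nth 0%N w) (nth 0%N w')))))).
  by apply: (bor_ext _ h) => xi; split=> [[? []]|[]].
have h := bor_and SX S1 (bor_and SX (bor_evs i (nth 0%N u)) (bor_all SX (fun w : seq nat =>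
  bor_imp SX (bor_close k D (nth 0%N u) (nth 0%N w))
    (bor_imp SX (bor_evs i (nth 0%N w)) (bor_dense_near k (ratr r1) (nth 0%N u) (nth 0%N w)))))).
by apply: (bor_ext _ h) => xi; split=> [[? []]|[]].
Qed.

Lemma bor_code_data s m : bnat (@borel X) (code_data s ^~ m).
Proof.
case: s => u [d [i r]]; case: m => [|j] /=; first exact: bnat_const.
apply: (bnat_ind SX); apply: (bor_ex SX) => w.
have h := bor_and SX (bor_close (index_arity fragF i) (ratr d) (nth 0%N u) (nth 0%N w))
  (bor_and SX (bor_evs i (nth 0%N w)) (bor_evs j (nth 0%N w))).
by apply: (bor_ext _ h) => xi; split=> [[? []]|[]].
Qed.

Lemma bor_code_piece p s s' : borel [set xi | code_piece p s s' xi].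
Proof.
case: p => d' [i' j]; case: s => u [d [i r]]; case: s' => u' [d2 [i2 r']].
apply: (bor_and SX); first exact: bor_const.
apply: (bor_and SX); first exact: bor_evs.
apply: (bor_all SX) => w; apply: (bor_imp SX); first exact: bor_close.
apply: (bor_imp SX); first exact: bor_evs.
exact: bor_dense_near.
Qed.

Lemma datum_ext (M N : structure L) (b : nat -> M) (b' : nat -> N) i (d : R) :
  (forall j, datum b (index_formula fragF i) d (index_formula fragF j) <->
     datum b' (index_formula fragF i) d (index_formula fragF j)) ->
  forall n (phi : preformula L n), F n phi ->
    datum b (index_formula fragF i) d phi <-> datum b' (index_formula fragF i) d phi.
Proof.
move=> h n phi Fp; have [j jP] := index_formula_ex fragF Fp; have {}h := h j.
by case: jP h.
Qed.

Local Notation E := (@iso_rel R L F0 T fragF0).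

Lemma code_separates xi xi' s s' : code_valid s xi -> code_valid s' xi' ->
  code_data s xi = code_data s' xi' -> E xi xi'.
Proof.
move=> vs vs' /(code_data_eq vs vs')[ed ei ej].
have va := code_validP vs; have va' := code_validP vs'; rewrite -ed -ei in va' ej.
apply: (datum_iff_isomorphic fragF (@coded_dense _ _ _ fragF0 T xi)
  (@coded_dense _ _ _ fragF0 T xi') va va') => phi Fp.
by have [] := datum_ext ej Fp.
Qed.

(** The image of the tuple need not belong to the other dense sequence. Moving it by [d / 4] keeps
    it valid and keeps its data, as [d / 4 + d / 4 = d / 2]. *)
Lemma code_invariant xi xi' s : E xi xi' -> code_valid s xi ->
  exists2 s', code_valid s' xi' & code_data s' xi' = code_data s xi.
Proof.
move=> [h hi] vs; have va := code_validP vs; have vh := valid_iso hi va.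
case: s vs va vh => u [d [i r]] vs /= va vh.
have d0 := valid_gt0 va; have d4 : 0 < ratr d / 4 :> R by rewrite divr_gt0.
have [eta eta0 etaP] := valid_open fragF (index_formulaP fragF i) vh.
have m0 : 0 < Num.min eta (ratr d / 4) by rewrite lt_min eta0.
have [u' bu] := dense_close (index_arity fragF i) (h \o (csq xi @@ u))
  (@coded_dense _ _ _ fragF0 T xi') m0.
have va' : valid F (csq xi' @@ u') (index_formula fragF i) (ratr d).
  by apply: etaP; apply: (close_le (leqnn _) _ bu); rewrite ge_min lexx.
have [d1 [r1 vs']] := valid_code va'.
exists (u', (d, (i, (d1, r1)))) => //; apply/(code_data_eq vs' vs); split => //= j.
have bu4 : close (index_arity fragF i) (ratr d / 4) (h \o (csq xi @@ u)) (csq xi' @@ u').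
  by apply: (close_le (leqnn _) _ bu); rewrite ge_min lexx orbT.
have half : ratr d / 4 + ratr d / 4 = ratr d / 2 :> R by lra.
have Fi := index_formulaP fragF i; have Fj := index_formulaP fragF j.
split; [apply: (near_datum fragF Fi Fj va')|apply: (near_datum fragF Fi Fj va)];
  rewrite -half; apply: (near_trans FF d4).
- exact: (near_isol hi (@near_refl R L F _ _ _ _ d4)).
- exact: (near_close bu4).
- exact: (near_close (close_sym bu4)).
- exact: (near_isor hi (@near_refl R L F _ _ _ _ d4)).
Qed.

Lemma code_piece_cover xi s s' : code_valid s xi -> code_valid s' xi ->
  exists p, code_piece p s s' xi.
Proof.
move=> vs vs'; have va := code_validP vs; have va' := code_validP vs'.
have d0 := valid_gt0 va; have d0' := valid_gt0 va'.
case: s vs va d0 => u [d [i r]] vs /= va d0; case: s' vs' va' d0' => u' [d' [i' r']] vs' /= va' d0'.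
have [chi [Fc pc]] := piece_exists fragF (csq xi @@ u') (index_arity fragF i') va d0'.
have [j jP] := index_formula_ex fragF Fc.
exists (d', (i', j)); split => //.
apply/(dense_pieceP fragF (@coded_dense _ _ _ fragF0 T xi)) => //.
by case: jP.
Qed.

(** Equal data make the first tuples near in both directions. The common formula of the piece passes
    this to the second tuples up to [d' / 32], which is within the stability of data. *)
Lemma code_piece_fun p xi s s' xi1 s1 s1' :
  code_valid s xi -> code_valid s' xi -> code_valid s1 xi1 -> code_valid s1' xi1 ->
  code_piece p s s' xi -> code_piece p s1 s1' xi1 ->
  code_data s xi = code_data s1 xi1 -> code_data s' xi = code_data s1' xi1.
Proof.
move=> vs vs' vs1 vs1'.
have va := code_validP vs; have va' := code_validP vs'.
have va1 := code_validP vs1; have va1' := code_validP vs1'.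
have d0 := valid_gt0 va; have d0' := valid_gt0 va'.
move=> pc pc1 /(code_data_eq vs vs1)[ed ei ej]; apply/(code_data_eq vs' vs1').
case: p pc pc1 => d' [i' j].
case: s vs va d0 ed ei ej => u [d [i r]] vs /= va d0 ed ei ej.
case: s' vs' va' d0' => u' [d2 [i2 r']] vs' /= va' d0' [[d2E i2E] pc].
case: s1 vs1 va1 ed ei ej => u1 [d1 [i1 r1]] vs1 /= va1 ed ei ej.
case: s1' vs1' va1' => u1' [d3 [i3 r1']] vs1' /= va1' [[d3E i3E] pc1].
subst d1 i1 d2 i2 d3 i3; split => //.
have ej' := datum_ext ej.
have dd := @coded_dense _ _ _ fragF0 T.
have {}pc := proj1 (dense_pieceP fragF (dd xi) _ _ _ _ _ d0 d0') pc.
have {}pc1 := proj1 (dense_pieceP fragF (dd xi1) _ _ _ _ _ d0 d0') pc1.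
have n1 : near_type F (index_arity fragF i) (ratr d) (csq xi @@ u) (csq xi1 @@ u1).
  apply: (near_le (r := ratr d / 32)); first by lra.
  by apply: (datum_near va va1) => phi /ej'[].
have n2 : near_type F (index_arity fragF i) (ratr d) (csq xi1 @@ u1) (csq xi @@ u).
  apply: (near_le (r := ratr d / 32)); first by lra.
  by apply: (datum_near va1 va) => phi /ej'[].
have n1' := piece_near fragF d0 (index_formulaP fragF j) pc (proj1 pc1) n1.
have n2' := piece_near fragF d0 (index_formulaP fragF j) pc1 (proj1 pc) n2.
move=> l; have Fi := index_formulaP fragF i'; have Fl := index_formulaP fragF l.
split; [apply: (near_datum fragF Fi Fl va'); apply: near_le n2'|
  apply: (near_datum fragF Fi Fl va1'); apply: near_le n1']; lra.
Qed.

Lemma iso_rel_equivalence : RelationClasses.Equivalence E.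
Proof.
split.
- by move=> xi; exact: isomorphic_refl.
- by move=> xi xi'; exact: isomorphic_sym.
- by move=> xi xi' xi''; exact: isomorphic_trans.
Qed.

Let dflt (A : Type) (f : code -> A) (a : A) (n : nat) : A := if unpickle n is Some s then f s else a.
Let V := dflt (fun s => [set xi | code_valid s xi]) set0.
Let g := dflt code_data (fun _ _ => 0%N).
Let Pc (c n n' : nat) : set X :=
  if unpickle c is Some p
  then dflt (fun s => dflt (fun s' => [set xi | code_piece p s s' xi]) set0 n') set0 n
  else set0.

Theorem classified_by_data :
  potentially_Sigma02 R E /\ essentially_countable R E.
Proof.
have [j [std0 gen0]] := Mod_standard fragF0 TF0.
have bV n : borel (V n).
  by rewrite /V /dflt; case: unpickle => [s|]; [exact: bor_code_valid|exact: sa_set0].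
have bg n m : bnat (@borel X) (g n ^~ m).
  by rewrite /g /dflt; case: unpickle => [s|]; [exact: bor_code_data|exact: bnat_const].
have Vs (s : code) xi : V (pickle s) xi = code_valid s xi by rewrite /V /dflt pickleK.
have gs (s : code) : g (pickle s) = code_data s by rewrite /g /dflt pickleK.
have unV n xi : V n xi -> exists s : code,
    [/\ V n = [set xi | code_valid s xi], g n = code_data s & unpickle n = Some s].
  by rewrite /V /g /dflt; case: unpickle => // s _; exists s.
have cover xi : exists n, V n xi.
  have [u [d [i [d0 va]]]] := valid_exists xi; have [d1 [r1 vs]] := valid_code va.
  by exists (pickle (u, (d, (i, (d1, r1))))); rewrite Vs.
have sep x x' n n' : V n x -> V n' x' -> g n x = g n' x' -> E x x'.
  move=> Vn Vn'; have [s [sV sg _]] := unV _ _ Vn; have [s' [sV' sg' _]] := unV _ _ Vn'.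
  by move: Vn Vn'; rewrite sV sV' sg sg'; exact: code_separates.
have inv x x' n : E x x' -> V n x -> exists2 n', V n' x' & g n' x' = g n x.
  move=> Exx Vn; have [s [sV sg _]] := unV _ _ Vn; rewrite sV in Vn.
  have [s' vs' e] := code_invariant Exx Vn.
  by exists (pickle s'); rewrite ?Vs// gs sg.
split.
  apply: (@potentially_Sigma02_codes R X j std0 gen0 V g E bV bg) => x x'.
  split=> [Exx|[n [n' [Vn Vn' e]]]]; last exact: sep e.
  have [n Vn] := cover x; have [n' Vn' e] := inv _ _ _ Exx Vn.
  by exists n, n'.
apply: (@essentially_countable_codes R X j std0 gen0 V g E bV bg Pc) => //.
- move=> c n n'; rewrite /Pc /dflt; case: unpickle => [p|]; last exact: sa_set0.
  case: unpickle => [s|]; last exact: sa_set0.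
  by case: unpickle => [s'|]; [exact: bor_code_piece|exact: sa_set0].
- exact: iso_rel_equivalence.
- move=> x n n' Vn Vn'; have [s [sV _ se]] := unV _ _ Vn; have [s' [sV' _ se']] := unV _ _ Vn'.
  rewrite sV in Vn; rewrite sV' in Vn'; have [p pP] := code_piece_cover Vn Vn'.
  by exists (pickle p); rewrite /Pc /dflt pickleK se se'.
move=> c x n n' x1 n1 n1' Vn Vn' V1 V1'.
have [s [sV sg se]] := unV _ _ Vn; have [s' [sV' sg' se']] := unV _ _ Vn'.
have [s1 [sV1 sg1 se1]] := unV _ _ V1; have [s1' [sV1' sg1' se1']] := unV _ _ V1'.
rewrite sV in Vn; rewrite sV' in Vn'; rewrite sV1 in V1; rewrite sV1' in V1'.
rewrite sg sg' sg1 sg1' /Pc /dflt se se' se1 se1'; case: unpickle => // p.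
exact: code_piece_fun.
Qed.

End ClassificationByData.

(** * Rigid types from countably separated classes *)

Section FragmentExtension.
Context (R : realType) (L : signature R).
Variable F0 : formulas L.
Arguments F0 : clear implicits.
Hypothesis fragF0 : fragment F0.

Definition some_formula := {n : nat & preformula L n}.
Definition formula_of n (phi : preformula L n) : some_formula := existT _ n phi.

Lemma formula_of_inj n : injective (@formula_of n).
Proof. move=> p q pq; exact: (Eqdep_dec.inj_pair2_eq_dec _ PeanoNat.Nat.eq_dec _ _ _ _ pq). Qed.

(** Terms embed into the countable set of formulas [Dist t t] of the fragment. *)
Lemma countable_terms m : exists f : term L m -> nat, injective f.
Proof.
have /countable_injP[f fi] := fragment_countable fragF0 m.
exists (fun t => f (Dist t t)) => t u tu.
pose left n (p : preformula L n) : option (term L n) :=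
  if p is Dist _ t _ then Some t else None.
have h : Dist t t = Dist u u.
  by apply: fi => //; rewrite inE; exact: fragment_dist.
by have [] := congr1 (@left m) h.
Qed.

Definition term_code m : term L m -> nat := projT1 (cid (countable_terms m)).
Lemma term_code_inj m : injective (@term_code m).
Proof. exact: projT2 (cid (countable_terms m)). Qed.

(** A substitution is a finite tuple of terms, so a list of term codes names it; lists that name
    none leave [x] unchanged. *)
Definition subst_op (m : nat) (w : seq nat) (x : some_formula) : some_formula :=
  let: existT n p := x in
  if pselect (exists s : 'I_n -> term L m, forall i, term_code (s i) = nth 0%N w i) is left h
  then formula_of (subst p (projT1 (cid h))) else x.

Lemma subst_opP n (p : preformula L n) m (s : 'I_n -> term L m) :
  exists w, subst_op m w (formula_of p) = formula_of (subst p s).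
Proof.
exists [seq term_code (s i) | i <- enum 'I_n].
have sE (i : 'I_n) : nth 0%N [seq term_code (s j) | j <- enum 'I_n] i = term_code (s i).
  by rewrite (nth_map i) ?size_enum_ord// nth_ord_enum.
rewrite /subst_op /=; case: pselect => [h|[]]; last by exists s => i; rewrite sE.
congr (formula_of (subst p _)); apply/funext => i.
by apply: term_code_inj; rewrite (projT2 (cid h)) sE.
Qed.

Definition binary_op (f : forall n, preformula L n -> preformula L n -> preformula L n)
    (x y : some_formula) : some_formula :=
  let: existT n p := x in
  match y with existT m q =>
    if m =P n is ReflectT e then formula_of (f n p (ecast n (preformula L n) e q)) else x end.

Lemma binary_opE f n (p q : preformula L n) :
  binary_op f (formula_of p) (formula_of q) = formula_of (f n p q).
Proof. by rewrite /binary_op /=; case: eqP => // e; rewrite (eq_axiomK e). Qed.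

Definition quantifier_op (f : forall n, preformula L n.+1 -> preformula L n)
    (x : some_formula) : some_formula :=
  match x with
  | existT 0 _ => x
  | existT n.+1 p => formula_of (f n p)
  end.

Definition subformula_op (j : nat) (x : some_formula) : some_formula :=
  match projT2 x with
  | Scale _ _ p => formula_of p
  | Add _ p q | Max _ p q | Min _ p q => formula_of (if j is 0 then p else q)
  | Sup _ p | Inf _ p => formula_of p
  | CSup _ ps | CInf _ ps => formula_of (ps j)
  | _ => x
  end.

Definition basic_op (c m : nat) (r : rat) (w : seq nat) (x y : some_formula) : some_formula :=
  match c with
  | 0 => binary_op (@Add R L) x y
  | 1 => formula_of (Scale r (projT2 x))
  | 2 => binary_op (@Max R L) x y
  | 3 => binary_op (@Min R L) x y
  | 4 => quantifier_op (@Sup R L) x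
  | 5 => quantifier_op (@Inf R L) x
  | 6 => subformula_op m x
  | 7 => subst_op m w x
  | _ => x
  end.

Definition closure_op (j : nat) (x y : some_formula) : some_formula :=
  if (unpickle j : option (nat * (nat * (rat * seq nat)))) is Some (c, (m, (r, w)))
  then basic_op c m r w x y else x.

Lemma closure_op_formula j x y : is_formula (projT2 x) -> is_formula (projT2 y) ->
  is_formula (projT2 (closure_op j x y)).
Proof.
have bin f : (forall n p q, is_formula p -> is_formula q -> is_formula (f n p q)) ->
    is_formula (projT2 x) -> is_formula (projT2 y) -> is_formula (projT2 (binary_op f x y)).
  move=> hf; case: x y => n p [m q] /= fp fq; case: eqP => //= e.
  by apply: hf => //; case: _ / e.
rewrite /closure_op; case: unpickle => [[c [m [r w]]]|//] fx fy.
rewrite /basic_op; case: c => [|[|[|[|[|[|[|[|c]]]]]]]] //=.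
- exact: bin.
- exact: bin.
- exact: bin.
- by case: x fx {bin} => -[|n] p.
- by case: x fx {bin} => -[|n] p.
- case: x fx {bin} => n p /=; rewrite /subformula_op /=.
  case: p => //= {}n.
  + by move=> p q [fp fq]; case: m.
  + by move=> p q [fp fq]; case: m.
  + by move=> p q [fp fq]; case: m.
  + by move=> ps [fps _].
  + by move=> ps [fps _].
- case: x fx {bin} => n p /= fp; rewrite /subst_op; case: pselect => // h.
  exact: is_formula_subst.
Qed.

Variable G : nat -> some_formula.
Hypothesis G_formula : forall i, is_formula (projT2 (G i)).

(** Level [0] interleaves [F0] with [G], and each further level applies numbered operations to pairs
    from the level below. Indexing by numbers makes the result countable. *)
Fixpoint closure_level (k m : nat) : some_formula :=
  match k with
  | 0 => if odd m then G m./2 else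
      let: existT n phi := idx fragF0 m./2 in formula_of (sval phi)
  | k'.+1 => if (unpickle m : option (nat * (nat * nat))) is Some (j, (a, b))
      then closure_op j (closure_level k' a) (closure_level k' b) else closure_level k' 0
  end.

Lemma closure_levelS k j a b : closure_level k.+1 (pickle (j, (a, b))) =
  closure_op j (closure_level k a) (closure_level k b).
Proof. by rewrite [in LHS]/closure_level -/closure_level pickleK. Qed.

Definition generated : formulas L := fun n phi => exists k m, closure_level k m = formula_of phi.

Lemma closure_level_formula k m : is_formula (projT2 (closure_level k m)).
Proof.
elim: k m => [|k IH] m /=.
  case: ifP => _ //; case: (idx fragF0 m./2) => n [phi Fp] /=.
  exact: fragment_formula Fp.
by case: unpickle => [[j [a b]]|//]; exact: closure_op_formula.
Qed.

Lemma closure_level_le k k' x : (k <= k')%N -> (exists m, closure_level k m = x) ->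
  exists m, closure_level k' m = x.
Proof.
move=> kk'; rewrite -(subnKC kk'); elim: (k' - k)%N => [|j IH]; first by rewrite addn0.
move=> /IH[m mx]; rewrite addnS.
have [i iE] : exists i, forall x y, closure_op i x y = x.
  exists (pickle (8%N, (0%N, (0 : rat, [::] : seq nat)))) => y z.
  by rewrite /closure_op pickleK.
by exists (pickle (i, (m, m))); rewrite closure_levelS iE.
Qed.

Lemma generated_op (c m : nat) (r : rat) (w : seq nat) n (p q : preformula L n) k
    (phi : preformula L k) :
  generated p -> generated q ->
  basic_op c m r w (formula_of p) (formula_of q) = formula_of phi -> generated phi.
Proof.
move=> [k1 [m1 e1]] [k2 [m2 e2]] pE.
have [a ea] := closure_level_le (leq_maxl k1 k2) (ex_intro _ m1 e1).
have [b eb] := closure_level_le (leq_maxr k1 k2) (ex_intro _ m2 e2).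
exists (maxn k1 k2).+1, (pickle (pickle (c, (m, (r, w))), (a, b))).
by rewrite closure_levelS ea eb /closure_op pickleK.
Qed.

Lemma generated_base n (phi : preformula L n) : F0 n phi -> generated phi.
Proof.
move=> Fp; have [i iP] := idxP fragF0 (existT _ n (exist _ phi Fp)).
by exists 0%N, i.*2; rewrite /= odd_double doubleK iP.
Qed.

Lemma generated_extra i : generated (projT2 (G i)).
Proof.
exists 0%N, i.*2.+1; rewrite /= odd_double /= uphalf_double.
by case: (G i).
Qed.

Lemma generated_fragment : fragment generated.
Proof.
split.
- move=> n; apply/countable_injP.
  have /choice[f fP] : forall phi : preformula L n, exists km : nat * nat,
      generated phi -> closure_level km.1 km.2 = formula_of phi.
    move=> phi; have [[k [m km]]|ng] := pselect (generated phi); first by exists (k, m).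
    by exists (0%N, 0%N) => /ng.
  exists (fun phi => pickle (f phi)) => p q; rewrite !inE => gp gq.
  move=> /(pcan_inj pickleK) pq.
  by apply: formula_of_inj; rewrite -fP// pq fP.
- move=> n phi [k [m km]]; have := closure_level_formula k m; rewrite km; exact.
- by move=> n P ts; apply: generated_base; exact: fragment_pred.
- by move=> n t u; apply: generated_base; exact: fragment_dist.
- by move=> n; apply: generated_base; exact: fragment_one.
- move=> n p q gp gq; apply: (@generated_op 0 0 0 [::] n p q n) => //; exact: binary_opE.
- move=> n r p gp; exact: (@generated_op 1 0 r [::] n p p n).
- move=> n p q gp gq; apply: (@generated_op 2 0 0 [::] n p q n) => //; exact: binary_opE.
- move=> n p q gp gq; apply: (@generated_op 3 0 0 [::] n p q n) => //; exact: binary_opE.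
- move=> n p gp; exact: (@generated_op 4 0 0 [::] n.+1 p p n).
- move=> n p gp; exact: (@generated_op 5 0 0 [::] n.+1 p p n).
- move=> n phi gp.
  have sub j k (psi : preformula L k) : subformula_op j (formula_of phi) = formula_of psi ->
      generated psi.
    by move=> e; exact: (@generated_op 6 j 0 [::] n phi phi k).
  move: sub {gp}; case: phi => //= {}n.
  + by move=> p q sub; split; [exact: (sub 0%N)|exact: (sub 1%N)].
  + by move=> r p sub; exact: (sub 0%N).
  + by move=> p q sub; split; [exact: (sub 0%N)|exact: (sub 1%N)].
  + by move=> p q sub; split; [exact: (sub 0%N)|exact: (sub 1%N)].
  + by move=> p sub; exact: (sub 0%N).
  + by move=> p sub; exact: (sub 0%N).
  + by move=> ps sub i; exact: (sub i).
  + by move=> ps sub i; exact: (sub i).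
- move=> n m s phi gp; have [w wE] := subst_opP phi s.
  exact: (@generated_op 7 m 0 w n phi phi m).
Qed.

End FragmentExtension.

(** * Baire category in the space of sequences *)

Section Category.
Context (R : realType) (N : metricType R).
Implicit Types (P W : (nat -> N) -> Prop).

Definition seq_open W := forall a, W a ->
  exists n, exists2 r : R, 0 < r & forall b, close n r a b -> W b.

Definition seq_dense W := forall a n (r : R), 0 < r -> exists2 b, close n r a b & W b.

Definition comeager P := exists W : nat -> (nat -> N) -> Prop,
  (forall j, seq_open (W j) /\ seq_dense (W j)) /\ forall e, (forall j, W j e) -> P e.

Lemma comeager_sub P Q : (forall e, P e -> Q e) -> comeager P -> comeager Q.
Proof. by move=> PQ [W [hW WP]]; exists W; split => // e /WP/PQ. Qed.

Lemma comeager_all (P : nat -> (nat -> N) -> Prop) : (forall j, comeager (P j)) ->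
  comeager (fun e => forall j, P j e).
Proof.
move=> /choice[W WP].
pose W' m := if (pickle_inv m : option (nat * nat)) is Some (i, j) then W i j else fun=> True.
exists W'; split=> [m|e W'e i].
  rewrite /W'; case: pickle_inv => [[i j]|]; first by case: (WP i).
  split; first by move=> a _; exists 0%N, 1.
  by move=> a n r r0; exists a => //; exact: close_refl.
apply: (proj2 (WP i)) => j; have := W'e (pickle (i, j)); rewrite /W' pickleK_inv; exact.
Qed.

Lemma comeager_and P Q : comeager P -> comeager Q -> comeager (fun e => P e /\ Q e).
Proof.
move=> cP cQ; pose S j := if j is 0 then P else Q.
have cS j : comeager (S j) by case: j.
have := comeager_all cS.
by apply: comeager_sub => e h; split; [exact: (h 0%N)|exact: (h 1%N)].
Qed.

Lemma comeager_open_dense W : seq_open W -> seq_dense W -> comeager W.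
Proof. by move=> oW dW; exists (fun=> W); split => // e; apply; exact: 0%N. Qed.

Lemma comeager_dense_seq (e0 : nat -> N) : dense_seq e0 -> comeager (@dense_seq R N).
Proof.
move=> de0; pose W j := if (unpickle j : option (nat * rat)) is Some (i, q) then
  fun e : nat -> N => 0 < q -> exists l : nat, mdist (e0 i) (e l) < ratr q else fun=> True.
exists W; split=> [j|e We x r r0].
  rewrite /W; case: unpickle => [[i q]|]; last first.
    split; first by move=> a _; exists 0%N, 1.
    by move=> a n r r0; exists a => //; exact: close_refl.
  have [q0|q0] := pselect (0 < q); last first.
    split; first by move=> a _; exists 0%N, 1.
    by move=> a n r r0; exists a => //; exact: close_refl.
  split=> [a /(_ q0)[l al]|a n r r0].
    exists l.+1, (ratr q - mdist (e0 i) (a l)); first by rewrite subr_gt0.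
    move=> b /(_ l (ltnSn l)) ab _; exists l.
    by have := metric_triangle (e0 i) (a l) (b l); lra.
  exists (upd a n (e0 i)).
    by move=> l ln; rewrite -(agree_upd a (e0 i) ln) mdistxx.
  by move=> _; exists n; rewrite /upd eqxx mdistxx ltr0q.
have r2 : 0 < r / 2 by rewrite divr_gt0.
have [i xi] := de0 x _ r2; have [q [q0 qr]] := rat_between r2.
have := We (pickle (i, q)); rewrite /W pickleK -(ltr0q R) => /(_ q0)[l il].
by exists l; have := metric_triangle x (e0 i) (e l); lra.
Qed.

(** Nested balls on ever more coordinates: a state is a centre, a number of coordinates and a radius
    [t]. Centres move by at most [t / 2] and radii shrink by a factor [4], so the limit stays within
    [2 t], the size for which membership in the open set is arranged. *)
Theorem baire (cN : complete_space N) P a n (r : R) : comeager P -> 0 < r ->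
  exists2 e, close n r a e & P e.
Proof.
move=> [W [hW WP]] r0.
pose state := ((nat -> N) * (nat * R))%type.
have step (js : nat * state) : exists s : state, 0 < js.2.2.2 ->
    [/\ 0 < s.2.2, s.2.2 <= js.2.2.2 / 4, (js.2.2.1 < s.2.1)%N,
      close js.2.2.1 (js.2.2.2 / 2) js.2.1 s.1 &
      forall c, close s.2.1 (2 * s.2.2) s.1 c -> W js.1 c].
  case: js => j [b [m t]] /=; have [t0|t0] := pselect (0 < t); last by exists (b, (m, t)).
  have [oW dW] := hW j; have t2 : 0 < t / 2 by rewrite divr_gt0.
  have [b' bb' /oW[m' [t' t'0 h]]] := dW b m _ t2.
  have lt0 : 0 < Num.min (t' / 2) (t / 4) by rewrite lt_min !divr_gt0.
  exists (b', (maxn m.+1 m', Num.min (t' / 2) (t / 4))) => _; split => //=.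
  - by rewrite ge_min lexx orbT.
  - exact: leq_maxl.
  - move=> c bc; apply: h; apply: (close_le (leq_maxr m.+1 m') _ bc).
    have : Num.min (t' / 2) (t / 4) <= t' / 2 by rewrite ge_min lexx.
    by lra.
have [f fP] := choice step.
pose s := fix s l : state := if l is l'.+1 then f (l', s l') else (a, (n, r / 2)).
have s0 l : 0 < (s l).2.2.
  elim: l => [|l IH] /=; first by rewrite divr_gt0.
  by have [] := fP (l, s l) IH.
have sP l := fP (l, s l) (s0 l).
have nl l : (l <= (s l).2.1)%N.
  by elim: l => [//|l IH]; have [_ _ h _ _] := sP l; exact: leq_ltn_trans IH h.
have [l|l|l|l|w wP] := @coordinate_limits R N (fun l => (s l).1) (fun l => (s l).2.1)
    (fun l => (s l).2.2 / 2) cN _ _ nl.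
- by rewrite divr_gt0.
- have [_ + _ _ _] := sP l; have := s0 l; rewrite [f _]/(s l.+1) /=; lra.
- by have [_ _ /ltnW + _ _] := sP l.
- by have [_ _ _ + _] := sP l.
have {}wP l : close (s l).2.1 (2 * (s l).2.2) (s l).1 w.
  move=> i il; rewrite metric_sym; apply: (le_lt_trans (wP l i il)).
  by have := s0 l; lra.
exists w.
  by have := wP 0%N; rewrite /= mulrC divfK//; apply: lt0r_neq0.
by apply: WP => j; have [_ _ _ _] := sP j; apply; exact: (wP j.+1).
Qed.

End Category.

(** * Borel sets of codes as open sets up to meager sets *)

Section BorelCodes.
Context (R : realType) (L : signature R) (T : theory L).
Variable F0 : formulas L.
Arguments F0 : clear implicits.
Hypotheses (fragF0 : fragment F0) (TF0 : theory_in F0 T).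
Let Fall := @formula_fclosed R L.
Implicit Types N : structure L.

Local Notation X := (set_type (Mod F0 T)).

Definition union_open (psi : nat -> some_formula L) N (e : nat -> N) :=
  exists i, evs (projT2 (psi i)) e < 0.

Lemma union_open_open psi N : (forall i, is_formula (projT2 (psi i))) ->
  seq_open (@union_open psi N).
Proof.
move=> fpsi a [i ia]; have [d d0 dP] := evs_lt_open (fpsi i) ia.
by exists (projT1 (psi i)), d => // b /dP ib; exists i.
Qed.

(** Where the formula [p] is negative, a large multiple of it outweighs the [1]; minimizing over [m]
    therefore measures the distance to the open set where [p < 0], cut off at [1]. *)
Lemma distance_formula n (p : some_formula L) (m : nat) : is_formula (projT2 p) ->
  exists phi : preformula L n, is_formula phi /\
    forall N (b : nat -> N) t, 0 < t -> evs phi b < t <->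
      exists2 c, close n t b c & m%:R * evs (projT2 p) c + 1 < t.
Proof.
case: p => k p /= fp.
have [i i_n|f1 [Ff1 f1P]] := @Fd_close R L _ Fall ((k + n) + n) n id (addn n).
  split; first exact: ltn_addl.
  by rewrite -addnA; apply: (leq_trans _ (leq_addl _ _)); rewrite ltn_add2l.
have Ff2 : Fdef (fun n => [set phi : preformula L n | is_formula phi]) ((k + n) + n)
    (fun N (w : nat -> N) => ratr m%:R * evs p (w \o addn n) + ratr 1).
  apply: (Fd_add Fall); last exact: Fd_const.
  apply: (Fd_scale Fall); apply: (Fd_ren Fall (Fd_base fp)) => i ik.
  by rewrite addnC ltn_add2r; apply: ltn_addr.
have [g [[phi Fp pE] g1 g2]] := Fd_tail Fall (Fd_max Fall Ff1 Ff2).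
exists phi; split => // N b t t0; rewrite pE; split=> [/g2[w bw]|[c bc ct]].
  rewrite gt_max ratr_nat rmorph1 => /andP[/(f1P _ _ _ t0) cl wt].
  by exists (w \o addn n) => // i i_n; rewrite (bw i i_n); exact: cl.
apply: (le_lt_trans (g1 _ _ (shift_seq n b c) (shift_seq_lo _ _))).
rewrite gt_max shift_addn ratr_nat rmorph1 ct andbT; apply/(f1P _ _ _ t0) => i i_n.
by have := shift_seq_lo b c i_n => /= <-; rewrite shift_seq_hi; exact: bc.
Qed.

(** [rho] is the truncated distance to the open set of sequences. *)
Lemma exterior_formula (psi : nat -> some_formula L) n :
  (forall i, is_formula (projT2 (psi i))) ->
  exists rho : preformula L n, is_formula rho /\
    forall N (b : nat -> N) t, 0 < t -> t <= 1 -> evs rho b < t <->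
      exists2 c, close n t b c & union_open psi c.
Proof.
move=> fpsi.
have /choice[G GP] : forall im : nat * nat, exists phi : preformula L n, is_formula phi /\
    forall N (b : nat -> N) t, 0 < t -> evs phi b < t <->
      exists2 c, close n t b c & im.2%:R * evs (projT2 (psi im.1)) c + 1 < t.
  by move=> im; exact: distance_formula.
(* Truncation to [[0, 1]] gives a common bound, and distances are 1-Lipschitz; thus the family
   satisfies the side condition of [CInf]. *)
pose H l : preformula L n := Max (Scale 0 (One L n)) (Min (One L n)
  (G (odflt (0%N, 0%N) (unpickle l)))).
have HE l N (b : nat -> N) : evs (H l) b =
    Num.max 0 (Num.min 1 (evs (G (odflt (0%N, 0%N) (unpickle l))) b)).
  by rewrite /evs /= rmorph0 mul0r.
have H01 l N (b : nat -> N) : 0 <= evs (H l) b <= 1.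
  by rewrite HE le_max lexx /= ge_max ler01 ge_min lexx.
have lip l N (b b' : nat -> N) eta : 0 < eta -> close n eta b b' ->
    evs (H l) b' <= evs (H l) b + eta.
  move=> eta0 bb'; rewrite !HE; set Gl := G _.
  have Glt t : 0 < t -> evs Gl b < t -> evs Gl b' < t + eta.
    move=> t0 /(proj2 (GP _) _ _ _ t0)[c bc ct].
    apply/(proj2 (GP _)); first by rewrite addr_gt0.
    exists c; last by apply: lt_trans ct _; rewrite ltrDl.
    by rewrite addrC; apply: (close_trans _ bc); exact: close_sym.
  have h : evs Gl b' <= Num.max 0 (evs Gl b) + eta.
    apply/ler_addgt0Pr => e e0; apply: ltW; rewrite -addrA [eta + e]addrC addrA.
    have m0 : 0 <= Num.max 0 (evs Gl b) by rewrite le_max lexx.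
    apply: Glt; first by lra.
    by apply: (@le_lt_trans _ _ (Num.max 0 (evs Gl b))); rewrite ?le_max ?lexx ?orbT// ltrDl.
  move: h; rewrite /Num.max /Num.min; do ![case: ifPn]; rewrite -?leNgt; lra.
have fH l : is_formula (H l).
  by rewrite /=; split => //; split => //; case: (GP (odflt (0%N, 0%N) (unpickle l))).
exists (CInf H); split.
  split => //; exists id, 0, 1; split; first exact: modulus_id.
  move=> l N a b; have [x0] := carrier_inhabited N.
  have aE (c : 'I_n -> N) : eval (H l) c = evs (H l) (pad c x0).
    by rewrite /evs initial_pad.
  split; first by rewrite aE.
  have half (a1 b1 : 'I_n -> N) : eval (H l) b1 <= eval (H l) a1 + max_dist a1 b1.
    apply/ler_addgt0Pr => e e0; rewrite !aE -addrA; apply: lip.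
      by apply: ltr_wpDl => //; exact: max_dist_ge0.
    move=> i i_n; rewrite /pad insubT /=; apply: le_lt_trans (le_max_dist a1 b1 _) _.
    by rewrite ltrDl.
  rewrite ler_distl; apply/andP; split; last first.
    have := half b a; rewrite (_ : max_dist b a = max_dist a b)//.
    by apply: eq_bigr => i _; exact: metric_sym.
  by have := half a b; lra.
move=> N b t t0 t1.
have I0 : inhabited nat by exists; exact: 0%N.
have lt l : evs (H l) b < t <-> evs (G (odflt (0%N, 0%N) (unpickle l))) b < t.
  rewrite HE gt_max t0 gt_min /=; split; last by move=> ->; rewrite orbT.
  by case/orP => // /(le_lt_trans t1); rewrite ltxx.
split=> [/(inf_range_lt I0)[l]|[c bc [i ic]]].
  move=> /(lt l)/(proj2 (GP _) _ _ _ t0)[c bc]; set im := odflt _ _ => ct; exists c => //.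
  exists im.1; rewrite ltNge; apply/negP => c0.
  have : 0 <= im.2%:R * evs (projT2 (psi im.1)) c by rewrite mulr_ge0.
  by lra.
(* With this [m] the product is below [-1], so the sum is negative. *)
pose m := Num.Def.archi_bound (- evs (projT2 (psi i)) c)^-1.
apply: (@le_lt_trans _ _ (evs (H (pickle (i, m))) b)).
  by apply: (@ge_inf_range _ _ (fun l => evs (H l) b) 0) => l; case/andP: (H01 l N b).
apply/lt; rewrite pickleK /=; apply/(proj2 (GP (i, m)) _ _ _ t0); exists c => //=.
have v0 : 0 < - evs (projT2 (psi i)) c by rewrite oppr_gt0.
have : (- evs (projT2 (psi i)) c)^-1 < m%:R by apply: archi_boundP; rewrite invr_ge0 ltW.
rewrite -(ltr_pM2r v0) mulVf ?gt_eqF// mulrN => h.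
by lra.
Qed.

(** The Baire property of [V] on enumerations, uniformly in the model: one family of formulas
    defines the open set in all separable models of [T]. *)
Definition fcode (V : set X) := exists psi : nat -> some_formula L,
  (forall i, is_formula (projT2 (psi i))) /\
  forall N (e0 : nat -> N), dense_seq e0 -> models N T ->
    comeager (fun e : nat -> N => forall x : X, set_val x = omega_tp F0 e ->
      (V x <-> union_open psi e)).

Definition exterior psi N (e : nat -> N) := exists n, exists2 t : R, 0 < t &
  forall c, close n t e c -> ~ union_open psi c.

(** An open set and its exterior have dense union, so the complement agrees with the exterior up to
    a meager set; the exterior is where some truncated distance exceeds a positive rational. *)
Lemma fcode_not V : fcode V -> fcode (~` V).
Proof.
move=> [psi [fpsi psiP]].
have ex n : exists rho : preformula L n, is_formula rho /\
    forall N (b : nat -> N) t, 0 < t -> t <= 1 -> evs rho b < t <->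
      exists2 c, close n t b c & union_open psi c by exact: exterior_formula.
pose rho n := projT1 (cid (ex n)).
have rhoP n : is_formula (rho n) /\ forall N (b : nat -> N) t, 0 < t -> t <= 1 ->
    evs (rho n) b < t <-> exists2 c, close n t b c & union_open psi c := projT2 (cid (ex n)).
have ex' (nq : nat * rat) : exists p : some_formula L, is_formula (projT2 p) /\
    forall N (e : nat -> N), evs (projT2 p) e < 0 <->
      [/\ 0 < ratr nq.2 :> R, ratr nq.2 <= 1 :> R & ratr nq.2 < evs (rho nq.1) e].
  have [q01|q01] := pselect (0 < ratr nq.2 :> R /\ ratr nq.2 <= 1 :> R); last first.
    exists (formula_of (One L 0)); split => // N e; rewrite /evs /=.
    by rewrite ltr10; split => // -[q0 q1 _]; case: q01.
  have [p fp pE] := Fd_csub Fall nq.2 (Fd_base (proj1 (rhoP nq.1))).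
  exists (formula_of p); split => // N e; rewrite /= pE subr_lt0.
  by case: q01 => q0 q1; split => [h|[]].
have /choice[psi' psi'P] := ex'.
exists (fun l => psi' (odflt (0%N, 0) (unpickle l))); split=> [l|N e0 de0 NT].
  by case: (psi'P (odflt (0%N, 0) (unpickle l))).
have ext (e : nat -> N) : union_open (fun l => psi' (odflt (0%N, 0) (unpickle l))) e <->
    exterior psi e.
  split=> [[l /(proj2 (psi'P _) N e)]|[n [t t0 h]]].
    set nq := odflt _ _ => -[q0 q1 qr]; exists nq.1, (ratr nq.2) => // c ec oc.
    have /(proj2 (rhoP nq.1) N e _ q0 q1) : exists2 c, close nq.1 (ratr nq.2) e c & union_open psi c.
      by exists c.
    by move=> /(lt_trans qr); rewrite ltxx.
  have m0 : 0 < Num.min t 1 by rewrite lt_min t0 ltr01.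
  have [q [q0]] := rat_between m0; rewrite lt_min => /andP[qt q1].
  exists (pickle (n, q)); apply/(proj2 (psi'P _) N e); rewrite pickleK /=.
  split => //; first exact: ltW.
  have m1 : Num.min t 1 <= 1 by rewrite ge_min lexx orbT.
  apply: (@lt_le_trans _ _ (Num.min t 1)); first by rewrite lt_min qt.
  rewrite leNgt; apply/negP => /(proj2 (rhoP n) N e _ m0 m1)[c ec].
  by apply: h; apply: (close_le (leqnn _) _ ec); rewrite ge_min lexx.
have cW : comeager (fun e : nat -> N => union_open psi e \/ exterior psi e).
  apply: comeager_open_dense => [a [/(union_open_open fpsi)|]|a n r r0].
  - by move=> [n [r r0 h]]; exists n, r => // b /h; left.
  - move=> [n [t t0 h]]; have t2 : 0 < t / 2 by rewrite divr_gt0.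
    exists n, (t / 2) => // b ab; right; exists n, (t / 2) => // c bc; apply: h.
    by apply: (close_le (leqnn _) _ (close_trans ab bc)); lra.
  have [[c ac oc]|nc] := pselect (exists2 c, close n r a c & union_open psi c).
    by exists c => //; left.
  exists a; first exact: close_refl.
  by right; exists n, r => // c ac oc; apply: nc; exists c.
apply: comeager_sub (comeager_and (psiP N e0 de0 NT) cW) => e [h we] x xe.
rewrite ext; split=> [nVx|[n [t t0 hx]] Vx].
  by case: we => // /(h x xe).
by move/(h x xe): Vx; apply: hx; exact: close_refl.
Qed.

Lemma fcode_union (V : nat -> set X) : (forall n, fcode (V n)) -> fcode [set x | exists n, V n x].
Proof.
move=> /choice[psi psiP].
exists (fun l => let: (n, i) := odflt (0%N, 0%N) (unpickle l) in psi n i); split=> [l|N e0 de0 NT].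
  by case: (odflt _ _) => n i; case: (psiP n).
have := comeager_all (fun n => proj2 (psiP n) N e0 de0 NT).
apply: comeager_sub => e h x xe; split=> [[n /(h n x xe)[i ie]]|[l]].
  by exists (pickle (n, i)); rewrite pickleK.
by case: (odflt _ _) => n i ie; exists n; apply/(h n x xe); exists i.
Qed.

Lemma fcode_sigma : sigma_alg fcode.
Proof.
split; [exact: fcode_not|exact: fcode_union|].
exists (fun=> formula_of (One L 0)); split => // N e0 de0 NT.
apply: comeager_sub (comeager_dense_seq de0) => e _ x _; split => // -[_].
by rewrite /evs /= ltr10.
Qed.

Lemma borel_fcode V : @borel X V -> fcode V.
Proof.
apply: (borel_coords fragF0 fcode_sigma) => -[n [phi Fp]] q.
have [p fp pE] := Fd_subc Fall q (Fd_base (fragment_formula fragF0 Fp)).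
exists (fun=> formula_of p); split => // N e0 de0 NT.
apply: comeager_sub (comeager_dense_seq de0) => e _ x xe.
rewrite /union_open /= pE subr_lt0 xe; split => [h|[_ //]].
by exists 0%N.
Qed.

End BorelCodes.

(** * Rigid types from a countable description of the classes *)

Section ClassesToFragments.
Context (R : realType) (L : signature R) (T : theory L).
Variable F0 : formulas L.
Arguments F0 : clear implicits.
Hypotheses (fragF0 : fragment F0) (TF0 : theory_in F0 T).
Implicit Types N : structure L.

Local Notation X := (set_type (Mod F0 T)).
Local Notation cs := (coded_structure fragF0).
Local Notation csq := (coded_seq fragF0).
Local Notation E := (@iso_rel R L F0 T fragF0).

Lemma iso_rel_code (xi x : X) N (e : nat -> N) : dense_seq e -> omega_tp F0 e = set_val x ->
  isomorphic (cs x) N.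
Proof. by move=> de ex; have [h [hi _]] := coded_iso fragF0 de ex; exists h. Qed.

Variable V : nat -> set X.
Hypothesis V_borel : forall m, borel (V m).
Hypothesis classes : forall x, exists S : nat -> set nat, forall x',
  E x x' <-> exists n, forall m, S n m -> ~ V m x'.

Theorem rigid_fragment : exists F : formulas L, fragment F /\ theory_in F T /\
  forall xi : X, exists k : nat,
    interior [set a : {ptws 'I_k -> cs xi} | rigid T (tp F a)] !=set0.
Proof.
have /choice[psi psiP] : forall m, exists psi : nat -> some_formula L,
    (forall i, is_formula (projT2 (psi i))) /\
    forall N (e0 : nat -> N), dense_seq e0 -> models N T ->
      comeager (fun e : nat -> N => forall x : X, set_val x = omega_tp F0 e ->
        (V m x <-> union_open psi e)).
  by move=> m; exact: (borel_fcode fragF0 (V_borel m)).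
pose G l := let: (m, i) := odflt (0%N, 0%N) (unpickle l) in psi m i.
have fG l : is_formula (projT2 (G l)).
  by rewrite /G; case: (odflt _ _) => m i; case: (psiP m).
pose F := generated fragF0 G; have fragF : fragment F := generated_fragment fragF0 fG.
have F0F n (phi : preformula L n) : F0 n phi -> F n phi by exact: generated_base.
have Fpsi m i : F _ (projT2 (psi m i)).
  by have := generated_extra fragF0 G (pickle (m, i)); rewrite /G pickleK.
have FF := fragment_fclosed fragF.
exists F; split => //; split; first by move=> c /TF0/F0F.
move=> xi; have [S SP] := classes xi; pose M := cs xi; pose c : nat -> M := csq xi.
have dc : dense_seq c := @coded_dense _ _ _ fragF0 T xi.
have MT : models M T := @coded_models _ _ _ fragF0 _ TF0 xi.
have sM : separable_space M := coded_separable fragF0 xi.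
(* Otherwise, for every [n], the union of the open sets with index in [S n] is dense. A generic
   enumeration of [M] then meets each of these unions, although its code belongs to the class of
   [xi]. *)
have [n [a [k [r r0 disj]]]] : exists n (a : nat -> M) k, exists2 r : R, 0 < r &
    forall m e, S n m -> close k r a e -> ~ union_open (psi m) e.
  apply: contrapT => none.
  pose W n (e : nat -> M) := exists2 m, S n m & union_open (psi m) e.
  have cW n : comeager (W n).
    apply: comeager_open_dense => [a [m Snm om]|a k r r0].
      have [k [r r0 h]] := union_open_open (proj1 (psiP m)) om.
      by exists k, r => // b /h ob; exists m.
    apply: contrapT => nW; apply: none; exists n, a, k, r => // m e Sm ae oe.
    by apply: nW; exists e => //; exists m.
  have cm := comeager_all (fun m => proj2 (psiP m) M c dc MT).
  have [e _ [de [he we]]] := baire (carrier_complete (s := M)) c 0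
    (comeager_and (comeager_dense_seq dc) (comeager_and cm (comeager_all cW))) ltr01.
  have [x xe] := code_exists fragF0 de MT.
  have /(SP x)[n nV] : E xi x by apply: isomorphic_sym; exact: iso_rel_code de xe.
  have [m Sm om] := we n; apply: (nV m Sm).
  by apply/(he m x (esym xe)).
have r4 : 0 < r / 4 by rewrite divr_gt0.
(* Take a generic enumeration of [N] within [r / 4] of [d0]. If it met an open set with index in
   [S n], a condition of [F] would hold there, hence also in [M] within [r / 2 + r / 8 + r / 4 < r]
   of [a]. So its code lies in the class of [xi]. *)
have isoM N (c0 : nat -> M) (d0 : nat -> N) : close k (r / 2) a c0 ->
    separable_space N -> models N T ->
    (forall phi : preformula L k, F k phi -> evs phi d0 = evs phi c0) -> isomorphic M N.
  move=> ac sN NT dc0; have [y0] := carrier_inhabited N; have [e1 de1] := separable_dense_seq y0 sN.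
  have cm := comeager_all (fun m => proj2 (psiP m) N e1 de1 NT).
  have [e d0e [de he]] := baire (carrier_complete (s := N)) d0 k
    (comeager_and (comeager_dense_seq de1) cm) r4.
  have [x xe] := code_exists fragF0 de NT.
  apply: isomorphic_trans (iso_rel_code xi de xe).
  apply/(SP x); exists n => m Sm /(he m x (esym xe))[i ie].
  have r8 : 0 < r / 8 by rewrite divr_gt0.
  have n1 : near_type F k (r / 8) c0 d0.
    by apply: near_same_type => // phi Fp; rewrite dc0.
  have n2 : near_type F k (r / 8 + r / 4) c0 e.
    by apply: (near_trans FF r4 n1); exact: near_close.
  have Fw := Fd_weak FF (leq_maxr k _) (Fd_base (Fpsi m i)).
  have [z cz iz] := near_ext FF n2 (leq_maxl k _) Fw ie.
  apply: (disj m z Sm); last by exists i.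
  by apply: (close_le (leqnn _) _ (close_trans ac cz)); lra.
exists k, (@initial_segment M a k); rewrite /interior /=.
have r2 : 0 < r / 2 by rewrite divr_gt0.
have : nbhs (@initial_segment M a k : {ptws 'I_k -> M})
    [set c0 : {ptws 'I_k -> M} | forall i : 'I_k, mdist (a i) (c0 i) < r / 2].
  apply: (@filter_forall _ _ (fun (i : 'I_k) (f : {ptws 'I_k -> M}) => mdist (a i) (f i) < r / 2)
    (nbhs (@initial_segment M a k : {ptws 'I_k -> M}))) => i.
  apply: (@ptws_proj_continuous 'I_k M i (@initial_segment M a k) [set y | mdist (a i) y < r / 2]).
  by rewrite -ballEmdist; exact: nbhsx_ballx.
apply: filterS => c0 ac0; split; first by exists M, c0.
have tpE (N : structure L) (b : 'I_k -> N) y0 : tp F b = tp F c0 ->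
    forall phi : preformula L k, F k phi -> evs phi (pad b y0) = evs phi (pad c0 (a 0%N)).
  by move=> bc phi Fp; rewrite /evs !initial_pad; have := congr1 (@^~ (exist _ phi Fp)) bc.
have ac : close k (r / 2) a (pad c0 (a 0%N)).
  by move=> i ik; rewrite /pad insubT; exact: (ac0 (Ordinal ik)).
move=> N N' b b' sN NT sN' N'T bc bc'.
have [y0] := carrier_inhabited N; have [y0'] := carrier_inhabited N'.
apply: (isomorphic_trans (isomorphic_sym _)).
  exact: (isoM N _ (pad b y0) ac sN NT (tpE _ _ _ bc)).
exact: (isoM N' _ (pad b' y0') ac sN' N'T (tpE _ _ _ bc')).
Qed.

End ClassesToFragments.

(** * Countable descriptions of classes from (i) and from (iii) *)

Section PolishClasses.
Context (R : realType).

Lemma polish_base (Y : topologicalType) (y0 : Y) : polish R Y ->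
  exists B : nat -> set Y, [/\ forall m, open (B m),
    forall y U, nbhs y U -> exists2 m, B m y & B m `<=` U &
    forall y z, y <> z -> exists2 m, B m y & ~ B m z].
Proof.
move=> [M [_ sM [f [g [fK gK cf cg]]]]].
have [e de] := separable_dense_seq (f y0) sM.
pose B m := let: (i, q) := odflt (0%N, 0 : rat) (unpickle m) in
  [set y | mdist (e i) (f y) < ratr q].
have base y U : nbhs y U -> exists2 m, B m y & B m `<=` U.
  move=> yU; have : nbhs (f y) (g @^-1` U) by apply: cg; rewrite fK.
  move=> /nbhs_ballP[r /= r0 rU]; have r2 : 0 < r / 2 by rewrite divr_gt0.
  have [i yi] := de (f y) _ r2.
  have [q [q1 q2]] := rat_between yi.
  exists (pickle (i, q)); rewrite /B pickleK /=; first by rewrite metric_sym.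
  move=> z /= zi; rewrite -(fK z); apply: rU; rewrite ballEmdist /=.
  by have := metric_triangle (f y) (e i) (f z); lra.
exists B; split => // [m|y z yz].
  rewrite /B; case: (odflt _ _) => i q.
  rewrite -[[set _ | _]]/(f @^-1` [set x | mdist (e i) x < ratr q]).
  move/continuousP : cf; apply; rewrite openE => x /= ix.
  apply/nbhs_ballP; exists (ratr q - mdist (e i) x); first by rewrite /= subr_gt0.
  move=> x'; rewrite ballEmdist /= => xx'.
  by have := metric_triangle (e i) x x'; lra.
have d0 : 0 < mdist (f y) (f z).
  rewrite lt_neqAle mdist_ge0 andbT; apply/eqP => /esym/mdist_positivity yz'.
  by apply: yz; rewrite -(fK y) yz' fK.
have [|m my mU] := base y (f @^-1` ball (f y) (mdist (f y) (f z))).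
  by apply: cf; exact: nbhsx_ballx.
by exists m => // /mU; rewrite /= ballEmdist /= ltxx.
Qed.

Variables (X : topologicalType) (E : X -> X -> Prop).

Definition countably_separated := exists V : nat -> set X, (forall m, borel (V m)) /\
  forall x, exists S : nat -> set nat, forall x',
    E x x' <-> exists n, forall m, S n m -> ~ V m x'.

Lemma countably_separated_empty : ~ inhabited X -> countably_separated.
Proof.
move=> nX; exists (fun=> set0); split=> [m|x]; first exact: sa_set0 (borel_sigma X).
by case: nX.
Qed.

Lemma potentially_Sigma02_separated : potentially_Sigma02 R E -> countably_separated.
Proof.
move=> [tau [pX bX [C cC EC]]].
have [[x0]|nX] := pselect (inhabited X); last exact: countably_separated_empty.
set Xtau := Topological.Pack tau in pX bX C cC EC.
have [B [oB base _]] := polish_base (x0 : Xtau) pX.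
have EP x x' : E x x' <-> exists n, C n (x, x').
  have -> : E x x' = [set p : Xtau * Xtau | E p.1 p.2] (x, x') by [].
  by rewrite EC; split=> [[n _ Cn]|[n Cn]]; exists n.
exists B; split=> [m|x].
  by have := borel_open (oB m); rewrite bX.
(* [S n] lists the basic open sets that miss the section of [C n] at [x]; this section is closed,
   hence the complement of their union. *)
exists (fun n m => forall x', C n (x, x') -> ~ B m x') => x'; rewrite EP.
split=> [[n Cn]|[n Sn]]; exists n; first by move=> m; exact.
apply: contrapT => nCn.
have : nbhs ((x, x') : Xtau * Xtau) (~` C n).
  by apply: open_nbhs_nbhs; split => //; rewrite openC.
move=> [[A A'] /= [xA xA'] AC].
have [m mx' mA'] := base x' A' xA'.
apply: (Sn m) mx' => x'' Cx'' mx''.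
by apply: (AC (x, x'')) => //; split => /=; [exact: (@nbhs_singleton Xtau _ _ xA)|exact: mA'].
Qed.

Lemma essentially_countable_separated : essentially_countable R E -> countably_separated.
Proof.
move=> [Y [Q [f [pY [[Qr Qs Qt] _] cQ bf EQ]]]].
have [[x0]|nX] := pselect (inhabited X); last exact: countably_separated_empty.
have [B [oB _ sep]] := polish_base (f x0) pY.
exists (fun m => f @^-1` B m); split=> [m|x]; first by apply: bf; exact: borel_open.
have [z zE] := countable_enum (cQ (f x)) (Qr (f x)).
(* The class is the preimage of the countable set of the [z n], and avoiding every [B m] that misses
   [z n] leaves only the point [z n]. *)
exists (fun n m => ~ B m (z n)) => x'; rewrite EQ; split=> [Qx|[n nP]].
  have : range z (f x') by rewrite zE.
  by move=> [n _ zn]; exists n => m; rewrite /= zn.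
suff -> : f x' = z n by have : range z (z n) by [exists n]; rewrite zE.
by apply: contrapT => /sep[m mx mz]; exact: (nP m mz mx).
Qed.

End PolishClasses.

Theorem theorem1p2 (R : realType) (L : signature R) (T : theory L)
    (T_theory : is_theory T) (T_countable : countable T)
    (T_locally_compact : forall M : structure L,
      separable_space M -> models M T -> locally_compact [set: M])
    (F0 : formulas L) (F0_fragment : fragment F0) (T_in_F0 : theory_in F0 T) :
  let cond_i := potentially_Sigma02 R (@iso_rel R L F0 T F0_fragment) in
  let cond_ii :=
    exists F : formulas L, fragment F /\ theory_in F T /\
      forall xi : Mod F0 T, exists k : nat,
        let M := coded_structure F0_fragment xi in
        interior [set a : {ptws 'I_k -> M} | rigid T (tp F a)] !=set0 in
  let cond_iii := essentially_countable R (@iso_rel R L F0 T F0_fragment) in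
  (cond_i <-> cond_ii) /\ (cond_ii <-> cond_iii).
Proof.
move=> cond_i cond_ii cond_iii.
have to_ii : countably_separated (@iso_rel R L F0 T F0_fragment) -> cond_ii.
  by move=> [V [bV VE]]; exact: rigid_fragment VE.
have from_ii : cond_ii -> cond_i /\ cond_iii.
  by move=> [F [fragF [TF rg]]]; exact: classified_by_data rg.
split; split=> h.
- exact: to_ii (potentially_Sigma02_separated h).
- by case: (from_ii h).
- by case: (from_ii h).
- exact: to_ii (essentially_countable_separated h).
Qed.
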